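(* Let $(X,g,I)$ be a compact Kähler manifold with boundary. There is $\varepsilon>0$ (depending on $X$) such that for every holomorphic function $F\colon X\to\mathbb{C}$ with $\|F\|_{C^2}<\varepsilon$ the following holds. Let $f=\mathrm{Re}(F)$, let $M=T^*X$ with projection $\pi\colon M\to X$, let $L_0\subset M$ be the zero section and $L_1\subset M$ the graph of $\mathrm{Re}(dF)=df$. There is a $\tau$-dependent almost quaternionic structure $(I_\tau,J_\tau,K_\tau)_{\tau\in[0,1]}$ on $M$ such that the Fueter strips $$U\colon[0,1]\times\mathbb{R}^2\to M,\qquad I_\tau(U)\partial_\tau U+J_\tau(U)\partial_sU+K_\tau(U)\partial_tU=0,$$ with boundary on $L_0$ and $L_1$ correspond to the complex gradient trajectories of $F$ in $X$. That is: for every such Fueter strip $U$ the map $\pi\circ U$ is independent of $\tau$, hence of the form $\pi(U(\tau,s,t))=w(s,t)$, and setting $v(s,t)=w(s,-t)$, the assignment $U\mapsto v$ is a bijection from the set of Fueter strips onto the set of complex gradient trajectories of $F$ (with asymptotic conditions as in the context).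
   Context: Coordinates on $[0,1]\times\mathbb{R}^2$ are $(\tau,s,t)$. An almost quaternionic structure on $M$ is a triple of almost complex structures $(I,J,K)$ with $IJ=K$; a $\tau$-dependent one is a smooth family parametrized by $\tau\in[0,1]$. The points of $L_0\cap L_1$ are the critical points of $f$ in $X$. A Fueter strip (for $(I_\tau,J_\tau,K_\tau)$, $L_0$, $L_1$) is a $C^2$ map $U\colon[0,1]\times\mathbb{R}^2\to M$ solving the displayed equation, with $U(0,s,t)\in L_0$ and $U(1,s,t)\in L_1$ for all $(s,t)$, with $\partial_sU(\tau,\cdot,\cdot)\in L^1(\mathbb{R}^2)\cap L^2(\mathbb{R}^2)$ for every $\tau$, and such that there are points $p_\pm\in L_0\cap L_1$ and maps $u_\pm\colon\mathbb{R}\times[0,1]\to M$ (in coordinates $(t,\tau)$) with $\partial_tu_\pm-J_\tau(u_\pm)\partial_\tau u_\pm=0$, $u_\pm(t,0)\in L_0$, $u_\pm(t,1)\in L_1$, each converging to $p_-$ as $t\to-\infty$ and to $p_+$ as $t\to+\infty$, such that $$\lim_{s\to\pm\infty}U(\tau,s,t)=u_\pm(t,\tau)\ \text{ in } C^1(\mathbb{R}\times[0,1]),\qquad \lim_{t\to\pm\infty}U(\tau,s,t)=p_\pm\ \text{ in } C^1_{\mathrm{loc}}([0,1]\times\mathbb{R}).$$ A complex gradient trajectory of $F$ is a $C^2$ map $v\colon\mathbb{R}^2\to X$ with $$\partial_sv+I(v)\bigl(\partial_tv-\nabla f(v)\bigr)=0,\qquad f=\mathrm{Re}(F),$$ with $\partial_sv\in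 L^1(\mathbb{R}^2)\cap L^2(\mathbb{R}^2)$, converging in $C^1_{\mathrm{loc}}(\mathbb{R})$ to critical points of $F$ as $t\to\pm\infty$ and in $C^1(\mathbb{R})$ to gradient trajectories $\gamma_\pm$ of $f$ ($\dot\gamma_\pm=\nabla f(\gamma_\pm)$, with the same limits as $t\to\pm\infty$) as $s\to\pm\infty$. *)

(* Defs.v *)
From HB Require Import structures.
From mathcomp Require Import all_boot all_order all_algebra.
From mathcomp Require Import all_classical all_reals all_analysis.
From mathcomp Require Import complex.

Set Implicit Arguments.
Unset Strict Implicit.
Unset Printing Implicit Defensive.
Import Order.TTheory GRing.Theory Num.Theory.
Import numFieldNormedType.Exports.

Local Open Scope classical_set_scope.
Local Open Scope ring_scope.

Section EuclideanCalculus.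
Context {R : realType}.
Implicit Types (d k : nat) (W : normedModType R).

(* Frechet differentiability relative to [A], so that [A] may be a half-space
   or a strip and the derivatives at its boundary points are one-sided. *)
Definition diff_within d W (A : set 'cV[R]_d) (f : 'cV[R]_d -> W)
    (z : 'cV[R]_d) (G : 'I_d -> W) : Prop :=
  let near_z := within A (nbhs z) in
  (fun w => f w - f z - \sum_j (w j 0 - z j 0) *: G j) =o_near_z
  (fun w => w - z).

(* [diff_within] determines its last argument when [A] is relatively open in a
   closed half-space or a strip; all uses below are of this kind. *)
Definition partial d W (A : set 'cV[R]_d) (f : 'cV[R]_d -> W) (j : 'I_d)
    (z : 'cV[R]_d) : W :=
  xget (fun=> 0) [set G | diff_within A f z G] j.

Fixpoint Ck k d W (A : set 'cV[R]_d) (f : 'cV[R]_d -> W) : Prop :=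
  if k is k'.+1 then
    (forall z, A z -> exists G, diff_within A f z G) /\
    (forall j, Ck k' A (partial A f j))
  else {within A, continuous f}.

Definition smooth d W (A : set 'cV[R]_d) (f : 'cV[R]_d -> W) : Prop :=
  forall k, Ck k A f.

(* The condition is empty for [d = 0]. *)
Definition halfspace d : set 'cV[R]_d :=
  [set x | forall i : 'I_d, val i = 0%N -> 0 <= x i 0].

Definition vec2 (a b : R) : 'cV[R]_2 := \col_k [:: a; b]`_k.

End EuclideanCalculus.

(* A type with coordinate systems; the axioms of a manifold with boundary are in
   [manifold_with_boundary]. *)
Record charted (R : realType) (n : nat) (Y : Type) := Charted {
  cidx : Type;
  cdom : cidx -> set Y;
  cmap : cidx -> Y -> 'cV[R]_n
}.

Section Charts.
Context {R : realType} {n : nat} {Y : Type} (C : charted R n Y).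
Implicit Types (i j : cidx C) (x : Y).

Definition cimg i : set 'cV[R]_n := cmap i @` cdom i.

Definition in_chart (W : normedModType R) i (h : Y -> W) (y : 'cV[R]_n) : W :=
  if pselect (exists2 x, cdom i x & cmap i x = y) is left e then h (s2val (cid2 e))
  else 0.

(* partial derivative in the [a]-th coordinate of the chart [i] *)
Definition cpartial (W : normedModType R) i (h : Y -> W) (a : 'I_n) x : W :=
  partial (cimg i) (in_chart i h) a (cmap i x).

Definition cpartial2 (W : normedModType R) i (h : Y -> W) (a b : 'I_n) x : W :=
  partial (cimg i) (partial (cimg i) (in_chart i h) a) b (cmap i x).

Definition smooth_fun (W : normedModType R) (h : Y -> W) : Prop :=
  forall i, smooth (cimg i) (in_chart i h).

Definition overlap i j : set 'cV[R]_n := cmap i @` (cdom i `&` cdom j).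

Definition jac i j x : 'M[R]_n :=
  \matrix_(a, b) partial (overlap i j) (in_chart i (cmap j)) b (cmap i x) a 0.

Definition Ck_map k d (A : set 'cV[R]_d) (u : 'cV[R]_d -> Y) : Prop :=
  forall z i, A z -> cdom i (u z) -> exists2 r : R, 0 < r &
    (forall w, (A `&` ball z r) w -> cdom i (u w)) /\
    Ck k (A `&` ball z r) (cmap i \o u).

(* A tensor field with two indices, given by its matrix in every chart. *)
Definition tensor := cidx C -> Y -> 'M[R]_n.
Implicit Types (T g : tensor).

Definition endo_law T : Prop := forall i j x, cdom i x -> cdom j x ->
  T j x *m jac i j x = jac i j x *m T i x.

Definition form_law T : Prop := forall i j x, cdom i x -> cdom j x ->
  (jac i j x)^T *m T j x *m jac i j x = T i x.

Definition smooth_tensor T : Prop :=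
  forall i, smooth (cimg i) (in_chart i (T i)).

Definition riemannian g : Prop :=
  [/\ form_law g, smooth_tensor g &
      forall i x, cdom i x -> (g i x)^T = g i x /\
        forall v : 'cV[R]_n, v != 0 -> 0 < (v^T *m g i x *m v) 0 0].

Definition almost_complex_at T : Prop :=
  endo_law T /\ forall i x, cdom i x -> T i x *m T i x = - 1%:M.

Definition unit_itv : set R := [set tau | 0 <= tau <= 1].

(* joint smoothness in the parameter and the point *)
Definition smooth_family (T : R -> tensor) : Prop :=
  forall i, smooth
    [set z : 'cV[R]_(1 + n) | unit_itv (usubmx z 0 0) /\ cimg i (dsubmx z)]
    (fun z => in_chart i (T (usubmx z 0 0) i) (dsubmx z)).

Definition almost_complex_family (T : R -> tensor) : Prop :=
  smooth_family T /\ forall tau, unit_itv tau -> almost_complex_at (T tau).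

Definition almost_quaternionic_family (I J K : R -> tensor) : Prop :=
  [/\ almost_complex_family I, almost_complex_family J,
      almost_complex_family K &
      forall tau, unit_itv tau -> forall i x, cdom i x ->
        I tau i x *m J tau i x = K tau i x].

(* Convergence in C^1 of maps into [Y], uniformly on [K]: all smooth functions
   on [Y] are used as test functions, which is convergence with respect to any
   proper smooth embedding of [Y] in a Euclidean space. *)
Definition C1_cvg d (B K : set 'cV[R]_d) (F : set_system R)
    (us : R -> 'cV[R]_d -> Y) (u : 'cV[R]_d -> Y) : Prop :=
  forall h : Y -> R, smooth_fun h -> forall e : R, 0 < e ->
    \forall s \near F, forall z, K z ->
      `|h (us s z) - h (u z)| <= e /\
      forall j : 'I_d, `|partial B (h \o us s) j z - partial B (h \o u) j z| <= e.

Definition C1_loc_cvg d (B : set 'cV[R]_d) (F : set_system R)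
    (us : R -> 'cV[R]_d -> Y) (u : 'cV[R]_d -> Y) : Prop :=
  forall K : set 'cV[R]_d, compact K -> K `<=` B -> C1_cvg B K F us u.

Definition tnorm g i x (v : 'cV[R]_n) : R :=
  Num.sqrt ((v^T *m g i x *m v) 0 0).

(* The norm of [ds u] with respect to [g] is in L^1 and in L^2 of the plane. *)
Definition ds_L1_L2 g (u : R -> R -> Y) : Prop :=
  exists rho : R -> R -> R,
    [/\ forall s t i, cdom i (u s t) -> rho s t =
          tnorm g i (u s t)
            (partial setT (fun z => cmap i (u (z 0 0) (z 1 0))) 0 (vec2 s t)),
        (lebesgue_measure \x lebesgue_measure)%E.-integrable setT
          (fun st : measurableTypeR R * measurableTypeR R =>
             (rho st.1 st.2)%:E) &
        (lebesgue_measure \x lebesgue_measure)%E.-integrable setT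
          (fun st : measurableTypeR R * measurableTypeR R =>
             (rho st.1 st.2 ^+ 2)%:E)].

End Charts.

Arguments cidx {R n Y} c.

Section Cotangent.
Context {R : realType} {n : nat} {X : Type} (C : charted R n X).

(* A covector at [ct_pt] is the family of its components in all charts around
   that point; the components in the other charts are set to 0. *)
Record cotangent := Cotangent {
  ct_pt : X;
  ct_cov : cidx C -> 'cV[R]_n;
  ct_off : forall i, ~ cdom i ct_pt -> ct_cov i = 0;
  ct_law : forall i j, cdom i ct_pt -> cdom j ct_pt ->
    ct_cov i = (jac i j ct_pt)^T *m ct_cov j
}.

Definition cotangent_charts : charted R (n + n) cotangent :=
  Charted (fun i : cidx C => [set y | cdom i (ct_pt y)])
          (fun i y => col_mx (cmap i (ct_pt y)) (ct_cov y i)).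

Definition zero_section : set cotangent :=
  [set y | forall i, cdom i (ct_pt y) -> ct_cov y i = 0].

Definition differential_graph (f : X -> R) : set cotangent :=
  [set y | forall i, cdom i (ct_pt y) ->
     ct_cov y i = \col_a cpartial i f a (ct_pt y)].

End Cotangent.

Section Kahler.
Context {R : realType} {n : nat} {X : topologicalType} (C : charted R n X).
Implicit Types (i j : cidx C) (x : X) (g I : tensor C) (f : X -> R)
  (F : X -> R[i]).

(* Second countability is not listed: it follows from compactness. *)
Definition manifold_with_boundary : Prop :=
  [/\ hausdorff_space X,
      (forall i, open (cdom i)) /\ (forall x, exists i, cdom i x),
      forall i, {in cdom i &, injective (cmap i)} /\
        {in cdom i, continuous (cmap i)},
      forall i (O : set X), open O -> O `<=` cdom i ->
        exists2 V : set 'cV[R]_n, open V & cmap i @` O = V `&` halfspace (d := n) &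
      forall i j, smooth (overlap i j) (in_chart i (cmap j))].

Definition nijenhuis I i x (a b c : 'I_n) : R :=
  \sum_l (I i x l a * cpartial i (I i) l x c b
          - I i x l b * cpartial i (I i) l x c a
          - I i x c l * (cpartial i (I i) a x l b - cpartial i (I i) b x l a)).

Definition complex_structure I : Prop :=
  [/\ almost_complex_at I, smooth_tensor I &
      forall i x, cdom i x -> forall a b c, nijenhuis I i x a b c = 0].

(* [omega(v, w) = g(I v, w)] *)
Definition kahler_form g I : tensor C := fun i x => (I i x)^T *m g i x.

Definition closed_form (w : tensor C) : Prop :=
  forall i x, cdom i x -> forall a b c,
    cpartial i (w i) a x b c + cpartial i (w i) b x c a
      + cpartial i (w i) c x a b = 0.

Definition kahler_manifold g I : Prop :=
  [/\ manifold_with_boundary, riemannian g, complex_structure I,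
      forall i x, cdom i x -> (I i x)^T *m g i x *m I i x = g i x &
      closed_form (kahler_form g I)].

Definition differential f i x : 'cV[R]_n := \col_a cpartial i f a x.

Definition gradient g f i x : 'cV[R]_n := invmx (g i x) *m differential f i x.

Definition Fre F : X -> R := fun x => complex.Re (F x).
Definition Fim F : X -> R := fun x => complex.Im (F x).

(* The last two conditions are the real and imaginary parts of
   [dF (I v) = 'i * dF v]. *)
Definition holomorphic I F : Prop :=
  [/\ smooth_fun C (Fre F), smooth_fun C (Fim F) &
      forall i x, cdom i x ->
        (I i x)^T *m differential (Fre F) i x = - differential (Fim F) i x /\
        (I i x)^T *m differential (Fim F) i x = differential (Fre F) i x].

Definition critical F : set X :=
  [set x | forall i, cdom i x ->
     differential (Fre F) i x = 0 /\ differential (Fim F) i x = 0].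

Definition christoffel g i x (c a b : 'I_n) : R :=
  2^-1 * \sum_d invmx (g i x) c d *
    (cpartial i (g i) a x b d + cpartial i (g i) b x a d
     - cpartial i (g i) d x a b).

Definition hessian g f i x : 'M[R]_n :=
  \matrix_(a, b) (cpartial2 i f a b x
                  - \sum_c christoffel g i x c a b * cpartial i f c x).

Definition sqnorm1 g f i x : R :=
  ((differential f i x)^T *m invmx (g i x) *m differential f i x) 0 0.

Definition sqnorm2 g f i x : R :=
  \tr (invmx (g i x) *m hessian g f i x *m invmx (g i x) *m hessian g f i x).

(* The summands |F|, |dF| and |nabla dF| are measured with [g] and its
   Levi-Civita connection, and do not depend on the chart [i]. *)
Definition C2_norm g F : \bar R :=
  ereal_sup [set e | exists i x, cdom i x /\
    e = (Num.sqrt (Fre F x ^+ 2 + Fim F x ^+ 2)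
         + Num.sqrt (sqnorm1 g (Fre F) i x + sqnorm1 g (Fim F) i x)
         + Num.sqrt (sqnorm2 g (Fre F) i x + sqnorm2 g (Fim F) i x))%:E].

Definition gradient_trajectory g f (gamma : R -> X) (pm pp : X) : Prop :=
  [/\ Ck_map C 1 setT (fun z : 'cV[R]_1 => gamma (z 0 0)),
      forall (z : 'cV[R]_1) i, cdom i (gamma (z 0 0)) ->
        partial setT (fun w => cmap i (gamma (w 0 0))) 0 z
          = gradient g f i (gamma (z 0 0)),
      gamma t @[t --> -oo] --> pm &
      gamma t @[t --> +oo] --> pp].

Definition complex_gradient_trajectory g I F (v : R -> R -> X) : Prop :=
  let v2 := fun z : 'cV[R]_2 => v (z 0 0) (z 1 0) in
  [/\ Ck_map C 2 setT v2,
      forall z i, cdom i (v2 z) ->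
        partial setT (cmap i \o v2) 0 z
        + I i (v2 z) *m (partial setT (cmap i \o v2) 1 z
                         - gradient g (Fre F) i (v2 z)) = 0,
      ds_L1_L2 g v &
      exists pm pp : X, exists gm gp : R -> X,
        [/\ critical F pm /\ critical F pp,
            gradient_trajectory g (Fre F) gm pm pp /\
            gradient_trajectory g (Fre F) gp pm pp,
            C1_loc_cvg C setT -oo (fun t (z : 'cV[R]_1) => v (z 0 0) t)
              (fun=> pm) /\
            C1_loc_cvg C setT +oo (fun t (z : 'cV[R]_1) => v (z 0 0) t)
              (fun=> pp) &
            C1_cvg C setT setT -oo (fun s (z : 'cV[R]_1) => v s (z 0 0))
              (fun z => gm (z 0 0)) /\
            C1_cvg C setT setT +oo (fun s (z : 'cV[R]_1) => v s (z 0 0))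
              (fun z => gp (z 0 0))]].

End Kahler.

Definition interval01 (R : realType) := {tau : R | 0 <= tau <= 1}.

Lemma clamp_subproof (R : realType) (tau : R) :
  0 <= Num.max 0 (Num.min tau 1) <= 1.
Proof. by rewrite le_max lexx /= ge_max ler01 ge_min lexx orbT. Qed.

Definition clamp (R : realType) (tau : R) : interval01 R :=
  exist (fun x : R => is_true (0 <= x <= 1)) _ (clamp_subproof tau).

Section Fueter.
Context {R : realType} {m : nat} {M : Type} (C : charted R m M).
Variables (I J K : R -> tensor C) (L0 L1 : set M).

(* coordinates (t, tau) *)
Definition holomorphic_strip (u : R -> R -> M) (pm pp : M) : Prop :=
  let B := [set z : 'cV[R]_2 | unit_itv (z 1 0)] in
  let u2 := fun z : 'cV[R]_2 => u (z 0 0) (z 1 0) in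
  let tends (F : set_system R) (p : M) :=
    forall h : M -> R, smooth_fun C h -> forall e : R, 0 < e ->
      \forall t \near F, forall tau, unit_itv tau -> `|h (u t tau) - h p| <= e in
  [/\ Ck_map C 1 B u2,
      forall z i, B z -> cdom i (u2 z) ->
        partial B (cmap i \o u2) 0 z
        - J (z 1 0) i (u2 z) *m partial B (cmap i \o u2) 1 z = 0,
      forall t, L0 (u t 0) /\ L1 (u t 1),
      tends -oo pm & tends +oo pp].

(* [U] lives on [0,1] x R^2; [clamp] extends it to R^3, but all derivatives are
   taken within [0,1] x R^2. *)
Definition fueter_strip (U : interval01 R -> R -> R -> M) : Prop :=
  let V := fun tau => U (clamp tau) in
  let B := [set z : 'cV[R]_3 | unit_itv (z 0 0)] in
  let V3 := fun z : 'cV[R]_3 => V (z 0 0) (z 1 0) (z 2 0) in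
  let Btt := [set z : 'cV[R]_2 | unit_itv (z 1 0)] in
  let Bts := [set z : 'cV[R]_2 | unit_itv (z 0 0)] in
  [/\ Ck_map C 2 B V3,
      forall z i, B z -> cdom i (V3 z) ->
        I (z 0 0) i (V3 z) *m partial B (cmap i \o V3) 0 z
        + J (z 0 0) i (V3 z) *m partial B (cmap i \o V3) 1 z
        + K (z 0 0) i (V3 z) *m partial B (cmap i \o V3) 2 z = 0,
      forall s t, L0 (V 0 s t) /\ L1 (V 1 s t),
      (* the images of such maps are relatively compact, so that all
         Riemannian metrics on [M] give the same condition *)
      forall g : tensor C, riemannian g -> forall tau, ds_L1_L2 g (U tau) &
      exists pm pp : M, exists um up : R -> R -> M,
        [/\ (L0 `&` L1) pm /\ (L0 `&` L1) pp,
            holomorphic_strip um pm pp /\ holomorphic_strip up pm pp,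
            C1_cvg C Btt Btt -oo (fun s z => V (z 1 0) s (z 0 0))
              (fun z => um (z 0 0) (z 1 0)) /\
            C1_cvg C Btt Btt +oo (fun s z => V (z 1 0) s (z 0 0))
              (fun z => up (z 0 0) (z 1 0)) &
            C1_loc_cvg C Bts -oo (fun t z => V (z 0 0) (z 1 0) t)
              (fun=> pm) /\
            C1_loc_cvg C Bts +oo (fun t z => V (z 0 0) (z 1 0) t)
              (fun=> pp)]].

End Fueter.

(* Main.v *)
Require Import Defs.
From HB Require Import structures.
From mathcomp Require Import all_boot all_order all_algebra.
From mathcomp Require Import all_classical all_reals all_analysis.
From mathcomp Require Import measurable_realfun complex ring lra.

(* In a chart write [x] for the base coordinates, [p] for the covector and
   [q = p - tau df].  The Levi-Civita connection, shifted so that its horizontal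
   distribution is tangent to the graph of [tau df], splits T(T^*X) into two
   copies of the tangent space; [I_tau] acts on them as [I] and its transpose,
   [J_tau] exchanges them through the metric.  With these structures the graph
   [tau df(w(s,t))] solves the Fueter equation if and only if [w(s,-t)] solves
   the complex gradient equation.
   Conversely, on a Fueter strip let [e = |dx/dtau|^2 + |D_tau q|^2].  Because the
   connection is torsion free and [I] is parallel, [e] equals a divergence
   [d_t <q, x_tau> + d_s <q, I x_tau> + d_tau (...)] up to a term bounded by the
   Hessian of [f], and [q] vanishes at [tau = 0, 1]; so for a small Hessian
   [E = int e dtau] satisfies [E <= 2 (P_t + Q_s)] with [|P|, |Q| <= 2 E].
   The asymptotic conditions make [E] bounded, and a bounded function with this
   property on the plane is zero (integrate in [t] against a slowly decaying
   weight).  Hence [x] does not depend on [tau] and [p = tau df]. *)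

Set Implicit Arguments.
Unset Strict Implicit.
Unset Printing Implicit Defensive.
Import Order.TTheory GRing.Theory Num.Theory.
Import numFieldNormedType.Exports.
Local Open Scope classical_set_scope.
Local Open Scope ring_scope.

(** * Calculus within sets with corners *)

(** The energy cannot be integrated over the whole plane, because it is only known to be bounded and
    the boundary terms have its own size. In [t] a weight with logarithmic derivative at most 1/8 is
    used: as [|P| <= 2 E], the term in which the weight is differentiated is absorbed. The size of
    [q] enters through a Poincare inequality in divergence form,
    [|q|^2 <= 2 d_tau (tau |q|^2) + 4 |mu|^2] with [mu = I x_s + x_t + grad f], so every estimate is
    pointwise up to [tau]-derivatives of functions that vanish at 0 and 1. A Hessian bounded by
    [kap] costs [kap n / 2] times [|q|^2 + |x_tau|^2], whence [kap n <= 1/4]. Boundedness of [e] has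
    an obstacle of its own: the slices at infinity have variables [(t, tau)] or [(tau, s)], so only
    [tau]-derivatives are controlled in all directions. This suffices because the equation turns
    [mu] into a covariant [tau]-derivative of [p]. *)

Section CalculusWithin.
Context {R : realType}.
Implicit Types (d : nat).

(** Each point is the vertex of a small cube, in some orthant, that stays in [A]. Half-spaces,
    strips and their products all have this property; it passes to relatively open subsets and
    determines one-sided derivatives. *)
Definition cornered d (A : set 'cV[R]_d) : Prop := forall z, A z ->
  exists (r : R) (sg : 'I_d -> R), [/\ 0 < r, forall j, `|sg j| = 1 &
    forall w : 'cV[R]_d, (forall j, 0 <= sg j * (w j 0 - z j 0) < r) -> A w].

Lemma diff_withinP d (W : normedModType R) (A : set 'cV[R]_d) (f : 'cV[R]_d -> W) z G :
  diff_within A f z G <->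
  forall e : R, 0 < e -> exists2 r : R, 0 < r & forall w, A w -> `|w - z| < r ->
    `|f w - f z - \sum_j (w j 0 - z j 0) *: G j| <= e * `|w - z|.
Proof.
split.
  move=> /eqoP H e e0; have := H e e0.
  rewrite /within /= => /nbhs_ballP[r /= r0 rP].
  exists r => // w Aw wz; apply: rP => //.
  by rewrite -ball_normE /= distrC.
move=> H; apply/eqoP => e e0.
have [r r0 rP] := H e e0.
rewrite /within /=; apply/nbhs_ballP; exists r => //= w.
rewrite -ball_normE /= distrC => wz Aw; exact: rP.
Qed.

Lemma ler_coord m n (x : 'M[R]_(m, n)) i j : `|x i j| <= `|x|.
Proof.
rewrite [leRHS]mx_normrE.
exact: (le_bigmax_cond 0 (fun k : 'I_m * 'I_n => `|x k.1 k.2|) (j := (i, j))).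
Qed.

Lemma mxnorm_le m n (x : 'M[R]_(m, n)) e :
  0 <= e -> (forall i j, `|x i j| <= e) -> `|x| <= e.
Proof. by move=> e0 H; rewrite [leLHS]mx_normrE; apply/bigmax_leP; split. Qed.

Lemma mxnorm_lt m n (x : 'M[R]_(m, n)) e :
  0 < e -> (forall i j, `|x i j| < e) -> `|x| < e.
Proof. by move=> e0 H; rewrite [ltLHS]mx_normrE; apply/bigmax_ltP; split. Qed.

Lemma lt_min3 (r1 r2 r3 : R) : 0 < r1 -> 0 < r2 -> 0 < r3 ->
  exists h : R, [/\ 0 < h, h < r1, h < r2 & h < r3].
Proof.
move=> r10 r20 r30; exists (Num.min r1 (Num.min r2 r3) / 2).
have m0 : 0 < Num.min r1 (Num.min r2 r3) by rewrite !lt_min r10 r20 r30.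
have : Num.min r1 (Num.min r2 r3) / 2 < Num.min r1 (Num.min r2 r3).
  by rewrite ltr_pdivrMr // ltr_pMr // ltr1n.
by rewrite !lt_min => /and3P[]; split => //; rewrite divr_gt0.
Qed.

Lemma eq_by_le (W : normedModType R) (x y : W) :
  (forall e : R, 0 < e -> `|x - y| <= e) -> x = y.
Proof.
move=> H; apply/eqP; rewrite -subr_eq0 -normr_eq0 eq_le normr_ge0 andbT.
by apply/ler_addgt0Pl => e e0; rewrite addr0; exact: H.
Qed.

(** The edge of the cube at [z] in direction [j] lies in [A], and along it only the [j]-th term of
    the linear part survives; so both candidates differ by at most [e] in each component. *)
Lemma diff_within_uniq d (W : normedModType R) (A : set 'cV[R]_d) (f : 'cV[R]_d -> W) z G G' :
  cornered A -> A z -> diff_within A f z G -> diff_within A f z G' -> G = G'.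
Proof.
move=> cA Az /diff_withinP H /diff_withinP H'; apply: funext => j.
apply: eq_by_le => e e0.
have e20 : 0 < e / 2 by rewrite divr_gt0.
have [r1 r10 H1] := H _ e20; have [r2 r20 H2] := H' _ e20.
have [r3 [sg [r30 sg1 H3]]] := cA _ Az.
have [h [h0 hr1 hr2 hr3]] := lt_min3 r10 r20 r30.
pose w := z + (h * sg j) *: delta_mx j 0 : 'cV[R]_d.
have wz k : w k 0 - z k 0 = (h * sg j) * (k == j)%:R.
  by rewrite /w !mxE eqxx andbT [RHS]mulrC addrAC subrr add0r mulrC.
have sq : sg j * sg j = 1 by have := sg1 j; case: (lerP 0 (sg j)) => s0; [rewrite ger0_norm //|rewrite ltr0_norm //] => E; nra.
have Aw : A w.
  apply: H3 => k; rewrite wz; case: eqP => [->|_]; last by rewrite !mulr0 lexx r30.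
  by rewrite mulr1 mulrCA sq mulr1 (ltW h0).
have nw : `|w - z| = h.
  apply/eqP; rewrite eq_le; apply/andP; split.
    apply: mxnorm_le; first exact: ltW.
    move=> k l; rewrite ord1 !mxE eqxx andbT addrAC subrr add0r.
    rewrite normrM normrM sg1 mulr1 (ger0_norm (ltW h0)).
    by case: (k == j); rewrite ?normr1 ?normr0 ?mulr1 ?mulr0 // ltW.
  have := ler_coord (w - z) j 0; rewrite mxE [X in _ + X]mxE wz eqxx mulr1.
  by rewrite normrM sg1 mulr1 (ger0_norm (ltW h0)).
have S (K : 'I_d -> W) : \sum_k (w k 0 - z k 0) *: K k = (h * sg j) *: K j.
  rewrite (bigD1 j) //= big1 ?addr0 ?wz ?eqxx ?mulr1 // => k /negbTE kj.
  by rewrite wz kj mulr0 scale0r.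
have := H1 _ Aw; rewrite nw S => /(_ hr1) B1.
have := H2 _ Aw; rewrite nw S => /(_ hr2) B2.
have : `|(h * sg j) *: (G j - G' j)| <= e * h.
  have -> : (h * sg j) *: (G j - G' j) = (f w - f z - (h * sg j) *: G' j) - (f w - f z - (h * sg j) *: G j).
    by rewrite opprB [RHS]addrC subrKA scalerBr.
  apply: le_trans (ler_normB _ _) _; apply: le_trans (lerD B2 B1) _.
  by rewrite -mulrDl -splitr.
by rewrite normrZ normrM sg1 mulr1 (ger0_norm (ltW h0)) mulrC ler_pM2r.
Qed.

Lemma partialE d (W : normedModType R) (A : set 'cV[R]_d) (f : 'cV[R]_d -> W) j z G :
  cornered A -> A z -> diff_within A f z G -> partial A f j z = G j.
Proof.
move=> cA Az H; rewrite /partial; case: xgetP => [G' _ /= HG'|/(_ G)//].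
by rewrite (diff_within_uniq cA Az H HG').
Qed.

Lemma diff_within_partial d (W : normedModType R) (A : set 'cV[R]_d) (f : 'cV[R]_d -> W) z :
  cornered A -> A z -> (exists G, diff_within A f z G) ->
  diff_within A f z (fun j => partial A f j z).
Proof.
move=> cA Az [G H]; suff -> : (fun j => partial A f j z) = G by [].
by apply: funext => j; rewrite (partialE _ cA Az H).
Qed.

Lemma diff_within_local d (W : normedModType R) (A A' : set 'cV[R]_d) (f f' : 'cV[R]_d -> W) z G r :
  0 < r -> (forall w, `|w - z| < r -> A' w -> A w /\ f' w = f w) -> f' z = f z ->
  diff_within A f z G -> diff_within A' f' z G.
Proof.
move=> r0 H Hz /diff_withinP D; apply/diff_withinP => e e0.
have [r1 r10 D1] := D _ e0; exists (Num.min r r1) => [|w A'w]; first by rewrite lt_min r0.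
rewrite lt_min => /andP[wr wr1]; have [Aw ->] := H _ wr A'w; rewrite Hz; exact: D1.
Qed.

(** Both sides select from the same set of candidate derivatives, so the choice operator returns the
    same value, even at points where no derivative exists. *)
Lemma partial_local d (W : normedModType R) (A A' : set 'cV[R]_d) (f f' : 'cV[R]_d -> W) j z r :
  0 < r -> (forall w, `|w - z| < r -> (A w <-> A' w)) ->
  (forall w, `|w - z| < r -> A w -> f w = f' w) -> f z = f' z ->
  partial A f j z = partial A' f' j z.
Proof.
move=> r0 HA Hf fz; rewrite /partial; congr (xget _ _ j).
apply/seteqP; split => G /=; apply: (diff_within_local r0) => // w wr Aw.
  by have Aw' := (HA w wr).2 Aw; rewrite Hf.
by split; [exact/HA|exact: Hf].
Qed.

Lemma cont_withinP d (W : normedModType R) (A : set 'cV[R]_d) (f : 'cV[R]_d -> W) :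
  {within A, continuous f} <->
  forall z, A z -> forall e : R, 0 < e -> exists2 r : R, 0 < r &
    forall w, A w -> `|w - z| < r -> `|f w - f z| < e.
Proof.
split.
  move=> /subspace_continuousP H z Az e e0; have := H z Az.
  move=> /cvgrPdist_lt/(_ e e0); rewrite /within /= => /nbhs_ballP[r /= r0 rP].
  exists r => // w Aw wz; rewrite distrC; apply: rP => //.
  by rewrite -ball_normE /= distrC.
move=> H; apply/subspace_continuousP => z Az; apply/cvgrPdist_lt => e e0.
have [r r0 rP] := H z Az e e0; rewrite /within /=; apply/nbhs_ballP; exists r => //= w.
rewrite -ball_normE /= distrC => wz Aw; rewrite distrC; exact: rP.
Qed.

Lemma Ck_ext k d (W : normedModType R) (A : set 'cV[R]_d) (f f' : 'cV[R]_d -> W) :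
  (forall z, A z -> f z = f' z) -> Ck k A f -> Ck k A f'.
Proof.
elim: k f f' => [|k IH] f f' E /=.
  move=> /cont_withinP H; apply/cont_withinP => z Az e e0.
  by have [r r0 rP] := H z Az e e0; exists r => // w Aw wz; rewrite -!E //; exact: rP.
move=> [D C]; split.
  move=> z Az; have [G HG] := D z Az; exists G.
  by apply: (diff_within_local ltr01) HG => [w _ Aw|]; [rewrite E|rewrite E].
move=> j; apply: IH (C j) => z Az.
by apply: (partial_local _ ltr01) => //; [move=> w _ /E|exact: E].
Qed.

Lemma CkS k d (W : normedModType R) (A : set 'cV[R]_d) (f : 'cV[R]_d -> W) (D : 'I_d -> 'cV[R]_d -> W) :
  cornered A -> (forall z, A z -> diff_within A f z (D^~ z)) ->
  (forall j, Ck k A (D j)) -> Ck k.+1 A f.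
Proof.
move=> cA H C; split=> [z Az|j]; first by exists (D^~ z); exact: H.
by apply: Ck_ext (C j) => z Az; rewrite (partialE _ cA Az (H z Az)).
Qed.

Lemma Ck_diff k d (W : normedModType R) (A : set 'cV[R]_d) (f : 'cV[R]_d -> W) z :
  cornered A -> Ck k.+1 A f -> A z -> diff_within A f z (fun j => partial A f j z).
Proof. by move=> cA [D _] Az; apply: diff_within_partial => //; exact: D. Qed.

Lemma Ck_partial k d (W : normedModType R) (A : set 'cV[R]_d) (f : 'cV[R]_d -> W) j :
  Ck k.+1 A f -> Ck k A (partial A f j).
Proof. by move=> [_ C]; exact: C. Qed.

Lemma diff_within_lip d (W : normedModType R) (A : set 'cV[R]_d) (f : 'cV[R]_d -> W) z G :
  diff_within A f z G -> exists2 K : R, 0 < K & exists2 r : R, 0 < r &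
    forall w, A w -> `|w - z| < r -> `|f w - f z| <= K * `|w - z|.
Proof.
move=> /diff_withinP H; have [r r0 rP] := H 1 ltr01.
have S0 : 0 <= \sum_j `|G j| by apply: sumr_ge0.
exists (1 + \sum_j `|G j|); first lra.
exists r => // w Aw wz; have := rP w Aw wz; rewrite mul1r => B.
rewrite -[f w - f z](subrK (\sum_j (w j 0 - z j 0) *: G j)) mulrDl mul1r.
apply: le_trans (ler_normD _ _) (lerD B _).
apply: le_trans (ler_norm_sum _ _ _) _; rewrite mulr_suml; apply: ler_sum => j _.
rewrite normrZ mulrC ler_wpM2l //.
by have := ler_coord (w - z) j 0; rewrite !mxE.
Qed.

Lemma diff_within_cont d (W : normedModType R) (A : set 'cV[R]_d) (f : 'cV[R]_d -> W) z G :
  diff_within A f z G -> forall e : R, 0 < e -> exists2 r : R, 0 < r &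
    forall w, A w -> `|w - z| < r -> `|f w - f z| < e.
Proof.
move=> /diff_within_lip[K K0 [r r0 rP]] e e0.
exists (Num.min r (e / K)); first by rewrite lt_min r0 divr_gt0.
move=> w Aw; rewrite lt_min => /andP[wr we]; apply: le_lt_trans (rP w Aw wr) _.
by rewrite mulrC -ltr_pdivlMr.
Qed.

Lemma Ck_cont k d (W : normedModType R) (A : set 'cV[R]_d) (f : 'cV[R]_d -> W) :
  Ck k A f -> {within A, continuous f}.
Proof.
case: k => [//|k] [D _]; apply/cont_withinP => z Az.
by have [G HG] := D z Az; exact: diff_within_cont HG.
Qed.

Lemma Ck_leS k d (W : normedModType R) (A : set 'cV[R]_d) (f : 'cV[R]_d -> W) :
  Ck k.+1 A f -> Ck k A f.
Proof.
elim: k f => [|k IH] f; first exact: Ck_cont.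
by move=> [D C]; split => // j; exact: IH (C j).
Qed.

Lemma Ck_le k l d (W : normedModType R) (A : set 'cV[R]_d) (f : 'cV[R]_d -> W) :
  (l <= k)%N -> Ck k A f -> Ck l A f.
Proof.
move=> /subnK <-; elim: (k - l)%N => [//|m IH]; rewrite addSn => /Ck_leS; exact: IH.
Qed.

Definition locally_eq d (A A' : set 'cV[R]_d) (z : 'cV[R]_d) : Prop :=
  exists2 r : R, 0 < r & forall w, `|w - z| < r -> (A w <-> A' w).

Lemma locally_eq_near d (A A' : set 'cV[R]_d) z : locally_eq A A' z ->
  exists2 r : R, 0 < r & forall w, `|w - z| < r -> locally_eq A A' w.
Proof.
move=> [r r0 rP]; exists (r / 2); first by rewrite divr_gt0.
move=> w wz; exists (r / 2); first by rewrite divr_gt0.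
move=> v vw; apply: rP; rewrite -[v - z](subrKA w) (splitr r).
by apply: le_lt_trans (ler_normD _ _) _; rewrite ltrD.
Qed.

Lemma partial_locally_eq d (W : normedModType R) (A A' : set 'cV[R]_d) (f : 'cV[R]_d -> W) j z :
  locally_eq A A' z -> partial A f j z = partial A' f j z.
Proof. by move=> [r r0 rP]; apply: (partial_local _ r0). Qed.

Lemma Ck_subset k d (W : normedModType R) (A A' : set 'cV[R]_d) (f : 'cV[R]_d -> W) :
  (forall z, A' z -> A z /\ locally_eq A A' z) -> Ck k A f -> Ck k A' f.
Proof.
elim: k f => [|k IH] f H /=.
  move=> /cont_withinP Cg; apply/cont_withinP => v A'v e e0; have [Av [r r0 rP]] := H v A'v.
  have [r2 r20 H2] := Cg v Av e e0; exists r2 => // w A'w; apply: H2.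
  by have [] := H w A'w.
move=> [D C]; split=> [z A'z|j].
  have [Az [r r0 rP]] := H z A'z; have [G HG] := D z Az; exists G.
  by apply: (diff_within_local r0) HG => // w wr; split => //; exact/rP.
apply: Ck_ext (IH _ H (C j)) => z A'z.
by apply: partial_locally_eq; have [] := H z A'z.
Qed.

(** Regularity may be checked with a different domain and a different representative near each
    point. In the inductive step the local domain is cut down to a ball on which [A] and [A'] agree
    near every point, not only near [z], so that the partial derivatives agree there too. *)
Lemma Ck_local k d (W : normedModType R) (A : set 'cV[R]_d) (f : 'cV[R]_d -> W) :
  (forall z, A z -> exists A' f', [/\ locally_eq A A' z, A' z, (forall w, A' w -> f w = f' w)
     & Ck k A' f']) -> Ck k A f.
Proof.
elim: k f => [|k IH] f H.
  apply/cont_withinP => z Az e e0; have [A' [f' [[r r0 rP] Az' E C]]] := H z Az.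
  have [r1 r10 H1] := (cont_withinP _ _).1 C z Az' e e0.
  exists (Num.min r r1); first by rewrite lt_min r0.
  move=> w Aw; rewrite lt_min => /andP[wr wr1]; have A'w := (rP w wr).1 Aw.
  by rewrite !E //; exact: H1.
split=> [z Az|j].
  have [A' [f' [[r r0 rP] Az' E [D C]]]] := H z Az; have [G HG] := D z Az'; exists G.
  apply: (diff_within_local r0) HG => [w wr Aw|]; last exact: E.
  by have A'w := (rP w wr).1 Aw; split => //; exact: E.
apply: IH => z Az; have [A' [f' [AA Az' E [D C]]]] := H z Az.
have [r r0 rP] := locally_eq_near AA; have [r1 r10 r1P] := AA.
pose m := Num.min r r1.
have m0 : 0 < m by rewrite lt_min r0.
exists (A' `&` [set w | `|w - z| < m]), (partial A' f' j); split.
- exists m => // w wm; move: (wm); rewrite lt_min => /andP[wr wr1].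
  by split => [Aw|[A'w _]]; [split => //; exact/(r1P w wr1)|exact/(r1P w wr1)].
- by split => //=; rewrite subrr normr0.
- move=> w /= [A'w]; rewrite lt_min => /andP[wr _].
  rewrite (partial_locally_eq _ _ (rP w wr)).
  by apply: (partial_local _ ltr01) => // [v _|]; exact: E.
- apply: Ck_subset (C j) => v [A'v /= vz]; split => //; exists (m - `|v - z|); first by rewrite subr_gt0.
  move=> w wv; split=> [A'w|[]//]; split => //=.
  rewrite -[w - z](subrKA v); apply: le_lt_trans (ler_normD _ _) _.
  by rewrite -ltrBrDr.
Qed.

Section Rules.
Variables (d : nat) (A : set 'cV[R]_d).
Implicit Types (f g : 'cV[R]_d -> R) (z : 'cV[R]_d).

Lemma diff_within_cst (W : normedModType R) (c : W) z : diff_within A (fun=> c) z (fun=> 0).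
Proof.
apply/diff_withinP => e e0; exists 1 => // w _ _.
by rewrite subrr big1 ?subr0 ?normr0 ?mulr_ge0 // ?ltW // => j _; rewrite scaler0.
Qed.

Lemma diff_within_coord (a : 'I_d) z :
  diff_within A (fun w => w a 0) z (fun j => (a == j)%:R : R).
Proof.
apply/diff_withinP => e e0; exists 1 => // w _ _.
rewrite (bigD1 a) //= eqxx big1 ?addr0; last first.
  by move=> j /negbTE ja; rewrite eq_sym ja scaler0.
by rewrite [_ *: _]mulr1 subrr normr0 mulr_ge0 // ltW.
Qed.

Lemma diff_withinD (W : normedModType R) (f g : 'cV[R]_d -> W) z G H : diff_within A f z G -> diff_within A g z H ->
  diff_within A (fun w => f w + g w) z (fun j => G j + H j).
Proof.
move=> /diff_withinP Df /diff_withinP Dg; apply/diff_withinP => e e0.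
have e20 : 0 < e / 2 by rewrite divr_gt0.
have [r1 r10 H1] := Df _ e20; have [r2 r20 H2] := Dg _ e20.
exists (Num.min r1 r2); first by rewrite lt_min r10.
move=> w Aw; rewrite lt_min => /andP[wr1 wr2].
have -> : \sum_j (w j 0 - z j 0) *: (G j + H j) =
    \sum_j (w j 0 - z j 0) *: G j + \sum_j (w j 0 - z j 0) *: H j.
  by rewrite -big_split /=; apply: eq_bigr => j _; rewrite scalerDr.
set SG := \sum_j _ *: G j; set SH := \sum_j _ *: H j.
have -> : f w + g w - (f z + g z) - (SG + SH) = (f w - f z - SG) + (g w - g z - SH).
  by rewrite [RHS]addrACA -opprD [X in _ = X - _]addrACA -opprD.
apply: le_trans (ler_normD _ _) _.
by rewrite (splitr e) mulrDl; apply: lerD; [exact: H1|exact: H2].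
Qed.

Lemma diff_withinM f g z G H : diff_within A f z G -> diff_within A g z H ->
  diff_within A (fun w => f w * g w) z (fun j => G j * g z + f z * H j).
Proof.
move=> Df Dg.
have [K K0 [r3 r30 H3]] := diff_within_lip Df.
have Cg := diff_within_cont Dg.
move: Df Dg => /diff_withinP Df /diff_withinP Dg; apply/diff_withinP => e e0.
(* The remainder of the product splits into three terms; [M] dominates all their factors, so that
   each of them is at most a third of the allowed error. *)
pose M := 1 + `|f z| + `|g z| + K.
have M0 : 0 < M.
  by rewrite /M -!addrA ltr_pwDl // !addr_ge0 // ltW.
have e30 : 0 < e / (3 * M) by rewrite divr_gt0 // mulr_gt0.
have [r1 r10 H1] := Df _ e30; have [r2 r20 H2] := Dg _ e30; have [r4 r40 H4] := Cg _ e30.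
exists (Num.min (Num.min r1 r2) (Num.min r3 r4)); first by rewrite !lt_min r10 r20 r30.
move=> w Aw; rewrite !lt_min => /andP[/andP[wr1 wr2] /andP[wr3 wr4]].
have {H1} B1 := H1 w Aw wr1; have {H2} B2 := H2 w Aw wr2.
have {H3} B3 := H3 w Aw wr3; have {H4} B4 := H4 w Aw wr4.
have -> : \sum_j (w j 0 - z j 0) *: (G j * g z + f z * H j) =
    (\sum_j (w j 0 - z j 0) *: G j) * g z + f z * (\sum_j (w j 0 - z j 0) *: H j).
  rewrite mulr_suml mulr_sumr -big_split /=; apply: eq_bigr => j _.
  by rewrite scalerDr /GRing.scale /= mulrA [in RHS]mulrCA.
move: B1 B2; set SG := \sum_j _ *: G j; set SH := \sum_j _ *: H j => B1 B2.
have -> : f w * g w - f z * g z - (SG * g z + f z * SH) =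
  (f w - f z - SG) * g z + f z * (g w - g z - SH) + (f w - f z) * (g w - g z) by ring.
set N := `|w - z| in B1 B2 B3 *.
have N0 : 0 <= N by rewrite normr_ge0.
have E0 := ltW e30.
have X1 : `|(f w - f z - SG) * g z| <= e / (3 * M) * N * M.
  rewrite normrM; apply: ler_pM => //; rewrite /M.
  by rewrite -addrA (addrC (`|g z|)) addrA lerDr !addr_ge0 // ltW.
have X2 : `|f z * (g w - g z - SH)| <= e / (3 * M) * N * M.
  rewrite normrM mulrC; apply: ler_pM => //; rewrite /M.
  by rewrite addrAC -!addrA addrC -!addrA lerDl !addr_ge0 // ltW.
have X3 : `|(f w - f z) * (g w - g z)| <= e / (3 * M) * N * M.
  rewrite normrM; apply: le_trans (ler_pM _ _ B3 (ltW B4)) _ => //.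
  rewrite mulrC [K * N]mulrC mulrA; apply: ler_wpM2l; first by rewrite mulr_ge0.
  by rewrite /M lerDr !addr_ge0.
apply: le_trans (ler_normD _ _) _; apply: le_trans (lerD (ler_normD _ _) (lexx _)) _.
apply: le_trans (lerD (lerD X1 X2) X3) _.
have -> : e / (3 * M) * N * M = e * N / 3 by field; rewrite gt_eqF.
by lra.
Qed.

Lemma diff_withinN (W : normedModType R) (f : 'cV[R]_d -> W) z G : diff_within A f z G ->
  diff_within A (fun w => - f w) z (fun j => - G j).
Proof.
move=> /diff_withinP D; apply/diff_withinP => e e0; have [r r0 rP] := D e e0.
exists r => // w Aw wr; have := rP w Aw wr; rewrite -normrN.
by congr (`| _ | <= _); rewrite !opprD !opprK -sumrN; congr (_ + _); apply: eq_bigr => j _; rewrite scalerN opprK.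
Qed.

Lemma diff_within_sum (W : normedModType R) (I : Type) (s : seq I) (P : pred I) (F : I -> 'cV[R]_d -> W) z G :
  (forall i, P i -> diff_within A (F i) z (G i)) ->
  diff_within A (fun w => \sum_(i <- s | P i) F i w) z (fun j => \sum_(i <- s | P i) G i j).
Proof.
move=> D; elim: s => [|i s IH].
  have -> : (fun w => \sum_(i <- [::] | P i) F i w) = (fun=> 0) by apply: funext => w; rewrite big_nil.
  have -> : (fun j => \sum_(i <- [::] | P i) G i j) = (fun=> 0) by apply: funext => w; rewrite big_nil.
  exact: diff_within_cst.
have -> : (fun w => \sum_(j <- i :: s | P j) F j w) = (fun w => (if P i then F i w else 0) + \sum_(j <- s | P j) F j w).
  by apply: funext => w; rewrite big_cons; case: ifP => // _; rewrite add0r.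
have -> : (fun j => \sum_(k <- i :: s | P k) G k j) = (fun j => (if P i then G i j else 0) + \sum_(k <- s | P k) G k j).
  by apply: funext => w; rewrite big_cons; case: ifP => // _; rewrite add0r.
by apply: diff_withinD => //; case: (boolP (P i)) => [/D//|_]; exact: diff_within_cst.
Qed.

Lemma diff_within_comp1 (phi : R -> R) (c : R) f z G : is_derive (f z) 1 phi c ->
  diff_within A f z G -> diff_within A (phi \o f) z (fun j => c * G j).
Proof.
move=> [Dphi Dc] Df.
have [K K0 [r3 r30 H3]] := diff_within_lip Df.
have P (e : R) : 0 < e -> exists2 r : R, 0 < r & forall y, `|y - f z| < r ->
    `|phi y - phi (f z) - c * (y - f z)| <= e * `|y - f z|.
  move=> e0; have /derivable_nbhsP/eqaddoP/(_ e e0) := Dphi.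
  move=> /nbhs_ballP[r /= r0 rP]; exists r => // y yr.
  have := rP (y - f z); rewrite -ball_normE /= sub0r normrN => /(_ yr).
  rewrite /= !fctE /= /shift /= scaler1 subrK /GRing.scale /= mulrC => H.
  by rewrite -addrA -opprD -Dc.
have Cf := diff_within_cont Df.
move: Df => /diff_withinP Df.
apply/diff_withinP => e e0.
have e10 : 0 < e / 2 / K by rewrite !divr_gt0.
have M0 : 0 < 1 + `|c| by rewrite ltr_pwDl.
have e20 : 0 < e / 2 / (1 + `|c|) by rewrite !divr_gt0.
have [r1 r10 H1] := P _ e10; have [r2 r20 H2] := Df _ e20; have [r4 r40 H4] := Cf _ r10.
exists (Num.min r2 (Num.min r3 r4)); first by rewrite !lt_min r20 r30.
move=> w Aw; rewrite !lt_min => /and3P[wr2 wr3 wr4].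
have B1 := H1 _ (H4 _ Aw wr4); have B2 := H2 _ Aw wr2; have B3 := H3 _ Aw wr3.
have -> : \sum_j (w j 0 - z j 0) *: (c * G j) = c * \sum_j (w j 0 - z j 0) *: G j.
  by rewrite mulr_sumr; apply: eq_bigr => j _; rewrite /GRing.scale /= mulrCA.
move: B2; set SG := \sum_j _ *: G j => B2 /=.
have -> : phi (f w) - phi (f z) - c * SG =
  (phi (f w) - phi (f z) - c * (f w - f z)) + c * (f w - f z - SG) by ring.
apply: le_trans (ler_normD _ _) _; rewrite [e in leRHS]splitr mulrDl; apply: lerD.
  apply: le_trans B1 _; apply: le_trans (ler_wpM2l (ltW e10) B3) _.
  by rewrite mulrA divfK // gt_eqF.
rewrite normrM; apply: le_trans (ler_wpM2l _ B2) _ => //.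
rewrite mulrA; apply: ler_wpM2r => //.
by rewrite mulrA ler_pdivrMr // mulrC ler_wpM2l ?divr_ge0 ?(ltW e0) // lerDr.
Qed.

End Rules.

Lemma finite_radius (I : finType) (P : I -> R -> Prop) :
  (forall i r r', r' <= r -> P i r -> P i r') ->
  (forall i, exists2 r : R, 0 < r & P i r) -> exists2 r : R, 0 < r & forall i, P i r.
Proof.
move=> mono H.
have /choice[rr Hr] : forall i, exists r : R, 0 < r /\ P i r.
  by move=> i; have [r r0 rP] := H i; exists r.
exists (\big[Num.min/1]_i rr i).
  by apply: (big_ind (fun x : R => 0 < x)) => // [x y x0 y0|i _]; [rewrite lt_min x0|have [] := Hr i].
by move=> i; apply: mono (Hr i).2; exact: bigmin_le_cond.
Qed.

Lemma diff_within_mx d (A : set 'cV[R]_d) m n (f : 'cV[R]_d -> 'M[R]_(m, n)) z G :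
  diff_within A f z G <-> forall a b, diff_within A (fun w => f w a b) z (fun j => G j a b).
Proof.
have E w a b : f w a b - f z a b - \sum_j (w j 0 - z j 0) *: G j a b =
    (f w - f z - \sum_j (w j 0 - z j 0) *: G j) a b.
  by rewrite !mxE summxE; congr (_ - _); apply: eq_bigr => j _; rewrite mxE.
split=> [/diff_withinP H a b|H]; apply/diff_withinP => e e0.
  have [r r0 rP] := H e e0; exists r => // w Aw wr.
  by rewrite E; apply: le_trans (rP w Aw wr); exact: ler_coord.
have {}H a b : exists2 r : R, 0 < r & forall w, A w -> `|w - z| < r ->
    `|(f w - f z - \sum_j (w j 0 - z j 0) *: G j) a b| <= e * `|w - z|.
  have /diff_withinP/(_ e e0)[r r0 rP] := H a b; exists r => // w Aw wr.
  by rewrite -E; exact: rP.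
have [|[a b]|r r0 rP] := @finite_radius _ (fun (ab : 'I_m * 'I_n) (r : R) => forall w, A w -> `|w - z| < r ->
    `|(f w - f z - \sum_j (w j 0 - z j 0) *: G j) ab.1 ab.2| <= e * `|w - z|).
- by move=> ab r r' rr H1 w Aw wr; apply: H1 => //; exact: lt_le_trans rr.
- exact: H.
exists r => // w Aw wr; apply: mxnorm_le; first by rewrite mulr_ge0 // ltW.
by move=> a b; exact: (rP (a, b)).
Qed.

Lemma partial_mx d (A : set 'cV[R]_d) m n (f : 'cV[R]_d -> 'M[R]_(m, n)) z j a b :
  cornered A -> A z -> (exists G, diff_within A f z G) ->
  partial A f j z a b = partial A (fun w => f w a b) j z.
Proof.
move=> cA Az [G H]; rewrite (partialE _ cA Az H).
by rewrite (partialE j cA Az ((diff_within_mx _ _ _ _).1 H a b)).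
Qed.

Lemma cont_within_mx d (A : set 'cV[R]_d) m n (f : 'cV[R]_d -> 'M[R]_(m, n)) :
  {within A, continuous f} <-> forall a b, {within A, continuous (fun w => f w a b)}.
Proof.
split=> [/cont_withinP H a b|H]; apply/cont_withinP => z Az e e0.
  have [r r0 rP] := H z Az e e0; exists r => // w Aw wr.
  by have := le_lt_trans (ler_coord (f w - f z) a b) (rP w Aw wr); rewrite !mxE.
have [|[a b]|r r0 rP] := @finite_radius _ (fun (ab : 'I_m * 'I_n) (r : R) => forall w, A w -> `|w - z| < r ->
    `|(f w - f z) ab.1 ab.2| < e).
- by move=> ab r r' rr H1 w Aw wr; apply: H1 => //; exact: lt_le_trans rr.
- have /cont_withinP/(_ z Az e e0)[r r0 rP] := H a b; exists r => // w Aw wr.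
  by have := rP w Aw wr; rewrite !mxE.
by exists r => // w Aw wr; apply: mxnorm_lt => // a b; exact: (rP (a, b)).
Qed.

Lemma Ck_mx k d (A : set 'cV[R]_d) m n (f : 'cV[R]_d -> 'M[R]_(m, n)) : cornered A ->
  (Ck k A f <-> forall a b, Ck k A (fun w => f w a b)).
Proof.
move=> cA; elim: k f => [|k IH] f; first exact: cont_within_mx.
split=> [[D C] a b|H].
  apply: (CkS (D := fun j w => partial A f j w a b)) => //.
    by move=> z Az; have := (diff_within_mx _ _ _ _).1 (diff_within_partial cA Az (D z Az)) a b.
  by move=> j; have := (IH _).1 (C j) a b.
apply: (CkS (D := fun j w => \matrix_(a, b) partial A (fun v => f v a b) j w)) => //.
  move=> z Az; apply/diff_within_mx => a b.
  have [Dab _] := H a b; have := diff_within_partial cA Az (Dab z Az).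
  by congr diff_within; apply: funext => j; rewrite mxE.
move=> j; apply/IH => a b; have [_ Cab] := H a b; apply: Ck_ext (Cab j) => z _.
by rewrite mxE.
Qed.

Lemma diff_within_comp d m (W : normedModType R) (A : set 'cV[R]_d) (f : 'cV[R]_d -> W)
  (B : set 'cV[R]_m) (u : 'cV[R]_m -> 'cV[R]_d) z G H :
  diff_within A f (u z) G -> diff_within B u z H -> (forall w, B w -> A (u w)) ->
  diff_within B (f \o u) z (fun k => \sum_j H k j 0 *: G j).
Proof.
move=> Df Du BA.
have [K K0 [r3 r30 H3]] := diff_within_lip Du.
have Cu := diff_within_cont Du.
move: Df Du => /diff_withinP Df /diff_withinP Du; apply/diff_withinP => e e0.
pose S := 1 + \sum_j `|G j|.
have S0 : 0 < S by rewrite ltr_pwDl // sumr_ge0.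
have e10 : 0 < e / 2 / K by rewrite !divr_gt0.
have e20 : 0 < e / 2 / S by rewrite !divr_gt0.
have [r1 r10 H1] := Df _ e10; have [r2 r20 H2] := Du _ e20; have [r4 r40 H4] := Cu _ r10.
exists (Num.min r2 (Num.min r3 r4)); first by rewrite !lt_min r20 r30.
move=> w Bw; rewrite !lt_min => /and3P[wr2 wr3 wr4].
have B1 := H1 _ (BA _ Bw) (H4 _ Bw wr4); have B2 := H2 _ Bw wr2; have B3 := H3 _ Bw wr3.
set N := `|w - z| in B2 B3 *.
pose rem := u w - u z - \sum_k (w k 0 - z k 0) *: H k.
have -> : \sum_k (w k 0 - z k 0) *: (\sum_j H k j 0 *: G j) =
    \sum_j (u w j 0 - u z j 0) *: G j - \sum_j rem j 0 *: G j.
  rewrite -sumrB; under eq_bigr do rewrite scaler_sumr.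
  rewrite exchange_big /=; apply: eq_bigr => j _.
  rewrite -scalerBl /rem !mxE subKr summxE scaler_suml.
  by apply: eq_bigr => k _; rewrite mxE scalerA.
rewrite opprB addrCA [X in `|X|]addrC; apply: le_trans (ler_normD _ _) _.
rewrite [e in leRHS]splitr mulrDl; apply: lerD.
  apply: le_trans B1 _; apply: le_trans (ler_wpM2l (ltW e10) B3) _.
  by rewrite mulrA divfK // gt_eqF.
apply: le_trans (ler_norm_sum _ _ _) _.
have X j : `|rem j 0 *: G j| <= e / 2 / S * N * `|G j|.
  rewrite normrZ; apply: ler_wpM2r => //; apply: le_trans (ler_coord _ _ _) _; exact: B2.
apply: le_trans (ler_sum _ (fun j _ => X j)) _; rewrite -mulr_sumr.
apply: (@le_trans _ _ (e / 2 / S * N * S)).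
  by apply: ler_wpM2l; [rewrite mulr_ge0 ?normr_ge0 // ltW|rewrite /S lerDr].
by rewrite mulrAC divfK // gt_eqF.
Qed.

Section CkRules.
Variables (d : nat) (A : set 'cV[R]_d).
Hypothesis cA : cornered A.
Implicit Types (f g : 'cV[R]_d -> R) (z : 'cV[R]_d) (k : nat).

Lemma Ck_cst k (W : normedModType R) (c : W) : Ck k A (fun=> c).
Proof.
elim: k c => [|k IH] c; first by apply/cont_withinP => z _ e e0; exists 1 => // w _ _; rewrite subrr normr0.
apply: (CkS (D := fun _ _ => 0)) => // z Az; exact: diff_within_cst.
Qed.

Lemma Ck_coord k (a : 'I_d) : Ck k A (fun w => w a 0).
Proof.
case: k => [|k].
  apply/cont_withinP => z Az; exact: diff_within_cont (diff_within_coord A a z).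
apply: (CkS (D := fun j _ => (a == j)%:R : R)) => // [z Az|j]; first exact: diff_within_coord.
exact: Ck_cst.
Qed.

Lemma CkD k (W : normedModType R) (f g : 'cV[R]_d -> W) :
  Ck k A f -> Ck k A g -> Ck k A (fun w => f w + g w).
Proof.
elim: k f g => [|k IH] f g Cf Cg.
  apply/cont_withinP => z Az e e0; have e20 : 0 < e / 2 by rewrite divr_gt0.
  have [r1 r10 H1] := (cont_withinP _ _).1 Cf z Az _ e20.
  have [r2 r20 H2] := (cont_withinP _ _).1 Cg z Az _ e20.
  exists (Num.min r1 r2); first by rewrite lt_min r10.
  move=> w Aw; rewrite lt_min => /andP[wr1 wr2]; rewrite opprD addrACA (splitr e).
  by apply: le_lt_trans (ler_normD _ _) _; apply: ltrD; [exact: H1|exact: H2].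
apply: (CkS (D := fun j w => partial A f j w + partial A g j w)) => //.
  by move=> z Az; exact: diff_withinD (Ck_diff cA Cf Az) (Ck_diff cA Cg Az).
by move=> j; apply: IH; apply: Ck_partial.
Qed.

Lemma CkN k (W : normedModType R) (f : 'cV[R]_d -> W) : Ck k A f -> Ck k A (fun w => - f w).
Proof.
elim: k f => [|k IH] f Cf.
  apply/cont_withinP => z Az e e0; have [r r0 H] := (cont_withinP _ _).1 Cf z Az e e0.
  by exists r => // w Aw wr; rewrite -opprD normrN; exact: H.
apply: (CkS (D := fun j w => - partial A f j w)) => //.
  by move=> z Az; exact: diff_withinN (Ck_diff cA Cf Az).
by move=> j; apply: IH; apply: Ck_partial.
Qed.

Lemma CkB k (W : normedModType R) (f g : 'cV[R]_d -> W) :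
  Ck k A f -> Ck k A g -> Ck k A (fun w => f w - g w).
Proof. by move=> Cf Cg; apply: CkD => //; exact: CkN. Qed.

Lemma CkM k f g : Ck k A f -> Ck k A g -> Ck k A (fun w => f w * g w).
Proof.
elim: k f g => [|k IH] f g Cf Cg.
  move: Cf Cg => /subspace_continuousP Cf /subspace_continuousP Cg.
  apply/subspace_continuousP => z Az; apply: cvgM; [exact: Cf|exact: Cg].
apply: (CkS (D := fun j w => partial A f j w * g w + f w * partial A g j w)) => //.
  by move=> z Az; exact: diff_withinM (Ck_diff cA Cf Az) (Ck_diff cA Cg Az).
by move=> j; apply: CkD; apply: IH; rewrite -/(Ck k A _); try exact: Ck_partial; exact: Ck_leS.
Qed.

Lemma Ck_sum k (W : normedModType R) (I : Type) (s : seq I) (P : pred I) (F : I -> 'cV[R]_d -> W) :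
  (forall i, P i -> Ck k A (F i)) -> Ck k A (fun w => \sum_(i <- s | P i) F i w).
Proof.
move=> H; elim: s => [|i s IH].
  by apply: Ck_ext (Ck_cst k 0) => z _; rewrite big_nil.
case: (boolP (P i)) => Pi; last by apply: Ck_ext IH => z _; rewrite big_cons (negbTE Pi).
by apply: Ck_ext (CkD (H i Pi) IH) => z _; rewrite big_cons Pi.
Qed.

Lemma Ck_prod k (I : Type) (s : seq I) (P : pred I) (F : I -> 'cV[R]_d -> R) :
  (forall i, P i -> Ck k A (F i)) -> Ck k A (fun w => \prod_(i <- s | P i) F i w).
Proof.
move=> H; elim: s => [|i s IH].
  by apply: (@Ck_ext _ _ _ _ (fun=> 1 : R)) => [z _|]; [rewrite big_nil|exact: Ck_cst].
case: (boolP (P i)) => Pi; last by apply: Ck_ext IH => z _; rewrite big_cons (negbTE Pi).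
by apply: Ck_ext (CkM (H i Pi) IH) => z _; rewrite big_cons Pi.
Qed.

(** The chain of successive derivatives is supplied as a sequence [phi], since the induction needs
    the statement for every derivative of the outer function. *)
Lemma Ck_comp1 k (phi : nat -> R -> R) f : Ck k A f ->
  (forall l z, A z -> is_derive (f z) 1 (phi l) (phi l.+1 (f z))) -> Ck k A (phi 0 \o f).
Proof.
move=> + H; suff G l : Ck k A f -> Ck k A (phi l \o f) by exact: G.
elim: k l => [|k IH] l Cf.
  apply/cont_withinP => z Az e e0.
  have /derivable1_diffP/differentiable_continuous C : derivable (phi l) (f z) 1 by have [] := H l z Az.
  have /cvgrPdist_lt/(_ e e0)/nbhs_ballP[r /= r0 rP] := C.
  have [r1 r10 H1] := (cont_withinP _ _).1 Cf z Az r r0; exists r1 => // w Aw wr.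
  rewrite distrC; apply: rP; rewrite -ball_normE /= distrC; exact: H1.
apply: (CkS (D := fun j w => phi l.+1 (f w) * partial A f j w)) => //.
  by move=> z Az; exact: diff_within_comp1 (H l z Az) (Ck_diff cA Cf Az).
by move=> j; apply: CkM; [apply: (IH l.+1); exact: Ck_leS|exact: Ck_partial].
Qed.

Lemma CkV k f : (forall z, A z -> f z != 0) -> Ck k A f -> Ck k A (fun w => (f w)^-1).
Proof.
move=> H Cf; elim: k Cf => [|k IH] Cf.
  move: Cf => /subspace_continuousP Cf.
  by apply/subspace_continuousP => z Az; apply: cvgV; [exact: H|exact: Cf].
apply: (CkS (D := fun j w => (- ((f w)^-1 * (f w)^-1)) * partial A f j w)) => //.
  move=> z Az; apply: (@diff_within_comp1 _ _ (fun y => y^-1)); last exact: Ck_diff cA Cf Az.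
  have := @is_deriveV R id (f z) 1 1 (H z Az) (is_derive_id _ _).
  by rewrite /= -expr2 exprVn [_ *: _]mulr1.
have C := IH (Ck_leS Cf).
by move=> j; apply: CkM; [apply: CkN; exact: CkM|exact: Ck_partial].
Qed.

Lemma Ck_det k n (M : 'cV[R]_d -> 'M[R]_n) : (forall a b, Ck k A (fun w => M w a b)) ->
  Ck k A (fun w => \det (M w)).
Proof.
move=> H; apply: Ck_sum => s _; apply: CkM; first exact: Ck_cst.
by apply: Ck_prod => i _; exact: H.
Qed.

Lemma Ck_mulmx k m n p (M : 'cV[R]_d -> 'M[R]_(m, n)) (N : 'cV[R]_d -> 'M[R]_(n, p)) :
  (forall a b, Ck k A (fun w => M w a b)) -> (forall a b, Ck k A (fun w => N w a b)) ->
  forall a b, Ck k A (fun w => (M w *m N w) a b).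
Proof.
move=> H H' a b; apply: (@Ck_ext _ _ _ _ (fun w => \sum_j M w a j * N w j b)).
  by move=> z _; rewrite mxE.
by apply: Ck_sum => j _; exact: CkM.
Qed.

Lemma Ck_invmx k n (M : 'cV[R]_d -> 'M[R]_n) : (forall w, A w -> M w \in unitmx) ->
  (forall a b, Ck k A (fun w => M w a b)) -> forall a b, Ck k A (fun w => invmx (M w) a b).
Proof.
move=> U H a b.
apply: (@Ck_ext _ _ _ _ (fun w => (\det (M w))^-1 * ((-1) ^+ (b + a) * \det (row' b (col' a (M w)))))).
  by move=> w Aw; rewrite /invmx U // !mxE.
apply: CkM; first by apply: CkV; [move=> z Az; rewrite -unitfE; exact: U|exact: Ck_det].
apply: CkM; first exact: Ck_cst.
by apply: Ck_det => i j; apply: Ck_ext (H (lift b i) (lift a j)) => w _; rewrite !mxE.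
Qed.

End CkRules.

Lemma Ck_comp k d m (A : set 'cV[R]_d) (f : 'cV[R]_d -> R) (B : set 'cV[R]_m) (u : 'cV[R]_m -> 'cV[R]_d) :
  cornered A -> cornered B -> (forall w, B w -> A (u w)) ->
  Ck k A f -> Ck k B u -> Ck k B (f \o u).
Proof.
move=> cA cB BA; elim: k f => [|k IH] f Cf Cu.
  apply/cont_withinP => z Bz e e0.
  have [r1 r10 H1] := (cont_withinP _ _).1 Cf _ (BA _ Bz) _ e0.
  have [r2 r20 H2] := (cont_withinP _ _).1 Cu z Bz _ r10.
  by exists r2 => // w Bw wr; apply: H1 (H2 _ _ _) => //; exact: BA.
apply: (CkS (D := fun j w => \sum_i partial B u j w i 0 *: partial A f i (u w))) => //.
  move=> z Bz; apply: (@diff_within_comp _ _ _ A _ _ _ _ (fun j => partial A f j (u z)) (fun j => partial B u j z)) => //.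
    exact: Ck_diff cA Cf (BA _ Bz).
  exact: Ck_diff cB Cu Bz.
move=> j; apply: Ck_sum => // i _; apply: CkM => //.
  by have /Ck_mx := Ck_partial j Cu; apply.
by apply: IH (Ck_leS Cu); exact: Ck_partial.
Qed.

End CalculusWithin.

(** * Corners of subsets and products, mean values along segments, symmetry of second derivatives *)

Section MoreCalculus.
Context {R : realType}.

Lemma cornered_sub d (A A' : set 'cV[R]_d) : cornered A ->
  (forall z, A' z -> A z /\ locally_eq A A' z) -> cornered A'.
Proof.
move=> cA H z A'z; have [Az [r r0 rP]] := H z A'z; have [r1 [sg [r10 sg1 HA]]] := cA z Az.
have [h [h0 hr hr1 _]] := lt_min3 r0 r10 r10.
exists h, sg; split => // w Hw.
have wz : `|w - z| < r.
  apply: le_lt_trans hr; apply: mxnorm_le; first exact: ltW.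
  move=> i j; rewrite ord1 !mxE; have /andP[H1 H2] := Hw i.
  by rewrite -[leLHS]mul1r -(sg1 i) -normrM ger0_norm // ltW.
apply/(rP w wz)/HA => j; have /andP[-> H2] := Hw j; exact: lt_trans hr1.
Qed.

Lemma cornered_setT d : cornered [set: 'cV[R]_d].
Proof. by move=> z _; exists 1, (fun=> 1); split => // j; rewrite normr1. Qed.

Lemma cornered_halfspace d : cornered (halfspace (d := d) : set 'cV[R]_d).
Proof.
move=> z Az; exists 1, (fun=> 1); split => // [j|w Hw i i0]; first by rewrite normr1.
by have /andP[] := Hw i; rewrite mul1r subr_ge0 => /(le_trans (Az i i0)).
Qed.

Lemma cornered_strip d (i : 'I_d) : cornered [set z : 'cV[R]_d | unit_itv (z i 0)].
Proof.
move=> z /= /andP[z0 z1]; case: (ltP (z i 0) (1 / 2)) => zi.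
  exists (1 / 2), (fun=> 1); split => // [j|w Hw]; first by rewrite normr1.
  by have /andP[] := Hw i; rewrite mul1r /unit_itv /= => *; apply/andP; split; lra.
exists (1 / 2), (fun=> -1); split => // [j|w Hw]; first by rewrite normrN1.
by have /andP[] := Hw i; rewrite /unit_itv /= => *; apply/andP; split; lra.
Qed.

Lemma cornered_prod a b (A : set 'cV[R]_a) (B : set 'cV[R]_b) : cornered A -> cornered B ->
  cornered [set z : 'cV[R]_(a + b) | A (usubmx z) /\ B (dsubmx z)].
Proof.
move=> cA cB z [/= /cA[r [sg [r0 sg1 HA]]] /cB[r' [sg' [r0' sg1' HB]]]].
have [h [h0 hr hr' _]] := lt_min3 r0 r0' r0'.
exists h, (fun j => match fintype.split j with inl j => sg j | inr j => sg' j end); split => //.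
  by move=> j; case: (fintype.split j).
move=> w Hw; split.
  apply: HA => j; have := Hw (lshift b j); rewrite (unsplitK (inl j)) !mxE => /andP[-> H].
  exact: lt_trans hr.
apply: HB => j; have := Hw (rshift a j); rewrite (unsplitK (inr j)) !mxE => /andP[-> H].
exact: lt_trans hr'.
Qed.

Lemma is_derive_eps (phi : R -> R) (t c : R) :
  (forall e : R, 0 < e -> exists2 r : R, 0 < r &
     forall y, `|y - t| < r -> `|phi y - phi t - c * (y - t)| <= e * `|y - t|) ->
  is_derive t 1 phi c.
Proof.
move=> H; apply/is_derive1_caratheodory.
exists (fun y => if y == t then c else (phi y - phi t) / (y - t)); split; last by rewrite eqxx.
  move=> y; case: eqP => [->|/eqP yt]; first by rewrite !subrr mulr0.
  by rewrite divfK // subr_eq0.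
apply/cvgrPdist_le => e e0; have [r r0 rP] := H e e0.
apply: filterS (nbhsx_ballx t r r0) => y; rewrite -ball_normE /= eqxx distrC => yr.
case: eqP => [_|/eqP yt]; first by rewrite subrr normr0 ltW.
have y0 : 0 < `|y - t| by rewrite normr_gt0 subr_eq0.
rewrite distrC -(ler_pM2r y0) -normrM mulrBl divfK ?subr_eq0 //; exact: rP.
Qed.

Lemma line_is_derive d (A : set 'cV[R]_d) (f : 'cV[R]_d -> R) z v (t : R) (G : 'I_d -> R) :
  diff_within A f (z + t *: v) G ->
  (exists2 r : R, 0 < r & forall t', `|t' - t| < r -> A (z + t' *: v)) ->
  is_derive t 1 (fun t' => f (z + t' *: v)) (\sum_j v j 0 * G j).
Proof.
move=> /diff_withinP H [r0 r00 rA]; apply: is_derive_eps => e e0.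
have v0 : 0 < 1 + `|v| by rewrite ltr_pwDl.
have e10 : 0 < e / (1 + `|v|) by rewrite divr_gt0.
have [r r0' rP] := H _ e10.
exists (Num.min r0 (r / (1 + `|v|))); first by rewrite lt_min r00 divr_gt0.
move=> y; rewrite lt_min => /andP[y0 yr].
have E : z + y *: v - (z + t *: v) = (y - t) *: v by rewrite opprD addrACA subrr add0r scalerBl.
have N : `|z + y *: v - (z + t *: v)| <= `|y - t| * (1 + `|v|).
  by rewrite E normrZ; apply: ler_wpM2l => //; rewrite lerDr.
have := rP _ (rA _ y0) (le_lt_trans N _); rewrite -ltr_pdivlMr // => /(_ yr) B.
have -> : (\sum_j v j 0 * G j) * (y - t) =
   \sum_j ((z + y *: v) j 0 - (z + t *: v) j 0) *: G j.
  rewrite mulr_suml; apply: eq_bigr => j _.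
  have -> : (z + y *: v) j 0 - (z + t *: v) j 0 = (y - t) * v j 0 by rewrite !mxE; ring.
  by rewrite /GRing.scale /=; ring.
apply: le_trans B _; apply: le_trans (ler_wpM2l (ltW e10) N) _.
by rewrite mulrCA divfK ?gt_eqF // mulrC.
Qed.

Lemma segment_mvt d (A : set 'cV[R]_d) (f : 'cV[R]_d -> R) (D : 'I_d -> 'cV[R]_d -> R) z v :
  (forall t : R, 0 <= t <= 1 -> A (z + t *: v)) ->
  (forall w, A w -> diff_within A f w (D^~ w)) ->
  exists2 t : R, 0 <= t <= 1 & f (z + v) - f z = \sum_j v j 0 * D j (z + t *: v).
Proof.
move=> S H.
have [x x01|/=|c c01] := @MVT_segment _ (fun t => f (z + t *: v)) (fun t => \sum_j v j 0 * D j (z + t *: v)) 0 1 ler01.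
- apply: line_is_derive (H _ (S x _)) _; first by move: x01; rewrite in_itv /= => /andP[/ltW -> /ltW ->].
  move: x01; rewrite in_itv /= => /andP[x0 x1].
  have x1' : 0 < 1 - x by rewrite subr_gt0.
  have [h [h0 hx hx1 _]] := lt_min3 x0 x1' x0.
  exists h => // t'; rewrite ltr_norml => /andP[t1 t2]; apply: S.
  by apply/andP; split; lra.
- apply/subspace_continuousP => x /=; rewrite in_itv /= => x01; apply/cvgrPdist_lt => e e0.
  have [r r0 rP] := diff_within_cont (H _ (S x x01)) e0.
  have v0 : 0 < 1 + `|v| by rewrite ltr_pwDl.
  have rv0 : 0 < r / (1 + `|v|) by rewrite divr_gt0.
  rewrite /within /=; apply: filterS (nbhsx_ballx x _ rv0) => y; rewrite -ball_normE /= distrC in_itv /= => yr y01; rewrite distrC; apply: rP; first exact: S.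
  rewrite opprD addrACA subrr add0r -scalerBl normrZ.
  apply: (@le_lt_trans _ _ (`|y - x| * (1 + `|v|))); first by rewrite ler_wpM2l // lerDr.
  by rewrite -ltr_pdivlMr.
- rewrite scale0r addr0 scale1r subr0 mulr1 => E; exists c => //.
Qed.

Lemma sum_delta d (i : 'I_d) (h : R) (K : 'I_d -> R) :
  \sum_j (h *: delta_mx i 0 : 'cV[R]_d) j 0 * K j = h * K i.
Proof.
rewrite (bigD1 i) //= big1 ?addr0 ?mxE ?eqxx ?mulr1 // => j /negbTE ji.
by rewrite !mxE ji mulr0 mul0r.
Qed.

Lemma norm_delta d (i : 'I_d) (h : R) : `|h *: delta_mx i 0 : 'cV[R]_d| <= `|h|.
Proof.
apply: mxnorm_le => // a b; rewrite !mxE normrM.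
by case: (_ && _); rewrite ?normr1 ?normr0 ?mulr1 ?mulr0.
Qed.

(* The second difference of [f] over a small rectangle with corner [z], divided by
   its area, is a value of each of the two mixed partials near [z]. *)
Lemma schwarz_aux d (A : set 'cV[R]_d) (f : 'cV[R]_d -> R) (i j : 'I_d) z h1 h2 :
  cornered A -> Ck 2 A f ->
  (forall a b : R, 0 <= a <= 1 -> 0 <= b <= 1 ->
     A (z + a *: (h1 *: delta_mx i 0) + b *: (h2 *: delta_mx j 0))) ->
  exists w, [/\ A w, `|w - z| <= `|h1| + `|h2| &
    f (z + h1 *: delta_mx i 0 + h2 *: delta_mx j 0) - f (z + h1 *: delta_mx i 0)
    - (f (z + h2 *: delta_mx j 0) - f z) = h1 * (h2 * partial A (partial A f i) j w)].
Proof.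
move=> cA C HA; set v1 := h1 *: delta_mx i 0; set v2 := h2 *: delta_mx j 0.
pose A' := A `&` [set w | A (w + v2)].
pose g w := f (w + v2) - f w.
have Dg w : A' w -> diff_within A' g w (fun k => partial A f k (w + v2) - partial A f k w).
  move=> [Aw Aw2]; apply: diff_withinD.
    have := @diff_within_comp _ _ _ _ A f A' (fun w => w + v2) w (fun k => partial A f k (w + v2)) (fun k => delta_mx k 0).
    move=> /(_ (Ck_diff cA C Aw2) _ (fun w H => H.2)).
    rewrite (_ : (fun k => _) = (fun k => partial A f k (w + v2))).
      apply; apply/diff_within_mx => a b; rewrite ord1.
      have := diff_withinD (diff_within_coord A' a w) (diff_within_cst A' (v2 a 0) w).
      congr diff_within; apply: funext => k; rewrite ?mxE ?addr0 ?eqxx ?andbT //.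
    apply: funext => k; rewrite (bigD1 k) //= big1 ?addr0 ?mxE ?eqxx ?scale1r // => l /negbTE lk.
    by rewrite mxE lk scale0r.
  apply: diff_withinN; apply: (diff_within_local ltr01 _ _ (Ck_diff cA C Aw)) => // x _ [].
  by [].
have S t : 0 <= t <= 1 -> A' (z + t *: v1).
  move=> t01; split; last by rewrite /= -[v2]scale1r; apply: HA => //; rewrite ler01 lexx.
  by rewrite -[_ + _]addr0 -(scale0r v2); apply: HA => //; rewrite ler01 lexx.
have [t t01] := @segment_mvt _ A' g _ z v1 S Dg.
rewrite sum_delta /g => ->.
have [t' t01'] := @segment_mvt _ A (partial A f i) (fun k => partial A (partial A f i) k) (z + t *: v1) v2
  (fun t' t01' => HA t t' t01 t01') (fun w Aw => Ck_diff cA (Ck_partial i C) Aw).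
rewrite sum_delta => ->.
exists (z + t *: v1 + t' *: v2); split => //; first exact: HA.
rewrite -[z + _ + _]addrA [X in `|X|]addrC addKr.
have Q (s : R) (v : 'cV[R]_d) : 0 <= s <= 1 -> `|s *: v| <= `|v|.
  by move=> /andP[s0 s1]; rewrite normrZ ger0_norm // ler_piMl.
apply: le_trans (ler_normD _ _) _; apply: lerD.
  exact: le_trans (Q _ _ t01) (norm_delta i h1).
exact: le_trans (Q _ _ t01') (norm_delta j h2).
Qed.

(** The second difference over a small rectangle does not depend on the order of the two directions,
    so it is a value of both mixed partials at points near [z]; continuity finishes. The sides of
    the rectangle follow the signs [sg] of the corner at [z], which keeps it inside [A]. *)
Lemma schwarz d (A : set 'cV[R]_d) (f : 'cV[R]_d -> R) (i j : 'I_d) z :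
  cornered A -> Ck 2 A f -> A z ->
  partial A (partial A f i) j z = partial A (partial A f j) i z.
Proof.
move=> cA C Az; have [->//|/eqP ij] := eqVneq i j.
have [r [sg [r0 sg1 HA]]] := cA z Az.
have sg2 k : sg k * sg k = 1.
  by rewrite -expr2 -real_normK ?num_real // sg1 expr1n.
have H h : 0 < h -> h < r -> forall i j, i <> j -> forall a b : R, 0 <= a <= 1 -> 0 <= b <= 1 ->
     A (z + a *: ((h * sg i) *: delta_mx i 0) + b *: ((h * sg j) *: delta_mx j 0)).
  move=> h0 hr {ij}i {}j ij a b a01 b01; apply: HA => k; rewrite !mxE eqxx !andbT.
  rewrite -[z k 0 + _ + _]addrA [z k 0 + _]addrC addrK; case: (eqVneq k i) => [->|ki].
    rewrite mulr1 (_ : (i == j) = false) ?mulr0 ?addr0; last by apply/negbTE/eqP.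
    have -> : sg i * (a * (h * sg i)) = a * h * (sg i * sg i) by ring.
    by rewrite sg2 mulr1; apply/andP; split; nra.
  case: (eqVneq k j) => [->|kj]; last by rewrite !mulr0 addr0 mulr0 lexx.
  rewrite !mulr0 add0r mulr1.
  have -> : sg j * (b * (h * sg j)) = b * h * (sg j * sg j) by ring.
  by rewrite sg2 mulr1; apply/andP; split; nra.
apply: eq_by_le => e e0; have e20 : 0 < e / 2 by rewrite divr_gt0.
have [r1 r10 H1] := (cont_withinP _ _).1 (Ck_cont (Ck_partial j (Ck_partial i C))) z Az _ e20.
have [r2 r20 H2] := (cont_withinP _ _).1 (Ck_cont (Ck_partial i (Ck_partial j C))) z Az _ e20.
have [h [h0 hr hr1 hr2]] := lt_min3 r0 (divr_gt0 r10 (ltr0Sn R 1)) (divr_gt0 r20 (ltr0Sn R 1)).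
have nh k : `|h * sg k| = h by rewrite normrM sg1 mulr1 gtr0_norm.
have ji : j <> i by move=> /esym.
have [w [Aw wz E]] := schwarz_aux cA C (H h h0 hr i j ij).
have [w' [Aw' wz' E']] := schwarz_aux cA C (H h h0 hr j i ji).
have : h * sg i * (h * sg j * partial A (partial A f i) j w) =
   h * sg j * (h * sg i * partial A (partial A f j) i w').
  by rewrite -E -E' [z + _ + _]addrAC; ring.
rewrite mulrCA => /mulfI HE.
have nz k : h * sg k != 0 by rewrite -normr_gt0 nh.
have {}HE := mulfI (nz i) (HE (nz j)).
have B1 : `|w - z| < r1 by move: wz; rewrite !nh; lra.
have B2 : `|w' - z| < r2 by move: wz'; rewrite !nh; lra.
have := H1 _ Aw B1; have := H2 _ Aw' B2; rewrite HE => X1 X2.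
rewrite -[X in `|X|](subrKA (partial A (partial A f j) i w')) (splitr e).
by apply: le_trans (ler_normD _ _) _; apply: lerD; [rewrite distrC|]; exact: ltW.
Qed.

End MoreCalculus.

(** * Bump functions *)

Section Bump.
Context {R : realType}.

(** Applied to [X^2 P] at [1/x] this gives [|flat P x| <= K x^2], which is what differentiability of
    [flat P] at 0 requires. *)
Lemma poly_expR_bound (P : {poly R}) :
  exists2 K : R, 0 < K & forall y, 0 <= y -> `|P.[y]| <= K * expR y.
Proof.
exists (1 + \sum_(i < size P) `|P`_i| * i`!%:R).
  by rewrite ltr_pwDl // sumr_ge0 // => i _; rewrite mulr_ge0.
move=> y y0; rewrite horner_coef mulrDl mul1r.
apply: le_trans (ler_norm_sum _ _ _) _.
rewrite -[leLHS]add0r; apply: lerD; first exact: expR_ge0.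
rewrite mulr_suml; apply: ler_sum => i _; rewrite normrM -mulrA; apply: ler_wpM2l => //.
rewrite ger0_norm ?exprn_ge0 //; case: i => [[|i] Hi] /=.
  by rewrite expr0 fact0 mul1r; apply: le_trans (expR_ge1Dx y); rewrite lerDl.
rewrite mulrC -ler_pdivrMr ?ltr0n ?fact_gt0 //.
by apply: le_trans (expR_ge1Dxn i y0); rewrite lerDr.
Qed.

(** The family [P(1/x) exp(-1/x)] is closed under differentiation: the derivative belongs to the
    polynomial [X^2 (P - P')]. This makes all derivatives of [exp(-1/x)] available at once through
    [flat_poly]. *)
Definition flat (P : {poly R}) (x : R) : R :=
  if 0 < x then P.[x^-1] * expR (- x^-1) else 0.

Lemma flat_is_derive (P : {poly R}) (x : R) : is_derive x 1 (flat P) (flat ('X^2 * (P - P^`())) x).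
Proof.
case: (ltgtP x 0) => x0.
- have E : \near x, (fun=> 0 : R) x = flat P x.
    have x0' : 0 < - x by rewrite oppr_gt0.
    apply: filterS (nbhsx_ballx x _ x0') => y; rewrite -ball_normE /= ltr_norml => /andP[y1 y2].
    by rewrite /flat ifF //; apply/negbTE; rewrite -leNgt; lra.
  rewrite [X in is_derive _ _ _ X]/flat ifF; last by apply/negbTE; rewrite -leNgt ltW.
  exact: (near_eq_is_derive E).
- have E : \near x, (fun y => P.[y^-1] * expR (- y^-1)) x = flat P x.
    apply: filterS (nbhsx_ballx x _ x0) => y; rewrite -ball_normE /= ltr_norml => /andP[y1 y2].
    by rewrite /flat ifT //; lra.
  apply: (near_eq_is_derive E).
  rewrite [X in is_derive _ _ _ X]/flat x0.
  have xn : x != 0 by rewrite gt_eqF.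
  have D : is_derive x 1 (fun y : R => y^-1) (- (x^-1 * x^-1)).
    have := @is_deriveV R id x 1 1 xn (is_derive_id _ _).
    by rewrite /= -expr2 exprVn [_ *: _]mulr1.
  have D1 := is_derive1_comp (is_derive_poly P x^-1) D.
  have D2 := @is_derive1_comp _ expR (- (fun y : R => y^-1)) x _ _ (is_derive_expR (- x^-1)) (is_deriveN D).
  apply: is_derive_eq (is_deriveM D1 D2) _.
  rewrite /comp /GRing.scale /= hornerM hornerXn hornerD hornerN.
  have -> : (- (fun y : R => y^-1)) x = - x^-1 by [].
  by ring.
rewrite x0 [X in is_derive _ _ _ X]/flat ltxx.
have [K K0 HK] := poly_expR_bound ('X^2 * P).
apply: is_derive_eps => e e0; exists (e / K); first by rewrite divr_gt0.
move=> y; rewrite !subr0 mul0r subr0 /flat ltxx subr0; move=> yK; case: (ltP 0 y) => y0; last first.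
  by rewrite normr0 mulr_ge0 // ltW.
have yi : 0 < y^-1 by rewrite invr_gt0.
have := HK y^-1 (ltW yi); rewrite !hornerE normrM => H.
have X : `|P.[y^-1]| * expR (- y^-1) <= K * y ^+ 2.
  rewrite expRN ler_pdivrMr ?expR_gt0 //.
  rewrite -(ler_pM2l (x := y^-1 ^+ 2)) ?exprn_gt0 //.
  have y20 : 0 <= y^-1 ^+ 2 by rewrite exprn_ge0 // ltW.
  rewrite (ger0_norm y20) in H; apply: le_trans H _.
  by rewrite [leRHS](_ : _ = (y^-1 * y) ^+ 2 * (K * expR y^-1)); [rewrite mulVf ?gt_eqF // expr1n mul1r|ring].
rewrite normrM [`|expR _|]ger0_norm ?expR_ge0 //; apply: le_trans X _.
rewrite (gtr0_norm y0) in yK *; rewrite expr2 mulrA ler_pM2r //.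
by rewrite mulrC -ler_pdivlMr // ltW.
Qed.

Fixpoint flat_poly (l : nat) : {poly R} :=
  if l is l'.+1 then 'X^2 * (flat_poly l' - (flat_poly l')^`()) else 1.

Lemma Ck_flat k d (A : set 'cV[R]_d) (f : 'cV[R]_d -> R) :
  cornered A -> Ck k A f -> Ck k A (fun w => flat 1 (f w)).
Proof.
move=> cA Cf; apply: (Ck_comp1 (phi := fun l => flat (flat_poly l)) cA Cf) => l z _.
exact: flat_is_derive.
Qed.

Lemma flat_gt0 x : (0 < flat 1 x) = (0 < x).
Proof. by rewrite /flat; case: (ltP 0 x) => x0; [rewrite hornerE mul1r expR_gt0|rewrite ltxx]. Qed.

Lemma flat_ge0 x : 0 <= flat 1 x.
Proof. by rewrite /flat; case: (ltP 0 x) => // x0; rewrite hornerE mul1r expR_ge0. Qed.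

(** A product over the coordinates, because its set of positivity is then exactly the open ball of
    the sup norm used on column vectors. *)
Definition cube_bump n (c : 'cV[R]_n) (r : R) (y : 'cV[R]_n) : R :=
  \prod_a flat 1 (r ^+ 2 - (y a 0 - c a 0) ^+ 2).

Lemma Ck_cube_bump k n c r (A : set 'cV[R]_n) : cornered A -> Ck k A (cube_bump c r).
Proof.
move=> cA; apply: Ck_prod => // a _; apply: Ck_flat => //; apply: CkB => //; first exact: Ck_cst.
have C : Ck k A (fun w : 'cV[R]_n => w a 0 - c a 0) by apply: CkB => //; [exact: Ck_coord|exact: Ck_cst].
by apply: Ck_ext (CkM cA C C) => z _; rewrite expr2.
Qed.

Lemma cube_bump_ge0 n (c : 'cV[R]_n) r y : 0 <= cube_bump c r y.
Proof. by apply: prodr_ge0 => a _; exact: flat_ge0. Qed.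

Lemma cube_bump_gt0 n (c : 'cV[R]_n) r y : 0 < r -> (0 < cube_bump c r y) = (`|y - c| < r).
Proof.
move=> r0.
have E a : (0 < flat 1 (r ^+ 2 - (y a 0 - c a 0) ^+ 2)) = (`|y a 0 - c a 0| < r).
  by rewrite flat_gt0 subr_gt0 -ltr_sqrt ?exprn_gt0 // !sqrtr_sqr (gtr0_norm r0).
apply/idP/idP => H.
  apply: mxnorm_lt => // i j; rewrite ord1 !mxE -E lt0r flat_ge0 andbT.
  apply: contraTneq H => H0; rewrite /cube_bump (bigD1 i) //= H0 mul0r ltxx //.
apply: prodr_gt0 => a _; rewrite E.
by have := le_lt_trans (ler_coord (y - c) a 0) H; rewrite !mxE.
Qed.

Lemma cube_bump_eq0 n (c : 'cV[R]_n) r y : 0 < r -> r <= `|y - c| -> cube_bump c r y = 0.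
Proof.
move=> r0 H; apply/eqP; rewrite -[_ == _]negbK; apply/negP => N.
have : 0 < cube_bump c r y by rewrite lt0r N cube_bump_ge0.
by rewrite cube_bump_gt0 // ltNge H.
Qed.

End Bump.

(** * Positive definite forms *)

Section BilinearForms.
Context {R : realType}.
Implicit Types (n : nat).

Definition bf n (M : 'M[R]_n) (u v : 'cV[R]_n) : R := (u^T *m M *m v) 0 0.
Definition dot n (u v : 'cV[R]_n) : R := (u^T *m v) 0 0.

Section Basic.
Variable n : nat.
Implicit Types (M N : 'M[R]_n) (u v w : 'cV[R]_n).

Lemma bf_dot M u v : bf M u v = dot u (M *m v).
Proof. by rewrite /bf /dot mulmxA. Qed.

Lemma bf1 u v : bf 1%:M u v = dot u v.
Proof. by rewrite /bf mulmx1. Qed.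

Lemma dotC u v : dot u v = dot v u.
Proof. by rewrite /dot -[u^T *m v]trmxK trmx_mul trmxK mxE. Qed.

Lemma dotE u v : dot u v = \sum_a u a 0 * v a 0.
Proof. by rewrite /dot mxE; apply: eq_bigr => a _; rewrite mxE. Qed.

Lemma bfE M u v : bf M u v = \sum_a \sum_b u a 0 * M a b * v b 0.
Proof.
rewrite bf_dot dotE; apply: eq_bigr => a _; rewrite mxE mulr_sumr.
by apply: eq_bigr => b _; rewrite mulrA.
Qed.

Lemma bf_tr M u v : bf M u v = bf M^T v u.
Proof.
have E : bf M u v = (u^T *m M *m v)^T 0 0 by rewrite [RHS]mxE.
by rewrite E /bf !trmx_mul trmxK mulmxA.
Qed.

Lemma bfDl M u v w : bf M (u + v) w = bf M u w + bf M v w.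
Proof. by rewrite /bf linearD !mulmxDl mxE. Qed.

Lemma bfDr M u v w : bf M w (u + v) = bf M w u + bf M w v.
Proof. by rewrite /bf mulmxDr mxE. Qed.

Lemma bfDm M N u v : bf (M + N) u v = bf M u v + bf N u v.
Proof. by rewrite /bf mulmxDr mulmxDl mxE. Qed.

Lemma bfZl M a u v : bf M (a *: u) v = a * bf M u v.
Proof. by rewrite /bf linearZ -!scalemxAl mxE. Qed.

Lemma bfZr M a u v : bf M u (a *: v) = a * bf M u v.
Proof. by rewrite /bf -scalemxAr mxE. Qed.

Lemma bfZm M a u v : bf (a *: M) u v = a * bf M u v.
Proof. by rewrite /bf -scalemxAr -scalemxAl mxE. Qed.

Lemma bfNl M u v : bf M (- u) v = - bf M u v.
Proof. by rewrite -scaleN1r bfZl mulN1r. Qed.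

Lemma bfNr M u v : bf M u (- v) = - bf M u v.
Proof. by rewrite -scaleN1r bfZr mulN1r. Qed.

Lemma bfNm M u v : bf (- M) u v = - bf M u v.
Proof. by rewrite -scaleN1r bfZm mulN1r. Qed.

Lemma bf_mulr M N u v : bf M u (N *m v) = bf (M *m N) u v.
Proof. by rewrite /bf !mulmxA. Qed.

Lemma bf_mull M N u v : bf M (N *m u) v = bf (N^T *m M) u v.
Proof. by rewrite /bf trmx_mul !mulmxA. Qed.

Lemma bf_summ (I : Type) (s : seq I) (P : pred I) (F : I -> 'M[R]_n) u v :
  bf (\sum_(i <- s | P i) F i) u v = \sum_(i <- s | P i) bf (F i) u v.
Proof. by rewrite /bf mulmx_sumr mulmx_suml summxE. Qed.

Lemma bf_delta M a b : bf M (delta_mx a 0) (delta_mx b 0) = M a b.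
Proof. by rewrite /bf trmx_delta -rowE -colE !mxE. Qed.

Lemma bf_inj M N : (forall u v, bf M u v = bf N u v) -> M = N.
Proof. by move=> H; apply/matrixP => a b; rewrite -!bf_delta. Qed.

Lemma bf0l M v : bf M 0 v = 0.
Proof. by rewrite /bf trmx0 !mul0mx mxE. Qed.

Lemma bf0r M v : bf M v 0 = 0.
Proof. by rewrite /bf mulmx0 mxE. Qed.

Lemma dot_inj u v : (forall w, dot w u = dot w v) -> u = v.
Proof.
move=> H; apply/matrixP => a b; rewrite ord1.
have := H (delta_mx a 0); rewrite !dotE !(bigD1 (P := xpredT) a) //= !big1 ?addr0 ?mxE ?eqxx ?mul1r //;
by move=> i /negbTE ia; rewrite mxE ia mul0r.
Qed.

Definition posdef M : Prop := M^T = M /\ forall v, v != 0 -> 0 < bf M v v.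

Lemma posdef_ge0 M v : posdef M -> 0 <= bf M v v.
Proof. by move=> [_ H]; have [->|/H/ltW//] := eqVneq v 0; rewrite bf0l. Qed.

Lemma posdef_eq0 M v : posdef M -> bf M v v = 0 -> v = 0.
Proof. by move=> [_ H] E; apply/eqP/negPn/negP => /H; rewrite E ltxx. Qed.

Lemma posdef_unit M : posdef M -> M \in unitmx.
Proof.
move=> gP; rewrite -row_free_unit -kermx_eq0; apply/rowV0P => v /sub_kermxP vM.
have : bf M v^T v^T = 0 by rewrite /bf trmxK vM mul0mx mxE.
by move/(posdef_eq0 gP)/(congr1 trmx); rewrite trmxK trmx0.
Qed.

Lemma posdef_inv_tr M : posdef M -> (invmx M)^T = invmx M.
Proof. by move=> [s _]; rewrite trmx_inv s. Qed.

Lemma bf_inv M u v : posdef M -> bf (invmx M) u v = bf M (invmx M *m u) (invmx M *m v).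
Proof.
move=> gP; rewrite bf_mulr bf_mull posdef_inv_tr // mulmxV ?posdef_unit // mulmx1 //.
Qed.

Lemma posdef_inv M : posdef M -> posdef (invmx M).
Proof.
move=> gP; split; first exact: posdef_inv_tr.
move=> v v0; rewrite bf_inv //; apply: gP.2; apply: contraNneq v0 => H.
by rewrite -[v]mul1mx -(mulmxV (posdef_unit gP)) -mulmxA H mulmx0.
Qed.

Lemma bf_sym M u v : posdef M -> bf M u v = bf M v u.
Proof. by move=> [s _]; rewrite bf_tr s. Qed.

(** Positivity at [th u - v], divided by [th]. *)
Lemma young M (th : R) u v : posdef M -> 0 < th -> 2 * bf M u v <= th * bf M u u + th^-1 * bf M v v.
Proof.
move=> gP th0; have := posdef_ge0 (th *: u - v) gP.
rewrite bfDl !bfDr !bfNl !bfNr !bfZl !bfZr (bf_sym v u gP) => H.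
have t1 : th^-1 * th = 1 by rewrite mulVf // gt_eqF.
have : 0 <= th^-1 * (th * (th * bf M u u) - th * bf M u v + (- (th * bf M u v) - - bf M v v)).
  by rewrite mulr_ge0 // invr_ge0 ltW.
have -> : th^-1 * (th * (th * bf M u u) - th * bf M u v + (- (th * bf M u v) - - bf M v v)) =
  (th^-1 * th) * (th * bf M u u) - 2 * ((th^-1 * th) * bf M u v) + th^-1 * bf M v v by ring.
by rewrite t1; lra.
Qed.

Lemma dot_bf_inv M u v : posdef M -> dot u v = bf M (invmx M *m u) v.
Proof. by move=> gP; rewrite bf_mull posdef_inv_tr // mulVmx ?posdef_unit // bf1. Qed.

Lemma young_dot M (th : R) u v : posdef M -> 0 < th ->
  2 * `|dot u v| <= th * bf (invmx M) u u + th^-1 * bf M v v.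
Proof.
move=> gP th0; have U := posdef_unit gP.
have E w : bf M (invmx M *m w) (invmx M *m w) = bf (invmx M) w w by rewrite -bf_inv.
case: (lerP 0 (dot u v)) => s.
  by rewrite ger0_norm // (dot_bf_inv _ _ gP) -E; exact: young.
rewrite ltr0_norm // (dot_bf_inv _ _ gP) -bfNl -mulmxN -E.
have -> : bf M (invmx M *m u) (invmx M *m u) = bf M (invmx M *m - u) (invmx M *m - u).
  by rewrite mulmxN bfNl bfNr opprK.
exact: young.
Qed.

(** Cauchy-Schwarz for the coordinate covector, obtained from Young's inequality with the optimal
    parameter [|v_a| / g^{aa}]. *)
Lemma coord_bf_le M v a : posdef M -> v a 0 ^+ 2 <= invmx M a a * bf M v v.
Proof.
move=> gP; pose u : 'cV[R]_n := delta_mx a 0.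
have Eu : dot u v = v a 0.
  rewrite dotE (bigD1 a) //= big1 ?addr0 ?mxE ?eqxx ?mul1r // => i /negbTE ia.
  by rewrite mxE ia mul0r.
have q0 : 0 < invmx M a a.
  rewrite -bf_delta; apply: (posdef_inv gP).2; apply/eqP => /matrixP/(_ a 0)/eqP.
  by rewrite !mxE !eqxx oner_eq0.
have [->|v0] := eqVneq (v a 0) 0.
  by rewrite expr0n mulr_ge0 ?(ltW q0) ?posdef_ge0.
have th0 : 0 < `|v a 0| / invmx M a a by rewrite divr_gt0 // normr_gt0.
have := young_dot u v gP th0; rewrite Eu bf_delta mulfVK ?gt_eqF // invf_div.
set X := _ / _ * _ => H; have {H} H : `|v a 0| <= X by lra.
have n0 : 0 < `|v a 0| by rewrite normr_gt0.
rewrite -[v a 0 ^+ 2]real_normK ?num_real // expr2.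
have -> : invmx M a a * bf M v v = `|v a 0| * X by rewrite /X mulrA [`|_| * _]mulrC divfK // gt_eqF.
by rewrite ler_pM2l.
Qed.

End Basic.

(** Gram-Schmidt as an induction on the size, splitting off the first row and column. *)
Lemma orthonormal_basis n (g : 'M[R]_n) : posdef g ->
  exists2 P : 'M[R]_n, P \in unitmx & P^T *m g *m P = 1%:M.
Proof.
elim: n g => [|n IH] g gP.
  by exists 1%:M; [exact: unitmx1|rewrite [LHS]flatmx0 [RHS]flatmx0].
suff key (h : 'M[R]_(1 + n)) : posdef h ->
    exists2 P : 'M[R]_(1 + n), P \in unitmx & P^T *m h *m P = 1%:M by exact: key.
move=> {g}{}gP; move: h gP => g gP.
pose a := ulsubmx g; pose b := dlsubmx g; pose d := drsubmx g.
have gs := gP.1.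
have gE : g = block_mx a b^T b d.
  have -> : b^T = ursubmx g by rewrite /b trmx_dlsub gs.
  by rewrite -[LHS]submxK.
pose al := a 0 0; have aE : a = al%:M by exact: mx11_scalar.
have al0 : 0 < al.
  pose i0 : 'I_(1 + n) := lshift n 0.
  have -> : al = g i0 i0 by rewrite /al /a !mxE.
  rewrite -bf_delta; apply: gP.2; apply/eqP => /matrixP/(_ i0 0)/eqP.
  by rewrite !mxE !eqxx oner_eq0.
(* [Q] clears the off-diagonal blocks and leaves the Schur complement [d'] of the corner entry,
   which is positive definite because it is a restriction of a congruent form. *)
pose c := al^-1 *: b; pose Q : 'M[R]_(1 + n) := block_mx 1%:M (- c^T) 0 1%:M.
pose d' := d - al^-1 *: (b *m b^T).
have QE : Q^T *m g *m Q = block_mx a 0 0 d'.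
  rewrite gE /Q tr_block_mx !trmx1 trmx0 linearN /= trmxK !mulmx_block.
  rewrite !mul1mx !mulmx1 !mul0mx !mulmx0 !addr0 aE /c linearZ /= !mulNmx !mulmxN.
  rewrite -!scalemxAl -!scalemxAr mul_scalar_mx mul_mx_scalar !scalerA !mulVf ?mulfV ?gt_eqF // !scale1r.
  by rewrite !addNr mul0mx scaler0 oppr0 add0r /d' [in RHS]addrC.
have Qu : Q \in unitmx by rewrite unitmxE det_ublock !det1 mulr1 unitr1.
have dP : posdef d'.
  split.
    have : (d^T)%R = d by rewrite /d -[in RHS]gs trmx_drsub.
    by move=> ds; rewrite /d' linearB linearZ /= trmx_mul trmxK ds.
  move=> v v0.
  have -> : bf d' v v = bf g (Q *m col_mx 0 v) (Q *m col_mx 0 v).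
    rewrite bf_mulr bf_mull mulmxA QE /bf tr_col_mx trmx0 mul_row_block !mul0mx !mulmx0 mul_row_col.
    by rewrite !add0r mulmx0 add0r.
  apply: gP.2; apply: contraNneq v0 => H.
  have : col_mx 0 v = 0 :> 'cV[R]_(1 + n) by rewrite -[LHS]mul1mx -(mulVmx Qu) -mulmxA H mulmx0.
  by move/(congr1 dsubmx); rewrite col_mxKd linear0 => ->.
have [P' P'u P'E] := IH d' dP.
have sa : Num.sqrt al * Num.sqrt al = al by rewrite -expr2 sqr_sqrtr // ltW.
have sa0 : Num.sqrt al != 0 by rewrite sqrtr_eq0 -ltNge.
pose S : 'M[R]_(1 + n) := block_mx (Num.sqrt al)^-1%:M 0 0 P'.
exists (Q *m S).
  rewrite unitmx_mul Qu unitmxE det_ublock unitrM -!unitmxE P'u andbT.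
  by rewrite unitmxE det_scalar1 unitfE invr_eq0.
rewrite trmx_mul -!mulmxA (mulmxA g) (mulmxA Q^T) mulmxA (mulmxA Q^T) QE /S tr_block_mx !trmx0 tr_scalar_mx.
rewrite mulmx_block !mulmx0 !mul0mx !addr0 !add0r mulmx_block !mulmx0 !mul0mx !addr0 !add0r P'E aE.
rewrite -!scalar_mxM -{2}sa mulrA mulVf // mul1r mulfV //.
by rewrite -[RHS]/(1%:M : 'M[R]_(1 + n)) (scalar_mx_block 1 n).
Qed.

(** In a frame orthonormal for [g] the inverse metric is [P P^T], so the invariant trace becomes the
    sum of squares of the entries of [H] in that frame. *)
Lemma trace_frame n (g H P : 'M[R]_n) : posdef g -> H^T = H -> P^T *m g *m P = 1%:M ->
  \tr (invmx g *m H *m invmx g *m H) = \sum_a \sum_b (P^T *m H *m P) a b ^+ 2.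
Proof.
move=> gP Hs PE; have gu := posdef_unit gP.
have iP : invmx g = P *m P^T.
  have E : P *m P^T *m g = 1%:M by rewrite -mulmxA; exact: mulmx1C.
  by rewrite -[RHS]mulmx1 -(mulmxV gu) mulmxA E mul1mx.
set K := P^T *m H *m P.
have Ks : K^T = K by rewrite /K !trmx_mul trmxK Hs mulmxA.
have -> : invmx g *m H *m invmx g *m H = P *m (K *m (P^T *m H)) by rewrite iP /K !mulmxA.
rewrite mxtrace_mulC -mulmxA -/K.
rewrite /mxtrace; apply: eq_bigr => a _; rewrite mxE; apply: eq_bigr => b _.
have -> : K b a = K a b by rewrite -{1}Ks [LHS]mxE.
by rewrite expr2.
Qed.

(** In an orthonormal frame each entry of [H] is at most the Frobenius norm, hence at most [kap].
    Summing [2 |u_a K_ab v_b| <= kap (u_a^2 + v_b^2)] over all pairs counts each square [n] times;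
    this is where the factor [n] in the smallness condition comes from. *)
Lemma frobenius_bound n (g H : 'M[R]_n) (kap : R) (u v : 'cV[R]_n) : posdef g -> H^T = H ->
  Num.sqrt (\tr (invmx g *m H *m invmx g *m H)) <= kap ->
  2 * `|bf H u v| <= kap * n%:R * (bf g u u + bf g v v).
Proof.
move=> gP Hs; have [P Pu PE] := orthonormal_basis gP; have gu := posdef_unit gP.
pose K := P^T *m H *m P; rewrite (trace_frame gP Hs PE) -/K => HK.
have Kab a b : `|K a b| <= kap.
  apply: le_trans HK; rewrite -sqrtr_sqr ler_wsqrtr //.
  rewrite (bigD1 a) //= (bigD1 b) //= -addrA lerDl addr_ge0 ?sumr_ge0 // => [i _|i _].
    by rewrite sqr_ge0.
  by apply: sumr_ge0 => j _; rewrite sqr_ge0.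
pose u' := invmx P *m u; pose v' := invmx P *m v.
have uE : u = P *m u' by rewrite /u' mulKVmx.
have vE : v = P *m v' by rewrite /v' mulKVmx.
have gE w : bf g (P *m w) (P *m w) = \sum_a w a 0 ^+ 2.
  rewrite bf_mulr bf_mull mulmxA PE bf1 dotE; by apply: eq_bigr => a _; rewrite expr2.
rewrite uE vE !gE bf_mulr bf_mull mulmxA -/K bfE.
apply: le_trans (ler_wpM2l _ (ler_norm_sum _ _ _)) _ => //.
apply: le_trans (ler_wpM2l _ (ler_sum _ (fun a _ => ler_norm_sum _ _ _))) _ => //.
rewrite mulr_sumr.
have k0 : 0 <= kap by apply: le_trans HK; exact: sqrtr_ge0.
apply: (@le_trans _ _ (\sum_a \sum_b kap * (u' a 0 ^+ 2 + v' b 0 ^+ 2))).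
  apply: ler_sum => a _; rewrite mulr_sumr; apply: ler_sum => b _; rewrite !normrM.
  have : 2 * (`|u' a 0| * `|v' b 0|) <= u' a 0 ^+ 2 + v' b 0 ^+ 2.
    rewrite -[u' a 0 ^+ 2]real_normK ?num_real // -[v' b 0 ^+ 2]real_normK ?num_real //.
    by have := sqr_ge0 (`|u' a 0| - `|v' b 0|); rewrite !expr2; nra.
  move=> X; have := ler_wpM2l k0 X; apply: le_trans.
  have -> : 2 * (`|u' a 0| * `|K a b| * `|v' b 0|) = `|K a b| * (2 * (`|u' a 0| * `|v' b 0|)) by ring.
  by apply: ler_wpM2r => //; rewrite mulr_ge0 // mulr_ge0.
under eq_bigr do rewrite -mulr_sumr big_split /= sumr_const card_ord.
rewrite -mulr_sumr big_split /= sumr_const card_ord -sumrMnl.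
by rewrite -[leRHS]mulrA [n%:R * _]mulrDr !mulr_natl ?sumrMnl.
Qed.

End BilinearForms.

(** * Charts and test functions *)

Section NiceCharts.
Context {R : realType} {n : nat} {Y : Type} (C : charted R n Y).
Implicit Types (i j : cidx C) (x : Y).

(** What an atlas must satisfy for the chain rule to work, stated without a topology on [Y]: the
    cotangent bundle is a bare type here, and the same lemmas have to serve it and the base
    manifold. *)
Record nice_charts : Prop := NiceCharts {
  nice_inj : forall i x y, cdom i x -> cdom i y -> cmap i x = cmap i y -> x = y;
  nice_cornered : forall i, cornered (cimg i);
  nice_overlap : forall i j z, overlap i j z -> locally_eq (cimg i) (overlap i j) z;
  nice_smooth : forall i j, smooth (overlap i j) (in_chart i (cmap j)) }.

Hypothesis nice : nice_charts.

Lemma in_chartE (W : normedModType R) i (h : Y -> W) x : cdom i x -> in_chart i h (cmap i x) = h x.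
Proof.
move=> ix; rewrite /in_chart; case: pselect => [e|[]]; last by exists x.
by case: (cid2 e) => y iy yx /=; rewrite (nice_inj nice iy ix yx).
Qed.

Lemma cimg_in i x : cdom i x -> cimg i (cmap i x).
Proof. by move=> ix; exists x. Qed.

Lemma overlap_in i j x : cdom i x -> cdom j x -> overlap i j (cmap i x).
Proof. by move=> ix jx; exists x. Qed.

Lemma overlap_cornered i j : cornered (overlap i j).
Proof.
apply: (cornered_sub (nice_cornered nice (i := i))) => z Hz; split; last exact: nice_overlap.
by case: Hz => x [ix _] <-; exact: cimg_in.
Qed.

Lemma trans_diff i j x : cdom i x -> cdom j x ->
  diff_within (overlap i j) (in_chart i (cmap j)) (cmap i x)
    (fun b => col b (jac i j x)).
Proof.
move=> ix jx.
have := Ck_diff (overlap_cornered (j := j)) (nice_smooth nice i j 1) (overlap_in ix jx).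
congr diff_within; apply: funext => b; apply/matrixP => a c.
by rewrite ord1 !mxE.
Qed.

Lemma chart_chain (W : normedModType R) i j (h : Y -> W) x G : cdom i x -> cdom j x ->
  diff_within (cimg j) (in_chart j h) (cmap j x) G ->
  diff_within (cimg i) (in_chart i h) (cmap i x) (fun a => \sum_b jac i j x b a *: G b).
Proof.
move=> ix jx D; have [r r0 rP] := nice_overlap nice (overlap_in ix jx).
have D' : diff_within (overlap i j) (in_chart j h \o in_chart i (cmap j)) (cmap i x)
    (fun a => \sum_b jac i j x b a *: G b).
  have := @diff_within_comp _ _ _ _ (cimg j) (in_chart j h) (overlap i j)
    (in_chart i (cmap j)) (cmap i x) G (fun b => col b (jac i j x)).
  rewrite in_chartE // => /(_ D (trans_diff ix jx)) H.
  have -> : (fun a => \sum_b jac i j x b a *: G b) = (fun a => \sum_b col a (jac i j x) b 0 *: G b).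
    by apply: funext => a; apply: eq_bigr => b _; rewrite [col _ _ _ _]mxE.
  apply: H => w [y [iy jy] <-]; rewrite in_chartE //; exact: cimg_in.
apply: (diff_within_local r0 _ _ D').
  move=> w wr iw; have ow := (rP w wr).1 iw; split => //.
  by case: ow => y [iy jy] <-; rewrite /= !in_chartE.
by rewrite /= !in_chartE.
Qed.

Lemma jac_id i x : cdom i x -> jac i i x = 1%:M.
Proof.
move=> ix; apply/matrixP => a b; rewrite !mxE.
have D : diff_within (overlap i i) (in_chart i (cmap i)) (cmap i x) (fun b => delta_mx b 0).
  apply/diff_within_mx => c d; rewrite ord1.
  have -> : (fun l : 'I_n => (delta_mx l 0 : 'cV[R]_n) c 0) = (fun l => (c == l)%:R).
    by apply: funext => l; rewrite mxE eqxx andbT.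
  have := diff_within_coord (overlap i i) c (cmap i x).
  apply: (diff_within_local ltr01) => [w _ ow|].
    split; first exact: ow.
    by case: ow => y [iy _] <-; rewrite in_chartE.
  by rewrite in_chartE.
rewrite (partialE b (overlap_cornered (j := i)) (overlap_in ix ix) D).
by rewrite !mxE eqxx andbT.
Qed.

Lemma jac_mul i j k x : cdom i x -> cdom j x -> cdom k x ->
  jac i k x = jac j k x *m jac i j x.
Proof.
move=> ix jx kx; apply/matrixP => a b; rewrite !mxE.
have [r r0 rP] := nice_overlap nice (overlap_in jx kx).
have D : diff_within (cimg j) (in_chart j (cmap k)) (cmap j x) (fun b => col b (jac j k x)).
  have := trans_diff jx kx; apply: (diff_within_local r0) => // w wr jw.
  by split => //; apply/(rP w wr).
have D2 := chart_chain ix jx D.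
have D3 : diff_within (overlap i k) (in_chart i (cmap k)) (cmap i x)
   (fun a => \sum_b jac i j x b a *: col b (jac j k x)).
  apply: (diff_within_local ltr01 _ _ D2) => // w _ [y [iy _] <-]; split => //; exact: cimg_in.
rewrite (partialE b (overlap_cornered (j := k)) (overlap_in ix kx) D3).
by rewrite summxE; apply: eq_bigr => c _; rewrite !mxE mulrC.
Qed.

Lemma jac_inv i j x : cdom i x -> cdom j x -> jac j i x *m jac i j x = 1%:M.
Proof. by move=> ix jx; rewrite -jac_mul // jac_id. Qed.

Lemma jac_unit i j x : cdom i x -> cdom j x -> jac i j x \in unitmx.
Proof. by move=> ix jx; have /mulmx1_unit[] := jac_inv ix jx. Qed.

Lemma jac_smooth i j a b : smooth (overlap i j)
  (fun y => partial (overlap i j) (in_chart i (cmap j)) b y a 0).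
Proof.
move=> k; have C1 := Ck_partial b (nice_smooth nice i j k.+1).
exact: ((Ck_mx _ _ (overlap_cornered (j := j))).1 C1 a 0).
Qed.

Lemma cpartial_jac (h : Y -> R) i j a x : cdom i x -> cdom j x ->
  smooth_fun C h -> cpartial i h a x = \sum_b jac i j x b a * cpartial j h b x.
Proof.
move=> ix jx sh; have D := Ck_diff (nice_cornered nice (i := j)) (sh j 1) (cimg_in jx).
by rewrite /cpartial (partialE a (nice_cornered nice (i := i)) (cimg_in ix) (chart_chain ix jx D)).
Qed.

Lemma curve_chain d (A : set 'cV[R]_d) (u : 'cV[R]_d -> Y) z i j (H : 'I_d -> 'cV[R]_n) r :
  0 < r -> (forall w, A w -> `|w - z| < r -> cdom i (u w) /\ cdom j (u w)) ->
  cdom i (u z) -> cdom j (u z) ->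
  diff_within A (cmap i \o u) z H ->
  diff_within A (cmap j \o u) z (fun k => jac i j (u z) *m H k).
Proof.
move=> r0 Hu iz jz D.
pose B := A `&` [set w | `|w - z| < r].
have DB : diff_within B (cmap i \o u) z H by apply: (diff_within_local ltr01 _ _ D) => // w _ [].
have D2 := @diff_within_comp _ _ _ _ (overlap i j) (in_chart i (cmap j)) B (cmap i \o u) z _ H
  (trans_diff iz jz) DB.
have {}D2 : diff_within B (in_chart i (cmap j) \o (cmap i \o u)) z (fun k => jac i j (u z) *m H k).
  have -> : (fun k => jac i j (u z) *m H k) = (fun k => \sum_l H k l 0 *: col l (jac i j (u z))).
    apply: funext => k; apply/matrixP => a b; rewrite ord1 mxE summxE.
    by apply: eq_bigr => l _; rewrite !mxE mulrC.
  by apply: D2 => w [Aw wr]; have [iw jw] := Hu w Aw wr; exact: overlap_in.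
apply: (diff_within_local r0 _ _ D2) => [w wr Aw|]; last by rewrite /= in_chartE.
by split => //; have [iw jw] := Hu w Aw wr; rewrite /= in_chartE.
Qed.

Lemma Ck_map_near k d (A : set 'cV[R]_d) (u : 'cV[R]_d -> Y) z i : cornered A ->
  Ck_map C k A u -> A z -> cdom i (u z) ->
  exists A', [/\ A' z, forall w, A' w -> A w /\ cdom i (u w), locally_eq A A' z,
    cornered A' & Ck k A' (cmap i \o u)].
Proof.
move=> cA H Az iz; have [r r0 [ri rC]] := H z i Az iz.
exists (A `&` ball z r); split => //.
- by split => //; exact: ballxx.
- by move=> w Aw; split; [case: Aw|exact: ri].
- exists r => // w wr; split=> [Aw|[]//]; split => //.
  by rewrite -ball_normE /= distrC.
- apply: (cornered_sub cA) => w [Aw]; rewrite -ball_normE /= => wr; split => //.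
  exists (r - `|z - w|); first by rewrite subr_gt0.
  move=> v vw; split=> [Av|[]//]; split => //=.
  rewrite -[z - v](subrKA w); apply: le_lt_trans (ler_normD _ _) _.
  by rewrite [`|w - v|]distrC -ltrBrDl.
Qed.

Lemma comp_smooth_fun k d (A : set 'cV[R]_d) (u : 'cV[R]_d -> Y) (h : Y -> R) : cornered A ->
  (forall w, A w -> exists i, cdom i (u w)) ->
  Ck_map C k A u -> smooth_fun C h -> Ck k A (h \o u).
Proof.
move=> cA cov H sh; apply: Ck_local => z Az; have [i iz] := cov z Az.
have [A' [A'z A'P AA' cA' C']] := Ck_map_near cA H Az iz.
exists A', (in_chart i h \o (cmap i \o u)); split => // [w A'w|].
  by rewrite /= in_chartE //; have [] := A'P w A'w.
apply: (Ck_comp (nice_cornered nice (i := i)) cA' _ (sh i k) C').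
by move=> w /A'P[_ iw]; exact: cimg_in.
Qed.

Lemma comp_smooth_partial d (A : set 'cV[R]_d) (u : 'cV[R]_d -> Y) (h : Y -> R) z i k : cornered A ->
  Ck_map C 1 A u -> smooth_fun C h -> A z -> cdom i (u z) ->
  partial A (h \o u) k z = \sum_a partial A (cmap i \o u) k z a 0 * cpartial i h a (u z).
Proof.
move=> cA H sh Az iz; have [A' [A'z A'P AA' cA' C']] := Ck_map_near cA H Az iz.
have D := @diff_within_comp _ _ _ _ (cimg i) (in_chart i h) A' (cmap i \o u) z _ _
  (Ck_diff (nice_cornered nice (i := i)) (sh i 1) (cimg_in iz)) (Ck_diff cA' C' A'z)
  (fun w A'w => cimg_in (A'P w A'w).2).
have D2 : diff_within A' (h \o u) z
    (fun k => \sum_a partial A' (cmap i \o u) k z a 0 * cpartial i h a (u z)).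
  apply: (diff_within_local ltr01 _ _ D) => [w _ A'w|]; last by rewrite /= in_chartE.
  by split => //; rewrite /= in_chartE //; have [] := A'P w A'w.
rewrite (partial_locally_eq _ _ AA') (partialE k cA' A'z D2).
by apply: eq_bigr => a _; rewrite (partial_locally_eq _ _ AA').
Qed.

End NiceCharts.

(** * Charts of a manifold with boundary *)

Section ManifoldCharts.
Context {R : realType} {n : nat} {X : topologicalType} (C : charted R n X).
Hypothesis mfd : manifold_with_boundary C.
Implicit Types (i j : cidx C) (x : X).

Lemma chart_open i (O : set X) x : open O -> O `<=` cdom i -> O x ->
  exists2 r : R, 0 < r & forall y, halfspace y -> `|y - cmap i x| < r -> exists2 x', O x' & cmap i x' = y.
Proof.
move=> oO Oi Ox; have [_ _ _ /(_ i O oO Oi)[V oV VE] _] := mfd.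
have [Vx hx] : (V `&` halfspace (d := n)) (cmap i x) by rewrite -VE; exists x.
have /nbhs_ballP[r /= r0 rP] : nbhs (cmap i x) V by exact: open_nbhs_nbhs.
exists r => // y hy yr; have : (V `&` halfspace (d := n)) y.
  by split => //; apply: rP; rewrite -ball_normE /= distrC.
by rewrite -VE => -[x' Ox' <-]; exists x'.
Qed.

Lemma cdom_open i : open (cdom i).
Proof. by have [_ [H _] _ _ _] := mfd. Qed.

Lemma cdom_cover x : exists i, cdom i x.
Proof. by have [_ [_ H] _ _ _] := mfd. Qed.

Lemma cimg_half i y : cimg i y -> halfspace y.
Proof.
have [_ _ _ /(_ i (cdom i) (cdom_open i) (fun _ => id))[V oV VE] _] := mfd.
by rewrite /cimg VE => -[].
Qed.

Lemma cimg_locally i (O : set X) x : open O -> O `<=` cdom i -> O x ->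
  locally_eq (halfspace (d := n)) (cmap i @` O) (cmap i x).
Proof.
move=> oO Oi Ox; have [r r0 rP] := chart_open oO Oi Ox; exists r => // y yr.
split=> [hy|[x' Ox' <-]]; first by have [x' Ox' <-] := rP y hy yr; exists x'.
by apply: (@cimg_half i); exists x' => //; exact: Oi.
Qed.

Lemma cimg_locally2 i (O : set X) x : open O -> O `<=` cdom i -> O x ->
  locally_eq (cimg i) (cmap i @` O) (cmap i x).
Proof.
move=> oO Oi Ox; have [r r0 rP] := chart_open oO Oi Ox; exists r => // y yr.
split=> [/cimg_half hy|[x' Ox' <-]]; first by have [x' Ox' <-] := rP y hy yr; exists x'.
by exists x' => //; exact: Oi.
Qed.

Lemma manifold_nice : nice_charts C.
Proof.
have [_ _ ci _ sm] := mfd; split.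
- by move=> i x y ix iy; have [inj _] := ci i; apply: inj; rewrite inE.
- move=> i; apply: (cornered_sub (cornered_halfspace (d := n))) => z [x ix <-]; split.
    by apply: (@cimg_half i); exists x.
  exact: (cimg_locally (cdom_open i)).
- move=> i j z [x [ix jx] <-]; apply: (@cimg_locally2 i (cdom i `&` cdom j)) => //.
  by apply: openI; exact: cdom_open.
- exact: sm.
Qed.

Lemma chart_cont i x (e : R) : cdom i x -> 0 < e -> exists O : set X,
  [/\ open O, O x, O `<=` cdom i & forall x', O x' -> `|cmap i x' - cmap i x| < e].
Proof.
move=> ix e0; have [_ _ /(_ i)[_ cc] _ _] := mfd.
have /cvgrPdist_lt/(_ e e0) : {for x, continuous (cmap i)} by apply: cc; rewrite inE.
rewrite nearE nbhsE => -[U [Uo Ux] HU].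
exists (U `&` cdom i); split => //.
- by apply: openI => //; exact: cdom_open.
- by move=> x' [/HU /=]; rewrite distrC.
Qed.

End ManifoldCharts.

(** Compactness in its near-covering form, the second filter being that of large constants; it turns
    local bounds on [X] into a global one. *)
Lemma compact_uniform (R : realType) (X : topologicalType) (Q : R -> X -> Prop) :
  compact [set: X] -> (forall c c' x, c <= c' -> Q c x -> Q c' x) ->
  (forall x, exists c : R, exists O : set X, [/\ open O, O x & forall x', O x' -> Q c x']) ->
  exists2 c : R, 0 < c & forall x, Q c x.
Proof.
move=> cX mono H.
have := (compact_near_coveringP [set: X]).1 cX R (pinfty_nbhs R) Q.
case=> [x _|M [Mr HM]].
  have [c [U [Uo Ux HU]]] := H x.
  exists (U, [set c' | c < c']); first by split => /=; [exact: open_nbhs_nbhs|exists c; split => //; exact: num_real].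
  by move=> [x' c'] /= [Ux' cc']; apply: mono (HU _ Ux'); exact: ltW.
exists (Num.max 1 (M + 1)); first by rewrite lt_max ltr01.
move=> x; apply: (HM (Num.max 1 (M + 1))) => //.
by rewrite lt_max ltrDl ltr01 orbT.
Qed.

Section ChartBalls.
Context {R : realType} {n : nat} {X : topologicalType} (C : charted R n X).
Hypothesis mfd : manifold_with_boundary C.
Implicit Types (i j : cidx C) (x : X).

Definition chart_ball i x (r : R) : Prop :=
  forall y, halfspace y -> `|y - cmap i x| <= r -> cimg i y.

Lemma chart_ball_ex i x : cdom i x -> exists2 r : R, 0 < r & chart_ball i x r.
Proof.
move=> ix; have [r r0 rP] := chart_open mfd (cdom_open mfd i) (fun _ => id) ix.
exists (r / 2) => [|y hy yr]; first by rewrite divr_gt0.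
have [|x' ix' <-] := rP y hy; last by exists x'.
by apply: le_lt_trans yr _; lra.
Qed.

(** A closed coordinate ball that fits into the chart image is the continuous image of a compact box
    under the inverse chart, hence compact, hence closed in the Hausdorff space [X] and not merely
    in the chart domain. This is what lets a bump function be extended by 0. *)
Lemma chart_ball_closed i x r : 0 < r -> cdom i x -> chart_ball i x r ->
  closed [set x' | cdom i x' /\ `|cmap i x' - cmap i x| <= r].
Proof.
move=> r0 ix H; have [hX _ _ _ _] := mfd; apply: compact_closed => //.
have inj := nice_inj (manifold_nice mfd).
(* The box is intersected with the half-space by cutting the interval of the boundary coordinate off
   at 0. *)
pose D := [set v : 'rV[R]_n | forall a, `[(if val a == 0%N then Num.max 0 (cmap i x a 0 - r) else cmap i x a 0 - r), cmap i x a 0 + r]%classic (v 0 a)].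
have cD : compact D by apply: (rV_compact (A := fun a => `[_, _]%classic)) => a; exact: segment_compact.
have DP v : D v <-> halfspace v^T /\ (forall a, `|v 0 a - cmap i x a 0| <= r).
  split=> [Dv|[hv nv] a] /=.
    split=> [a a0|a]; first by have := Dv a; rewrite /= in_itv /= a0 eqxx mxE => /andP[]; rewrite ge_max => /andP[].
    have := Dv a; rewrite /= in_itv /= ler_norml; case: ifP => _ /andP[H1 H2]; apply/andP; split; try lra.
    by move: H1; rewrite ge_max => /andP[_]; lra.
  have := nv a; rewrite ler_norml => /andP[H1 H2]; rewrite in_itv /=; apply/andP; split; last lra.
  case: ifP => [/eqP a0|_]; last lra.
  by rewrite ge_max; have := hv a a0; rewrite mxE => ->; lra.
have Dcimg v : D v -> cimg i v^T.
  move=> /DP[hv nv]; apply: H => //.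
  by apply: mxnorm_le => [|a b]; [exact: ltW|rewrite ord1 !mxE].
pose inv (v : 'rV[R]_n) : X := xget x [set x' | cdom i x' /\ cmap i x' = v^T].
have invP v : D v -> cdom i (inv v) /\ cmap i (inv v) = v^T.
  move=> Dv; have [y iy yv] := Dcimg v Dv.
  by rewrite /inv; case: xgetP => [y' _ //|/(_ y)[]].
have invK y v : cdom i y -> D v -> cmap i y = v^T -> inv v = y.
  by move=> iy Dv yv; have [iv iE] := invP v Dv; apply: (inj i) => //; rewrite iE.
have KE : [set x' | cdom i x' /\ `|cmap i x' - cmap i x| <= r] = inv @` D.
  apply/seteqP; split=> [x' [ix' nx']|_ [v Dv <-]] /=.
    have Dv : D (cmap i x')^T.
      apply/DP; rewrite trmxK; split; first exact: cimg_half (cimg_in ix').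
      by move=> a; rewrite mxE; have := le_trans (ler_coord _ a 0) nx'; rewrite !mxE.
    by exists (cmap i x')^T => //; apply: invK => //; rewrite trmxK.
  have [iv ->] := invP v Dv; split => //.
  have /DP[_ nv] := Dv; apply: mxnorm_le => [|a b]; first exact: ltW.
  by rewrite ord1 !mxE.
rewrite KE; apply: continuous_compact => //; apply/subspace_continuousP => v Dv N.
rewrite nbhsE => -[U [Uo Uv] UN].
have [iv vE] := invP v Dv.
have [r' r'0 r'P] := @chart_open _ _ _ _ mfd i (U `&` cdom i) (inv v) (openI Uo (cdom_open mfd i)) (@subIsetr _ _ _) (conj Uv iv).
suff: within D (nbhs v) (inv @^-1` N) by [].
rewrite /within /=; apply: filterS (nbhsx_ballx v r' r'0) => w.
rewrite -ball_normE /= => wv Dw; apply: UN.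
have [|y [Uy iy] yE] := r'P w^T (cimg_half mfd (Dcimg w Dw)); last by rewrite (invK y).
rewrite vE -linearB /=; apply: mxnorm_lt => // a b; rewrite !mxE.
by have := le_lt_trans (ler_coord (v - w) b a) wv; rewrite !mxE distrC.
Qed.

Lemma chart_ball_in i x (U : set X) : cdom i x -> open U -> U x ->
  exists r : R, [/\ 0 < r, chart_ball i x r &
    forall x', cdom i x' -> `|cmap i x' - cmap i x| <= r -> U x'].
Proof.
move=> ix Uo Ux.
have [r r0 rP] := @chart_open _ _ _ _ mfd i (U `&` cdom i) x (openI Uo (cdom_open mfd i)) (@subIsetr _ _ _) (conj Ux ix).
exists (r / 2); split; first by rewrite divr_gt0.
  move=> y hy yr; have [|x' [_ ix'] <-] := rP y hy; last by exists x'.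
  by apply: le_lt_trans yr _; lra.
move=> x' ix' xr; have [|x'' [Ux' ix''] E] := rP _ (cimg_half mfd (cimg_in ix')).
  by apply: le_lt_trans xr _; lra.
by rewrite -(nice_inj (manifold_nice mfd) ix'' ix' E).
Qed.

End ChartBalls.

(** * Smooth functions cut off in a chart *)

Section TestFunctions.
Context {R : realType} {n : nat} {X : topologicalType} (C : charted R n X).
Hypothesis mfd : manifold_with_boundary C.
Context {m : nat} {Y : Type} (C' : charted R m Y) (idx : cidx C' -> cidx C) (pr : Y -> X).

(** Covers both [X] over itself and [T^*X] over [X]. The cut-off is always made in the base, and
    [fib_open] supplies the open sets of the total space that this uses. *)
Record fibered : Prop := Fibered {
  fib_nice : nice_charts C';
  fib_dom : forall (i : cidx C') (y : Y), cdom i y <-> cdom (idx i) (pr y);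
  fib_open : forall (i : cidx C') (y : Y) (U : set X), cdom i y -> open U -> U (pr y) ->
    locally_eq (cimg i) (cmap i @` (cdom i `&` pr @^-1` U)) (cmap i y);
  fib_smooth : forall i : cidx C', smooth (cimg i) (in_chart i (cmap (idx i) \o pr)) }.

Hypothesis fib : fibered.

Definition testfun (i : cidx C') (x0 : X) (r : R) (phi : Y -> R) (y : Y) : R :=
  if pselect (cdom i y) is left _
  then cube_bump (cmap (idx i) x0) r (cmap (idx i) (pr y)) * phi y else 0.

(** In the chart [i] the function is a product of smooth functions. At a point outside this chart
    the complement of the closed coordinate ball is an open neighbourhood of the base point, and the
    function vanishes above it. *)
Lemma testfun_smooth i x0 r phi : 0 < r -> cdom (idx i) x0 -> chart_ball (C := C) (idx i) x0 r ->
  smooth (cimg i) (in_chart i phi) -> smooth_fun C' (testfun i x0 r phi).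
Proof.
move=> r0 ix0 H sphi j k; have nC := fib_nice fib.
apply: Ck_local => z [y jy <-]; have [iy|niy] := pselect (cdom i y).
  exists (overlap j i), ((fun w => cube_bump (cmap (idx i) x0) r (in_chart i (cmap (idx i) \o pr) w) * in_chart i phi w)
    \o in_chart j (cmap i)); split.
  - by apply: (nice_overlap nC); exact: overlap_in.
  - exact: overlap_in.
  - move=> w [y' [jy' iy'] <-]; rewrite /= !in_chartE // /testfun.
    by case: pselect.
  - apply: (@Ck_comp _ _ _ _ (cimg i)); [exact: nice_cornered|exact: overlap_cornered| | |exact: nice_smooth].
      by move=> w [y' [jy' iy'] <-]; rewrite in_chartE //; exact: cimg_in.
    have cA := nice_cornered nC (i := i).
    apply: CkM => //.
    apply: (@Ck_comp _ _ _ _ setT (cube_bump (cmap (idx i) x0) r)) => //; first exact: cornered_setT.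
      by apply: Ck_cube_bump; exact: cornered_setT.
    exact: fib_smooth.
pose K := [set x' | cdom (idx i) x' /\ `|cmap (idx i) x' - cmap (idx i) x0| <= r].
have oK : open (~` K) by apply: closed_openC; exact: chart_ball_closed.
have Ky : (~` K) (pr y) by move=> [iy _]; apply: niy; exact/(fib_dom fib).
exists (cmap j @` (cdom j `&` pr @^-1` ~` K)), (fun=> 0); split.
- exact: (fib_open fib).
- by exists y.
- move=> w [y' [jy' Ky'] <-]; rewrite in_chartE // /testfun; case: pselect => // iy'.
  rewrite cube_bump_eq0 ?mul0r //; rewrite leNgt; apply/negP => rr; apply: Ky'; split; last exact: ltW.
  exact/(fib_dom fib).
- apply: Ck_cst; apply: (cornered_sub (nice_cornered nC (i := j))) => w [y' [jy' Ky'] <-].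
  by split; [exact: cimg_in|exact: (fib_open fib)].
Qed.

Lemma testfunE i x0 r phi y : cdom i y ->
  testfun i x0 r phi y = cube_bump (cmap (idx i) x0) r (cmap (idx i) (pr y)) * phi y.
Proof. by rewrite /testfun; case: pselect. Qed.

End TestFunctions.

Section BaseTests.
Context {R : realType} {n : nat} {X : topologicalType} (C : charted R n X).
Hypothesis mfd : manifold_with_boundary C.

Lemma base_fibered : fibered (C := C) (C' := C) (fun i => i) (fun x => x).
Proof.
have nC := manifold_nice mfd.
split => //.
- move=> i y U iy Uo Uy.
  apply: (cimg_locally2 mfd (O := cdom i `&` U)) => //; first by apply: openI => //; exact: cdom_open.
- move=> i k; apply: (@Ck_ext _ _ _ _ _ id) => [z [y iy <-]|]; first by rewrite in_chartE.
  apply/(Ck_mx _ _ (nice_cornered nC (i := i))) => a b; rewrite ord1; apply: Ck_coord.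
  exact: nice_cornered.
Qed.

Lemma test_in (x : X) (U : set X) : open U -> U x ->
  exists h : X -> R, [/\ smooth_fun C h, 0 < h x & forall x', h x' != 0 -> U x'].
Proof.
move=> Uo Ux; have [i ix] := cdom_cover mfd x.
have [r [r0 rB rU]] := chart_ball_in mfd ix Uo Ux.
have nC := manifold_nice mfd.
exists (testfun (C := C) (C' := C) (fun i => i) (fun x => x) i x r (fun=> 1)); split.
- apply: (testfun_smooth mfd base_fibered) => // k.
  apply: (@Ck_ext _ _ _ _ _ (fun=> 1 : R)) => [z [y iy <-]|]; first by rewrite in_chartE.
  by apply: Ck_cst; exact: nice_cornered.
- by rewrite testfunE // mulr1 cube_bump_gt0 // subrr normr0.
- move=> x'; rewrite /testfun; case: pselect => [ix'|]; last by rewrite eqxx.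
  rewrite mulr1 => h0; apply: rU => //; apply: ltW; rewrite -cube_bump_gt0 //.
  by rewrite lt0r h0 cube_bump_ge0.
Qed.

(** Limits are prescribed only through test functions; this recovers equality of points from
    equality of all their values. *)
Lemma test_separate (x y : X) : (forall h : X -> R, smooth_fun C h -> h x = h y) -> x = y.
Proof.
move=> H; have [hX _ _ _ _] := mfd; apply: hX => U V.
rewrite {1}nbhsE => -[U' [Uo Ux] UU] NV.
have [h [sh hx hU]] := test_in Uo Ux.
exists y; split; last exact: nbhs_singleton.
by apply: UU; apply: hU; rewrite -(H h sh) gt_eqF.
Qed.

Lemma test_cvg (T : Type) (F : set_system T) (u : T -> X) (x : X) : Filter F ->
  (forall h : X -> R, smooth_fun C h -> forall e : R, 0 < e -> \forall t \near F, `|h (u t) - h x| <= e) ->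
  u t @[t --> F] --> x.
Proof.
move=> FF H N; rewrite nbhsE => -[U [Uo Ux] UN].
have [h [sh hx hU]] := test_in Uo Ux.
have h2 : 0 < h x / 2 by rewrite divr_gt0.
have := H h sh _ h2; apply: filterS => t ht; apply: UN; apply: hU.
by apply/eqP => E; move: ht; rewrite E sub0r normrN gtr0_norm //; lra.
Qed.

End BaseTests.

(** * The cotangent bundle *)

Section CotangentCharts.
Context {R : realType} {n : nat} {X : topologicalType} (C : charted R n X).
Hypothesis mfd : manifold_with_boundary C.
Let nC := manifold_nice mfd.
Let MC := cotangent_charts C.
Implicit Types (i j : cidx C) (x : X) (y : cotangent C).

Lemma cotangent_ext i y y' : cdom i (ct_pt y) -> ct_pt y = ct_pt y' ->
  ct_cov y i = ct_cov y' i -> y = y'.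
Proof.
case: y => x c off law; case: y' => x' c' off' law' /= ix E; subst x' => Ec.
suff E : c = c'.
  by subst c'; congr Cotangent; exact: Prop_irrelevance.
apply: funext => j; have [jx|jx] := pselect (cdom j x); last by rewrite off // off'.
by rewrite (law j i jx ix) (law' j i jx ix) Ec.
Qed.

Lemma mkcov_ex i x (p : 'cV[R]_n) : cdom i x -> exists2 y, ct_pt y = x & ct_cov y i = p.
Proof.
move=> ix; pose c (j : cidx C) : 'cV[R]_n := if pselect (cdom j x) is left _ then (jac j i x)^T *m p else 0.
have off (j : cidx C) : ~ cdom j x -> c j = 0 by rewrite /c; case: pselect.
have law j k : cdom j x -> cdom k x -> c j = (jac j k x)^T *m c k.
  move=> jx kx; rewrite /c; case: pselect => // _; case: pselect => // _.
  by rewrite (jac_mul nC jx kx ix) trmx_mul mulmxA.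
exists (Cotangent off law) => //=; rewrite /c; case: pselect => // _.
by rewrite (jac_id nC ix) trmx1 mul1mx.
Qed.

Lemma dgraph_off (f : X -> R) (tau : R) x i : ~ cdom i x ->
  (if pselect (cdom i x) is left _ then tau *: differential f i x else 0) = 0.
Proof. by case: pselect. Qed.

Lemma dgraph_law (f : X -> R) (tau : R) x : smooth_fun C f -> forall i j, cdom i x -> cdom j x ->
  (if pselect (cdom i x) is left _ then tau *: differential f i x else 0) =
  (jac i j x)^T *m (if pselect (cdom j x) is left _ then tau *: differential f j x else 0).
Proof.
move=> sf i j ix jx; case: pselect => // _; case: pselect => // _.
rewrite -scalemxAr; congr (_ *: _); apply/matrixP => a b; rewrite !mxE (cpartial_jac nC a ix jx sf).
by apply: eq_bigr => c _; rewrite !mxE.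
Qed.

(* the section [tau df] of the cotangent bundle *)
Definition dgraph (f : X -> R) (sf : smooth_fun C f) (tau : R) (x : X) : cotangent C :=
  Cotangent (fun i => @dgraph_off f tau x i) (dgraph_law tau sf (x := x)).

Lemma dgraph_cov f (sf : smooth_fun C f) tau x i : cdom i x ->
  ct_cov (dgraph sf tau x) i = tau *: differential f i x.
Proof. by move=> ix /=; case: pselect. Qed.

Lemma cimgM i z : cimg (C := MC) i z <-> cimg i (usubmx z).
Proof.
split=> [[y iy <-]|[x ix E]]; first by rewrite /= col_mxKu; exact: cimg_in.
have [y yx yp] := mkcov_ex (dsubmx z) ix; exists y => /=; first by rewrite yx.
by rewrite yx yp E vsubmxK.
Qed.

Lemma overlapM i j z : overlap (C := MC) i j z <-> overlap i j (usubmx z).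
Proof.
split=> [[y [iy jy] <-]|[x [ix jx] E]]; first by rewrite /= col_mxKu; exact: overlap_in.
have [y yx yp] := mkcov_ex (dsubmx z) ix; exists y => /=; first by rewrite yx.
by rewrite yx yp E vsubmxK.
Qed.

Lemma cimgM_cornered i : cornered (cimg (C := MC) i).
Proof.
have -> : cimg (C := MC) i = [set z : 'cV[R]_(n + n) | cimg i (usubmx z) /\ setT (dsubmx z)].
  by apply/seteqP; split=> [z /cimgM|z [/cimgM]].
by apply: cornered_prod; [exact: nice_cornered|exact: cornered_setT].
Qed.

Lemma norm_usub m k (z : 'cV[R]_(m + k)) : `|usubmx z| <= `|z|.
Proof. by apply: mxnorm_le => // i j; rewrite mxE; exact: ler_coord. Qed.

Lemma locally_eq_usub m k (A A' : set 'cV[R]_m) (z : 'cV[R]_(m + k)) :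
  locally_eq A A' (usubmx z) ->
  locally_eq [set w : 'cV[R]_(m + k) | A (usubmx w)] [set w | A' (usubmx w)] z.
Proof.
move=> [r r0 rP]; exists r => // w wz /=; apply: rP; rewrite -linearB.
exact: le_lt_trans (norm_usub _) wz.
Qed.

Lemma overlapM_cimg i j z : overlap (C := MC) i j z -> locally_eq (cimg (C := MC) i) (overlap (C := MC) i j) z.
Proof.
move=> /overlapM/(nice_overlap nC)/locally_eq_usub[r r0 rP]; exists r => // w wz.
split; first by move/cimgM => H; apply/overlapM/(rP w wz).
by move/overlapM => H; apply/cimgM/(rP w wz).
Qed.

Lemma overlapM_cornered i j : cornered (overlap (C := MC) i j).
Proof.
apply: (cornered_sub (@cimgM_cornered i)) => z Hz; split; last exact: overlapM_cimg.
by case: Hz => x [ix _] <-; exact: cimg_in.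
Qed.

Lemma Ck_usub k m l (A : set 'cV[R]_(m + l)) : cornered A -> Ck k A (fun w => usubmx w).
Proof.
move=> cA; apply/Ck_mx => // a b; rewrite ord1.
by apply: Ck_ext (Ck_coord cA k (lshift l a)) => z _; rewrite mxE.
Qed.

Lemma Ck_dsub_coord k m l (A : set 'cV[R]_(m + l)) a : cornered A -> Ck k A (fun w => dsubmx w a 0).
Proof. by move=> cA; apply: Ck_ext (Ck_coord cA k (rshift m a)) => z _; rewrite mxE. Qed.

Lemma Ck_lift k m l (A : set 'cV[R]_m) (B : set 'cV[R]_(m + l)) (f : 'cV[R]_m -> R) :
  cornered A -> cornered B -> (forall w, B w -> A (usubmx w)) -> Ck k A f -> Ck k B (fun w => f (usubmx w)).
Proof. by move=> cA cB BA Cf; apply: (Ck_comp cA cB BA Cf); exact: Ck_usub. Qed.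

Lemma in_chartM_trans i j y : cdom i (ct_pt y) -> cdom j (ct_pt y) ->
  in_chart (C := MC) i (cmap (c := MC) j) (cmap (c := MC) i y) =
  col_mx (cmap j (ct_pt y)) ((jac j i (ct_pt y))^T *m ct_cov y i).
Proof.
move=> iy jy; rewrite /in_chart; case: pselect => [e|[]]; last by exists y.
case: (cid2 e) => y' iy' /= E.
have := congr1 usubmx E; have := congr1 dsubmx E; rewrite !col_mxKu !col_mxKd => E2 E1.
have pE : ct_pt y' = ct_pt y := @nice_inj _ _ _ C nC i _ _ iy' iy E1.
by rewrite (@cotangent_ext i y' y) // (ct_law jy iy).
Qed.

(** The Jacobian as a function of the coordinates instead of the point, so that it can be
    differentiated once more. *)
Definition jacf i j (w : 'cV[R]_n) : 'M[R]_n :=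
  \matrix_(a, b) partial (overlap i j) (in_chart i (cmap j)) b w a 0.

Lemma jacfE i j x : jacf i j (cmap i x) = jac i j x.
Proof. by []. Qed.

Lemma transM_smooth i j : smooth (overlap (C := MC) i j) (in_chart (C := MC) i (cmap (c := MC) j)).
Proof.
move=> k; have cO := @overlapM_cornered i j.
have cO' := overlap_cornered nC (i := i) (j := j).
have cO2 := overlap_cornered nC (i := j) (j := i).
have sub w : overlap (C := MC) i j w -> overlap i j (usubmx w) by move/overlapM.
apply: (@Ck_ext _ _ _ _ _ (fun w => col_mx (in_chart i (cmap j) (usubmx w))
   ((jacf j i (in_chart i (cmap j) (usubmx w)))^T *m dsubmx w))).
  move=> z [y [iy jy] <-]; rewrite [RHS]in_chartM_trans //= col_mxKu col_mxKd in_chartE //.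
have Ct : Ck k (overlap i j) (in_chart i (cmap j)) by exact: nice_smooth.
apply/Ck_mx => // a b; rewrite ord1; rewrite -[a]splitK; case: (fintype.split a) => {}a /=.
  apply: (@Ck_ext _ _ _ _ _ (fun w => in_chart i (cmap j) (usubmx w) a 0)).
    by move=> z _; rewrite col_mxEu.
  apply: (Ck_lift cO' cO sub (f := fun w => in_chart i (cmap j) w a 0)).
  exact: ((Ck_mx _ _ cO').1 Ct a 0).
apply: (@Ck_ext _ _ _ _ _ (fun w => \sum_b jacf j i (in_chart i (cmap j) (usubmx w)) b a * dsubmx w b 0)).
  by move=> z _; rewrite col_mxEd mxE; apply: eq_bigr => c _; rewrite [in RHS]mxE.
apply: Ck_sum => // c _; apply: CkM => //; last exact: Ck_dsub_coord.
apply: (Ck_lift cO' cO sub (f := fun w => jacf j i (in_chart i (cmap j) w) c a)).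
apply: (@Ck_comp _ _ _ _ (overlap j i) (fun w => jacf j i w c a)) => //.
  by move=> w [x [ix jx] <-]; rewrite in_chartE //; exact: overlap_in.
apply: (@Ck_ext _ _ _ _ _ (fun w => partial (overlap j i) (in_chart j (cmap i)) a w c 0)).
  by move=> z _; rewrite mxE.
exact: (jac_smooth nC).
Qed.

Lemma cotangent_nice : nice_charts MC.
Proof.
split.
- move=> i y y' iy iy' E; have := congr1 usubmx E; have := congr1 dsubmx E.
  rewrite !col_mxKu !col_mxKd => E2 E1; apply: (@cotangent_ext i) => //.
  exact: (@nice_inj _ _ _ C nC i _ _ iy iy' E1).
- exact: cimgM_cornered.
- exact: overlapM_cimg.
- exact: transM_smooth.
Qed.

Lemma cotangent_fibered : fibered (C := C) (C' := MC) (fun i => i) (@ct_pt _ _ _ C).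
Proof.
split.
- exact: cotangent_nice.
- by [].
- move=> i y U iy Uo Uy.
  pose V : set X := @cdom _ _ _ C i `&` U.
  have Vo : open V by apply: openI => //; exact: (cdom_open mfd).
  have L := @cimg_locally2 _ _ _ _ mfd i V (ct_pt y) Vo (@subIsetl _ _ _) (conj iy Uy).
  have [r r0 rP] : locally_eq [set w : 'cV[R]_(n + n) | @cimg _ _ _ C i (usubmx w)]
      [set w : 'cV[R]_(n + n) | (@cmap _ _ _ C i @` V) (usubmx w)] (cmap (c := MC) i y).
    by apply: locally_eq_usub; rewrite /= col_mxKu; exact: L.
  exists r => // w wz; split=> [/cimgM cw|[y' [iy' _] <-]]; last exact: cimg_in.
  have [x [ix Ux] E] := (rP w wz).1 cw.
  have [y' yx yp] := mkcov_ex (dsubmx w) ix; exists y'; first by rewrite /preimage /= yx.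
  by rewrite /= yx yp E vsubmxK.
- move=> i k; have cA := @cimgM_cornered i.
  apply: (@Ck_ext _ _ _ _ _ (fun w => usubmx w)); last exact: Ck_usub.
  by move=> z [y iy <-]; rewrite (in_chartE cotangent_nice) //= col_mxKu.
Qed.

Lemma in_chartM_cov i a w : cimg (C := MC) i w ->
  in_chart (C := MC) i (fun y => ct_cov y i a 0) w = dsubmx w a 0.
Proof. by move=> [y iy <-]; rewrite (in_chartE cotangent_nice) //= col_mxKd. Qed.

Lemma in_chartM_base (W : normedModType R) i (h : X -> W) w : cimg (C := MC) i w ->
  in_chart (C := MC) i (h \o (@ct_pt _ _ _ C)) w = in_chart i h (usubmx w).
Proof. by move=> [y iy <-]; rewrite (in_chartE cotangent_nice) //= col_mxKu in_chartE. Qed.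

Lemma smooth_fun_base (h : X -> R) : smooth_fun C h -> smooth_fun MC (h \o (@ct_pt _ _ _ C)).
Proof.
move=> sh i k; apply: (@Ck_ext _ _ _ _ _ (fun w => in_chart (C := C) i h (usubmx w) : R)).
  by move=> z cz; rewrite in_chartM_base.
apply: (Ck_lift _ _ _ (sh i k)); [exact: nice_cornered|exact: cimgM_cornered|by move=> w /cimgM].
Qed.

(* [jac2 i j x d c a]: derivative of the entry [jac i j x d c] in direction [a] *)
Definition jac2 i j x (d c a : 'I_n) : R :=
  partial (overlap i j) (fun w => jacf i j w d c) a (cmap i x).

Lemma jac2C i j x d c a : cdom i x -> cdom j x -> jac2 i j x d c a = jac2 i j x d a c.
Proof.
move=> ix jx; have ox : overlap i j (cmap i x) by exact: overlap_in.
have cO := overlap_cornered nC (i := i) (j := j).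
have C2 := (Ck_mx _ _ cO).1 (nice_smooth nC i j 2) d 0.
have E b w : overlap i j w -> jacf i j w d b = partial (overlap i j) (fun w => in_chart i (cmap j) w d 0) b w.
  move=> ow; rewrite mxE (partial_mx _ _ _ cO ow) //.
  by have [D _] := nice_smooth nC i j 1; exact: D.
rewrite /jac2 !(partial_local _ (r := 1) ltr01 (fun _ _ => iff_refl _) (fun w _ ow => E _ w ow) (E _ _ ox)).
exact: schwarz.
Qed.

(** The second derivative of the coordinate change contracted with a covector: the inhomogeneous
    term that appears when [(jac i j)^T p] is differentiated in the base. *)
Definition jacS i j x (p : 'cV[R]_n) : 'M[R]_n := \matrix_(c, a) \sum_d jac2 i j x d c a * p d 0.

Section JacM.
Variables (i j : cidx C) (y : cotangent C).
Hypotheses (iy : cdom i (ct_pt y)) (jy : cdom j (ct_pt y)).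
Let x := ct_pt y.
Let z : 'cV[R]_(n + n) := cmap (c := MC) i y.
Let A := jac i j x.

Lemma lift_diff (W : normedModType R) (f : 'cV[R]_n -> W) (U : set 'cV[R]_n) (V : set 'cV[R]_(n + n)) (w : 'cV[R]_(n + n)) G :
  diff_within U f (usubmx w) G -> (forall v, V v -> U (usubmx v)) ->
  diff_within V (fun v => f (usubmx v)) w
    (fun k => match fintype.split k with inl a => G a | inr _ => 0 end).
Proof.
move=> D UV; have Du : diff_within V (fun v => usubmx v) w (fun k => usubmx (delta_mx k 0)).
  apply/diff_within_mx => a b; rewrite ord1.
  have -> : (fun k : 'I_(n + n) => usubmx (delta_mx k 0 : 'cV[R]_(n + n)) a 0) = (fun k => (lshift n a == k)%:R).
    by apply: funext => k; rewrite !mxE eqxx andbT.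
  by apply: (diff_within_local ltr01 _ _ (diff_within_coord V (lshift n a) w)) => [v _ Vv|]; rewrite mxE.
have := diff_within_comp D Du UV; congr diff_within.
apply: funext => k; case: splitP => [a ka|a ka].
  rewrite (bigD1 a) //= big1 ?addr0 => [|b ba]; rewrite !mxE eqxx andbT.
    by rewrite (_ : lshift n a == k) ?scale1r //; apply/eqP/val_inj.
  by rewrite (_ : (lshift n b == k) = false) ?scale0r //; apply/negbTE; apply: contraNneq ba => E; apply/eqP/val_inj; have := congr1 val E; rewrite /= ka.
rewrite big1 // => b _; rewrite !mxE eqxx andbT (_ : (lshift n b == k) = false) ?scale0r //.
by apply/negbTE/eqP => E; have := congr1 val E; rewrite /= ka => H; have := ltn_ord b; rewrite H ltnNge leq_addr.
Qed.

(** The lower-left block is characterised by an equation instead of a formula: differentiate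
    [A^T p_j = p_i] with respect to the base coordinates, in which the independent coordinate [p_i]
    is constant. *)
Lemma jacM_block : exists2 B : 'M[R]_n, jac (C := MC) i j y = block_mx A 0 B (invmx A)^T &
  A^T *m B + jacS i j x (ct_cov y j) = 0.
Proof.
have cO := overlap_cornered nC (i := i) (j := j).
have cOM := @overlapM_cornered i j.
have oz : overlap (C := MC) i j z by exact: (@overlap_in _ _ _ MC).
have ox : overlap i j (cmap i x) by exact: overlap_in.
have uz : usubmx z = cmap i x by rewrite /z /= col_mxKu.
have sub w : overlap (C := MC) i j w -> overlap i j (usubmx w) by move/overlapM.
have jx : cdom j x by [].
pose T := jac (C := MC) i j y.
have DT := trans_diff cotangent_nice iy jy.
have Au : A \in unitmx := @jac_unit _ _ _ C nC i j (ct_pt y) iy jy.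
have D1 a : diff_within (overlap (C := MC) i j) (fun w => in_chart (C := MC) i (cmap (c := MC) j) w (lshift n a) 0) z
  (fun k => match fintype.split k with inl b => A a b | inr _ => 0 end).
  have H := (diff_within_mx _ _ _ _).1 (trans_diff nC iy jy) a 0.
  rewrite -uz in H; have := lift_diff H sub.
  have -> : (fun k : 'I_(n + n) => match fintype.split k with inl b => col b (jac i j (ct_pt y)) a 0 | inr _ => 0 end) =
     (fun k => match fintype.split k with inl b => A a b | inr _ => 0 end).
    by apply: funext => k; case: (fintype.split k) => // b; rewrite mxE.
  apply: (diff_within_local ltr01) => [w _ ow|].
    split => //; have [y' [iy' jy'] <-] := ow.
    by rewrite in_chartM_trans //= col_mxEu col_mxKu in_chartE.
  by rewrite in_chartM_trans // col_mxEu uz in_chartE.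
(* [D2] and [D3] differentiate the same function, once as the product [A^T p_j] and once as the
   coordinate [p_i]; uniqueness of the derivative equates the results. *)
have D2 c : diff_within (overlap (C := MC) i j)
  (fun w => \sum_d jacf i j (usubmx w) d c * in_chart (C := MC) i (cmap (c := MC) j) w (rshift n d) 0) z
  (fun k => \sum_d (match fintype.split k with inl b => jac2 i j x d c b | inr _ => 0 end * ct_cov y j d 0
     + A d c * T (rshift n d) k)).
  apply: diff_within_sum => d _.
  have Cj : Ck 1 (overlap i j) (fun w => jacf i j w d c).
    by apply: Ck_ext (jac_smooth nC i j d c 1) => w _; rewrite mxE.
  have := Ck_diff cO Cj ox; rewrite -uz => H.
  have L := lift_diff H sub.
  have H2 := (diff_within_mx _ _ _ _).1 DT (rshift n d) 0.
  have := diff_withinM L H2.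
  congr diff_within; apply: funext => k; rewrite [col _ _ _ _]mxE uz jacfE; congr (_ * _ + _).
  by rewrite in_chartM_trans // col_mxEd -(ct_law jy iy).
have D3 c : diff_within (overlap (C := MC) i j)
  (fun w => \sum_d jacf i j (usubmx w) d c * in_chart (C := MC) i (cmap (c := MC) j) w (rshift n d) 0) z
  (fun k => (rshift n c == k)%:R).
  have G w : overlap (C := MC) i j w -> \sum_d jacf i j (usubmx w) d c * in_chart (C := MC) i (cmap (c := MC) j) w (rshift n d) 0 = w (rshift n c) 0.
    move=> [y' [iy' jy'] <-]; rewrite in_chartM_trans //= col_mxEd (ct_law iy' jy') mxE.
    apply: eq_bigr => d _; rewrite col_mxKu jacfE col_mxEd mxE; congr (_ * _); first by rewrite !mxE.
    by rewrite -(ct_law iy' jy') -(ct_law jy' iy').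
  by apply: (diff_within_local ltr01 _ _ (diff_within_coord (overlap (C := MC) i j) (rshift n c) z)) => [w _ ow|]; rewrite G.
have E c k := congr1 (fun G => G k) (diff_within_uniq cOM oz (D2 c) (D3 c)).
have ET (l k : 'I_(n + n)) : col k T l 0 = T l k by rewrite mxE.
have Tul a k : T (lshift n a) k = match fintype.split k with inl b => A a b | inr _ => 0 end.
  have H := (diff_within_mx _ _ _ _).1 DT (lshift n a) 0.
  have := congr1 (fun G => G k) (diff_within_uniq cOM oz H (D1 a)); by rewrite ET.
have S1 a : fintype.split (lshift n a) = inl a := unsplitK (inl a).
have S2 a : fintype.split (rshift n a) = inr a := unsplitK (inr a).
have TE : jac (C := MC) i j y = T by [].
clearbody T; rewrite {}TE.
exists (dlsubmx T).
  rewrite -[LHS]submxK; congr block_mx.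
  - by apply/matrixP => a b; rewrite [LHS]mxE [LHS]mxE Tul S1.
  - by apply/matrixP => a b; rewrite [LHS]mxE [LHS]mxE Tul S2 [RHS]mxE.
  - have TD : A^T *m drsubmx T = 1%:M.
      apply/matrixP => c b; have := E c (rshift n b); rewrite S2 !mxE.
      rewrite (_ : (rshift n c == rshift n b) = (c == b)) => [<-|]; last exact: (inj_eq (@rshift_inj n n)).
      by apply: eq_bigr => d _; rewrite mul0r add0r !mxE.
    have AtU : A^T \in unitmx by rewrite unitmx_tr.
    by rewrite -[LHS]mul1mx -(mulVmx AtU) -mulmxA TD mulmx1 trmx_inv.
apply/matrixP => c a; have := E c (lshift n a); rewrite S1 !mxE.
have F : (rshift n c == lshift n a) = false.
  apply/negbTE/eqP => H; have /= H' := congr1 val H.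
  by have := ltn_ord a; rewrite -H' ltnNge leq_addr.
rewrite F => H; rewrite -[RHS]/(false%:R : R) -H.
by rewrite -big_split /=; apply: eq_bigr => d _; rewrite !mxE addrC.
Qed.

End JacM.

End CotangentCharts.

(** * Kaehler geometry in charts *)

Section MatrixCalculus.
Context {R : realType}.

(** Multilinear identities are reduced with this to basis vectors, one argument at a time; there the
    coordinate definitions of the tensors apply. *)
Lemma lin0 n (F : 'cV[R]_n -> R) : (forall u v, F (u + v) = F u + F v) ->
  (forall a u, F (a *: u) = a * F u) -> (forall c, F (delta_mx c 0) = 0) -> forall u, F u = 0.
Proof.
move=> FD FZ F0 u.
have -> : u = \sum_c u c 0 *: delta_mx c 0.
  apply/matrixP => a b; rewrite ord1 summxE (bigD1 a) //= big1 ?addr0 ?mxE ?eqxx ?mulr1 // => c /negbTE ca.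
  by rewrite !mxE eq_sym ca mulr0.
have F00 : F 0 = 0 by rewrite -(scale0r (0 : 'cV[R]_n)) FZ mul0r.
elim/big_rec: _ => // c v _ Fv.
by rewrite FD FZ F0 mulr0 add0r.
Qed.

Lemma bf0m n (u v : 'cV[R]_n) : bf 0 u v = 0.
Proof. by rewrite /bf mulmx0 mul0mx mxE. Qed.

Lemma bf_skew n (G J dG dJ : 'M[R]_n) (u v : 'cV[R]_n) :
  bf (dJ^T *m G + J^T *m dG + (dG *m J + G *m dJ)) u v =
  bf G (dJ *m u) v + bf dG (J *m u) v + (bf dG u (J *m v) + bf G u (dJ *m v)).
Proof. by rewrite !bfDm !bf_mull !bf_mulr. Qed.

Lemma diff_within_mulmx d m n p (A : set 'cV[R]_d) (F : 'cV[R]_d -> 'M[R]_(m, n)) (G : 'cV[R]_d -> 'M[R]_(n, p)) z F' G' :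
  diff_within A F z F' -> diff_within A G z G' ->
  diff_within A (fun w => F w *m G w) z (fun k => F' k *m G z + F z *m G' k).
Proof.
move=> /diff_within_mx DF /diff_within_mx DG; apply/diff_within_mx => a b.
have D : diff_within A (fun w => \sum_j F w a j * G w j b) z
   (fun k => \sum_j (F' k a j * G z j b + F z a j * G' k j b)).
  by apply: diff_within_sum => j _; exact: diff_withinM.
have E (w : 'cV[R]_d) : (F w *m G w) a b = \sum_j F w a j * G w j b by rewrite mxE.
have -> : (fun k => (F' k *m G z + F z *m G' k) a b) =
  (fun k => \sum_j (F' k a j * G z j b + F z a j * G' k j b)).
  by apply: funext => k; rewrite !mxE -big_split.
by apply: (diff_within_local ltr01 _ _ D) => [w _ Aw|]; rewrite E.
Qed.

Lemma diff_within_trmx d m n (A : set 'cV[R]_d) (F : 'cV[R]_d -> 'M[R]_(m, n)) z F' :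
  diff_within A F z F' -> diff_within A (fun w => (F w)^T) z (fun k => (F' k)^T).
Proof.
move=> /diff_within_mx D; apply/diff_within_mx => a b.
have -> : (fun k => (F' k)^T a b) = (fun k => F' k b a) by apply: funext => k; rewrite mxE.
by apply: (diff_within_local ltr01 _ _ (D b a)) => [w _ Aw|]; rewrite mxE.
Qed.

End MatrixCalculus.

Section Kahler.
Context {R : realType} {n : nat} {X : topologicalType} (C : charted R n X) (g I : tensor C).
Hypothesis K : kahler_manifold g I.
Implicit Types (i j : cidx C) (x : X) (u v w : 'cV[R]_n).

Lemma kahler_mfd : manifold_with_boundary C. Proof. by case: K. Qed.
Let mfd := kahler_mfd.
Let nC := manifold_nice mfd.

Lemma kahler_posdef i x : cdom i x -> posdef (g i x).
Proof. by case: K => _ [_ _ H] _ _ _ ix; have [s p] := H i x ix; split => // v /p. Qed.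

Lemma g_smooth : smooth_tensor g. Proof. by case: K => _ []. Qed.
Lemma I_smooth : smooth_tensor I. Proof. by case: K => _ _ []. Qed.

Lemma I_sqr i x : cdom i x -> I i x *m I i x = - 1%:M.
Proof. by case: K => _ _ [[_ H] _ _] _ _; exact: H. Qed.

Lemma I_law i j x : cdom i x -> cdom j x -> I j x *m jac i j x = jac i j x *m I i x.
Proof. by case: K => _ _ [[H _] _ _] _ _; exact: H. Qed.

Lemma g_law i j x : cdom i x -> cdom j x -> (jac i j x)^T *m g j x *m jac i j x = g i x.
Proof. by case: K => _ [H _ _] _ _ _; exact: H. Qed.

Lemma IgI i x : cdom i x -> (I i x)^T *m g i x *m I i x = g i x.
Proof. by case: K => _ _ _ H _; exact: H. Qed.

Lemma Ig_skew i x : cdom i x -> (I i x)^T *m g i x = - (g i x *m I i x).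
Proof.
move=> ix; have : (I i x)^T *m g i x *m (I i x *m I i x) = g i x *m I i x.
  by rewrite mulmxA IgI.
by rewrite I_sqr // mulmxN mulmx1 => <-; rewrite opprK.
Qed.

Lemma g_I u v i x : cdom i x -> bf (g i x) (I i x *m u) v = - bf (g i x) u (I i x *m v).
Proof. by move=> ix; rewrite bf_mull Ig_skew // bfNm bf_mulr. Qed.

Lemma gI_I u v i x : cdom i x -> bf (g i x) (I i x *m u) (I i x *m v) = bf (g i x) u v.
Proof. by move=> ix; rewrite bf_mull bf_mulr IgI. Qed.

Lemma tensor_diff (T : tensor C) i x : smooth_tensor T -> cdom i x ->
  diff_within (cimg i) (in_chart i (T i)) (cmap i x) (fun a => cpartial i (T i) a x).
Proof. by move=> sT ix; exact: Ck_diff (nice_cornered nC (i := i)) (sT i 1) (cimg_in ix). Qed.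

Lemma tensor_partial (T : tensor C) i x (D : 'I_n -> 'M[R]_n) : cdom i x ->
  diff_within (cimg i) (in_chart i (T i)) (cmap i x) D ->
  forall a, cpartial i (T i) a x = D a.
Proof. by move=> ix H a; rewrite /cpartial (partialE a (nice_cornered nC (i := i)) (cimg_in ix) H). Qed.

Definition dT (T : tensor C) i x v : 'M[R]_n := \sum_c v c 0 *: cpartial i (T i) c x.

Lemma dTD T i x u v : dT T i x (u + v) = dT T i x u + dT T i x v.
Proof. by rewrite /dT -big_split; apply: eq_bigr => c _; rewrite mxE scalerDl. Qed.

Lemma dTZ T i x a v : dT T i x (a *: v) = a *: dT T i x v.
Proof. by rewrite /dT scaler_sumr; apply: eq_bigr => c _; rewrite mxE scalerA. Qed.

Lemma dT_delta T i x c : dT T i x (delta_mx c 0) = cpartial i (T i) c x.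
Proof.
rewrite /dT (bigD1 c) //= big1 ?addr0 ?mxE ?eqxx ?scale1r // => a /negbTE ac.
by rewrite mxE ac scale0r.
Qed.

Lemma dT_bf T i x u v w : bf (dT T i x w) u v = \sum_c w c 0 * bf (cpartial i (T i) c x) u v.
Proof. by rewrite /dT bf_summ; apply: eq_bigr => c _; rewrite bfZm. Qed.

Lemma dg_sym i x u v w : cdom i x -> bf (dT g i x w) u v = bf (dT g i x w) v u.
Proof.
move=> ix; rewrite !dT_bf; apply: eq_bigr => c _; congr (_ * _).
rewrite [RHS]bf_tr; congr (bf _ _ _).
apply: (tensor_partial (T := g) (D := fun k => (cpartial i (g i) k x)^T) ix _ c).
have := diff_within_trmx (tensor_diff g_smooth ix).
apply: (diff_within_local ltr01) => [z _ [y iy <-]|].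
  by split; [exact: cimg_in|rewrite in_chartE // (kahler_posdef iy).1].
by rewrite in_chartE // (kahler_posdef ix).1.
Qed.

Definition Gam i x v : 'M[R]_n := \matrix_(c, a) \sum_b christoffel g i x c a b * v b 0.

Lemma GamD i x u v : Gam i x (u + v) = Gam i x u + Gam i x v.
Proof.
by apply/matrixP => c a; rewrite !mxE -big_split; apply: eq_bigr => b _; rewrite mxE mulrDr.
Qed.

Lemma GamZ i x a v : Gam i x (a *: v) = a *: Gam i x v.
Proof.
by apply/matrixP => c b; rewrite !mxE mulr_sumr; apply: eq_bigr => d _; rewrite mxE mulrCA.
Qed.

(** Koszul's formula for constant coordinate fields. Being free of inverse matrices, it is the only
    access to the Christoffel symbols in what follows. *)
Lemma Gam_key i x u v w : cdom i x ->
  2 * bf (g i x) w (Gam i x v *m u) =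
  bf (dT g i x u) v w + bf (dT g i x v) u w - bf (dT g i x w) u v.
Proof.
move=> ix; have gP := kahler_posdef ix; have gU := posdef_unit gP.
apply/eqP; rewrite -subr_eq0; apply/eqP.
move: u; apply: lin0 => [u u'|a u|a].
- by rewrite mulmxDr !bfDr dTD bfDm !bfDl; ring.
- by rewrite -scalemxAr !bfZr dTZ bfZm !bfZl; ring.
move: v; apply: lin0 => [v v'|b v|b].
- by rewrite GamD mulmxDl !bfDr dTD bfDm !bfDl; ring.
- by rewrite GamZ -scalemxAl !bfZr dTZ bfZm !bfZl; ring.
move: w; apply: lin0 => [w w'|c w|c].
- by rewrite dTD bfDm !bfDr !bfDl; ring.
- by rewrite dTZ bfZm !bfZr !bfZl; ring.
rewrite !dT_delta !bf_delta bf_mulr bf_delta mxE.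
have E d : Gam i x (delta_mx b 0) d a = christoffel g i x d a b.
  rewrite mxE (bigD1 b) //= big1 ?addr0 ?mxE ?eqxx ?mulr1 // => e /negbTE eb.
  by rewrite mxE eb mulr0.
under eq_bigr do rewrite E /christoffel.
set L := fun d : 'I_n => cpartial i (g i) a x b d + cpartial i (g i) b x a d - cpartial i (g i) d x a b.
have -> : \sum_d g i x c d * (2^-1 * \sum_e invmx (g i x) d e * L e) =
   2^-1 * \sum_e (g i x *m invmx (g i x)) c e * L e.
  rewrite mulr_sumr.
  under eq_bigr => d _ do rewrite mulrCA mulr_sumr mulr_sumr.
  rewrite exchange_big /=; apply: eq_bigr => e _; rewrite mxE mulr_suml mulr_sumr.
  by apply: eq_bigr => d _; rewrite [X in _ * X]mulrA.
rewrite mulmxV // (bigD1 c) //= big1 ?addr0 ?mxE ?eqxx => [|e /negbTE ec]; last first.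
  by rewrite mxE eq_sym ec mul0r.
by rewrite mulr1n mul1r mulrA mulfV // mul1r subrr.
Qed.

Lemma Gam_sym i x u v : cdom i x -> Gam i x v *m u = Gam i x u *m v.
Proof.
move=> ix; have gP := kahler_posdef ix.
have H w : bf (g i x) w (Gam i x v *m u) = bf (g i x) w (Gam i x u *m v).
  have := Gam_key u v w ix; have := Gam_key v u w ix.
  by rewrite (dg_sym v u) // => H1 H2; lra.
have : Gam i x v *m u - Gam i x u *m v = 0.
  by apply: (posdef_eq0 gP); rewrite bfDr bfNr H subrr.
by move/subr0_eq.
Qed.

(** The connection preserves the metric: add Koszul's formula for the two orders of [u] and [w]; the
    other derivatives of [g] cancel by symmetry. *)
Lemma Gam_compat i x u v w : cdom i x ->
  bf (dT g i x v) u w = bf (g i x) (Gam i x v *m u) w + bf (g i x) u (Gam i x v *m w).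
Proof.
move=> ix; have gP := kahler_posdef ix; rewrite (bf_sym _ w gP).
have := Gam_key u v w ix; have := Gam_key w v u ix.
by rewrite (dg_sym w u) // (dg_sym v u) // (dg_sym v w) // => H1 H2; lra.
Qed.

(** The covariant derivative of [I] in direction [v], that is [d_v I + [Gam_v, I]]. *)
Definition nablaI i x v : 'M[R]_n := dT I i x v + Gam i x v *m I i x - I i x *m Gam i x v.

Lemma nablaIZ i x (r : R) u : nablaI i x (r *: u) = r *: nablaI i x u.
Proof. by rewrite /nablaI dTZ GamZ -scalemxAl -scalemxAr -scalerDr -scalerBr. Qed.

(** The covariant derivative of the relation [I^T g + g I = 0], as [g] is parallel. *)
Lemma nablaI_skew i x a b c : cdom i x ->
  bf (g i x) c (nablaI i x a *m b) = - bf (g i x) b (nablaI i x a *m c).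
Proof.
move=> ix; have gP := kahler_posdef ix.
have D : bf (g i x) (dT I i x a *m b) c + bf (dT g i x a) (I i x *m b) c +
   (bf (dT g i x a) b (I i x *m c) + bf (g i x) b (dT I i x a *m c)) = 0.
  move: a; apply: lin0 => [u v|r u|d].
  - by rewrite !dTD !mulmxDl !bfDl !bfDm !bfDr; ring.
  - by rewrite !dTZ -!scalemxAl !bfZl !bfZm !bfZr; ring.
  rewrite !dT_delta.
  have D1 := diff_within_mulmx (diff_within_trmx (tensor_diff I_smooth ix)) (tensor_diff g_smooth ix).
  have D2 := diff_within_mulmx (tensor_diff g_smooth ix) (tensor_diff I_smooth ix).
  have D3 := diff_withinD D1 D2.
  have D0 := diff_within_cst (cimg i) (0 : 'M[R]_n) (cmap i x).
  have Z y : cdom i y -> (in_chart i (I i) (cmap i y))^T *m in_chart i (g i) (cmap i y) +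
     in_chart i (g i) (cmap i y) *m in_chart i (I i) (cmap i y) = 0.
    by move=> iy; rewrite !in_chartE // Ig_skew // addNr.
  have {}D0 : diff_within (cimg i) (fun z => (in_chart i (I i) z)^T *m in_chart i (g i) z +
     in_chart i (g i) z *m in_chart i (I i) z) (cmap i x) (fun=> 0).
    by apply: (diff_within_local ltr01 _ _ D0) => [z _ [y iy <-]|]; rewrite Z //; split => //; exact: cimg_in.
  have E := congr1 (fun G => G d) (diff_within_uniq (nice_cornered nC (i := i)) (cimg_in ix) D3 D0).
  have {}E := etrans (congr1 (fun M => bf M b c) E) (bf0m b c).
  have Ei := in_chartE nC (I i) ix.
  have Eg := in_chartE nC (g i) ix.
  by move: E; rewrite Ei Eg bf_skew.
move: D; rewrite !Gam_compat // /nablaI !mulmxDl !mulNmx -!mulmxA !bfDr !bfNr !g_I //.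
have g1 := bf_sym c (dT I i x a *m b) gP.
have g2 := bf_sym c (Gam i x a *m (I i x *m b)) gP.
have g3 := bf_sym c (I i x *m (Gam i x a *m b)) gP; rewrite g_I // in g3.
rewrite g1 g2 g3; lra.
Qed.

(** Closedness of the Kaehler form: for a torsion-free connection the Christoffel terms drop out of
    the cyclic sum, and coordinate derivatives may be replaced by covariant ones. *)
Lemma nablaI_cyclic i x a b c : cdom i x ->
  bf (g i x) c (nablaI i x a *m b) + bf (g i x) a (nablaI i x b *m c) + bf (g i x) b (nablaI i x c *m a) = 0.
Proof.
move=> ix; have gP := kahler_posdef ix.
have dW u : dT (kahler_form g I) i x u = (dT I i x u)^T *m g i x + (I i x)^T *m dT g i x u.
  have D1 := diff_within_mulmx (diff_within_trmx (tensor_diff I_smooth ix)) (tensor_diff g_smooth ix).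
  have D2 : diff_within (cimg i) (in_chart i (kahler_form g I i)) (cmap i x)
     (fun k => (cpartial i (I i) k x)^T *m in_chart i (g i) (cmap i x) + (in_chart i (I i) (cmap i x))^T *m cpartial i (g i) k x).
    by apply: (diff_within_local ltr01 _ _ D1) => [z _ [y iy <-]|]; rewrite ?in_chartE //; split => //; exact: cimg_in.
  rewrite /dT linear_sum mulmx_suml mulmx_sumr -big_split /=; apply: eq_bigr => d _.
  by rewrite (tensor_partial ix D2) (in_chartE nC (I i) ix) (in_chartE nC (g i) ix) linearZ /= -scalemxAl -scalemxAr scalerDr.
have cl : bf (dT (kahler_form g I) i x a) b c + bf (dT (kahler_form g I) i x b) c a + bf (dT (kahler_form g I) i x c) a b = 0.
  move: a; apply: lin0 => [u v|r u|a]; rewrite ?dTD ?bfDm ?bfDl ?bfDr ?dTZ ?bfZm ?bfZl ?bfZr; try ring.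
  move: b; apply: lin0 => [u v|r u|b]; rewrite ?dTD ?bfDm ?bfDl ?bfDr ?dTZ ?bfZm ?bfZl ?bfZr; try ring.
  move: c; apply: lin0 => [u v|r u|c]; rewrite ?dTD ?bfDm ?bfDl ?bfDr ?dTZ ?bfZm ?bfZl ?bfZr; try ring.
  by rewrite !dT_delta !bf_delta; case: K => _ _ _ _ H; exact: H.
have E u v w : bf (dT (kahler_form g I) i x u) v w =
  bf (g i x) w (nablaI i x u *m v) - bf (g i x) (I i x *m w) (Gam i x u *m v) + bf (g i x) (I i x *m v) (Gam i x u *m w).
  rewrite dW bfDm -!bf_mull Gam_compat // /nablaI !mulmxDl !mulNmx -!mulmxA !bfDr !bfNr.
  have g1 := bf_sym w (dT I i x u *m v) gP.
  have g2 := bf_sym w (Gam i x u *m (I i x *m v)) gP.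
  have g3 := g_I w (Gam i x u *m v) ix.
  rewrite g1 g2 g3; lra.
move: cl; rewrite !E.
have s1 := Gam_sym b a ix; have s2 := Gam_sym c b ix; have s3 := Gam_sym a c ix.
by rewrite s1 s2 s3; lra.
Qed.

(** Again by absence of torsion, the Nijenhuis tensor keeps its value when the coordinate
    derivatives of [I] are replaced by covariant ones. *)
Lemma nablaI_nijenhuis i x a b : cdom i x ->
  nablaI i x (I i x *m a) *m b - nablaI i x (I i x *m b) *m a
  - I i x *m (nablaI i x a *m b) + I i x *m (nablaI i x b *m a) = 0.
Proof.
move=> ix.
have N : dT I i x (I i x *m a) *m b - dT I i x (I i x *m b) *m a
   - I i x *m (dT I i x a *m b) + I i x *m (dT I i x b *m a) = 0.
  apply: dot_inj => w; rewrite -bf1 -bf1 bf0r.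
  move: a; apply: lin0 => [u v|r u|a].
  - by rewrite !mulmxDr !dTD !mulmxDl !mulmxDr !bfDr !bfNr !bfDr; ring.
  - by rewrite -!scalemxAr !dTZ -!scalemxAl -!scalemxAr !bfDr !bfNr !bfZr; ring.
  move: b; apply: lin0 => [u v|r u|b].
  - by rewrite !mulmxDr !dTD !mulmxDl !mulmxDr !bfDr !bfNr !bfDr; ring.
  - by rewrite -!scalemxAr !dTZ -!scalemxAl -!scalemxAr !bfDr !bfNr !bfZr; ring.
  move: w; apply: lin0 => [u v|r u|c]; [by rewrite bfDl|by rewrite bfZl|].
  have [_ _ H] : complex_structure I by case: K.
  rewrite -[RHS](H i x ix a b c) /nijenhuis !bfDr !bfNr !dT_delta.
  have E (M : 'M[R]_n) d e : bf 1%:M (delta_mx d 0 : 'cV[R]_n) (M *m delta_mx e 0) = M d e.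
    by rewrite bf_mulr mul1mx bf_delta.
  have E1 d e f : bf 1%:M (delta_mx d 0 : 'cV[R]_n) (dT I i x (I i x *m delta_mx e 0) *m delta_mx f 0) =
      \sum_l I i x l e * cpartial i (I i) l x d f.
    rewrite E /dT summxE; apply: eq_bigr => l _; rewrite -colE !mxE //.
  rewrite !E1 !mulmxA !E !mxE -!sumrN -!big_split /=; apply: eq_bigr => l _; ring.
apply: dot_inj => w; rewrite -bf1 -bf1 bf0r.
have := congr1 (bf 1%:M w) N; rewrite bf0r /nablaI.
rewrite !mulmxDl !mulNmx -!mulmxA !mulmxDr !mulmxN !bfDr !bfNr !bfDr !bfNr.
rewrite (Gam_sym b (I i x *m a)) // (Gam_sym a (I i x *m b)) // (Gam_sym a b) // (Gam_sym (I i x *m b) (I i x *m a)) //.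
lra.
Qed.

(** Pure algebra for [h a b c = g(c, (nabla_a I) b)]: skewness in the last two arguments, the cyclic
    identity and the vanishing Nijenhuis tensor together leave only 0. *)
Lemma nablaI0 i x (a b : 'cV[R]_n) : cdom i x -> nablaI i x a *m b = 0.
Proof.
move=> ix; have gP := kahler_posdef ix.
pose h a b c := bf (g i x) c (nablaI i x a *m b).
have hs a' b' c' : h a' b' c' = - h a' c' b' by exact: nablaI_skew.
have hc a' b' c' : h a' b' c' + h b' c' a' + h c' a' b' = 0 by exact: nablaI_cyclic.
have hn a' b' c' : h (I i x *m a') b' c' - h (I i x *m b') a' c' - h (I i x *m c') a' b' = 0.
  have := congr1 (bf (g i x) c') (nablaI_nijenhuis a' b' ix).
  rewrite bf0r !bfDr !bfNr -!g_I // => N.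
  have N' : h (I i x *m a') b' c' - h (I i x *m b') a' c' + h a' b' (I i x *m c') - h b' a' (I i x *m c') = 0.
    rewrite /h; have e1 := g_I c' (nablaI i x a' *m b') ix; have e2 := g_I c' (nablaI i x b' *m a') ix.
    by move: N; lra.
  have := hc a' b' (I i x *m c'); rewrite (hs b' (I i x *m c') a'); move: N'; lra.
(* Put [x = h (Ia) b c], [y = h (Ib) c a], [z = h (Ic) a b]. By skewness the three cyclic instances
   of [hn] say [x + y = z], [y + z = x] and [z + x = y], so all three vanish. *)
have h0 a' b' c' : h (I i x *m a') b' c' = 0.
  have := hn a' b' c'; have := hn b' c' a'; have := hn c' a' b'.
  rewrite (hs (I i x *m b') a' c') (hs (I i x *m a') c' b') (hs (I i x *m c') b' a'); lra.
apply: (posdef_eq0 gP).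
have -> : nablaI i x a = - nablaI i x (I i x *m (I i x *m a)).
  by rewrite mulmxA I_sqr // mulNmx mul1mx -(scaleN1r a) nablaIZ scaleN1r opprK.
by rewrite mulNmx bfNl bfNr opprK; exact: h0.
Qed.

(* [nabla I = 0] makes this expression symmetric in [a] and [b] *)
Lemma dI_Gam_sym i x (a b : 'cV[R]_n) : cdom i x ->
  dT I i x a *m b + Gam i x a *m (I i x *m b) = dT I i x b *m a + Gam i x b *m (I i x *m a).
Proof.
move=> ix.
have E u v : dT I i x u *m v + Gam i x u *m (I i x *m v) = I i x *m (Gam i x u *m v).
  have := nablaI0 u v ix; rewrite /nablaI !mulmxDl mulNmx -!mulmxA => /subr0_eq //.
by rewrite !E Gam_sym.
Qed.

End Kahler.

Lemma diff_within_eq (R : realType) d (W : normedModType R) (A : set 'cV[R]_d) (f f' : 'cV[R]_d -> W) z G :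
  A z -> (forall w, A w -> f' w = f w) -> diff_within A f z G -> diff_within A f' z G.
Proof.
by move=> Az E; apply: (diff_within_local ltr01) => [w _ Aw|]; rewrite E.
Qed.

Lemma bf_jac (R : realType) n (J2 G A DG : 'M[R]_n) (u w : 'cV[R]_n) :
  bf ((J2^T *m G + A^T *m DG) *m A + A^T *m G *m J2) u w =
  bf G (J2 *m u) (A *m w) + bf DG (A *m u) (A *m w) + bf G (A *m u) (J2 *m w).
Proof. by rewrite mulmxDl !bfDm !bf_mulr !bf_mull !mulmxA. Qed.

Lemma dot_tr (R : realType) n (A : 'M[R]_n) (p w : 'cV[R]_n) : dot (A^T *m p) w = dot p (A *m w).
Proof. by rewrite /dot trmx_mul trmxK mulmxA. Qed.

Lemma bf_conj (R : realType) n (A M : 'M[R]_n) (u v : 'cV[R]_n) :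
  bf (A^T *m M *m A) u v = bf M (A *m u) (A *m v).
Proof. by rewrite -bf_mulr -bf_mull. Qed.

(** * Behaviour of the connection and the Hessian under a change of chart *)

Section Transformation.
Context {R : realType} {n : nat} {X : topologicalType} (C : charted R n X) (g I : tensor C).
Hypothesis K : kahler_manifold g I.
Implicit Types (i j : cidx C) (x : X) (u v w : 'cV[R]_n).
Let mfd := kahler_mfd K.
Let nC := manifold_nice mfd.

(* second derivative of the coordinate change *)
Definition jacV i j x u v : 'cV[R]_n := \col_d \sum_c \sum_a jac2 i j x d c a * u c 0 * v a 0.

Lemma jacVDr i j x u v w : jacV i j x u (v + w) = jacV i j x u v + jacV i j x u w.
Proof.
apply/matrixP => d e; rewrite !mxE -big_split; apply: eq_bigr => c _.
by rewrite -big_split; apply: eq_bigr => a _; rewrite mxE mulrDr.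
Qed.

Lemma jacVZr i j x u r v : jacV i j x u (r *: v) = r *: jacV i j x u v.
Proof.
apply/matrixP => d e; rewrite !mxE mulr_sumr; apply: eq_bigr => c _.
by rewrite mulr_sumr; apply: eq_bigr => a _; rewrite mxE mulrCA.
Qed.

Lemma jacV_sym i j x u v : cdom i x -> cdom j x -> jacV i j x u v = jacV i j x v u.
Proof.
move=> ix jx; apply/matrixP => d e; rewrite !mxE exchange_big; apply: eq_bigr => a _.
by apply: eq_bigr => c _; rewrite (jac2C mfd d c a ix jx) mulrAC.
Qed.

Lemma jacV_delta i j x u a : jacV i j x u (delta_mx a 0) = (\matrix_(d, c) jac2 i j x d c a) *m u.
Proof.
apply/matrixP => d e; rewrite !mxE ord1; apply: eq_bigr => c _.
rewrite (bigD1 a) //= big1 ?addr0 ?mxE ?eqxx ?mulr1 // => b /negbTE ba.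
by rewrite mxE ba mulr0.
Qed.

Lemma jacVDl i j x u v w : cdom i x -> cdom j x -> jacV i j x (v + w) u = jacV i j x v u + jacV i j x w u.
Proof. by move=> ix jx; rewrite !(jacV_sym _ u) // jacVDr. Qed.

Lemma jacVZl i j x u r v : cdom i x -> cdom j x -> jacV i j x (r *: v) u = r *: jacV i j x v u.
Proof. by move=> ix jx; rewrite !(jacV_sym _ u) // jacVZr. Qed.

Lemma bf_jacS i j x p u v : bf (jacS i j x p) u v = dot p (jacV i j x u v).
Proof.
rewrite bfE dotE exchange_big /=.
under [RHS]eq_bigr do rewrite mxE mulr_sumr.
rewrite [RHS]exchange_big /= exchange_big /=; apply: eq_bigr => c _.
under [RHS]eq_bigr do rewrite mulr_sumr.
rewrite [RHS]exchange_big /=; apply: eq_bigr => a _.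
rewrite mxE mulr_sumr mulr_suml; apply: eq_bigr => d _; ring.
Qed.

Lemma jacf_diff i j x : cdom i x -> cdom j x ->
  diff_within (overlap i j) (jacf i j) (cmap i x) (fun a => \matrix_(d, c) jac2 i j x d c a).
Proof.
move=> ix jx; have cO := overlap_cornered nC (i := i) (j := j); apply/diff_within_mx => d c.
have -> : (fun a : 'I_n => (\matrix_(d, c) jac2 i j x d c a) d c) = (fun a => jac2 i j x d c a).
  by apply: funext => a; rewrite mxE.
apply: (Ck_diff (k := 0) cO); last exact: overlap_in.
by apply: Ck_ext (jac_smooth nC i j d c 1) => w _; rewrite mxE.
Qed.

Lemma overlap_diff (W : normedModType R) i j (h : X -> W) x G : cdom i x -> cdom j x ->
  diff_within (cimg j) (in_chart j h) (cmap j x) G ->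
  diff_within (overlap i j) (in_chart i h) (cmap i x) (fun a => \sum_b jac i j x b a *: G b).
Proof.
move=> ix jx D; apply: (diff_within_local ltr01 _ _ (chart_chain nC ix jx D)) => // w _ [y [iy _] <-].
by split => //; exact: cimg_in.
Qed.

Lemma overlap_uniq (W : normedModType R) i j (h : 'cV[R]_n -> W) x G G' : cdom i x -> cdom j x ->
  diff_within (overlap i j) h (cmap i x) G -> diff_within (cimg i) h (cmap i x) G' -> G' = G.
Proof.
move=> ix jx D D'; apply: (diff_within_uniq (overlap_cornered nC (i := i) (j := j)) (overlap_in ix jx) _ D).
by apply: (diff_within_local ltr01 _ _ D') => // w _ [y [iy _] <-]; split => //; exact: cimg_in.
Qed.

Lemma g_law_bf i j x u v : cdom i x -> cdom j x ->
  bf (g i x) u v = bf (g j x) (jac i j x *m u) (jac i j x *m v).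
Proof. by move=> ix jx; rewrite bf_mull bf_mulr (g_law K). Qed.

Lemma dg_law i j x u v w : cdom i x -> cdom j x ->
  bf (dT g i x v) u w = bf (g j x) (jacV i j x u v) (jac i j x *m w)
   + bf (dT g j x (jac i j x *m v)) (jac i j x *m u) (jac i j x *m w)
   + bf (g j x) (jac i j x *m u) (jacV i j x w v).
Proof.
move=> ix jx; set A := jac i j x.
apply/eqP; rewrite -subr_eq0; apply/eqP; move: v; apply: lin0 => [v v'|r v|a].
- by rewrite mulmxDr !dTD !jacVDr !bfDm !bfDl !bfDr; ring.
- by rewrite -scalemxAr !dTZ !jacVZr !bfZm !bfZl !bfZr; ring.
have D1 := jacf_diff ix jx.
have D2 := overlap_diff ix jx (tensor_diff K (g_smooth K) jx).
have D3 := diff_within_mulmx (diff_within_mulmx (diff_within_trmx D1) D2) D1.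
have Eq z : overlap i j z -> in_chart i (g i) z = (jacf i j z)^T *m in_chart i (g j) z *m jacf i j z.
  by move=> [y [iy jy] <-]; rewrite !(in_chartE nC _ iy) jacfE (g_law K).
have D4 := diff_within_eq (overlap_in ix jx) Eq D3.
have E := congr1 (fun G => G a) (overlap_uniq ix jx D4 (tensor_diff K (g_smooth K) ix)).
have Ej := in_chartE nC (g j) ix.
move: E => /=; rewrite Ej jacfE => E.
rewrite dT_delta E !jacV_delta.
have -> : dT g j x (A *m delta_mx a 0) = \sum_b jac i j x b a *: cpartial j (g j) b x.
  by rewrite -colE; apply: eq_bigr => b _; rewrite [col _ _ _ _]mxE.
move: (\matrix_(d, c) _) (\sum_b _ *: _) => J2 DG; rewrite -/A.
by rewrite bf_jac subrr.
Qed.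

(** Koszul's formula in both charts. The three derivatives of [g] contribute six second-derivative
    terms of the coordinate change; four cancel by symmetry and the remaining two are equal, which
    gives the single term [jacV]. *)
Lemma Gam_law i j x u v : cdom i x -> cdom j x ->
  jac i j x *m (Gam g i x v *m u) = Gam g j x (jac i j x *m v) *m (jac i j x *m u) + jacV i j x u v.
Proof.
move=> ix jx; set A := jac i j x.
have gP := kahler_posdef K jx; have AU : A \in unitmx := jac_unit nC ix jx.
have H w : bf (g j x) (A *m w) (A *m (Gam g i x v *m u)) =
    bf (g j x) (A *m w) (Gam g j x (A *m v) *m (A *m u) + jacV i j x u v).
  rewrite -g_law_bf //.
  have := Gam_key K u v w ix; have := Gam_key K (A *m u) (A *m v) (A *m w) jx.
  rewrite !(dg_law _ _ _ ix jx) -/A => H1 H2; rewrite bfDr.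
  have s1 := bf_sym (jacV i j x v u) (A *m w) gP; have s2 := bf_sym (jacV i j x u v) (A *m w) gP.
  have e1 := jacV_sym u v ix jx; have e2 := jacV_sym w u ix jx; have e3 := jacV_sym w v ix jx.
  rewrite e1 e2 e3 in H2 *; rewrite e1 in s2.
  have s3 := bf_sym (jacV i j x u w) (A *m v) gP; have s4 := bf_sym (A *m u) (jacV i j x v w) gP.
  by move: H1 H2 s1 s2 s3 s4; lra.
apply/eqP; rewrite -subr_eq0; apply/eqP; apply: (posdef_eq0 gP).
set d := _ - _; have -> : bf (g j x) d d = bf (g j x) (A *m (invmx A *m d)) d by rewrite mulKVmx.
by rewrite {2}/d bfDr bfNr H subrr.
Qed.

Variable f : X -> R.
Hypothesis sf : smooth_fun C f.

Definition d2 i x : 'M[R]_n := \matrix_(a, b) cpartial2 i f a b x.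

Lemma differential_law i j x : cdom i x -> cdom j x ->
  differential f i x = (jac i j x)^T *m differential f j x.
Proof.
move=> ix jx; apply/matrixP => a b; rewrite !mxE (cpartial_jac nC a ix jx sf).
by apply: eq_bigr => c _; rewrite !mxE.
Qed.

Lemma cpartial_diff i x a : cdom i x ->
  diff_within (cimg i) (in_chart i (cpartial i f a)) (cmap i x) (fun b => cpartial2 i f a b x).
Proof.
move=> ix; have H := Ck_diff (k := 0) (nice_cornered nC (i := i)) (Ck_partial a (sf i 2)) (cimg_in ix).
apply: (diff_within_local ltr01 _ _ H) => [w _ [y iy <-]|]; rewrite (in_chartE nC) //.
by split => //; exact: cimg_in.
Qed.

Lemma d2_law i j x u v : cdom i x -> cdom j x ->
  bf (d2 i x) u v = bf (d2 j x) (jac i j x *m u) (jac i j x *m v) + dot (differential f j x) (jacV i j x u v).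
Proof.
move=> ix jx; set A := jac i j x.
apply/eqP; rewrite -subr_eq0; apply/eqP; move: v; apply: lin0 => [v v'|r v|c].
- by rewrite mulmxDr jacVDr -!bf1 !bfDr; ring.
- by rewrite -scalemxAr jacVZr -!bf1 !bfZr; ring.
move: u; apply: lin0 => [v v'|r v|a].
- by rewrite mulmxDr jacVDl // -!bf1 !bfDr !bfDl; ring.
- by rewrite -scalemxAr jacVZl // -!bf1 !bfZr !bfZl; ring.
have D1 := jacf_diff ix jx.
have D2 : diff_within (overlap i j) (fun w => \sum_b jacf i j w b a * in_chart i (cpartial j f b) w) (cmap i x)
   (fun c => \sum_b (jac2 i j x b a c * cpartial j f b x + A b a * \sum_e A e c * cpartial2 j f b e x)).
  apply: diff_within_sum => b _.
  have H1 := (diff_within_mx _ _ _ _).1 D1 b a.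
  have H2 := overlap_diff ix jx (cpartial_diff b jx).
  have := diff_withinM H1 H2; rewrite (in_chartE nC) // jacfE.
  by congr diff_within; apply: funext => d; rewrite mxE.
have Eq z : overlap i j z -> in_chart i (cpartial i f a) z = \sum_b jacf i j z b a * in_chart i (cpartial j f b) z.
  move=> [y [iy jy] <-]; rewrite (in_chartE nC) // (cpartial_jac nC a iy jy sf); apply: eq_bigr => b _.
  by rewrite (in_chartE nC) // jacfE.
have D3 := diff_within_eq (overlap_in ix jx) Eq D2.
have E := congr1 (fun G => G c) (overlap_uniq ix jx D3 (cpartial_diff a ix)).
rewrite bf_delta mxE; move: E => /= ->.
rewrite big_split /= [X in X - _]addrC opprD addrACA -[RHS]addr0; congr (_ + _); last first.
  apply/eqP; rewrite subr_eq0 jacV_delta dotE; apply/eqP; apply: eq_bigr => b _.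
  by rewrite -colE !mxE mulrC.
apply/eqP; rewrite subr_eq0 -!colE bfE; apply/eqP; apply: eq_bigr => b _.
rewrite mulr_sumr; apply: eq_bigr => e _.
by rewrite [col a A b 0]mxE [col c A e 0]mxE [d2 j x b e]mxE; ring.
Qed.

Lemma d2_sym i x : cdom i x -> (d2 i x)^T = d2 i x.
Proof.
move=> ix; apply/matrixP => a b; rewrite !mxE.
exact: (schwarz _ _ (nice_cornered nC (i := i)) (sf i 2) (cimg_in ix)).
Qed.

Lemma hess_bf i x u v : bf (hessian g f i x) u v =
  bf (d2 i x) u v - dot (differential f i x) (Gam g i x v *m u).
Proof.
have E c : (Gam g i x v *m u) c 0 = \sum_a \sum_b christoffel g i x c a b * u a 0 * v b 0.
  rewrite mxE; apply: eq_bigr => a _; rewrite mxE mulr_suml; apply: eq_bigr => b _; ring.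
rewrite dotE; under [X in _ - X]eq_bigr do rewrite E mulr_sumr.
rewrite exchange_big /= !bfE -sumrB; apply: eq_bigr => a _.
under [X in _ - X]eq_bigr do rewrite mulr_sumr.
rewrite exchange_big /= -sumrB; apply: eq_bigr => b _.
rewrite [hessian _ _ _ _ _ _]mxE [d2 i x a b]mxE mulrBr mulrBl; congr (_ - _).
rewrite mulr_sumr mulr_suml; apply: eq_bigr => c _.
rewrite [differential _ _ _ _ _]mxE; ring.
Qed.

Lemma hess_sym i x : cdom i x -> (hessian g f i x)^T = hessian g f i x.
Proof.
move=> ix; apply: bf_inj => u v; rewrite -bf_tr !hess_bf (bf_tr (d2 i x)) d2_sym //.
by rewrite (Gam_sym K).
Qed.

(** The second derivatives of the coordinate change in [d2_law] and in [Gam_law] are both paired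
    with the differential and cancel. *)
Lemma hess_law i j x u v : cdom i x -> cdom j x ->
  bf (hessian g f i x) u v = bf (hessian g f j x) (jac i j x *m u) (jac i j x *m v).
Proof.
move=> ix jx; rewrite !hess_bf (d2_law _ _ ix jx) (differential_law ix jx).
have -> : dot ((jac i j x)^T *m differential f j x) (Gam g i x v *m u) =
   dot (differential f j x) (jac i j x *m (Gam g i x v *m u)).
  by exact: dot_tr.
by rewrite (Gam_law _ _ ix jx) -!bf1 bfDr; ring.
Qed.

(* Connection matrix of the horizontal distribution that is tangent to the graph of [tau df]:
   a tangent vector [(a, b)] of the cotangent bundle has vertical part [b - Nmx a]. *)
Definition Nmx (tau : R) i x (p : 'cV[R]_n) : 'M[R]_n :=
  (\matrix_(a, b) \sum_c p c 0 * christoffel g i x c a b) + tau *: hessian g f i x.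

Lemma bf_Nmx tau i x p u v :
  bf (Nmx tau i x p) u v = dot p (Gam g i x v *m u) + tau * bf (hessian g f i x) u v.
Proof.
rewrite bfDm bfZm; congr (_ + _).
have E c : (Gam g i x v *m u) c 0 = \sum_a \sum_b christoffel g i x c a b * u a 0 * v b 0.
  rewrite mxE; apply: eq_bigr => a _; rewrite mxE mulr_suml; apply: eq_bigr => b _; ring.
rewrite dotE; under [RHS]eq_bigr do rewrite E mulr_sumr.
rewrite exchange_big /= bfE; apply: eq_bigr => a _.
under [RHS]eq_bigr do rewrite mulr_sumr.
rewrite [RHS]exchange_big /=; apply: eq_bigr => b _.
rewrite mxE mulr_sumr mulr_suml; apply: eq_bigr => c _; ring.
Qed.

Lemma Nmx_sym tau i x p : cdom i x -> (Nmx tau i x p)^T = Nmx tau i x p.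
Proof.
move=> ix; apply: bf_inj => u v; rewrite -bf_tr !bf_Nmx (bf_tr (hessian _ _ _ _)) hess_sym //.
by rewrite (Gam_sym K).
Qed.

(** The inhomogeneous part comes from the Christoffel symbols alone, since the Hessian is a tensor,
    and it is exactly the [jacS] of the cotangent Jacobian. Hence the horizontal distribution does
    not depend on the chart. *)
Lemma Nmx_law tau i j x (p : 'cV[R]_n) : cdom i x -> cdom j x ->
  Nmx tau i x ((jac i j x)^T *m p) = (jac i j x)^T *m Nmx tau j x p *m jac i j x + jacS i j x p.
Proof.
move=> ix jx; apply: bf_inj => u v.
rewrite [RHS]bfDm [X in _ = X + _]bf_conj !bf_Nmx bf_jacS (hess_law _ _ ix jx).
have -> : dot ((jac i j x)^T *m p) (Gam g i x v *m u) = dot p (jac i j x *m (Gam g i x v *m u)).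
  by exact: dot_tr.
by rewrite (Gam_law _ _ ix jx) -!bf1 bfDr; ring.
Qed.

End Transformation.

(** * The almost quaternionic structure *)

Section ChartSmooth.
Context {R : realType} {n : nat} {X : topologicalType} (C : charted R n X) (g I : tensor C).
Hypothesis K : kahler_manifold g I.
Variable f : X -> R.
Hypothesis sf : smooth_fun C f.
Variable i : cidx C.
Let mfd := kahler_mfd K.
Let nC := manifold_nice mfd.

(** For component functions, such as the Christoffel symbols of the chart [i], which have no meaning
    away from it. *)
Definition csm (phi : X -> R) : Prop := smooth (cimg i) (in_chart i phi).

Let cA : cornered (cimg i) := nice_cornered nC (i := i).

Lemma csm_ext phi phi' : (forall x, cdom i x -> phi x = phi' x) -> csm phi -> csm phi'.
Proof.
by move=> E H k; apply: Ck_ext (H k) => z [x ix <-]; rewrite !(in_chartE nC) // E.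
Qed.

Lemma csm_cst c : csm (fun=> c).
Proof. by move=> k; apply: Ck_ext (Ck_cst cA k c) => z [x ix <-]; rewrite (in_chartE nC). Qed.

Lemma csm_add phi psi : csm phi -> csm psi -> csm (fun x => phi x + psi x).
Proof. by move=> H H' k; apply: Ck_ext (CkD cA (H k) (H' k)) => z [x ix <-]; rewrite !(in_chartE nC). Qed.

Lemma csm_mul phi psi : csm phi -> csm psi -> csm (fun x => phi x * psi x).
Proof. by move=> H H' k; apply: Ck_ext (CkM cA (H k) (H' k)) => z [x ix <-]; rewrite !(in_chartE nC). Qed.

Lemma csm_opp phi : csm phi -> csm (fun x => - phi x).
Proof. by move=> H k; apply: Ck_ext (CkN cA (H k)) => z [x ix <-]; rewrite !(in_chartE nC). Qed.

Lemma csm_sum (J : finType) (F : J -> X -> R) : (forall j, csm (F j)) -> csm (fun x => \sum_j F j x).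
Proof.
move=> H k; apply: Ck_ext (@Ck_sum _ _ _ cA k _ J (index_enum J) xpredT _ (fun j _ => H j k)) => z [x ix <-].
by rewrite (in_chartE nC) //; apply: eq_bigr => j _; rewrite (in_chartE nC).
Qed.

Lemma csm_tensor (T : tensor C) a b : smooth_tensor T -> csm (fun x => T i x a b).
Proof.
move=> sT k; have := (Ck_mx _ _ cA).1 (sT i k) a b.
by apply: Ck_ext => z [x ix <-]; rewrite !(in_chartE nC).
Qed.

Lemma csm_dtensor (T : tensor C) c a b : smooth_tensor T -> csm (fun x => cpartial i (T i) c x a b).
Proof.
move=> sT k; have := (Ck_mx _ _ cA).1 (Ck_partial c (sT i k.+1)) a b.
by apply: Ck_ext => z [x ix <-]; rewrite !(in_chartE nC).
Qed.

Lemma csm_inv a b : csm (fun x => invmx (g i x) a b).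
Proof.
move=> k; have := @Ck_invmx _ _ _ cA k _ (in_chart i (g i)) _ _ a b.
move=> H; have {}H := H _ _; apply: Ck_ext (H _ _) => [z [x ix <-]|w [x ix <-]|c d].
- by rewrite !(in_chartE nC).
- by rewrite (in_chartE nC) //; exact: posdef_unit (kahler_posdef K ix).
- exact: ((Ck_mx _ _ cA).1 (g_smooth K i k) c d).
Qed.

Lemma csm_christoffel c a b : csm (fun x => christoffel g i x c a b).
Proof.
apply: csm_mul; first exact: csm_cst.
apply: csm_sum => d; apply: csm_mul; first exact: csm_inv.
have sg := g_smooth K.
by apply: csm_add; [apply: csm_add|apply: csm_opp]; exact: csm_dtensor.
Qed.

Lemma csm_df a : csm (fun x => cpartial i f a x).
Proof.
move=> k; apply: Ck_ext (Ck_partial a (sf i k.+1)) => z [x ix <-].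
by rewrite (in_chartE nC).
Qed.

Lemma csm_d2f a b : csm (fun x => cpartial2 i f a b x).
Proof.
move=> k; apply: Ck_ext (Ck_partial b (Ck_partial a (sf i k.+2))) => z [x ix <-].
by rewrite (in_chartE nC).
Qed.

Lemma csm_hess a b : csm (fun x => hessian g f i x a b).
Proof.
apply: (@csm_ext (fun x => cpartial2 i f a b x - \sum_c christoffel g i x c a b * cpartial i f c x)).
  by move=> x _; rewrite mxE.
apply: csm_add; first exact: csm_d2f.
by apply: csm_opp; apply: csm_sum => c; apply: csm_mul; [exact: csm_christoffel|exact: csm_df].
Qed.

End ChartSmooth.

Section Structure.
Context {R : realType} {n : nat} {X : topologicalType} (C : charted R n X) (g I : tensor C).
Hypothesis K : kahler_manifold g I.
Variable f : X -> R.
Hypothesis sf : smooth_fun C f.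
Implicit Types (i j : cidx C) (x : X) (y : cotangent C).
Let mfd := kahler_mfd K.
Let nC := manifold_nice mfd.
Let MC := cotangent_charts C.
Let nM := cotangent_nice mfd.

(** [FM] sends a coordinate vector [(a, b)] to its horizontal and vertical parts [(a, b - N a)], and
    [FMi] is its inverse. After conjugation by it the structures become [DI] and [DJ], which depend
    on the base point only; all dependence on [tau] sits in [FM]. *)
Definition FM (tau : R) i y : 'M[R]_(n + n) :=
  block_mx 1%:M 0 (- Nmx g f tau i (ct_pt y) (ct_cov y i)) 1%:M.
Definition FMi (tau : R) i y : 'M[R]_(n + n) :=
  block_mx 1%:M 0 (Nmx g f tau i (ct_pt y) (ct_cov y i)) 1%:M.
Definition DI i x : 'M[R]_(n + n) := block_mx (I i x) 0 0 (I i x)^T.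
Definition DJ i x : 'M[R]_(n + n) := block_mx 0 (- invmx (g i x)) (g i x) 0.
Definition It (tau : R) : tensor MC := fun i y => FMi tau i y *m DI i (ct_pt y) *m FM tau i y.
Definition Jt (tau : R) : tensor MC := fun i y => FMi tau i y *m DJ i (ct_pt y) *m FM tau i y.
Definition Kt (tau : R) : tensor MC := fun i y => It tau i y *m Jt tau i y.
Definition diagA (A : 'M[R]_n) : 'M[R]_(n + n) := block_mx A 0 0 (invmx A)^T.

Lemma FM_K tau i y : FM tau i y *m FMi tau i y = 1%:M.
Proof.
rewrite /FM /FMi mulmx_block !mulmx1 !mul1mx !mul0mx !mulmx0 !addr0 addNr add0r.
by rewrite -scalar_mx_block.
Qed.

Lemma FMi_K tau i y : FMi tau i y *m FM tau i y = 1%:M.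
Proof. exact: mulmx1C (FM_K tau i y). Qed.

(** In the split frames the cotangent Jacobian is block diagonal: its lower-left block is cancelled
    by the inhomogeneous term of [Nmx_law]. Tensoriality of the three structures is thereby reduced
    to that of [I] and [g]. *)
Lemma FM_law tau i j y : cdom i (ct_pt y) -> cdom j (ct_pt y) ->
  FM tau j y *m jac (C := MC) i j y = diagA (jac i j (ct_pt y)) *m FM tau i y.
Proof.
move=> iy jy; have [B -> BE] := jacM_block mfd iy jy.
set A := jac i j (ct_pt y) in BE *; have AU : A \in unitmx by exact: (jac_unit nC).
have AtU : A^T \in unitmx by rewrite unitmx_tr.
rewrite /FM /diagA !mulmx_block !mulmx1 !mul1mx !mul0mx !mulmx0 !addr0 !add0r.
congr block_mx.
have NE := Nmx_law K sf tau (ct_cov y j) iy jy; rewrite -(ct_law iy jy) in NE.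
move: (Nmx g f tau i _ _) (Nmx g f tau j _ _) NE => Ni Nj ->.
rewrite mulNmx mulmxN mulmxDr -/A trmx_inv -[A^T *m _ *m A]mulmxA mulKmx // opprD; congr (_ + _).
have -> : B = invmx A^T *m (A^T *m B) by rewrite mulKmx.
by rewrite (eqP (_ : A^T *m B == - jacS i j (ct_pt y) (ct_cov y j))) ?mulmxN // -addr_eq0 BE.
Qed.

Lemma FMi_law tau i j y : cdom i (ct_pt y) -> cdom j (ct_pt y) ->
  jac (C := MC) i j y *m FMi tau i y = FMi tau j y *m diagA (jac i j (ct_pt y)).
Proof.
move=> iy jy; have E := FM_law tau iy jy.
rewrite -[LHS]mul1mx -(FMi_K tau j y) -!mulmxA; congr (_ *m _).
by rewrite [LHS]mulmxA E -mulmxA FM_K mulmx1.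
Qed.

Lemma conj_law (D : cidx C -> X -> 'M[R]_(n + n)) tau :
  (forall i j x, cdom i x -> cdom j x -> D j x *m diagA (jac i j x) = diagA (jac i j x) *m D i x) ->
  endo_law (C := MC) (fun i y => FMi tau i y *m D i (ct_pt y) *m FM tau i y).
Proof.
move=> H i j y iy jy; rewrite -[LHS]mulmxA (FM_law _ iy jy) -mulmxA [D j _ *m _]mulmxA (H i j) //.
by rewrite -[in RHS]mulmxA [RHS]mulmxA (FMi_law _ iy jy) -!mulmxA.
Qed.

Lemma DI_law i j x : cdom i x -> cdom j x -> DI j x *m diagA (jac i j x) = diagA (jac i j x) *m DI i x.
Proof.
move=> ix jx; rewrite /DI /diagA !mulmx_block !mulmx0 !mul0mx !addr0 !add0r (I_law K) //.
have AU : jac i j x \in unitmx := jac_unit nC ix jx.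
congr block_mx; rewrite -!trmx_mul; congr trmx.
have -> : I j x = jac i j x *m I i x *m invmx (jac i j x) by rewrite -(I_law K) // mulmxK.
by rewrite !mulmxA mulVmx // mul1mx.
Qed.

Lemma g_lawV i j x : cdom i x -> cdom j x ->
  invmx (g j x) *m (invmx (jac i j x))^T = jac i j x *m invmx (g i x).
Proof.
move=> ix jx; have AU : jac i j x \in unitmx := jac_unit nC ix jx.
have AtU : (jac i j x)^T \in unitmx by rewrite unitmx_tr.
have gU := posdef_unit (kahler_posdef K jx); have gU' := posdef_unit (kahler_posdef K ix).
have E := g_law K ix jx.
rewrite -[LHS]mulmx1 -(mulmxV gU') mulmxA; congr (_ *m _).
by rewrite -E !mulmxA trmx_inv mulmxKV // mulVmx // mul1mx.
Qed.

Lemma g_lawA i j x : cdom i x -> cdom j x -> g j x *m jac i j x = (invmx (jac i j x))^T *m g i x.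
Proof.
move=> ix jx; have AU : jac i j x \in unitmx := jac_unit nC ix jx.
have AtU : (jac i j x)^T \in unitmx by rewrite unitmx_tr.
by rewrite -(g_law K ix jx) trmx_inv -[_ *m g j x *m _]mulmxA mulKmx.
Qed.

Lemma DJ_law i j x : cdom i x -> cdom j x -> DJ j x *m diagA (jac i j x) = diagA (jac i j x) *m DJ i x.
Proof.
move=> ix jx; rewrite /DJ /diagA !mulmx_block !mulmx0 !mul0mx !addr0 !add0r g_lawA //.
by rewrite mulNmx mulmxN g_lawV.
Qed.

Lemma It_law tau : endo_law (It tau).
Proof. by apply: conj_law; exact: DI_law. Qed.

Lemma Jt_law tau : endo_law (Jt tau).
Proof. by apply: conj_law; exact: DJ_law. Qed.

Lemma Kt_law tau : endo_law (Kt tau).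
Proof.
move=> i j y iy jy; have E := Jt_law tau iy jy; have E' := It_law tau iy jy.
change ((It tau j y *m Jt tau j y) *m jac (C := MC) i j y = jac (C := MC) i j y *m (It tau i y *m Jt tau i y)).
move: (It tau i y) (It tau j y) (Jt tau i y) (Jt tau j y) E E' => A A' B B' E E'.
by rewrite -mulmxA E mulmxA E' mulmxA.
Qed.

Lemma DI_sqr i x : cdom i x -> DI i x *m DI i x = - 1%:M.
Proof.
move=> ix; rewrite /DI mulmx_block !mulmx0 !mul0mx !addr0 !add0r -trmx_mul (I_sqr K) //.
by rewrite linearN /= trmx1 scalar_mx_block opp_block_mx !oppr0.
Qed.

Lemma DJ_sqr i x : cdom i x -> DJ i x *m DJ i x = - 1%:M.
Proof.
move=> ix; have gU := posdef_unit (kahler_posdef K ix).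
rewrite /DJ mulmx_block !mulmx0 !mul0mx !addr0 !add0r mulNmx mulmxN mulVmx // mulmxV //.
by rewrite scalar_mx_block opp_block_mx !oppr0.
Qed.

Lemma I_invg i x : cdom i x -> I i x *m invmx (g i x) = - (invmx (g i x) *m (I i x)^T).
Proof.
move=> ix; have gU := posdef_unit (kahler_posdef K ix).
have E := Ig_skew K ix.
have -> : (I i x)^T = - (g i x *m I i x) *m invmx (g i x) by rewrite -E mulmxK.
by rewrite mulNmx mulmxN opprK !mulmxA mulVmx // mul1mx.
Qed.

(** The two structures anticommute because [I] is skew for [g]; this is what makes the product [K]
    square to minus the identity. *)
Lemma DIJ i x : cdom i x -> DI i x *m DJ i x = - (DJ i x *m DI i x).
Proof.
move=> ix; rewrite /DI /DJ !mulmx_block !mulmx0 !mul0mx !addr0 !add0r (Ig_skew K) //.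
by rewrite opp_block_mx !oppr0 mulmxN I_invg // mulNmx !opprK.
Qed.

Lemma conj_mul (D D' : 'M[R]_(n + n)) tau i y :
  (FMi tau i y *m D *m FM tau i y) *m (FMi tau i y *m D' *m FM tau i y) = FMi tau i y *m (D *m D') *m FM tau i y.
Proof. by rewrite !mulmxA -[_ *m FM tau i y *m FMi tau i y]mulmxA FM_K mulmx1. Qed.

Lemma conj_N1 tau i y : FMi tau i y *m (- 1%:M) *m FM tau i y = - 1%:M.
Proof. by rewrite mulmxN mulmx1 mulNmx FMi_K. Qed.

Lemma It_sqr tau i y : cdom i (ct_pt y) -> It tau i y *m It tau i y = - 1%:M.
Proof. by move=> iy; rewrite /It conj_mul DI_sqr // conj_N1. Qed.

Lemma Jt_sqr tau i y : cdom i (ct_pt y) -> Jt tau i y *m Jt tau i y = - 1%:M.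
Proof. by move=> iy; rewrite /Jt conj_mul DJ_sqr // conj_N1. Qed.

Lemma Kt_sqr tau i y : cdom i (ct_pt y) -> Kt tau i y *m Kt tau i y = - 1%:M.
Proof.
move=> iy; rewrite /Kt /It /Jt !conj_mul.
have -> : DI i (ct_pt y) *m DJ i (ct_pt y) *m (DI i (ct_pt y) *m DJ i (ct_pt y)) = - 1%:M.
  rewrite {2}DIJ // mulmxN mulmxA -[_ *m DJ _ _ *m DJ _ _]mulmxA DJ_sqr // mulmxN mulmx1 mulNmx opprK.
  exact: DI_sqr.
exact: conj_N1.
Qed.

(* Dependence of chart expressions on parameters: [u] runs in the image of the chart [i] of
   the cotangent bundle and [tau] in the parameter interval. *)
Section ParametricCharts.
Variables (d : nat) (B : set 'cV[R]_d) (tau : 'cV[R]_d -> R) (u : 'cV[R]_d -> 'cV[R]_(n + n)) (i : cidx C) (k : nat).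
Hypotheses (cB : cornered B) (Ctau : Ck k B tau) (Cu : Ck k B u) (Bu : forall w, B w -> cimg (C := MC) i (u w)).

Definition csmM (M : R -> cotangent C -> R) : Prop :=
  Ck k B (fun w => in_chart (C := MC) i (M (tau w)) (u w)).

Lemma in_chartM (W : normedModType R) (M : cotangent C -> W) y : cdom i (ct_pt y) ->
  in_chart (C := MC) i M (cmap (c := MC) i y) = M y.
Proof. by move=> iy; rewrite (in_chartE nM). Qed.

Lemma csmM_P (M : R -> cotangent C -> R) (F : 'cV[R]_d -> R) :
  (forall w y, B w -> cdom i (ct_pt y) -> u w = cmap (c := MC) i y -> F w = M (tau w) y) ->
  Ck k B F -> csmM M.
Proof.
move=> E; apply: Ck_ext => w Bw; have [y iy yu] := Bu Bw.
by rewrite -yu in_chartM // (E w y).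
Qed.

Lemma csmM_E (M : R -> cotangent C -> R) w y : cdom i (ct_pt y) -> u w = cmap (c := MC) i y ->
  in_chart (C := MC) i (M (tau w)) (u w) = M (tau w) y.
Proof. by move=> iy ->; rewrite in_chartM. Qed.

Lemma csmM_ext M M' : (forall t y, cdom i (ct_pt y) -> M t y = M' t y) -> csmM M -> csmM M'.
Proof. by move=> E H; apply: (csmM_P _ H) => w y Bw iy uy; rewrite (csmM_E _ iy uy) E. Qed.

Lemma csmM_base phi : csm i phi -> csmM (fun _ y => phi (ct_pt y)).
Proof.
move=> H; apply: (csmM_P (F := fun w => in_chart (C := C) i phi (usubmx (u w)))).
  by move=> w y Bw iy ->; rewrite /= col_mxKu (in_chartE nC).
apply: (Ck_comp (nice_cornered nC (i := i)) cB _ (H k)) => [w Bw|].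
  by apply/(cimgM mfd); exact: Bu.
apply/(Ck_mx _ _ cB) => a b; rewrite ord1.
by have := (Ck_mx _ _ cB).1 Cu (lshift n a) 0; apply: Ck_ext => w _; rewrite mxE.
Qed.

Lemma csmM_cov a : csmM (fun _ y => ct_cov y i a 0).
Proof.
apply: (csmM_P (F := fun w => u w (rshift n a) 0)).
  by move=> w y Bw iy ->; rewrite /= col_mxEd.
exact: ((Ck_mx _ _ cB).1 Cu (rshift n a) 0).
Qed.

Lemma csmM_tau : csmM (fun t _ => t).
Proof. exact: csmM_P Ctau. Qed.

Lemma csmM_cst c : csmM (fun _ _ => c).
Proof. by apply: (csmM_P _ (Ck_cst cB k c)). Qed.

Lemma csmM_add M M' : csmM M -> csmM M' -> csmM (fun t y => M t y + M' t y).
Proof.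
by move=> H H'; apply: (csmM_P _ (CkD cB H H')) => w y Bw iy uy; rewrite !(csmM_E _ iy uy).
Qed.

Lemma csmM_mul M M' : csmM M -> csmM M' -> csmM (fun t y => M t y * M' t y).
Proof.
by move=> H H'; apply: (csmM_P _ (CkM cB H H')) => w y Bw iy uy; rewrite !(csmM_E _ iy uy).
Qed.

Lemma csmM_opp M : csmM M -> csmM (fun t y => - M t y).
Proof.
by move=> H; apply: (csmM_P _ (CkN cB H)) => w y Bw iy uy; rewrite !(csmM_E _ iy uy).
Qed.

Lemma csmM_sum (J : finType) (F : J -> R -> cotangent C -> R) : (forall a, csmM (F a)) ->
  csmM (fun t y => \sum_a F a t y).
Proof.
move=> H; apply: (csmM_P _ (@Ck_sum _ _ _ cB k _ J (index_enum J) xpredT _ (fun a _ => H a))) => w y Bw iy uy.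
by apply: eq_bigr => a _; rewrite (csmM_E _ iy uy).
Qed.

Lemma csmM_mulmx l m p (M : R -> cotangent C -> 'M[R]_(l, m)) (M' : R -> cotangent C -> 'M[R]_(m, p)) :
  (forall a b, csmM (fun t y => M t y a b)) -> (forall a b, csmM (fun t y => M' t y a b)) ->
  forall a b, csmM (fun t y => (M t y *m M' t y) a b).
Proof.
move=> H H' a b; apply: (@csmM_ext (fun t y => \sum_c M t y a c * M' t y c b)).
  by move=> t y _; rewrite mxE.
by apply: csmM_sum => c; exact: csmM_mul.
Qed.

Lemma csmM_block (M1 M2 M3 M4 : R -> cotangent C -> 'M[R]_n) :
  (forall a b, csmM (fun t y => M1 t y a b)) -> (forall a b, csmM (fun t y => M2 t y a b)) ->
  (forall a b, csmM (fun t y => M3 t y a b)) -> (forall a b, csmM (fun t y => M4 t y a b)) ->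
  forall a b, csmM (fun t y => block_mx (M1 t y) (M2 t y) (M3 t y) (M4 t y) a b).
Proof.
move=> H1 H2 H3 H4 a b; rewrite -[a]splitK -[b]splitK.
case: (fintype.split a) => {}a; case: (fintype.split b) => {}b /=.
- by apply: csmM_ext (H1 a b) => t y _; rewrite block_mxEul.
- by apply: csmM_ext (H2 a b) => t y _; rewrite block_mxEur.
- by apply: csmM_ext (H3 a b) => t y _; rewrite block_mxEdl.
- by apply: csmM_ext (H4 a b) => t y _; rewrite block_mxEdr.
Qed.

Lemma csmM_Nmx a b : csmM (fun t y => Nmx g f t i (ct_pt y) (ct_cov y i) a b).
Proof.
apply: (@csmM_ext (fun t y => \sum_c ct_cov y i c 0 * christoffel g i (ct_pt y) c a b + t * hessian g f i (ct_pt y) a b)).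
  by move=> t y _; rewrite /Nmx [RHS]mxE [X in _ = X + _]mxE [X in _ = _ + X]mxE.
apply: csmM_add.
  apply: csmM_sum => c; apply: csmM_mul; first exact: csmM_cov.
  by apply: (csmM_base (phi := fun x => christoffel g i x c a b)); exact: (csm_christoffel K).
by apply: csmM_mul; [exact: csmM_tau|apply: (csmM_base (phi := fun x => hessian g f i x a b)); exact: (csm_hess K sf)].
Qed.

Lemma csmM_1 a b : csmM (fun _ _ => (1%:M : 'M[R]_n) a b).
Proof. exact: csmM_cst. Qed.

Lemma csmM_0 a b : csmM (fun _ _ => (0 : 'M[R]_n) a b).
Proof. exact: csmM_cst. Qed.

Lemma csmM_FM a b : csmM (fun t y => FM t i y a b).
Proof.
apply: csmM_block => {}a {}b; [exact: csmM_1|exact: csmM_0| |exact: csmM_1].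
apply: (@csmM_ext (fun t y => - Nmx g f t i (ct_pt y) (ct_cov y i) a b)) => [t y _|]; first by rewrite [RHS]mxE.
by apply: csmM_opp; exact: csmM_Nmx.
Qed.

Lemma csmM_FMi a b : csmM (fun t y => FMi t i y a b).
Proof. by apply: csmM_block => {}a {}b; [exact: csmM_1|exact: csmM_0|exact: csmM_Nmx|exact: csmM_1]. Qed.

Lemma csmM_It a b : csmM (fun t y => It t i y a b).
Proof.
apply: csmM_mulmx => {}a {}b; last exact: csmM_FM.
apply: csmM_mulmx => {}a {}b; first exact: csmM_FMi.
apply: csmM_block => {}a {}b; [|exact: csmM_0|exact: csmM_0|].
  by apply: (csmM_base (phi := fun x => I i x a b)); apply: (csm_tensor K); exact: (I_smooth K).
apply: (@csmM_ext (fun t y => I i (ct_pt y) b a)) => [t y _|]; first by rewrite [RHS]mxE.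
by apply: (csmM_base (phi := fun x => I i x b a)); apply: (csm_tensor K); exact: (I_smooth K).
Qed.

Lemma csmM_invg a b : csmM (fun t y => invmx (g i (ct_pt y)) a b).
Proof. by apply: (csmM_base (phi := fun x => invmx (g i x) a b)); exact: (csm_inv K). Qed.

Lemma csmM_g a b : csmM (fun t y => g i (ct_pt y) a b).
Proof. by apply: (csmM_base (phi := fun x => g i x a b)); apply: (csm_tensor K); exact: (g_smooth K). Qed.

Lemma csmM_Jt a b : csmM (fun t y => Jt t i y a b).
Proof.
apply: csmM_mulmx => {}a {}b; last exact: csmM_FM.
apply: csmM_mulmx => {}a {}b; first exact: csmM_FMi.
apply: csmM_block => {}a {}b; [exact: csmM_0| |exact: csmM_g|exact: csmM_0].
apply: (@csmM_ext (fun t y => - invmx (g i (ct_pt y)) a b)) => [t y _|]; first by rewrite [RHS]mxE.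
by apply: csmM_opp; exact: csmM_invg.
Qed.

Lemma csmM_Kt a b : csmM (fun t y => Kt t i y a b).
Proof. by apply: csmM_mulmx => {}a {}b; [exact: csmM_It|exact: csmM_Jt]. Qed.

End ParametricCharts.

Lemma family_smooth (T : R -> tensor MC) :
  (forall d (B : set 'cV[R]_d) tau u i k, cornered B -> Ck k B tau -> Ck k B u ->
     (forall w, B w -> cimg (C := MC) i (u w)) -> forall a b, csmM B tau u i k (fun t y => T t i y a b)) ->
  smooth_family T.
Proof.
move=> H i k; set S := [set _ | _].
have cS : cornered S.
  apply: (@cornered_prod _ 1 (n + n) [set t : 'cV[R]_1 | unit_itv (t 0 0)]); first exact: cornered_strip.
  exact: (cimgM_cornered mfd).
apply/(Ck_mx _ _ cS) => a b.
have := H _ S (fun z => usubmx z 0 0) (fun z => dsubmx z) i k cS _ _ _ a b.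
move=> {}H; apply: Ck_ext (H _ _ _).
- move=> z [_ [y iy yz]]; rewrite -yz !(in_chartE nM) //.
- by apply: Ck_ext (Ck_coord cS k (lshift (n + n) 0)) => z _; rewrite mxE.
- apply/(Ck_mx _ _ cS) => c e; rewrite ord1.
  by apply: Ck_ext (Ck_coord cS k (rshift 1 c)) => z _; rewrite mxE.
- by move=> w [].
Qed.

Lemma structure_quaternionic : almost_quaternionic_family It Jt Kt.
Proof.
split => //; split; try (apply: family_smooth => *; first [exact: csmM_It|exact: csmM_Jt|exact: csmM_Kt]).
- by move=> tau _; split; [exact: It_law|move=> i y iy; exact: It_sqr].
- by move=> tau _; split; [exact: Jt_law|move=> i y iy; exact: Jt_sqr].
- by move=> tau _; split; [exact: Kt_law|move=> i y iy; exact: Kt_sqr].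
Qed.

(* a metric on the cotangent bundle that restricts to [g] on the zero section *)
Definition GM : tensor MC := fun i y =>
  (FM 0 i y)^T *m block_mx (g i (ct_pt y)) 0 0 (invmx (g i (ct_pt y))) *m FM 0 i y.

Lemma GM_bf i y (v : 'cV[R]_(n + n)) : bf (GM i y) v v =
  bf (g i (ct_pt y)) (usubmx (FM 0 i y *m v)) (usubmx (FM 0 i y *m v))
  + bf (invmx (g i (ct_pt y))) (dsubmx (FM 0 i y *m v)) (dsubmx (FM 0 i y *m v)).
Proof.
rewrite /GM bf_conj; set w := _ *m v; rewrite -{1 2}[w]vsubmxK /bf tr_col_mx mul_row_block !mulmx0 addr0 add0r.
by rewrite mul_row_col mxE.
Qed.

(** The integrability of [d_s U] in a Fueter strip is quantified over the metrics on the cotangent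
    bundle. Instantiated with this one at [tau = 0], it becomes integrability for [g] on the
    base. *)
Lemma GM_riemannian : riemannian GM.
Proof.
split.
- move=> i j y iy jy.
  have E := FM_law 0 iy jy.
  have AU : jac (C := C) i j (ct_pt y) \in unitmx := jac_unit nC iy jy.
  have G1 := g_lawA (i := i) (j := j) iy jy; have G2 := g_lawV (i := i) (j := j) iy jy.
  have G0 := g_law K (i := i) (j := j) iy jy.
  rewrite /GM; move: E G0 G1 G2 AU; rewrite /diagA.
  move: (jac (C := MC) i j y) (FM 0 j y) (FM 0 i y) (g i (ct_pt y)) (g j (ct_pt y)) (jac (C := C) i j (ct_pt y)).
  move=> JM Fj Fi gi gj A E G0 G1 G2 AU.
  have -> D : JM^T *m (Fj^T *m D *m Fj) *m JM = (Fj *m JM)^T *m D *m (Fj *m JM) by rewrite trmx_mul !mulmxA.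
  rewrite E trmx_mul -!mulmxA; congr (_ *m _).
  rewrite !mulmxA; congr (_ *m _).
  rewrite tr_block_mx !trmx0 trmxK !mulmx_block !mulmx0 !mul0mx !addr0 !add0r G0.
  by rewrite !mul0mx -mulmxA G2 mulmxA mulVmx // mul1mx.
- move=> i k.
  have cA := cimgM_cornered mfd (i := i).
  apply/(Ck_mx _ _ cA) => a b.
  have CM : csmM (cimg (C := MC) i) (fun=> 0) id i k (fun t y => ((FM t i y)^T *m block_mx (g i (ct_pt y)) 0 0 (invmx (g i (ct_pt y))) *m FM t i y) a b).
    have C0 : Ck k (cimg (C := MC) i) (fun=> 0 : R) by exact: Ck_cst.
    have Ci : Ck k (cimg (C := MC) i) (@id 'cV[R]_(n + n)).
      by apply/(Ck_mx _ _ cA) => c e; rewrite ord1; exact: Ck_coord.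
    apply: csmM_mulmx => // {}a {}b; last exact: csmM_FM.
    apply: csmM_mulmx => // {}a {}b.
      have H := csmM_FM cA C0 Ci (fun w Bw => Bw) b a.
      by apply: csmM_ext H => // t y _; rewrite [RHS]mxE.
    by apply: csmM_block => // {}a {}b; [exact: csmM_g|exact: csmM_0|exact: csmM_0|exact: csmM_invg].
  by apply: Ck_ext CM => z [y iy <-]; rewrite !(in_chartE nM).
- move=> i y iy; have gP := kahler_posdef K iy; split.
    rewrite /GM; move: (FM 0 i y) => Fi.
    rewrite !trmx_mul trmxK tr_block_mx !trmx0 gP.1 (posdef_inv_tr gP) mulmxA //.
  move=> v v0; rewrite -[X in 0 < X]/(bf (GM i y) v v) GM_bf.
  set w := FM 0 i y *m v.
  have w0 : w != 0.
    apply: contraNneq v0 => E; rewrite -[v]mul1mx -(FMi_K 0 i y) -mulmxA -/w E mulmx0 //.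
  have [u0|u0] := eqVneq (usubmx w) 0; last first.
    by apply: ltr_wpDr; [exact: posdef_ge0 (posdef_inv gP)|exact: gP.2].
  have d0 : dsubmx w != 0.
    by apply: contraNneq w0 => d0; rewrite -[w]vsubmxK u0 d0 col_mx0.
  by apply: ltr_wpDl; [exact: posdef_ge0|exact: (posdef_inv gP).2].
Qed.

End Structure.

(** * The energy identity *)

Section FrameIdentity.
Context {R : realType} {n : nat} {X : topologicalType} (C : charted R n X) (g I : tensor C).
Hypothesis K : kahler_manifold g I.
Variable f : X -> R.
Hypothesis sf : smooth_fun C f.
Implicit Types (i : cidx C) (x : X).

Lemma dotDl m (u v w : 'cV[R]_m) : dot (u + v) w = dot u w + dot v w.
Proof. by rewrite -!bf1 bfDl. Qed.
Lemma dotDr m (u v w : 'cV[R]_m) : dot w (u + v) = dot w u + dot w v.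
Proof. by rewrite -!bf1 bfDr. Qed.
Lemma dotNl m (u v : 'cV[R]_m) : dot (- u) v = - dot u v.
Proof. by rewrite -!bf1 bfNl. Qed.
Lemma dotZl m a (u v : 'cV[R]_m) : dot (a *: u) v = a * dot u v.
Proof. by rewrite -!bf1 bfZl. Qed.
Lemma dot_mx m (M : 'M[R]_m) (u v : 'cV[R]_m) : dot (M *m u) v = dot u (M^T *m v).
Proof. by rewrite -dot_tr trmxK. Qed.

Section Point.
(** Pointwise data along a strip: the indices 0, 1, 2 stand for derivatives in [tau], [s], [t], the
    [Xk] and [pk] being derivatives of base point and covector, and [X01], [X02] mixed second
    derivatives. [nu] is the gradient of [f], [rho] the vector dual to [q], and [dnu] the
    [tau]-derivative of [nu]. [E1] and [E0] are the two halves of the Fueter equation. *)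
Variables (i : cidx C) (x : X) (tau : R) (p p0 p1 p2 X0 X1 X2 X01 X02 nu rho dnu : 'cV[R]_n).
Hypothesis ix : cdom i x.
Let G := g i x.
Let J := I i x.
Let df := differential f i x.
Let D2 := d2 f i x.
Let N := Nmx g f tau i x p.
Let q := p - tau *: df.
Let mu := J *m X1 + X2 + nu.
Hypotheses (Enu : G *m nu = df) (Erho : G *m rho = q).
Hypothesis Ednu : D2 *m X0 = dT g i x X0 *m nu + G *m dnu.
Hypothesis E1 : G *m X0 = (p2 - N *m X2) + J^T *m (p1 - N *m X1).
Hypothesis E0 : p0 - N *m X0 = - (G *m (J *m X1 + X2)).

(** The pairing of [q] with the covariant derivative of the gradient is a Hessian; it is the one
    term of the energy identity that is neither a square nor a divergence. *)
Lemma dot_hess_nu : dot q (dnu + Gam g i x X0 *m nu) = bf (hessian g f i x) rho X0.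
Proof.
have gP := kahler_posdef K ix.
rewrite hess_bf dotDr -Erho.
have E v : dot (G *m rho) v = bf G rho v by rewrite bf_dot dot_mx gP.1.
rewrite !E.
have -> : bf G rho dnu = bf (d2 f i x) rho X0 - bf (dT g i x X0) rho nu.
  have := congr1 (dot rho) Ednu; rewrite dotDr -!bf_dot => ->; ring.
have -> : bf (dT g i x X0) rho nu = bf G (Gam g i x X0 *m rho) nu + bf G rho (Gam g i x X0 *m nu).
  exact: (Gam_compat K).
have -> : dot (differential f i x) (Gam g i x X0 *m rho) = bf G (Gam g i x X0 *m rho) nu.
  by rewrite -/df -Enu dotC bf_dot.
ring.
Qed.

(** The derivative of [q = p - tau df] splits into the vertical part of the shifted connection and a
    Levi-Civita term: the shift by [tau] times the Hessian exactly accounts for differentiating [df]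
    along the base. *)
Lemma q_deriv (pk Xk : 'cV[R]_n) (c : R) v :
  dot (pk - (c *: df + tau *: (D2 *m Xk))) v = dot (pk - N *m Xk) v - c * dot df v + dot q (Gam g i x Xk *m v).
Proof.
have gP := kahler_posdef K ix.
have Nv : dot (N *m Xk) v = dot p (Gam g i x Xk *m v) + tau * bf (hessian g f i x) Xk v.
  by rewrite dot_mx (Nmx_sym K sf tau p ix) -bf_dot bf_Nmx (Gam_sym K v).
rewrite /q !(dotDl, dotNl, dotZl) Nv hess_bf.
have -> : dot (D2 *m Xk) v = bf D2 Xk v by rewrite dot_mx (d2_sym K sf ix) -bf_dot.
have -> : Gam g i x v *m Xk = Gam g i x Xk *m v by rewrite (Gam_sym K v).
rewrite -/df -/D2; ring.
Qed.

Lemma dot_I u v : dot (J^T *m u) v = dot u (J *m v).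
Proof. exact: dot_tr. Qed.

(** Pair [E1] with [X0] and [E0] with [mu], then move the derivatives off [q]. The terms in which
    the second factor is differentiated cancel: mixed derivatives commute, the connection has no
    torsion, and [I] is parallel. What remains is the derivative of the gradient, which gives the
    Hessian. *)
Lemma energy_identity :
  bf G X0 X0 + bf G mu mu =
  (dot (p2 - (0 *: df + tau *: (D2 *m X2))) X0 + dot q X02)
  + (dot (p1 - (0 *: df + tau *: (D2 *m X1))) (J *m X0) + dot q (dT I i x X1 *m X0 + J *m X01))
  - (dot (p0 - (1 *: df + tau *: (D2 *m X0))) mu + dot q (dT I i x X0 *m X1 + J *m X01 + X02 + dnu))
  + bf (hessian g f i x) rho X0.
Proof.
have gP := kahler_posdef K ix.
rewrite -dot_hess_nu !q_deriv.
have -> : bf G X0 X0 = dot (p2 - N *m X2) X0 + dot (p1 - N *m X1) (J *m X0).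
  by rewrite bf_dot dotC E1 dotDl dot_I.
have -> : bf G mu mu = - dot (p0 - N *m X0) mu + dot df mu.
  rewrite E0 -Enu dotNl opprK -dotDl -mulmxDr -/mu bf_dot dot_mx gP.1 //.
have S1 : Gam g i x X1 *m (J *m X0) + dT I i x X1 *m X0 = dT I i x X0 *m X1 + Gam g i x X0 *m (J *m X1).
  by rewrite addrC; apply: (dI_Gam_sym K).
have {}S1 : dot q (Gam g i x X1 *m (J *m X0)) + dot q (dT I i x X1 *m X0)
   = dot q (dT I i x X0 *m X1) + dot q (Gam g i x X0 *m (J *m X1)).
  by rewrite -!dotDr S1.
have S2 : Gam g i x X2 *m X0 = Gam g i x X0 *m X2 by rewrite (Gam_sym K X2).
have -> : Gam g i x X0 *m mu = Gam g i x X0 *m (J *m X1) + Gam g i x X0 *m X2 + Gam g i x X0 *m nu.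
  by rewrite /mu !mulmxDr.
rewrite S2 !dotDr; move: S1.
rewrite !mul0r mul1r; lra.
Qed.

(** By [E0] the covariant [tau]-derivative of [q] is [- g mu]; hence the [tau]-derivative of [|q|^2]
    is [-2 <q, mu>]. *)
Lemma sqnorm_identity (drho : 'cV[R]_n) :
  p0 - (1 *: df + tau *: (D2 *m X0)) = dT g i x X0 *m rho + G *m drho ->
  dot (p0 - (1 *: df + tau *: (D2 *m X0))) rho + dot q drho = - 2 * dot q mu.
Proof.
move=> Edrho; have gP := kahler_posdef K ix.
have E v : dot q v = bf G rho v by rewrite -Erho bf_dot dot_mx gP.1.
have -> : dot q drho = dot (p0 - (1 *: df + tau *: (D2 *m X0))) rho - bf (dT g i x X0) rho rho.
  have H : dot rho (p0 - (1 *: df + tau *: (D2 *m X0))) = bf (dT g i x X0) rho rho + bf G rho drho.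
    by rewrite Edrho [LHS]dotDr !bf_dot.
  rewrite E [dot _ rho]dotC H; ring.
have -> : bf (dT g i x X0) rho rho = bf G (Gam g i x X0 *m rho) rho + bf G rho (Gam g i x X0 *m rho).
  exact: (Gam_compat K).
rewrite q_deriv E0 mul1r [bf G (_ *m _) rho](bf_sym _ _ gP) -!E.
have -> : dot df rho = dot q nu by rewrite E -Enu dot_mx gP.1 -bf_dot (bf_sym _ _ gP).
have -> : dot (- (G *m (J *m X1 + X2))) rho = - (dot q (J *m X1 + X2)).
  by rewrite E dotNl dot_mx gP.1 -bf_dot (bf_sym _ _ gP).
rewrite /mu !dotDr; ring.
Qed.

End Point.
End FrameIdentity.

(** * Product rules for vector-valued maps *)

Section StripCalculus.
Context {R : realType}.

Lemma diff_within_dot d n (A : set 'cV[R]_d) (F G : 'cV[R]_d -> 'cV[R]_n) z F' G' :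
  diff_within A F z F' -> diff_within A G z G' ->
  diff_within A (fun w => dot (F w) (G w)) z (fun k => dot (F' k) (G z) + dot (F z) (G' k)).
Proof.
move=> HF HG; have H := diff_within_mulmx (diff_within_trmx HF) HG.
have {}H := (diff_within_mx _ _ _ _).1 H 0 0.
suff -> : (fun k => dot (F' k) (G z) + dot (F z) (G' k)) = (fun k => ((F' k)^T *m G z + (F z)^T *m G' k) 0 0) by [].
by apply/funext => k; rewrite [RHS]mxE.
Qed.

Lemma diff_within_scale d m n (A : set 'cV[R]_d) (s : 'cV[R]_d -> R) (F : 'cV[R]_d -> 'M[R]_(m, n)) z s' F' :
  diff_within A s z s' -> diff_within A F z F' ->
  diff_within A (fun w => s w *: F w) z (fun k => s' k *: F z + s z *: F' k).
Proof.
move=> Hs /diff_within_mx HF; apply/diff_within_mx => a b.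
have H := diff_withinM Hs (HF a b).
suff -> : (fun k => (s' k *: F z + s z *: F' k) a b) = (fun k => s' k * F z a b + s z * F' k a b).
  by apply: (diff_within_local ltr01) H => [w _ Aw|]; [split|]; rewrite ?mxE.
by apply/funext => k; rewrite !mxE.
Qed.

Lemma mul_frame n (N : 'M[R]_n) (a b : 'cV[R]_n) :
  (block_mx 1%:M 0 (- N) 1%:M : 'M[R]_(n + n)) *m col_mx a b = col_mx a (b - N *m a).
Proof. by rewrite mul_block_col !mul1mx mul0mx addr0 mulNmx addrC. Qed.

Lemma Ck_dot k d n (A : set 'cV[R]_d) (F G : 'cV[R]_d -> 'cV[R]_n) : cornered A ->
  (forall a, Ck k A (fun w => F w a 0)) -> (forall a, Ck k A (fun w => G w a 0)) ->
  Ck k A (fun w => dot (F w) (G w)).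
Proof.
move=> cA HF HG; apply: (Ck_ext (f := fun w => \sum_a F w a 0 * G w a 0)).
  by move=> w _; rewrite dotE.
by apply: Ck_sum => // a _; exact: CkM.
Qed.

Lemma Ck_mulv k d m n (A : set 'cV[R]_d) (M : 'cV[R]_d -> 'M[R]_(m, n)) (F : 'cV[R]_d -> 'cV[R]_n) : cornered A ->
  (forall a b, Ck k A (fun w => M w a b)) -> (forall a, Ck k A (fun w => F w a 0)) ->
  forall a, Ck k A (fun w => (M w *m F w) a 0).
Proof. by move=> cA HM HF a; apply: Ck_mulmx => // b c; rewrite ord1. Qed.

End StripCalculus.

Section Along.
Context {R : realType} {n : nat} {X : topologicalType} (C : charted R n X) (g I : tensor C).
Hypothesis K : kahler_manifold g I.
Variable f : X -> R.
Hypothesis sf : smooth_fun C f.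
Let mfd := kahler_mfd K.
Let nC := manifold_nice mfd.
Variables (d : nat) (A : set 'cV[R]_d) (u : 'cV[R]_d -> X) (i : cidx C).
Hypotheses (cA : cornered A) (Au : forall w, A w -> cdom i (u w)).

Lemma Ck_along k phi : csm i phi -> Ck k A (cmap i \o u) -> Ck k A (phi \o u).
Proof.
move=> H Cu; have cI := nice_cornered nC (i := i).
have Hk := Ck_comp cI cA (fun w Aw => cimg_in (Au Aw)) (H k) Cu.
by apply: Ck_ext Hk => w Aw; rewrite /= (in_chartE nC) //; exact: Au.
Qed.

Variables (z : 'cV[R]_d) (H : 'I_d -> 'cV[R]_n).
Hypotheses (Az : A z) (du : diff_within A (cmap i \o u) z H).

Lemma tensor_along (T : tensor C) : smooth_tensor T ->
  diff_within A (T i \o u) z (fun k => dT T i (u z) (H k)).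
Proof.
move=> sT; have D := diff_within_comp (tensor_diff K sT (Au Az)) du (fun w Aw => cimg_in (Au Aw)).
by apply: diff_within_eq D => // w Aw; rewrite /= (in_chartE nC) //; exact: Au.
Qed.

Lemma differential_along :
  diff_within A (differential f i \o u) z (fun k => d2 f i (u z) *m H k).
Proof.
apply/diff_within_mx => a b; rewrite ord1.
have D := diff_within_comp (cpartial_diff K sf a (Au Az)) du (fun w Aw => cimg_in (Au Aw)).
have -> : (fun k => (d2 f i (u z) *m H k) a 0) = (fun k => \sum_b0 H k b0 0 *: cpartial2 i f a b0 (u z)).
  by apply/funext => k; rewrite mxE; apply: eq_bigr => c _; rewrite mxE mulrC.
by apply: diff_within_eq D => // w Aw; rewrite /= mxE (in_chartE nC) //; exact: Au.
Qed.

End Along.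

(** * The energy identity along a strip, within one chart *)

Section Strip.
Context {R : realType} {n : nat} {X : topologicalType} (C : charted R n X) (g I : tensor C).
Hypothesis K : kahler_manifold g I.
Variable f : X -> R.
Hypothesis sf : smooth_fun C f.
Let mfd := kahler_mfd K.
Let nC := manifold_nice mfd.
Let MC := cotangent_charts C.
Let nM := cotangent_nice mfd.
Let B : set 'cV[R]_3 := [set z : 'cV[R]_3 | unit_itv (z 0 0)].
Variable V3 : 'cV[R]_3 -> cotangent C.
Hypothesis HV : Ck_map MC 2 B V3.
Implicit Types (i j : cidx C) (z w : 'cV[R]_3).

Definition bx w : X := ct_pt (V3 w).
Definition cv i w : 'cV[R]_n := ct_cov (V3 w) i.
Definition dX i k w : 'cV[R]_n := partial B (cmap i \o bx) k w.
Definition dp i k w : 'cV[R]_n := partial B (cv i) k w.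

(** A relatively open piece of the strip that is mapped into one chart. There [x] and [p] are
    vector-valued functions, and derivatives within [A] agree with those within [B]. *)
Definition chart_patch i (A : set 'cV[R]_3) : Prop := [/\ cornered A, Ck 2 A (cmap i \o bx), Ck 2 A (cv i) &
  forall w, A w -> [/\ B w, cdom i (bx w) & locally_eq B A w]].

Lemma cornered_B : cornered B.
Proof. exact: cornered_strip. Qed.

Lemma patch_ex i z : B z -> cdom i (bx z) -> exists2 A, chart_patch i A & A z.
Proof.
move=> Bz iz; have [r r0 [Ai CA]] := HV Bz iz.
have locA w : (B `&` ball z r) w -> locally_eq B (B `&` ball z r) w.
  move=> [Bw zw]; have zw' : `|z - w| < r by move: zw; rewrite -ball_normE.
  exists (r - `|z - w|); first by rewrite subr_gt0.
  move=> w' H; split; [move=> Bw'; split=> //|by case].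
  rewrite -ball_normE /=; apply: le_lt_trans (ler_distD w z w') _.
  by rewrite [`|w - w'|]distrC; lra.
have cA : cornered (B `&` ball z r).
  by apply: (cornered_sub cornered_B) => w Aw; split; [case: Aw|exact: locA].
exists (B `&` ball z r); last by split=> //; exact: ballxx.
split=> //.
- apply/(Ck_mx _ _ cA) => a b; rewrite ord1.
  have := (Ck_mx _ _ cA).1 CA (lshift n a) 0; apply: Ck_ext => w _; by rewrite /= col_mxEu.
- apply/(Ck_mx _ _ cA) => a b; rewrite ord1.
  have := (Ck_mx _ _ cA).1 CA (rshift n a) 0; apply: Ck_ext => w _; by rewrite /= col_mxEd.
- by move=> w Aw; split; [case: Aw|exact: Ai|exact: locA].
Qed.

Section Patch.
Variables (i : cidx C) (A : set 'cV[R]_3).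
Hypothesis PA : chart_patch i A.

Lemma patch_cornered : cornered A. Proof. by case: PA. Qed.
Let cA := patch_cornered.
Lemma patch_dom w : A w -> cdom i (bx w). Proof. by case: PA => _ _ _ H /H[]. Qed.
Let Ai := patch_dom.
Lemma patch_B w : A w -> B w. Proof. by case: PA => _ _ _ H /H[]. Qed.

Lemma Ck_dX k : Ck 1 A (dX i k).
Proof.
have [_ Cx _ H] := PA; apply: Ck_ext (Ck_partial k Cx) => w Aw.
by apply/esym/partial_locally_eq; have [] := H w Aw.
Qed.

Lemma diff_x w : A w -> diff_within A (cmap i \o bx) w (dX i ^~ w).
Proof.
move=> Aw; have [_ Cx _ H] := PA; have D := Ck_diff cA Cx Aw.
suff -> : (dX i)^~ w = (fun k => partial A (cmap i \o bx) k w) by [].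
by apply/funext => k; apply/partial_locally_eq; have [] := H w Aw.
Qed.

Lemma diff_p w : A w -> diff_within A (cv i) w (dp i ^~ w).
Proof.
move=> Aw; have [_ _ Cp H] := PA; have D := Ck_diff cA Cp Aw.
suff -> : (dp i)^~ w = (fun k => partial A (cv i) k w) by [].
by apply/funext => k; apply/partial_locally_eq; have [] := H w Aw.
Qed.

Lemma dX_schwarz k l w : A w -> partial A (dX i k) l w = partial A (dX i l) k w.
Proof.
have [_ Cx _ H] := PA => Aw; apply/matrixP => a b; rewrite ord1.
have E m : A w -> partial A (dX i m) ^~ w = fun l => partial A (partial A (cmap i \o bx) m) l w.
  move=> _; apply/funext => l'.
  apply: (partialE _ cA Aw); apply: diff_within_eq (Ck_diff cA (Ck_partial m Cx) Aw) => // v Av.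
  by apply/partial_locally_eq; have [] := H v Av.
have CC := (Ck_mx _ _ cA).1 Cx.
have P2 m l' : partial A (partial A (cmap i \o bx) m) l' w a 0 =
    partial A (partial A (fun w => (cmap i \o bx) w a 0) m) l' w.
  rewrite (partial_mx _ _ _ cA Aw); last by exists (fun k => partial A (partial A (cmap i \o bx) m) k w); exact: (Ck_diff cA (Ck_partial m Cx)).
  apply: (partialE _ cA Aw); apply: diff_within_eq (Ck_diff cA (Ck_partial m (CC a 0)) Aw) => // v Av.
  by rewrite (partial_mx _ _ _ cA Av) //; eexists; exact: (Ck_diff cA Cx Av).
rewrite (congr1 (fun F => F l) (E k Aw)) (congr1 (fun F => F k) (E l Aw)) !P2.
exact: schwarz.
Qed.

Lemma full_partial k w : A w ->
  partial B (cmap (c := MC) i \o V3) k w = col_mx (dX i k w) (dp i k w).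
Proof.
move=> Aw; have [_ _ _ H] := PA; have [Bw iw lw] := H w Aw.
rewrite (partial_locally_eq _ _ lw).
have D : diff_within A (cmap (c := MC) i \o V3) w (fun k => col_mx (dX i k w) (dp i k w)).
  apply/diff_within_mx => a b; rewrite ord1 -[a]splitK; case: (fintype.split a) => {}a /=.
    have := (diff_within_mx _ _ _ _).1 (diff_x Aw) a 0.
    have -> : (fun l => col_mx (dX i l w) (dp i l w) (lshift n a) 0) = (fun l => dX i l w a 0) by apply/funext => l; rewrite col_mxEu.
    by apply: diff_within_eq => // v _; rewrite /= col_mxEu.
  have := (diff_within_mx _ _ _ _).1 (diff_p Aw) a 0.
  have -> : (fun l => col_mx (dX i l w) (dp i l w) (rshift n a) 0) = (fun l => dp i l w a 0) by apply/funext => l; rewrite col_mxEd.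
  by apply: diff_within_eq => // v _; rewrite /= col_mxEd.
by rewrite (partialE _ cA Aw D).
Qed.

End Patch.

Definition fq i w : 'cV[R]_n := cv i w - w 0 0 *: differential f i (bx w).
Definition fmu i w : 'cV[R]_n := I i (bx w) *m dX i 1 w + dX i 2 w + gradient g f i (bx w).
Definition frho i w : 'cV[R]_n := invmx (g i (bx w)) *m fq i w.
(** [fP], [fQ] and [fY] are the fluxes in the directions [t], [s] and [tau] of the energy identity;
    [fN] is [|q|^2], and [fE] is the energy density. By the equation [|fmu|] is the norm of the
    covariant [tau]-derivative of [q]. *)
Definition fP i w : R := dot (fq i w) (dX i 0 w).
Definition fQ i w : R := dot (fq i w) (I i (bx w) *m dX i 0 w).
Definition fY i w : R := - dot (fq i w) (fmu i w).
Definition fN i w : R := dot (fq i w) (frho i w).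
Definition fE i w : R := bf (g i (bx w)) (dX i 0 w) (dX i 0 w) + bf (g i (bx w)) (fmu i w) (fmu i w).

Section PatchQuantities.
Variables (i : cidx C) (A : set 'cV[R]_3).
Hypothesis PA : chart_patch i A.
Let cA := patch_cornered PA.
Let Ai := @patch_dom _ _ PA.

Lemma Ck_phi phi : csm i phi -> Ck 1 A (phi \o bx).
Proof. by move=> H; have [_ Cx _ _] := PA; apply: (Ck_along K cA Ai H); exact: Ck_leS. Qed.

Lemma Ck_dXa k a : Ck 1 A (fun w => dX i k w a 0).
Proof. exact: (Ck_mx _ _ cA).1 (Ck_dX PA k) a 0. Qed.

Lemma Ck_fq a : Ck 1 A (fun w => fq i w a 0).
Proof.
apply: (Ck_ext (f := fun w => cv i w a 0 - w 0 0 * cpartial i f a (bx w))) => [w _|]; first by rewrite !mxE.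
apply: CkB => //; last by apply: CkM => //; [exact: Ck_coord|apply: (Ck_phi (phi := cpartial i f a)); exact: (csm_df K sf)].
by have [_ _ Cp _] := PA; exact: ((Ck_mx _ _ cA).1 (Ck_leS Cp) a 0).
Qed.

Lemma Ck_fnu a : Ck 1 A (fun w => gradient g f i (bx w) a 0).
Proof.
apply: Ck_mulv => // [b c|b]; first by apply: (Ck_phi (phi := fun x => invmx (g i x) b c)); exact: (csm_inv K).
by apply: (Ck_ext (f := cpartial i f b \o bx)) => [w _|]; [rewrite /= mxE|apply: Ck_phi; exact: (csm_df K sf)].
Qed.

Lemma Ck_I a b : Ck 1 A (fun w => I i (bx w) a b).
Proof. apply: (Ck_phi (phi := fun x => I i x a b)); apply: (csm_tensor K); exact: (I_smooth K). Qed.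

Lemma Ck_g a b : Ck 1 A (fun w => g i (bx w) a b).
Proof. apply: (Ck_phi (phi := fun x => g i x a b)); apply: (csm_tensor K); exact: (g_smooth K). Qed.

Lemma Ck_fmu a : Ck 1 A (fun w => fmu i w a 0).
Proof.
apply: (Ck_ext (f := fun w => (I i (bx w) *m dX i 1 w) a 0 + dX i 2 w a 0 + gradient g f i (bx w) a 0)) => [w _|].
  by rewrite [RHS]mxE [X in _ = X + _]mxE.
apply: CkD => //; last exact: Ck_fnu.
apply: CkD => //; last exact: Ck_dXa.
by apply: Ck_mulv => //; [exact: Ck_I|exact: Ck_dXa].
Qed.

Lemma Ck_frho a : Ck 1 A (fun w => frho i w a 0).
Proof. by apply: Ck_mulv => // [b c|]; [by apply: (Ck_phi (phi := fun x => invmx (g i x) b c)); exact: (csm_inv K)|exact: Ck_fq]. Qed.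

Lemma Ck_fP : Ck 1 A (fP i).
Proof. by apply: Ck_dot => //; [exact: Ck_fq|exact: Ck_dXa]. Qed.

Lemma Ck_fQ : Ck 1 A (fQ i).
Proof. by apply: Ck_dot => //; [exact: Ck_fq|apply: Ck_mulv => //; [exact: Ck_I|exact: Ck_dXa]]. Qed.

Lemma Ck_fY : Ck 1 A (fY i).
Proof. by apply: CkN => //; apply: Ck_dot => //; [exact: Ck_fq|exact: Ck_fmu]. Qed.

Lemma Ck_fN : Ck 1 A (fN i).
Proof. by apply: Ck_dot => //; [exact: Ck_fq|exact: Ck_frho]. Qed.

Lemma Ck_bfg (F : 'cV[R]_3 -> 'cV[R]_n) : (forall a, Ck 1 A (fun w => F w a 0)) ->
  Ck 1 A (fun w => bf (g i (bx w)) (F w) (F w)).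
Proof.
move=> HF; apply: (Ck_ext (f := fun w => dot (F w) (g i (bx w) *m F w))) => [w _|]; first by rewrite bf_dot.
by apply: (Ck_dot cA HF) => a; exact: (Ck_mulv cA Ck_g HF).
Qed.

Lemma Ck_fE : Ck 1 A (fE i).
Proof. by apply: CkD => //; apply: Ck_bfg; [exact: Ck_dXa|exact: Ck_fmu]. Qed.

Hypothesis Heq : forall w, B w -> cdom i (bx w) ->
  It g I f (w 0 0) i (V3 w) *m partial B (cmap (c := MC) i \o V3) 0 w
  + Jt g f (w 0 0) i (V3 w) *m partial B (cmap (c := MC) i \o V3) 1 w
  + Kt g I f (w 0 0) i (V3 w) *m partial B (cmap (c := MC) i \o V3) 2 w = 0.

Let th k w := dp i k w - Nmx g f (w 0 0) i (bx w) (cv i w) *m dX i k w.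

Lemma fueter_frame w : A w ->
  g i (bx w) *m dX i 0 w = th 2 w + (I i (bx w))^T *m th 1 w /\
  th 0 w = - (g i (bx w) *m (I i (bx w) *m dX i 1 w + dX i 2 w)).
Proof.
move=> Aw; have iw := Ai Aw; have := Heq (patch_B PA Aw) iw; rewrite !(full_partial PA) //.
have EF k : FM g f (w 0 0) i (V3 w) *m col_mx (dX i k w) (dp i k w) = col_mx (dX i k w) (th k w).
  exact: mul_frame.
rewrite /Kt /It /Jt conj_mul -!mulmxA !EF -!mulmxDr => /(congr1 (mulmx (FM g f (w 0 0) i (V3 w)))).
rewrite mulmx0 mulmxA FM_K mul1mx /DI /DJ !mul_block_col !mul0mx !addr0 !add0r.
rewrite !add_col_mx -col_mx0 => /eq_col_mx[].
rewrite -/(bx w); set gg := g i (bx w); set J := I i (bx w).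
move: (th 0 w) (th 1 w) (th 2 w) (dX i 0 w) (dX i 1 w) (dX i 2 w) => t0 t1 t2 x0 x1 x2 H1 H2.
have gP := kahler_posdef K iw; have gU := posdef_unit gP.
have JJ := I_sqr K iw; have Jg := Ig_skew K iw; rewrite -/J -/gg in JJ Jg.
split.
- have E : J *m x0 = invmx gg *m t1 + J *m (invmx gg *m t2).
    apply/eqP; rewrite -subr_eq0; apply/eqP; rewrite -[RHS]H1 !mulNmx mulmxN !opprD addrA //.
  have {}E : x0 = invmx gg *m t2 - J *m (invmx gg *m t1).
    have := congr1 (mulmx J) E; rewrite mulmxDr !mulmxA JJ !mulNmx !mul1mx => E'.
    by rewrite -[LHS]opprK E' opprD opprK addrC.
  rewrite E mulmxBr mulmxA mulmxV // mul1mx; congr (_ + _).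
  by rewrite mulmxA -[gg *m J]opprK -Jg mulNmx opprK -mulmxA [gg *m _]mulmxA mulmxV // mul1mx.
- have JJt : J^T *m J^T = - 1%:M by rewrite -trmx_mul JJ linearN /= trmx1.
  have := congr1 (mulmx J^T) H2; rewrite mulmx0 !mulmxDr !mulmxA JJt Jg !mulNmx !mul1mx => E.
  apply/eqP; rewrite -subr_eq0; apply/eqP; rewrite opprK.
  by have := congr1 -%R E; rewrite !opprD !opprK oppr0 -addrA.
Qed.

Lemma diff_q w : A w -> diff_within A (fq i) w
  (fun k => dp i k w - ((0 == k)%:R *: differential f i (bx w) + w 0 0 *: (d2 f i (bx w) *m dX i k w))).
Proof.
move=> Aw; apply: diff_withinD; first exact: diff_p.
apply: diff_withinN; apply: (diff_within_scale (diff_within_coord A 0 w)).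
exact: (differential_along K sf Ai Aw (diff_x PA Aw)).
Qed.

Lemma diff_dX k w : A w -> diff_within A (dX i k) w (fun l => partial A (dX i k) l w).
Proof. by move=> Aw; exact: (Ck_diff cA (Ck_dX PA k)). Qed.

Lemma diff_vec (F : 'cV[R]_3 -> 'cV[R]_n) w : (forall a, Ck 1 A (fun w => F w a 0)) -> A w ->
  diff_within A F w (fun l => partial A F l w).
Proof.
by move=> H Aw; apply: (Ck_diff (k := 0) cA) => //; apply/(Ck_mx _ _ cA) => a b; rewrite ord1.
Qed.

(** Applied to the gradient and to the dual vector of [q], both solutions of [g F = D]:
    differentiating this equation avoids derivatives of the inverse metric. *)
Lemma diff_solve (F D : 'cV[R]_3 -> 'cV[R]_n) w D' : (forall a, Ck 1 A (fun w => F w a 0)) -> A w ->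
  diff_within A D w D' -> (forall v, A v -> g i (bx v) *m F v = D v) -> forall k,
  D' k = dT g i (bx w) (dX i k w) *m F w + g i (bx w) *m partial A F k w.
Proof.
move=> H Aw dD E k.
have H1 := diff_within_mulmx (tensor_along K Ai Aw (diff_x PA Aw) (g_smooth K)) (diff_vec H Aw).
have H2 := diff_within_eq Aw (fun v Av => esym (E v Av)) H1.
exact: (congr1 (fun F => F k) (diff_within_uniq cA Aw dD H2)).
Qed.

Lemma g_gradient w : A w -> g i (bx w) *m gradient g f i (bx w) = differential f i (bx w).
Proof.
by move=> Aw; rewrite /gradient mulmxA mulmxV ?mul1mx //; exact: posdef_unit (kahler_posdef K (Ai Aw)).
Qed.

Lemma g_frho w : A w -> g i (bx w) *m frho i w = fq i w.
Proof.
by move=> Aw; rewrite /frho mulmxA mulmxV ?mul1mx //; exact: posdef_unit (kahler_posdef K (Ai Aw)).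
Qed.

Lemma patch_identity w : A w -> fE i w =
  partial A (fP i) 2 w + partial A (fQ i) 1 w + partial A (fY i) 0 w
  + bf (hessian g f i (bx w)) (frho i w) (dX i 0 w).
Proof.
move=> Aw; have [E1 E0] := fueter_frame Aw.
have dJ k : diff_within A (fun v => I i (bx v) *m dX i k v) w
    (fun l => dT I i (bx w) (dX i l w) *m dX i k w + I i (bx w) *m partial A (dX i k) l w).
  exact: (diff_within_mulmx (tensor_along K Ai Aw (diff_x PA Aw) (I_smooth K)) (diff_dX k Aw)).
have dP := diff_within_dot (diff_q Aw) (diff_dX 0 Aw).
have dQ := diff_within_dot (diff_q Aw) (dJ 0).
have dY := diff_withinN (diff_within_dot (diff_q Aw)
  (diff_withinD (diff_withinD (dJ 1) (diff_dX 2 Aw)) (diff_vec Ck_fnu Aw))).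
rewrite (partialE _ cA Aw dP) (partialE _ cA Aw dQ) (partialE _ cA Aw dY).
have dnu := diff_solve Ck_fnu Aw (differential_along K sf Ai Aw (diff_x PA Aw)) g_gradient.
rewrite (dX_schwarz PA 1 0 Aw) (dX_schwarz PA 2 0 Aw).
exact: (energy_identity K sf _ _ (Ai Aw) (g_gradient Aw) (g_frho Aw) (dnu 0) E1 E0).
Qed.

Lemma patch_norm w : A w -> partial A (fN i) 0 w = 2 * fY i w.
Proof.
move=> Aw; have [E1 E0] := fueter_frame Aw.
have dN := diff_within_dot (diff_q Aw) (diff_vec Ck_frho Aw).
rewrite (partialE _ cA Aw dN).
have drho := diff_solve Ck_frho Aw (diff_q Aw) g_frho.
have := sqnorm_identity K sf (Ai Aw) (g_gradient Aw) (g_frho Aw) E0 (drho 0).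
by rewrite /fY => ->; rewrite mulrN mulNr.
Qed.

End PatchQuantities.
End Strip.

(** * Chart-independent quantities and pointwise estimates *)

Section Global.
Context {R : realType} {n : nat} {X : topologicalType} (C : charted R n X) (g I : tensor C).
Hypothesis K : kahler_manifold g I.
Variable f : X -> R.
Hypothesis sf : smooth_fun C f.
Let mfd := kahler_mfd K.
Let nC := manifold_nice mfd.
Let MC := cotangent_charts C.
Let B : set 'cV[R]_3 := [set z : 'cV[R]_3 | unit_itv (z 0 0)].
Variable V3 : 'cV[R]_3 -> cotangent C.
Hypothesis HV : Ck_map MC 2 B V3.
Implicit Types (i j : cidx C) (z w : 'cV[R]_3).
Notation bx := (bx V3).
Notation cv := (cv V3).
Notation dX := (dX V3).
Notation fq := (fq f V3).
Notation fmu := (fmu g I f V3).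
Notation frho := (frho g f V3).
Notation chart_patch := (chart_patch V3).

Lemma sharp_law i j x (p : 'cV[R]_n) : cdom i x -> cdom j x ->
  jac i j x *m (invmx (g i x) *m ((jac i j x)^T *m p)) = invmx (g j x) *m p.
Proof.
move=> ix jx; have AtU : (jac i j x)^T \in unitmx by rewrite unitmx_tr (jac_unit nC).
by rewrite !mulmxA -(g_lawV K ix jx) trmx_inv -[_ *m _ *m (jac i j x)^T]mulmxA mulVmx // mulmx1.
Qed.

Lemma gradient_law i j x : cdom i x -> cdom j x ->
  gradient g f j x = jac i j x *m gradient g f i x.
Proof. by move=> ix jx; rewrite /gradient (differential_law K sf ix jx) sharp_law. Qed.

Lemma diff_xB i z : B z -> cdom i (bx z) -> diff_within B (cmap i \o bx) z (dX i ^~ z).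
Proof.
move=> Bz iz; have [A PA Az] := patch_ex HV Bz iz; have [_ _ _ H] := PA.
have [_ _ [r r0 lr]] := H z Az.
by apply: (diff_within_local r0) (diff_x PA Az) => // w wr Bw; split=> //; apply/lr.
Qed.

Lemma bx_near i z : B z -> cdom i (bx z) ->
  exists2 r : R, 0 < r & forall w, B w -> `|w - z| < r -> cdom i (bx w).
Proof.
move=> Bz iz; have [A PA Az] := patch_ex HV Bz iz; have [_ _ _ H] := PA.
have [_ _ [r r0 lr]] := H z Az; exists r => // w Bw wr.
by have [] := H w ((lr w wr).1 Bw).
Qed.

Lemma dX_law i j k z : B z -> cdom i (bx z) -> cdom j (bx z) ->
  dX j k z = jac i j (bx z) *m dX i k z.
Proof.
move=> Bz iz jz; have [r r0 Hr] := bx_near Bz iz; have [r' r0' Hr'] := bx_near Bz jz.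
have D := curve_chain nC (r := Num.min r r') _ _ iz jz (diff_xB Bz iz).
have {}D : diff_within B (cmap j \o bx) z (fun k => jac i j (bx z) *m dX i k z).
  apply: D; first by rewrite lt_min r0.
  by move=> w Bw; rewrite lt_min => /andP[wr wr']; split; [exact: Hr|exact: Hr'].
exact: (partialE k (@cornered_strip R 3 0) Bz D).
Qed.

Lemma fq_law i j z : cdom i (bx z) -> cdom j (bx z) -> fq i z = (jac i j (bx z))^T *m fq j z.
Proof.
move=> iz jz; rewrite /fq mulmxBr -scalemxAr -(differential_law K sf iz jz); congr (_ - _).
exact: ct_law.
Qed.

Lemma fmu_law i j z : B z -> cdom i (bx z) -> cdom j (bx z) ->
  fmu j z = jac i j (bx z) *m fmu i z.
Proof.
move=> Bz iz jz; rewrite /fmu (gradient_law iz jz) !(dX_law _ Bz iz jz).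
by rewrite mulmxA (I_law K) // -mulmxA -!mulmxDr.
Qed.

Lemma frho_law i j z : cdom i (bx z) -> cdom j (bx z) ->
  frho j z = jac i j (bx z) *m frho i z.
Proof. by move=> iz jz; rewrite /frho (fq_law iz jz) sharp_law. Qed.

Definition chart_free (F : cidx C -> 'cV[R]_3 -> R) : Prop :=
  (forall z i j, B z -> cdom i (bx z) -> cdom j (bx z) -> F i z = F j z) /\
  (forall i A, chart_patch i A -> Ck 1 A (F i)).

Lemma fP_free : chart_free (fP f V3).
Proof.
split; last by move=> i A PA; exact: (Ck_fP K sf PA).
by move=> z i j Bz iz jz; rewrite /fP (fq_law iz jz) (dX_law 0 Bz iz jz) dot_tr.
Qed.

Lemma fQ_free : chart_free (fQ I f V3).
Proof.
split; last by move=> i A PA; exact: (Ck_fQ K sf PA).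
by move=> z i j Bz iz jz; rewrite /fQ (fq_law iz jz) (dX_law 0 Bz iz jz) dot_tr mulmxA -(I_law K) // mulmxA.
Qed.

Lemma fY_free : chart_free (fY g I f V3).
Proof.
split; last by move=> i A PA; exact: (Ck_fY K sf PA).
by move=> z i j Bz iz jz; rewrite /fY (fq_law iz jz) (fmu_law Bz iz jz) dot_tr.
Qed.

Lemma fN_free : chart_free (fN g f V3).
Proof.
split; last by move=> i A PA; exact: (Ck_fN K sf PA).
by move=> z i j Bz iz jz; rewrite /fN (frho_law iz jz) [in LHS](fq_law iz jz) dot_tr.
Qed.

Lemma fE_free : chart_free (fE g I f V3).
Proof.
split; last by move=> i A PA; exact: (Ck_fE K sf PA).
by move=> z i j Bz iz jz; rewrite /fE (fmu_law Bz iz jz) (dX_law 0 Bz iz jz) -!(g_law_bf K).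
Qed.

Definition ch z : cidx C := sval (cid (cdom_cover mfd (bx z))).

Lemma chP z : cdom (ch z) (bx z).
Proof. by rewrite /ch; case: cid. Qed.

(** The chosen chart jumps from point to point; [chart_free] guarantees that the value does not
    notice, so that the result is again of class C^1. *)
Definition glob (F : cidx C -> 'cV[R]_3 -> R) z : R := F (ch z) z.

Lemma globE F i z : chart_free F -> B z -> cdom i (bx z) -> glob F z = F i z.
Proof. by move=> [H _] Bz iz; apply: H => //; exact: chP. Qed.

Lemma glob_Ck F : chart_free F -> Ck 1 B (glob F).
Proof.
move=> HF; apply: Ck_local => z Bz.
have [A PA Az] := patch_ex HV Bz (chP z); have [cA _ _ H] := PA.
exists A, (F (ch z)); split=> //; first by have [] := H z Az.
- by move=> w Aw; have [Bw iw _] := H w Aw; exact: globE.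
- by apply: HF.2.
Qed.

Lemma glob_partial F i A k z : chart_free F -> chart_patch i A -> A z ->
  partial B (glob F) k z = partial A (F i) k z.
Proof.
move=> HF PA Az; have [cA _ _ H] := PA; have [Bz iz lz] := H z Az.
rewrite (partial_locally_eq _ _ lz).
apply: (partial_local _ ltr01) => // [w _ Aw|]; last exact: globE.
by have [Bw iw _] := H w Aw; exact: globE.
Qed.

Hypothesis Heq : forall w i, B w -> cdom i (bx w) ->
  It g I f (w 0 0) i (V3 w) *m partial B (cmap (c := MC) i \o V3) 0 w
  + Jt g f (w 0 0) i (V3 w) *m partial B (cmap (c := MC) i \o V3) 1 w
  + Kt g I f (w 0 0) i (V3 w) *m partial B (cmap (c := MC) i \o V3) 2 w = 0.
Variable kap : R.
Hypothesis kap_ge0 : 0 <= kap.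
Hypothesis kap_n : kap * n%:R <= 4^-1.
Hypothesis Hkap : forall i x, cdom i x -> Num.sqrt (sqnorm2 g f i x) <= kap.

Let gE := glob (fE g I f V3).
Let gN := glob (fN g f V3).
Let gP := glob (fP f V3).
Let gQ := glob (fQ I f V3).
(** [gS] is [tau |q|^2], whose [tau]-derivative controls [|q|^2]. A multiple of it is added to the
    [tau]-flux in [gZ] to pay for the Hessian term; both vanish at the ends of the interval because
    [q] does. *)
Let gS z : R := z 0 0 * gN z.
Let gZ z : R := glob (fY g I f V3) z + kap * n%:R * gS z.

Lemma Ck_gS : Ck 1 B gS.
Proof. by apply: CkM; [exact: cornered_strip|exact: (Ck_coord (@cornered_strip R 3 0))|exact: glob_Ck fN_free]. Qed.

Lemma Ck_gZ : Ck 1 B gZ.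
Proof.
have cB : cornered B by exact: cornered_strip.
apply: CkD => //; first exact: glob_Ck fY_free.
by apply: CkM => //; [exact: Ck_cst|exact: Ck_gS].
Qed.

Lemma gE_ge0 z : B z -> 0 <= gE z.
Proof.
move=> Bz; have pg := kahler_posdef K (chP z).
by apply: addr_ge0; exact: posdef_ge0.
Qed.

Lemma partial_gS z : B z -> partial B gS 0 z = gN z + z 0 0 * (2 * glob (fY g I f V3) z).
Proof.
move=> Bz; have cB : cornered B by exact: cornered_strip.
have DN := Ck_diff cB (glob_Ck fN_free) Bz.
rewrite (partialE _ cB Bz (diff_withinM (diff_within_coord B 0 z) DN)) mul1r; congr (_ + _ * _).
have [A PA Az] := patch_ex HV Bz (chP z).
by rewrite (glob_partial _ fN_free PA Az) (patch_norm K sf PA) // => w Bw iw; exact: Heq.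
Qed.

Lemma fN_bf i z : cdom i (bx z) -> fN g f V3 i z = bf (invmx (g i (bx z))) (fq i z) (fq i z).
Proof. by move=> iz; rewrite /fN bf_dot. Qed.

Lemma fN_rho i z : cdom i (bx z) -> fN g f V3 i z = bf (g i (bx z)) (frho i z) (frho i z).
Proof. by move=> iz; rewrite fN_bf // (bf_inv _ _ (kahler_posdef K iz)). Qed.

(** Poincare inequality in divergence form: the [tau]-derivative of [tau |q|^2] is
    [|q|^2 - 2 tau <q, mu>], and Young's inequality with parameter 1/2 bounds the last term by
    [|q|^2 / 2 + 2 |mu|^2]. *)
Lemma gN_le z : B z ->
  gN z <= 2 * partial B gS 0 z + 4 * bf (g (ch z) (bx z)) (fmu (ch z) z) (fmu (ch z) z).
Proof.
move=> Bz; rewrite partial_gS //; have pg := kahler_posdef K (chP z).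
have := young_dot (th := 2^-1) (fq (ch z) z) (fmu (ch z) z) pg.
rewrite invr_gt0 invrK -fN_bf; last exact: chP.
rewrite -/(glob (fN g f V3) z) -/gN => /(_ (ltr0Sn _ _)); set D := dot _ _; set M := bf _ _ _ => H.
have -> : glob (fY g I f V3) z = - D by [].
have /andP[t0 t1] : 0 <= z 0 0 <= 1 := Bz.
have : z 0 0 * D <= `|D|.
  apply: le_trans (ler_norm _) _; rewrite normrM (ger0_norm t0); exact: ler_piMl.
lra.
Qed.

(** Young's inequality and [gN_le]. The flux [Q] obeys the same bound as [P] because [I] is an
    isometry. *)
Lemma gP_le z : B z -> `|gP z| <= partial B gS 0 z + 2 * gE z /\ `|gQ z| <= partial B gS 0 z + 2 * gE z.
Proof.
move=> Bz; have Pz := kahler_posdef K (chP z); have HN := gN_le Bz.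
have H v : bf (g (ch z) (bx z)) v v = bf (g (ch z) (bx z)) (dX (ch z) 0 z) (dX (ch z) 0 z) ->
   `|dot (fq (ch z) z) v| <= partial B gS 0 z + 2 * gE z.
  move=> Ev; have := young_dot (th := 1) (fq (ch z) z) v Pz ltr01.
  rewrite invr1 !mul1r -fN_bf; last exact: chP.
  rewrite -/(glob (fN g f V3) z) -/gN Ev; move: HN; rewrite /gE /glob /fE.
  set a := bf _ _ _; set b := bf _ _ _ => HN H.
  have a0 : 0 <= a by exact: posdef_ge0.
  have b0 : 0 <= b by exact: posdef_ge0.
  lra.
by split; apply: H => //; exact: (gI_I K _ _ (chP z)).
Qed.

(** The Hessian term is at most [kn / 2] times [|q|^2 + |x_tau|^2], where [kn = kap n]. By [gN_le]
    and [kn <= 1/4] this is at most [kn d_tau gS] plus half of the energy; the half is moved to the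
    left, and the rest is contained in [gZ]. *)
Lemma gE_le z : B z ->
  gE z <= 2 * (partial B gP 2 z + partial B gQ 1 z + partial B gZ 0 z).
Proof.
move=> Bz; have Pz := kahler_posdef K (chP z); have HN := gN_le Bz.
have cB : cornered B by exact: cornered_strip.
have [A PA Az] := patch_ex HV Bz (chP z).
have := patch_identity K sf PA (fun w Bw iw => Heq Bw iw) Az.
rewrite -(glob_partial 2 fP_free PA Az) -(glob_partial 1 fQ_free PA Az) -(glob_partial 0 fY_free PA Az).
have -> : partial B gZ 0 z = partial B (glob (fY g I f V3)) 0 z + kap * n%:R * partial B gS 0 z.
  have D := diff_withinD (Ck_diff cB (glob_Ck fY_free) Bz)
     (diff_withinM (diff_within_cst B (kap * n%:R : R) z) (Ck_diff cB Ck_gS Bz)).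
  by rewrite (partialE _ cB Bz D) mul0r add0r.
set h := bf (hessian _ _ _ _) _ _ => E.
have := frobenius_bound (frho (ch z) z) (dX (ch z) 0 z) Pz (hess_sym K sf (chP z)) (Hkap (chP z)).
rewrite -fN_rho; last exact: chP.
rewrite -/h -/(glob (fN g f V3) z) -/gN; move: HN E; rewrite /gE /glob /fE.
set a := bf _ _ _; set b := bf _ _ _ => HN E H.
have a0 : 0 <= a by exact: posdef_ge0.
have b0 : 0 <= b by exact: posdef_ge0.
have Hkn := kap_n.
set kn := kap * n%:R in Hkn H *.
have kn0 : 0 <= kn by rewrite mulr_ge0.
rewrite -/(glob (fY g I f V3)) -/(glob (fP f V3)) -/(glob (fQ I f V3)) -/gP -/gQ in E *.
have h1 : h <= `|h| := ler_norm h.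
have : kn * gN z <= kn * (2 * partial B gS 0 z + 4 * a) by exact: ler_wpM2l.
have : kn * a <= 4^-1 * a by exact: ler_wpM2r.
have : kn * b <= 4^-1 * b by exact: ler_wpM2r.
lra.
Qed.

Lemma gS_boundary z : B z -> fq (ch z) z = 0 -> gS z = 0 /\ gZ z = 0.
Proof.
move=> Bz q0; rewrite /gZ /gS /gN /glob /fN /fY q0.
have d0 v : dot (0 : 'cV[R]_n) v = 0 by rewrite -bf1 bf0l.
by rewrite !d0 oppr0 !mulr0 addr0.
Qed.

Lemma gE_eq0 z i : B z -> cdom i (bx z) -> gE z = 0 -> dX i 0 z = 0 /\ fmu i z = 0.
Proof.
move=> Bz iz; rewrite /gE (globE fE_free Bz iz) /fE => E; have pg := kahler_posdef K iz.
have h1 := posdef_ge0 (dX i 0 z) pg; have h2 := posdef_ge0 (fmu i z) pg.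
split; apply: (posdef_eq0 pg); lra.
Qed.

Hypothesis Hbd : forall z i, B z -> cdom i (bx z) -> z 0 0 = 0 \/ z 0 0 = 1 -> fq i z = 0.

(** The interface between geometry and analysis: from here on the vanishing argument only sees real
    functions on the strip. *)
Lemma strip_estimates : exists E P Q Z S : 'cV[R]_3 -> R,
  [/\ [/\ Ck 1 B E, Ck 1 B P, Ck 1 B Q, Ck 1 B Z & Ck 1 B S],
      forall z, B z -> 0 <= E z /\
        E z <= 2 * (partial B P 2 z + partial B Q 1 z + partial B Z 0 z),
      forall z, B z -> `|P z| <= partial B S 0 z + 2 * E z /\ `|Q z| <= partial B S 0 z + 2 * E z,
      forall z, B z -> z 0 0 = 0 \/ z 0 0 = 1 -> S z = 0 /\ Z z = 0 &
      forall z i, B z -> cdom i (bx z) -> E z = fE g I f V3 i z /\ (E z = 0 -> dX i 0 z = 0 /\ fmu i z = 0)].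
Proof.
exists gE, gP, gQ, gZ, gS; split.
- split; [exact: glob_Ck fE_free|exact: glob_Ck fP_free|exact: glob_Ck fQ_free|exact: Ck_gZ|exact: Ck_gS].
- by move=> z Bz; split; [exact: gE_ge0|exact: gE_le].
- exact: gP_le.
- by move=> z Bz z01; apply: gS_boundary => //; apply: Hbd => //; exact: chP.
- by move=> z i Bz iz; split; [exact: globE fE_free Bz iz|exact: gE_eq0].
Qed.

End Global.

(** * Vanishing of bounded energies on the plane *)

Section SegmentIntegral.
Context {R : realType}.
Notation mu := (@lebesgue_measure R).
Implicit Types (a b : R) (f h : R -> R).

Definition Int a b f : R := \int[mu]_(x in `[a, b]) f x.

Lemma Int_integrable a b f : continuous f -> mu.-integrable `[a, b] (EFin \o f).
Proof.
move=> cf; apply: continuous_compact_integrable; first exact: segment_compact.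
exact: continuous_subspaceT.
Qed.

Let mI a b : measurable (`[a, b]%classic : set (measurableTypeR R)).
Proof. exact: measurable_itv. Qed.

Lemma IntD a b f h : continuous f -> continuous h -> Int a b (fun x => f x + h x) = Int a b f + Int a b h.
Proof. by move=> cf ch; apply: RintegralD => //; exact: Int_integrable. Qed.

Lemma IntB a b f h : continuous f -> continuous h -> Int a b (fun x => f x - h x) = Int a b f - Int a b h.
Proof. by move=> cf ch; apply: RintegralB => //; exact: Int_integrable. Qed.

Lemma IntZ a b (c : R) f : continuous f -> Int a b (fun x => c * f x) = c * Int a b f.
Proof. by move=> cf; apply: RintegralZl => //; exact: Int_integrable. Qed.

Lemma Int_le a b f h : continuous f -> continuous h -> (forall x, a <= x <= b -> f x <= h x) ->
  Int a b f <= Int a b h.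
Proof.
move=> cf ch H; apply: le_Rintegral; [exact: mI|exact: Int_integrable|exact: Int_integrable|].
by move=> x /=; rewrite in_itv => /H.
Qed.

Lemma Int_ge0 a b f : (forall x, a <= x <= b -> 0 <= f x) -> 0 <= Int a b f.
Proof. by move=> H; apply: Rintegral_ge0 => x /=; rewrite in_itv => /H. Qed.

Lemma Int_cst a b (c : R) : a <= b -> Int a b (fun=> c) = c * (b - a).
Proof.
move=> ab; rewrite /Int Rintegral_cst //; congr (_ * _).
transitivity (fine (if (a%:E < b%:E)%E then (b%:E - a%:E)%E else 0%E)).
  by congr fine; exact: (lebesgue_measure_itv `[a, b]).
by rewrite lte_fin; case: ltgtP ab => // -> _; rewrite subrr.
Qed.

Lemma Int_abs a b f (c : R) : a <= b -> continuous f -> (forall x, a <= x <= b -> `|f x| <= c) ->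
  `|Int a b f| <= c * (b - a).
Proof.
move=> ab cf H; have cc : continuous (fun _ : R => c) by move=> x; exact: cvg_cst.
rewrite -(Int_cst c ab) ler_norml; apply/andP; split.
  rewrite -mulN1r -IntZ //; apply: Int_le => // [|x /H].
    by move=> x; exact: cvg_cst.
  by rewrite mulN1r ler_norml => /andP[].
by apply: Int_le => // x /H; rewrite ler_norml => /andP[].
Qed.

Lemma Int_sub a b c d f : a <= c -> d <= b -> continuous f -> (forall x, a <= x <= b -> 0 <= f x) ->
  Int c d f <= Int a b f.
Proof.
move=> ac db cf f0; have i1 := Int_integrable c d cf; have i2 := Int_integrable a b cf.
apply: fine_le; [exact: integrable_fin_num|exact: integrable_fin_num|].
apply: ge0_subset_integral => //.
- by have /integrableP[] := i2.
- by move=> x /=; rewrite !in_itv /= => /andP[cx xd]; rewrite (le_trans ac cx) (le_trans xd db).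
Qed.

Lemma cont_eps f x (e : R) : continuous f -> 0 < e ->
  exists2 d : R, 0 < d & forall y, `|y - x| < d -> `|f y - f x| < e.
Proof.
move=> cf e0; have /cvgrPdist_lt /(_ e e0) := cf x.
move=> /nbhs_ballP[d /= d0 H]; exists d => // y yx.
by rewrite distrC; apply: H; rewrite -ball_normE /= distrC.
Qed.

Lemma Int_pos a b f x : a < b -> a <= x <= b -> continuous f -> (forall x, a <= x <= b -> 0 <= f x) ->
  0 < f x -> 0 < Int a b f.
Proof.
move=> ab /andP[ax xb] cf f0 fx.
have [d d0 H] := cont_eps x cf (divr_gt0 fx (ltr0Sn _ 1)).
set c := Num.max a (x - d / 2); set e := Num.min b (x + d / 2).
have [c1 c2 c3] : [/\ a <= c, x - d / 2 <= c & c <= x].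
  by rewrite !le_max !lexx ge_max orbT ax /=; split=> //; lra.
have [e1 e2 e3] : [/\ e <= b, e <= x + d / 2 & x <= e].
  by rewrite !ge_min !lexx le_min orbT xb /=; split=> //; lra.
have ce : c < e by rewrite /c /e gt_max !lt_min ab /=; apply/andP; split; [lra|apply/andP; split; lra].
apply: lt_le_trans (Int_sub c1 e1 cf f0).
apply: (@lt_le_trans _ _ (f x / 2 * (e - c))); first by rewrite mulr_gt0 // ?subr_gt0 // divr_gt0.
rewrite -(Int_cst _ (ltW ce)); apply: Int_le => // [|y /andP[cy ye]]; first by move=> y; exact: cvg_cst.
have : `|f y - f x| < f x / 2 by apply: H; rewrite ltr_norml; apply/andP; split; lra.
rewrite ltr_norml => /andP[]; lra.
Qed.

Lemma Int_FTC a b f F : a < b -> continuous f -> continuous F ->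
  (forall x, a < x < b -> is_derive x 1 F (f x)) -> Int a b f = F b - F a.
Proof.
move=> ab cf cF dF; rewrite /Int /Rintegral (continuous_FTC2 (F := F)) //.
- exact: continuous_subspaceT.
- split.
  + by move=> x; rewrite in_itv => /dF [].
  + by apply: cvg_within_filter; exact: cF.
  + by apply: cvg_within_filter; exact: cF.
- by move=> x; rewrite in_itv => /dF H; rewrite derive1E; exact: derive_val.
Qed.

(** Joint continuity is uniform along the compact segment; both continuity and differentiability of
    integrals with a parameter rest on this. *)
Lemma segment_uniform a b (T : topologicalType) (f : R -> T -> R) (p : T) (e : R) :
  continuous (fun z : R * T => f z.1 z.2) -> 0 < e ->
  \forall q \near p, forall u, a <= u <= b -> `|f u q - f u p| <= e.
Proof.
move=> cf e0; have /compact_near_coveringP cpt := @segment_compact R a b.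
have := cpt _ (nbhs p) (fun q u => `|f u q - f u p| <= e) _.
move=> H; have {}H := H _.
have : \forall q \near p, `[a, b]%classic `<=` (fun u => `|f u q - f u p| <= e).
  apply: H => u _.
  have e2 : 0 < e / 2 by rewrite divr_gt0.
  have /cvgrPdist_le /(_ _ e2) := cf (u, p).
  move=> [[A B] /= [nA nB] sAB].
  exists (A, B) => //= -[v q] /= [Av Bq].
  have h1 : `|f u p - f v q| <= e / 2 by apply: (sAB (v, q)).
  have h2 : `|f u p - f v p| <= e / 2 by apply: (sAB (v, p)); split=> //=; exact: nbhs_singleton nB.
  have := ler_distD (f u p) (f v q) (f v p).
  rewrite [`|f v q - f u p|]distrC; lra.
by apply: filterS => q H' u uab; apply: H'; rewrite /= in_itv.
Qed.

Lemma cont_slice (T : topologicalType) (f : R -> T -> R) p :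
  continuous (fun z : R * T => f z.1 z.2) -> continuous (f^~ p).
Proof.
move=> cf u; apply: (@continuous_comp _ _ _ (fun u => (u, p)) (fun z : R * T => f z.1 z.2)); last exact: cf.
exact: (cvg_pair cvg_id (cvg_cst p)).
Qed.

Lemma Int_cont a b (T : topologicalType) (f : R -> T -> R) : a <= b ->
  continuous (fun z : R * T => f z.1 z.2) -> continuous (fun p => Int a b (f^~ p)).
Proof.
move=> ab cf p; apply/cvgrPdist_le => e e0.
have e1 : 0 < e / (b - a + 1) by rewrite divr_gt0 //; lra.
have := segment_uniform a b p cf e1; apply: filterS => q H.
rewrite distrC -IntB; [|exact: cont_slice|exact: cont_slice].
apply: le_trans (Int_abs ab _ H) _.
  by move=> u; apply: cvgB; exact: cont_slice.
have ba : 0 < b - a + 1 by lra.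
by rewrite mulrAC ler_pdivrMr // ler_pM2l //; lra.
Qed.

Lemma mvt_abs (f df : R -> R) (x y c e : R) : (forall t : R, is_derive t 1 f (df t)) ->
  (forall t, `|t - x| <= `|y - x| -> `|df t - c| <= e) -> `|f y - f x - c * (y - x)| <= e * `|y - x|.
Proof.
move=> Df H; have cf : continuous f.
  by move=> t; apply: differentiable_continuous; apply/derivable1_diffP; have [] := Df t.
have [E|xy|xy] := ltgtP x y; last by rewrite xy !subrr mulr0 subrr normr0 mulr0.
  have [t] := MVT_segment (ltW E) (fun t _ => Df t) (continuous_subspaceT cf).
  rewrite in_itv /= => /andP[xt ty] ->; rewrite -mulrBl normrM ler_wpM2r //.
  by apply: H; rewrite !ger0_norm ?subr_ge0 // ?lerD2r // ltW.
have [t] := MVT_segment (ltW xy) (fun t _ => Df t) (continuous_subspaceT cf).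
rewrite in_itv /= => /andP[xt ty] E; have -> : f y - f x = df t * (y - x) by rewrite -opprB E -mulrN opprB.
rewrite -mulrBl normrM ler_wpM2r //.
by apply: H; rewrite !ler0_norm ?subr_le0 // ?opprB ?lerD2l ?lerN2 // ltW.
Qed.

Lemma Int_leibniz a b (f df : R -> R -> R) (y : R) : a <= b ->
  (forall y, continuous (f^~ y)) -> continuous (fun z : R * R => df z.1 z.2) ->
  (forall u y : R, is_derive y 1 (f u) (df u y)) ->
  is_derive y 1 (fun y => Int a b (f^~ y)) (Int a b (df^~ y)).
Proof.
move=> ab cf cdf D; apply: is_derive_eps => e e0.
have e1 : 0 < e / (b - a + 1) by rewrite divr_gt0 //; lra.
have /nbhs_ballP[r /= r0 H] := segment_uniform a b y cdf e1.
exists r => // y' yy'.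
have cd : continuous (df^~ y) by exact: cont_slice.
rewrite -IntB; [|exact: cf|exact: cf]; rewrite [Int a b (df^~ y) * _]mulrC -IntZ //.
have c1 : continuous (fun u => f u y' - f u y) by move=> u; apply: cvgB; exact: cf.
have c2 : continuous (fun u => (y' - y) * df u y) by move=> u; apply: cvgM; [exact: cvg_cst|exact: cd].
rewrite -IntB //.
apply: le_trans (Int_abs (c := e / (b - a + 1) * `|y' - y|) ab _ _) _.
- by move=> u; apply: cvgB; [exact: c1|exact: c2].
- move=> u uab; rewrite [(y' - y) * _]mulrC; apply: mvt_abs => // t ty.
  by apply: H => //; rewrite -ball_normE /= distrC; exact: le_lt_trans yy'.
- have ba : 0 < b - a + 1 by lra.
  by rewrite mulrAC ler_wpM2r // mulrAC ler_pdivrMr // ler_pM2l //; lra.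
Qed.

Lemma is_derive_val (f : R -> R) (x a b : R) : is_derive x 1 f a -> a = b -> is_derive x 1 f b.
Proof. by move=> ? <-. Qed.

Lemma is_derive_mul (f h : R -> R) (x a b : R) : is_derive x 1 f a -> is_derive x 1 h b ->
  is_derive x 1 (fun t => f t * h t) (a * h x + f x * b).
Proof.
by move=> Hf Hh; apply: is_derive_val (is_deriveM Hf Hh) _; rewrite /GRing.scale /=; ring.
Qed.

(** The hypothesis gives [G' >= (G - 2 ep) / 8], so [(G - 2 ep) exp(-s/8)] is nondecreasing. If [G]
    exceeded [2 ep] once, it would grow exponentially, against the bound [M]. The size of [M] does
    not enter the conclusion. *)
Lemma growth (G dG : R -> R) (ep M : R) : (forall s : R, is_derive s 1 G (dG s)) ->
  (forall s, `|G s| <= 2 * ep + 8 * dG s) -> (forall s, `|G s| <= M) -> forall s, G s <= 2 * ep.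
Proof.
move=> D H HM s; rewrite leNgt; apply/negP => Gs.
pose phi t := (G t - 2 * ep) * expR (- (8^-1 * t)).
have Dphi (t : R) : is_derive t 1 phi ((dG t - 8^-1 * (G t - 2 * ep)) * expR (- (8^-1 * t))).
  have D1 : is_derive t 1 (fun t => expR (- (8^-1 * t))) (- 8^-1 * expR (- (8^-1 * t))).
    have D0 : is_derive t 1 (fun t : R => - (8^-1 * t)) (- (8^-1 * 1)).
      apply: is_deriveN; apply: is_deriveZ.
    have := is_derive1_comp (is_derive_expR _) D0.
    by have -> : expR (- (8^-1 * t)) * - (8^-1 * 1) = - 8^-1 * expR (- (8^-1 * t)) by rewrite mulr1 mulrC.
  have D2 : is_derive t 1 (fun t => G t - 2 * ep) (dG t - 0).
    by apply: is_deriveB.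
  apply: is_derive_val (is_derive_mul D2 D1) _; ring.
have cphi : continuous phi.
  by move=> t; apply: differentiable_continuous; apply/derivable1_diffP; have [] := Dphi t.
have mono (t : R) : s <= t -> phi s <= phi t.
  move=> st; have [u _ E] := MVT_segment st (fun t _ => Dphi t) (continuous_subspaceT cphi).
  rewrite -subr_ge0 E mulr_ge0 ?subr_ge0 // mulr_ge0 ?expR_ge0 //.
  have := H u; have := ler_norm (G u); lra.
set m := G s - 2 * ep; have m0 : 0 < m by rewrite subr_gt0.
(* At this [t] already [exp x >= 1 + x] makes the excess at least [m + (M - 2 ep)], which is more
   than [M] allows. *)
pose t := s + 8 * (M - 2 * ep) / m.
have GM : G s <= M by apply: le_trans (HM s); exact: ler_norm.
have st : s <= t by rewrite lerDl divr_ge0 // ?(ltW m0) // mulr_ge0 // subr_ge0; lra.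
have := mono t st; rewrite /phi -/m => P.
have P2 : m * expR (8^-1 * (t - s)) <= G t - 2 * ep.
  have -> : 8^-1 * (t - s) = - (8^-1 * s) + 8^-1 * t by ring.
  by have := ler_wpM2r (expR_ge0 (8^-1 * t)) P; rewrite -!mulrA -!expRD addNr expR0 mulr1.
have := expR_ge1Dx (8^-1 * (t - s)).
rewrite -(ler_pM2l m0) => P3.
have E : m * (1 + 8^-1 * (t - s)) = m + (M - 2 * ep).
  by rewrite /t; field; rewrite gt_eqF.
have := HM t; have := ler_norm (G t); lra.
Qed.

End SegmentIntegral.

(** * The weighted inequality on the plane *)

Section Plane.
Context {R : realType}.
Implicit Types (e P Q : R -> R -> R -> R).

(** The scale 64 is chosen so that [|kw'| <= kw / 8], an instance of [(|t|/8 - 1)^2 >= 0]. The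
    weight still tends to 0, with [r kw(r) <= 64] for [r >= 1], and so do the boundary terms at
    [t = r] and [t = -r]. *)
Definition kw (t : R) : R := (1 + 64^-1 * (t * t))^-1.
Definition dkw (t : R) : R := - (32^-1 * t) * (kw t * kw t).

Lemma kw_den (t : R) : 0 < 1 + 64^-1 * (t * t).
Proof. by rewrite ltr_wpDr // mulr_ge0 // -expr2 sqr_ge0. Qed.

Lemma kw_gt0 t : 0 < kw t.
Proof. by rewrite invr_gt0 kw_den. Qed.

Lemma kw_derive (t : R) : is_derive t 1 kw (dkw t).
Proof.
have D1 : is_derive t 1 (fun t : R => t * t) (1 * t + t * 1).
  exact: is_derive_mul (is_derive_id t 1) (is_derive_id t 1).
have D2 : is_derive t 1 (fun t : R => 1 + 64^-1 * (t * t)) (0 + 64^-1 * (1 * t + t * 1)).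
  by apply: is_deriveD; apply: is_deriveZ.
have H := is_deriveV (f := fun t : R => 1 + 64^-1 * (t * t)) (lt0r_neq0 (kw_den t)) D2.
apply: is_derive_val H _.
rewrite /dkw /kw -[LHS]/(- (1 + 64^-1 * (t * t)) ^- 2 * (0 + 64^-1 * (1 * t + t * 1))); field.
by have := lt0r_neq0 (kw_den t); apply: contra => /eqP E; apply/eqP; lra.
Qed.

Lemma kw_cont : continuous kw.
Proof.
by move=> t; apply: differentiable_continuous; apply/derivable1_diffP; have [] := kw_derive t.
Qed.

Lemma dkw_cont : continuous dkw.
Proof.
move=> t; apply: cvgM; last by apply: cvgM; exact: kw_cont.
by apply: cvgN; apply: cvgM; [exact: cvg_cst|exact: cvg_id].
Qed.

Lemma dkw_le t : `|dkw t| <= 8^-1 * kw t.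
Proof.
have k0 := kw_gt0 t; have d0 := kw_den t.
rewrite /dkw normrM normrN normrM (ger0_norm (_ : 0 <= 32^-1)) // [`|kw t * kw t|]ger0_norm; last by rewrite mulr_ge0 // ltW.
rewrite mulrA ler_pM2r // /kw ler_pdivrMr //.
have E : t * t = `|t| * `|t| by rewrite -normrM ger0_norm // -expr2 sqr_ge0.
have : 0 <= (`|t| * 8^-1 - 1) ^+ 2 by exact: sqr_ge0.
rewrite expr2 E; move: `|t| => u; lra.
Qed.

Lemma kwN t : kw (- t) = kw t.
Proof. by rewrite /kw mulrNN. Qed.

Definition jc (f : R -> R -> R -> R) := continuous (fun z : R * (R * R) => f z.1 z.2.1 z.2.2).
Definition bar (f : R -> R -> R -> R) s t := Int 0 1 (fun tau => f tau s t).

Lemma jc_slice f s t : jc f -> continuous (fun tau => f tau s t).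
Proof. by move=> cf; exact: (@cont_slice R (R * R)%type (fun u q => f u q.1 q.2) (s, t) cf). Qed.

Lemma bar_cont f : jc f -> continuous (fun q : R * R => bar f q.1 q.2).
Proof. by move=> cf; exact: (@Int_cont R 0 1 (R * R)%type (fun u q => f u q.1 q.2) ler01 cf). Qed.

Lemma bar_cont2 f s : jc f -> continuous (bar f s).
Proof.
move=> /bar_cont cf t; apply: (@continuous_comp _ _ _ (fun t => (s, t)) (fun q : R * R => bar f q.1 q.2)); last exact: cf.
exact: (cvg_pair (cvg_cst s) cvg_id).
Qed.

Lemma kbar_cont f s : jc f -> continuous (fun t => kw t * bar f s t).
Proof. by move=> cf t; apply: cvgM; [exact: kw_cont|exact: bar_cont2]. Qed.

Lemma kbar_jcont f : jc f -> continuous (fun z : R * R => kw z.1 * bar f z.2 z.1).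
Proof.
move=> cf z; apply: cvgM.
  by apply: (@continuous_comp _ _ _ fst kw); [exact: cvg_fst|exact: kw_cont].
apply: (@continuous_comp _ _ _ (fun z : R * R => (z.2, z.1)) (fun q : R * R => bar f q.1 q.2)); last exact: bar_cont.
exact: (cvg_pair cvg_snd cvg_fst).
Qed.

Lemma bar_derive1 (f df : R -> R -> R -> R) (s t : R) : jc f -> jc df ->
  (forall tau s t : R, is_derive s 1 (fun s => f tau s t) (df tau s t)) ->
  is_derive s 1 (fun s => bar f s t) (bar df s t).
Proof.
move=> cf cdf D; apply: (@Int_leibniz R 0 1 (fun u s => f u s t) (fun u s => df u s t)) => //.
  by move=> y; exact: jc_slice.
move=> z; apply: (@continuous_comp _ _ _ (fun z : R * R => (z.1, (z.2, t))) (fun z : R * (R * R) => df z.1 z.2.1 z.2.2)); last exact: cdf.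
exact: (cvg_pair cvg_fst (cvg_pair cvg_snd (cvg_cst t))).
Qed.

Lemma bar_derive2 (f df : R -> R -> R -> R) (s t : R) : jc f -> jc df ->
  (forall tau s t : R, is_derive t 1 (f tau s) (df tau s t)) ->
  is_derive t 1 (bar f s) (bar df s t).
Proof.
move=> cf cdf D; apply: (@Int_leibniz R 0 1 (fun u t => f u s t) (fun u t => df u s t)) => //.
  by move=> y; exact: jc_slice.
move=> z; apply: (@continuous_comp _ _ _ (fun z : R * R => (z.1, (s, z.2))) (fun z : R * (R * R) => df z.1 z.2.1 z.2.2)); last exact: cdf.
exact: (cvg_pair cvg_fst (cvg_pair (cvg_cst s) cvg_snd)).
Qed.

Let abs_sub_le (x y c : R) : `|x| <= c -> `|y| <= c -> y - x <= 2 * c.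
Proof. by rewrite !ler_norml => /andP[? ?] /andP[? ?]; lra. Qed.
Let half_lt (x y : R) : `|x - y| < y / 2 -> y / 2 < x.
Proof. by rewrite ltr_norml => /andP[? ?]; lra. Qed.
Let square_le (x : R) : x <= x * x -> x <= 64 * (1 + 64^-1 * (x * x)).
Proof. lra. Qed.
Let no_gap (u v w c : R) : u < v -> v <= c -> u = w + c -> 0 < w -> False.
Proof. lra. Qed.

Section Vanishing.
Variables (e P Pt Q Qs Z Zt S St : R -> R -> R -> R) (M : R).
Hypotheses (ce : jc e) (cP : jc P) (cPt : jc Pt) (cQ : jc Q) (cQs : jc Qs)
  (cZ : jc Z) (cZt : jc Zt) (cS : jc S) (cSt : jc St).
Hypothesis dP : forall tau s t : R, is_derive t 1 (P tau s) (Pt tau s t).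
Hypothesis dQ : forall tau s t : R, is_derive s 1 (fun s => Q tau s t) (Qs tau s t).
Hypothesis dZ : forall tau s t : R, 0 < tau < 1 -> is_derive tau 1 (fun tau => Z tau s t) (Zt tau s t).
Hypothesis dS : forall tau s t : R, 0 < tau < 1 -> is_derive tau 1 (fun tau => S tau s t) (St tau s t).
Hypothesis Z01 : forall s t, Z 0 s t = 0 /\ Z 1 s t = 0.
Hypothesis S01 : forall s t, S 0 s t = 0 /\ S 1 s t = 0.
Hypothesis e_bd : forall tau s t, 0 <= tau <= 1 -> 0 <= e tau s t <= M.
Hypothesis e_le : forall tau s t, 0 <= tau <= 1 -> e tau s t <= 2 * (Pt tau s t + Qs tau s t + Zt tau s t).
Hypothesis P_le : forall tau s t, 0 <= tau <= 1 -> `|P tau s t| <= St tau s t + 2 * e tau s t.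
Hypothesis Q_le : forall tau s t, 0 <= tau <= 1 -> `|Q tau s t| <= St tau s t + 2 * e tau s t.

Let csl f (s t : R) : jc f -> continuous (fun tau : R => f tau s t).
Proof. exact: jc_slice. Qed.

Lemma bar_Zt s t : bar Zt s t = 0.
Proof.
rewrite /bar (Int_FTC (F := fun tau => Z tau s t) ltr01) ?(Z01 s t).1 ?(Z01 s t).2 ?subrr //; try exact: jc_slice.
Qed.

Lemma bar_St s t : bar St s t = 0.
Proof.
rewrite /bar (Int_FTC (F := fun tau => S tau s t) ltr01) ?(S01 s t).1 ?(S01 s t).2 ?subrr //; try exact: jc_slice.
Qed.

Lemma bar_e_bd s t : 0 <= bar e s t <= M.
Proof.
apply/andP; split; first by apply: Int_ge0 => x /(e_bd s t)/andP[].
have -> : M = Int 0 1 (fun _ : R => M) by rewrite Int_cst ?ler01 // subr0 mulr1.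
apply: Int_le; [exact: jc_slice|by move=> x; exact: cvg_cst|].
by move=> x /(e_bd s t)/andP[].
Qed.

Lemma bar_e_le s t : bar e s t <= 2 * (bar Pt s t + bar Qs s t).
Proof.
have c1 := @csl Pt s t cPt; have c2 := @csl Qs s t cQs; have c3 := @csl Zt s t cZt.
have c12 : continuous (fun tau => Pt tau s t + Qs tau s t) by move=> x; apply: cvgD; [exact: c1|exact: c2].
have c123 : continuous (fun tau => Pt tau s t + Qs tau s t + Zt tau s t) by move=> x; apply: cvgD; [exact: c12|exact: c3].
rewrite -[X in 2 * X]addr0 -(bar_Zt s t) /bar -IntD // -IntD // -IntZ //.
apply: Int_le; [exact: jc_slice|by move=> x; apply: cvgM; [exact: cvg_cst|exact: c123]|].
by move=> x; exact: e_le.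
Qed.

(** Integration over [tau] removes the derivative of [S], which vanishes at both ends; this turns
    the pointwise bounds on the fluxes into bounds by the energy alone. *)
Lemma bar_abs_le F s t : jc F -> (forall tau, 0 <= tau <= 1 -> `|F tau s t| <= St tau s t + 2 * e tau s t) ->
  `|bar F s t| <= 2 * bar e s t.
Proof.
move=> cF H; have c1 := @csl F s t cF; have c2 := @csl St s t cSt; have c3 := @csl e s t ce.
have c3' : continuous (fun tau => 2 * e tau s t) by move=> x; apply: cvgM; [exact: cvg_cst|exact: c3].
have c4 : continuous (fun tau => St tau s t + 2 * e tau s t) by move=> x; apply: cvgD; [exact: c2|exact: c3'].
have -> : 2 * bar e s t = Int 0 1 (fun tau => St tau s t + 2 * e tau s t).
  by rewrite IntD // IntZ // -/(bar St s t) bar_St add0r.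
rewrite ler_norml; apply/andP; split.
  rewrite -mulN1r -IntZ //; apply: Int_le => // [|x /H]; last by rewrite mulN1r ler_norml => /andP[].
  by move=> x; apply: cvgM; [exact: cvg_cst|exact: c4].
by apply: Int_le => // x /H; rewrite ler_norml => /andP[].
Qed.

Section Radius.
Variable r : R.
Hypothesis r0 : 0 < r.
Let rr : - r <= r.
Proof. by apply: (@le_trans _ _ 0); rewrite ?oppr_le0 ltW. Qed.

Let a s := Int (- r) r (fun t => kw t * bar e s t).
Let G s := Int (- r) r (fun t => kw t * bar Q s t).
Let dG s := Int (- r) r (fun t => kw t * bar Qs s t).

Lemma dG_derive (s : R) : is_derive s 1 G (dG s).
Proof.
apply: (@Int_leibniz R (- r) r (fun t s => kw t * bar Q s t) (fun t s => kw t * bar Qs s t)) => //.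
- by move=> y; exact: kbar_cont.
- exact: kbar_jcont.
- by move=> t y; apply: is_deriveZ; exact: bar_derive1.
Qed.

(** Integrate the energy inequality against the weight and integrate [P_t] by parts. The boundary
    terms are at most [4 M kw(r)], the term with [kw'] is at most a quarter of [a]. Hence
    [a <= 8 M kw(r) + a/2 + 2 G'], and half of [a] is absorbed. *)
Lemma a_le s : a s <= 16 * M * kw r + 4 * dG s.
Proof.
have ck f : jc f -> continuous (fun t => kw t * bar f s t) by move=> cf; exact: kbar_cont.
have cdP : continuous (fun t => dkw t * bar P s t) by move=> t; apply: cvgM; [exact: dkw_cont|exact: bar_cont2].
have h1 : a s <= 2 * (Int (- r) r (fun t => kw t * bar Pt s t) + dG s).
  have cs : continuous (fun t => kw t * bar Pt s t + kw t * bar Qs s t) by move=> t; apply: cvgD; exact: ck.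
  rewrite /dG -IntD; [|exact: ck|exact: ck]; rewrite -IntZ //.
  apply: Int_le; [exact: ck|by move=> t; apply: cvgM; [exact: cvg_cst|exact: cs]|].
  by move=> t _; rewrite -mulrDr mulrCA ler_pM2l ?kw_gt0 //; exact: bar_e_le.
have h2 : Int (- r) r (fun t => dkw t * bar P s t) + Int (- r) r (fun t => kw t * bar Pt s t) =
    kw r * bar P s r - kw r * bar P s (- r).
  have cs : continuous (fun t => dkw t * bar P s t + kw t * bar Pt s t).
    by move=> t; apply: cvgD; [exact: cdP|exact: ck].
  rewrite -IntD //; last exact: ck.
  rewrite -[in X in _ = _ - X]kwN; apply: (Int_FTC (F := fun t => kw t * bar P s t)); [by apply: (@lt_trans _ _ 0); rewrite ?oppr_lt0|exact: cs|exact: ck|].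
  move=> t _; exact: (is_derive_mul (kw_derive t) (bar_derive2 s t cP cPt dP)).
have h3 : - Int (- r) r (fun t => dkw t * bar P s t) <= 4^-1 * a s.
  rewrite -mulN1r -!IntZ //; last exact: ck.
  apply: Int_le; [by move=> t; apply: cvgM; [exact: cvg_cst|exact: cdP]|by move=> t; apply: cvgM; [exact: cvg_cst|exact: ck]|].
  move=> t _; rewrite mulN1r; apply: le_trans (ler_norm _) _; rewrite normrN normrM.
  have := dkw_le t; have := bar_abs_le cP (fun tau => @P_le tau s t).
  have k0 := kw_gt0 t => h h'.
  apply: le_trans (ler_pM (normr_ge0 _) (normr_ge0 _) h' h) _.
  have -> : 8^-1 * kw t * (2 * bar e s t) = 4^-1 * (kw t * bar e s t) by field.
  exact: lexx.
have h4 t : `|bar P s t| <= 2 * M.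
  by apply: le_trans (bar_abs_le cP (fun tau => @P_le tau s t)) _; rewrite ler_pM2l //; have /andP[] := bar_e_bd s t.
have h5 : kw r * bar P s r - kw r * bar P s (- r) <= kw r * (4 * M).
  rewrite -mulrBr ler_pM2l ?kw_gt0 //; apply: le_trans (abs_sub_le (h4 (- r)) (h4 r)) _; by rewrite mulrA -natrM.
have -> : 16 * M * kw r = 4 * (kw r * (4 * M)) by ring.
lra.
Qed.

Lemma G_le s : `|G s| <= 2 * a s.
Proof.
have ck f : jc f -> continuous (fun t => kw t * bar f s t) by move=> cf; exact: kbar_cont.
have H t : `|kw t * bar Q s t| <= 2 * (kw t * bar e s t).
  rewrite normrM (ger0_norm (ltW (kw_gt0 t))) mulrCA ler_pM2l ?kw_gt0 //.
  by apply: bar_abs_le => // tau; exact: Q_le.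
have c2 : continuous (fun t => 2 * (kw t * bar e s t)) by move=> t; apply: cvgM; [exact: cvg_cst|exact: ck].
rewrite -IntZ; last exact: ck.
rewrite ler_norml; apply/andP; split.
  rewrite -mulN1r -IntZ //; apply: Int_le; [by move=> t; apply: cvgM; [exact: cvg_cst|exact: c2]|exact: ck|].
  by move=> t _; rewrite mulN1r; have := H t; rewrite ler_norml => /andP[].
by apply: Int_le => //; [exact: ck|move=> t _; have := H t; rewrite ler_norml => /andP[]].
Qed.

(** [G_le] and [a_le] give the hypothesis of [growth] with [ep = 16 M kw(r)]; it is applied to [G]
    and to the reflected function [-G(-s)]. The crude bound [bd] grows with [r], but its size is
    irrelevant for [growth]. *)
Lemma G_bound s : `|G s| <= 32 * M * kw r.
Proof.
have M0 : 0 <= M by have /andP[h1 h2] := bar_e_bd s 0; exact: le_trans h1 h2.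
have k1 t : kw t <= 1.
  by rewrite invf_le1 ?kw_den // lerDl mulr_ge0 // -expr2 sqr_ge0.
have bd s' : `|G s'| <= 2 * M * (r - - r).
  apply: Int_abs => // [|t _]; first exact: kbar_cont.
  rewrite normrM (ger0_norm (ltW (kw_gt0 t))) -[leRHS]mul1r; apply: ler_pM => //; first exact: ltW (kw_gt0 _).
  apply: le_trans (bar_abs_le cQ (fun tau => @Q_le tau s' t)) _; rewrite ler_pM2l //.
  by have /andP[] := bar_e_bd s' t.
have HG s' : `|G s'| <= 2 * (16 * M * kw r) + 8 * dG s'.
  have := G_le s'; have := a_le s'; lra.
have -> : 32 * M * kw r = 2 * (16 * M * kw r) by ring.
rewrite ler_norml lerNl; apply/andP; split; last exact: (growth dG_derive HG bd).
have D s' : is_derive (s' : R) 1 (fun s => - G (- s)) (dG (- s')).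
  have D0 : is_derive s' 1 (fun s : R => - s) (- 1) by apply: is_deriveN.
  have D1 := is_derive1_comp (dG_derive (- s')) D0.
  have D2 := is_deriveN D1.
  by apply: is_derive_val D2 _; rewrite mulrN1 opprK.
have Hm1 s' : `|- G (- s')| <= 2 * (16 * M * kw r) + 8 * dG (- s') by rewrite normrN; exact: HG.
have Hm2 s' : `|- G (- s')| <= 2 * M * (r - - r) by rewrite normrN; exact: bd.
by have := growth D Hm1 Hm2 (- s); rewrite (opprK s).
Qed.

(** On an interval of length [h] the function [G] varies by at most [64 M kw(r)], so by the mean
    value theorem its derivative is small at some point, where [a_le] bounds [a]. *)
Lemma a_small s h : 0 < h -> exists2 x, s <= x <= s + h & a x <= (16 + 256 / h) * M * kw r.
Proof.
move=> h0; have cG : continuous G.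
  by move=> t; apply: differentiable_continuous; apply/derivable1_diffP; have [] := dG_derive t.
have sh : s <= s + h by lra.
have [x] := MVT_segment sh (fun t _ => dG_derive t) (continuous_subspaceT cG).
rewrite in_itv /= addrAC subrr add0r => xs E; exists x => //.
have h1 := G_bound s; have h2 := G_bound (s + h).
have h3 : dG x * h <= 64 * M * kw r by rewrite -E; apply: le_trans (abs_sub_le h1 h2) _; rewrite !mulrA -natrM.
have h4 : dG x <= 64 * M * kw r / h by rewrite ler_pdivlMr.
have -> : (16 + 256 / h) * M * kw r = 16 * M * kw r + 4 * (64 * M * kw r / h) by field; rewrite gt_eqF.
by apply: le_trans (a_le x) _; rewrite lerD2l ler_pM2l.
Qed.

End Radius.

(** If [e] were positive somewhere, its weighted integral over a fixed segment in [t] would stay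
    above a positive constant for all nearby [s]. For large [r] one of these [s] has an integral
    over the longer segment of order [kw(r)], which is smaller. *)
Lemma plane_vanishing tau s t : 0 <= tau <= 1 -> e tau s t = 0.
Proof.
move=> t01; apply/eqP; rewrite eq_le; have /andP[e0 _] := e_bd s t t01; rewrite e0 andbT leNgt; apply/negP => epos.
have E0 : 0 < bar e s t.
  apply: (Int_pos ltr01 t01) => //; first exact: jc_slice.
  by move=> x /(e_bd s t)/andP[].
have M0 : 0 <= M by have /andP[h1 h2] := bar_e_bd s 0; exact: le_trans h1 h2.
pose r0 := `|t| + 1.
have r0_gt0 : 0 < r0 by rewrite ltr_wpDl.
pose A s := Int (- r0) r0 (fun t => kw t * bar e s t).
have A0 : 0 < A s.
  apply: (@Int_pos _ _ _ _ t); [lra| |exact: kbar_cont| |by rewrite mulr_gt0 ?kw_gt0].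
    by rewrite -ler_norml /r0 lerDl.
  by move=> x _; rewrite mulr_ge0 ?(ltW (kw_gt0 _)) //; have /andP[] := bar_e_bd s x.
have cA : continuous A.
  by apply: (@Int_cont R (- r0) r0 R (fun t s => kw t * bar e s t)); [lra|exact: kbar_jcont].
have [d d0 Hd] := cont_eps s cA (divr_gt0 A0 (ltr0Sn _ 1)).
pose h := d / 2; have h0 : 0 < h by rewrite divr_gt0.
(* As [r kw(r) <= 64], the integral at the point from [a_small] times [r] is at most [K]; [r] is
   then taken so large that [A s / 2] times [r] exceeds [K]. *)
pose K := (16 + 256 / h) * M * 64.
have h16 : 0 <= 16 + 256 / h by exact: addr_ge0 (ler0n _ _) (divr_ge0 (ler0n _ _) (ltW h0)).
have hM : 0 <= (16 + 256 / h) * M by exact: mulr_ge0.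
have K0 : 0 <= K by exact: mulr_ge0 hM (ler0n _ _).
pose r := r0 + K / (A s / 2).
have rr0 : r0 <= r by rewrite lerDl divr_ge0 // divr_ge0 // ltW.
have r_gt0 : 0 < r by exact: lt_le_trans rr0.
have r_ge1 : 1 <= r by apply: le_trans rr0; rewrite /r0 lerDr.
have [x /andP[sx xs] ax] := a_small r_gt0 s h0.
have h1 : A s / 2 < A x.
  have : `|A x - A s| < A s / 2 by apply: Hd; rewrite ger0_norm ?subr_ge0 // /h in xs *; lra.
  exact: half_lt.
have h2 : A x <= (16 + 256 / h) * M * kw r.
  apply: le_trans ax; apply: Int_sub => //; [lra|exact: kbar_cont|].
  by move=> y _; rewrite mulr_ge0 ?(ltW (kw_gt0 _)) //; have /andP[] := bar_e_bd x y.
have h3 : kw r * r <= 64.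
  rewrite mulrC ler_pdivrMr ?kw_den //.
  have : r <= r * r by exact: ler_peMr (ltW r_gt0) r_ge1.
  exact: square_le.
have h4 : A s / 2 * r < (16 + 256 / h) * M * kw r * r by rewrite ltr_pM2r //; exact: lt_le_trans h2.
have h5 : (16 + 256 / h) * M * kw r * r <= K.
  by rewrite -mulrA; exact: ler_wpM2l hM _ _ h3.
have h6 : A s / 2 * r = A s / 2 * r0 + K by rewrite /r mulrDr [X in _ + X]mulrCA divff ?mulr1 // lt0r_neq0 // divr_gt0.
have h7 := mulr_gt0 (divr_gt0 A0 (ltr0Sn R 1)) r0_gt0.
exact: no_gap h4 h5 h6 h7.
Qed.

End Vanishing.
End Plane.

(** * From the closed strip to functions of three real variables *)

Section Clamped.
Context {R : realType}.

Definition v3 (a b c : R) : 'cV[R]_3 := \col_k [:: a; b; c]`_k.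

Lemma v3E a b c : ((v3 a b c) 0 0 = a) * ((v3 a b c) 1 0 = b) * ((v3 a b c) 2 0 = c).
Proof. by rewrite !mxE. Qed.

Lemma v3_eta (z : 'cV[R]_3) : v3 (z 0 0) (z 1 0) (z 2 0) = z.
Proof.
apply/matrixP => k j; rewrite ord1 mxE.
by case: k => [[|[|[|//]]] h] /=; congr (z _ 0); exact: val_inj.
Qed.

Lemma sum3 (F : 'I_3 -> R) : \sum_j F j = F 0 + F 1 + F 2.
Proof.
rewrite !big_ord_recl big_ord0 addr0 addrA; congr (_ + F _ + F _); exact: val_inj.
Qed.

Lemma vec2_eta (z : 'cV[R]_2) : vec2 (z 0 0) (z 1 0) = z.
Proof.
apply/matrixP => k j; rewrite ord1 mxE.
by case: k => [[|[|//]] h] /=; congr (z _ 0); exact: val_inj.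
Qed.

Definition cl (tau : R) : R := val (clamp tau).

Lemma cl_in tau : 0 <= cl tau <= 1.
Proof. by rewrite /cl /=; exact: clamp_subproof. Qed.

Lemma cl_id tau : 0 <= tau <= 1 -> cl tau = tau.
Proof. by rewrite /cl /= => /andP[t0 t1]; rewrite (min_idPl t1) (max_idPr t0). Qed.

Lemma clampK (x : interval01 R) : clamp (val x) = x.
Proof. by apply: val_inj; exact: cl_id (valP x). Qed.

Lemma cl_lip x y : `|cl x - cl y| <= `|x - y|.
Proof.
rewrite /cl /= /Num.max /Num.min.
have h1 := ler_norm (x - y); have h2 := ler_norm (y - x); have h0 := normr_ge0 (x - y).
move: h1 h2 h0; rewrite [`|y - x|]distrC; move: `|x - y| => u h1 h2 h0.
case: (ltP x 1) => hx; case: (ltP y 1) => hy; rewrite ?ltr01;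
  try (case: (ltP 0 x) => hx'); try (case: (ltP 0 y) => hy');
  by rewrite ler_norml; apply/andP; split; lra.
Qed.

Let B : set 'cV[R]_3 := [set z : 'cV[R]_3 | unit_itv (z 0 0)].
(** Clamping extends a function on the strip to all [tau], keeping joint continuity everywhere and
    the derivatives in [s] and [t]. The derivative in [tau] is claimed only in the open interval,
    which is all that the fundamental theorem of calculus asks for. *)
Definition clf (F : 'cV[R]_3 -> R) : R -> R -> R -> R := fun tau s t => F (v3 (cl tau) s t).

Lemma cl_B tau s t : B (v3 (cl tau) s t).
Proof. by rewrite /B /= v3E; exact: cl_in. Qed.

Lemma norm_v3 (a b c a' b' c' e : R) : 0 < e -> `|a - a'| < e -> `|b - b'| < e -> `|c - c'| < e ->
  `|v3 a b c - v3 a' b' c'| < e.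
Proof.
move=> e0 h1 h2 h3; apply: mxnorm_lt => // i j; rewrite ord1 !mxE.
by case: i => [[|[|[|//]]] h] /=.
Qed.

Lemma jc_clf F : {within B, continuous F} -> jc (clf F).
Proof.
move=> /cont_withinP cF [tau [s t]]; apply/cvgrPdist_lt => e e0.
have [r r0 H] := cF _ (cl_B tau s t) e e0.
exists (ball tau r, ball (s, t) r); first by split; exact: nbhsx_ballx.
move=> [tau' [s' t']] /= [h1 [h2 h3]]; rewrite distrC; apply: H; first exact: cl_B.
move: h1 h2 h3; rewrite -!ball_normE /= => h1 h2 h3.
apply: norm_v3 => //; rewrite 1?distrC //.
exact: le_lt_trans (cl_lip _ _) h1.
Qed.

Lemma v3_shift0 a b c (t : R) : v3 a b c + t *: delta_mx 0 0 = v3 (a + t) b c.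
Proof.
apply/matrixP => k j; rewrite ord1 !mxE.
by case: k => [[|[|[|//]]] h] /=; rewrite ?mulr1 ?mulr0 ?addr0.
Qed.
Lemma v3_shift1 a b c (t : R) : v3 a b c + t *: delta_mx 1 0 = v3 a (b + t) c.
Proof.
apply/matrixP => k j; rewrite ord1 !mxE.
by case: k => [[|[|[|//]]] h] /=; rewrite ?mulr1 ?mulr0 ?addr0.
Qed.
Lemma v3_shift2 a b c (t : R) : v3 a b c + t *: delta_mx 2 0 = v3 a b (c + t).
Proof.
apply/matrixP => k j; rewrite ord1 !mxE.
by case: k => [[|[|[|//]]] h] /=; rewrite ?mulr1 ?mulr0 ?addr0.
Qed.

Lemma delta_sum (k : 'I_3) (G : 'I_3 -> R) : \sum_j (delta_mx k 0 : 'cV[R]_3) j 0 * G j = G k.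
Proof. by have := sum_delta k 1 G; rewrite scale1r mul1r. Qed.

Lemma clf_derive2 F tau s (t : R) : Ck 1 B F -> is_derive t 1 (clf F tau s) (clf (partial B F 2) tau s t).
Proof.
move=> CF; have D := Ck_diff (@cornered_strip R 3 0) CF (cl_B tau s t).
have := @line_is_derive R 3 B F (v3 (cl tau) s 0) (delta_mx 2 0) t (fun j => partial B F j (v3 (cl tau) s t)).
rewrite v3_shift2 add0r delta_sum => /(_ D) H; have {}H := H _.
have -> : clf F tau s = (fun t' => F (v3 (cl tau) s 0 + t' *: delta_mx 2 0)).
  by apply/funext => t'; rewrite v3_shift2 add0r.
by apply: H; exists 1 => // t' _; rewrite v3_shift2; exact: cl_B.
Qed.

Lemma clf_derive1 F tau (s : R) t : Ck 1 B F ->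
  is_derive s 1 (fun s => clf F tau s t) (clf (partial B F 1) tau s t).
Proof.
move=> CF; have D := Ck_diff (@cornered_strip R 3 0) CF (cl_B tau s t).
have := @line_is_derive R 3 B F (v3 (cl tau) 0 t) (delta_mx 1 0) s (fun j => partial B F j (v3 (cl tau) s t)).
rewrite v3_shift1 add0r delta_sum => /(_ D) H; have {}H := H _.
have -> : (fun s => clf F tau s t) = (fun t' => F (v3 (cl tau) 0 t + t' *: delta_mx 1 0)).
  by apply/funext => t'; rewrite v3_shift1 add0r.
by apply: H; exists 1 => // t' _; rewrite v3_shift1; exact: cl_B.
Qed.

Lemma strip_near_tau (tau : R) : 0 < tau < 1 -> exists2 r : R, 0 < r & forall t', `|t' - tau| < r -> 0 <= t' <= 1.
Proof.
move=> /andP[t0 t1]; exists (Num.min tau (1 - tau)); first by rewrite lt_min t0 subr_gt0.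
by move=> t'; rewrite lt_min !ltr_norml => /andP[/andP[? ?] /andP[? ?]]; lra.
Qed.

Lemma clf_derive0 (F : 'cV[R]_3 -> R) (tau : R) s t : Ck 1 B F -> 0 < tau < 1 ->
  is_derive tau 1 (fun tau => clf F tau s t) (clf (partial B F 0) tau s t).
Proof.
move=> CF t01; have [r r0 Hr] := strip_near_tau t01.
have t01' : 0 <= tau <= 1 by case/andP: t01 => *; lra.
rewrite /clf (cl_id t01').
apply: is_derive_eps => e e0.
have [r' r0' H'] : exists2 r : R, 0 < r & forall y, `|y - tau| < r ->
    `|F (v3 y s t) - F (v3 tau s t) - partial B F 0 (v3 tau s t) * (y - tau)| <= e * `|y - tau|.
  have Bz : B (v3 tau s t) by rewrite /B /= v3E.
  have /diff_withinP /(_ e e0)[q q0 Hq] := Ck_diff (@cornered_strip R 3 0) CF Bz.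
  exists (Num.min q r); first by rewrite lt_min q0.
  move=> y; rewrite lt_min => /andP[yq yr].
  have Ey : v3 y s t - v3 tau s t = (y - tau) *: delta_mx 0 0.
    apply/matrixP => k j; rewrite ord1 !mxE.
    by case: k => [[|[|[|//]]] h] /=; rewrite ?mulr1 ?mulr0 ?subrr.
  have nd : `|v3 y s t - v3 tau s t| <= `|y - tau| by rewrite Ey; exact: norm_delta.
  have := Hq (v3 y s t) _ (le_lt_trans nd yq).
  rewrite (eq_bigr (fun j => (v3 y s t - v3 tau s t) j 0 *: partial B F j (v3 tau s t))); last by move=> j _; rewrite !mxE.
  rewrite Ey (sum_delta 0 (y - tau) (fun j => partial B F j (v3 tau s t))) [(y - tau) * _]mulrC => Hq'.
  apply: le_trans (Hq' _) _; first by rewrite /B /= v3E; exact: Hr.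
  by rewrite ler_pM2l //; rewrite -Ey.
exists (Num.min r' r); first by rewrite lt_min r0'.
move=> y; rewrite lt_min => /andP[yr' yr].
by rewrite !cl_id //; [exact: H'|exact: Hr].
Qed.

Lemma strip_zero (E P Q Z S : 'cV[R]_3 -> R) (M : R) :
  [/\ Ck 1 B E, Ck 1 B P, Ck 1 B Q, Ck 1 B Z & Ck 1 B S] ->
  (forall z, B z -> 0 <= E z /\ E z <= 2 * (partial B P 2 z + partial B Q 1 z + partial B Z 0 z)) ->
  (forall z, B z -> `|P z| <= partial B S 0 z + 2 * E z /\ `|Q z| <= partial B S 0 z + 2 * E z) ->
  (forall z, B z -> z 0 0 = 0 \/ z 0 0 = 1 -> S z = 0 /\ Z z = 0) ->
  (forall z, B z -> E z <= M) -> forall z, B z -> E z = 0.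
Proof.
move=> [CE CP CQ CZ CS] HE HPQ H01 HM z Bz.
have cont F : Ck 1 B F -> jc (clf F) by move=> /Ck_cont; exact: jc_clf.
have pcont F k : Ck 1 B F -> jc (clf (partial B F k)) by move=> /(Ck_partial k); exact: jc_clf.
have c0 : cl 0 = 0 :> R by rewrite cl_id // lexx ler01.
have c1 : cl 1 = 1 :> R by rewrite cl_id // lexx ler01.
have b0 s t : B (v3 0 s t) by rewrite -c0; exact: cl_B.
have b1 s t : B (v3 1 s t) by rewrite -c1; exact: cl_B.
rewrite -[z]v3_eta -[z 0 0](cl_id Bz) -/(clf E _ _ _).
apply: (@plane_vanishing R (clf E) (clf P) (clf (partial B P 2)) (clf Q) (clf (partial B Q 1))
  (clf Z) (clf (partial B Z 0)) (clf S) (clf (partial B S 0)) M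
  (cont _ CE) (cont _ CP) (pcont _ _ CP) (cont _ CQ) (pcont _ _ CQ) (cont _ CZ) (pcont _ _ CZ) (cont _ CS) (pcont _ _ CS)
  (fun tau s t => clf_derive2 tau s t CP) (fun tau s t => clf_derive1 tau s t CQ)
  (fun tau s t => clf_derive0 s t CZ) (fun tau s t => clf_derive0 s t CS) _ _ _ _ _ _ (z 0 0) (z 1 0) (z 2 0) Bz).
- by move=> s t; rewrite /clf c0 c1; split; [apply: (H01 _ (b0 s t) _).2|apply: (H01 _ (b1 s t) _).2]; rewrite v3E; [left|right].
- by move=> s t; rewrite /clf c0 c1; split; [apply: (H01 _ (b0 s t) _).1|apply: (H01 _ (b1 s t) _).1]; rewrite v3E; [left|right].
- by move=> tau s t _; rewrite (HE _ (cl_B _ _ _)).1; exact: HM (cl_B _ _ _).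
- by move=> tau s t _; exact: (HE _ (cl_B _ _ _)).2.
- by move=> tau s t _; exact: (HPQ _ (cl_B _ _ _)).1.
- by move=> tau s t _; exact: (HPQ _ (cl_B _ _ _)).2.
Qed.

End Clamped.

(** * Boundedness of the energy *)

Section Limits.
Context {R : realType}.

Lemma near_pinfty (P : R -> Prop) : (\forall s \near +oo, P s) ->
  exists2 S : R, 0 <= S & forall s, S < s -> P s.
Proof.
move=> [M [_ H]]; exists (Num.max 0 M); first by rewrite le_max lexx.
by move=> s; rewrite gt_max => /andP[_]; exact: H.
Qed.

Lemma near_ninfty (P : R -> Prop) : (\forall s \near -oo, P s) ->
  exists2 S : R, 0 <= S & forall s, s < - S -> P s.
Proof.
move=> [M [_ H]]; exists (Num.max 0 (- M)); first by rewrite le_max lexx.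
by move=> s; rewrite ltrNr gt_max => /andP[_]; rewrite ltrN2; exact: H.
Qed.

Lemma cont_vec2 : continuous (fun q : R * R => vec2 q.1 q.2).
Proof.
move=> [a b]; apply/cvgrPdist_lt => e e0.
exists (ball a e, ball b e); first by split; exact: nbhsx_ballx.
move=> [a' b'] [/= h1 h2]; move: h1 h2; rewrite -!ball_normE /= => h1 h2.
apply: mxnorm_lt => // i j; rewrite ord1 !mxE.
by case: i => [[|[|//]] h] /=.
Qed.

Lemma vec2E (a b : R) : ((vec2 a b) 0 0 = a) * ((vec2 a b) 1 0 = b).
Proof. by rewrite !mxE. Qed.

Lemma compact_box (a b c d : R) : compact [set z : 'cV[R]_2 | a <= z 0 0 <= b /\ c <= z 1 0 <= d].
Proof.
have -> : [set z : 'cV[R]_2 | a <= z 0 0 <= b /\ c <= z 1 0 <= d] = (fun q : R * R => vec2 q.1 q.2) @` (`[a, b] `*` `[c, d]).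
  apply/seteqP; split=> [z [h1 h2]|_ [[u v] [/= h1 h2] <-]]; last by rewrite /= !vec2E; rewrite in_itv in h1; rewrite in_itv in h2.
  by exists (z 0 0, z 1 0); [split; rewrite /= in_itv|rewrite /= vec2_eta].
apply: continuous_compact; first exact: continuous_subspaceT cont_vec2.
by apply: compact_setX; exact: segment_compact.
Qed.

Lemma jc_bounded (f : R -> R -> R -> R) (r : R) : jc f ->
  exists c : R, forall tau s t, 0 <= tau <= 1 -> - r <= s <= r -> - r <= t <= r -> `|f tau s t| <= c.
Proof.
move=> cf; have cpt : compact (`[0 : R, 1] `*` (`[- r, r] `*` `[- r, r])).
  by apply: compact_setX; [exact: segment_compact|apply: compact_setX; exact: segment_compact].
have := continuous_compact (continuous_subspaceT cf) cpt.
move=> /compact_bounded [M [_ HM]]; exists (M + 1) => tau s t h1 h2 h3.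
apply: (HM (M + 1)); first by rewrite ltrDl.
by exists (tau, (s, t)).
Qed.

Lemma bounded_strip (f : R -> R -> R -> R) (c0 S : R) : jc f -> 0 <= S -> 0 <= c0 ->
  (forall tau s t, 0 <= tau <= 1 -> S < s -> `|f tau s t - f tau (S + 1) t| <= 2) ->
  (forall tau s t, 0 <= tau <= 1 -> s < - S -> `|f tau s t - f tau (- (S + 1)) t| <= 2) ->
  (forall r : R, exists T : R, forall tau s t, 0 <= tau <= 1 -> - r <= s <= r -> T < `|t| -> `|f tau s t| <= c0) ->
  exists2 c : R, 0 <= c & forall tau s t, 0 <= tau <= 1 -> `|f tau s t| <= c.
Proof.
move=> cf S0 c00 Hp Hm HT; have [T HT'] := HT (S + 1).
have [c Hc] := @jc_bounded f (Num.max (S + 1) T) cf.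
have mid tau s t : 0 <= tau <= 1 -> - (S + 1) <= s <= S + 1 -> `|f tau s t| <= Num.max c0 c.
  move=> t01 /andP[s1 s2]; rewrite le_max; have [Tt|tT] := ltP T `|t|.
    by rewrite HT' ?s1 ?s2.
  apply/orP; right; apply: Hc => //.
    by rewrite le_max s2 andbT lerNl le_max lerNl s1.
  by rewrite -ler_norml le_max tT orbT.
exists (Num.max c0 c + 2); first by rewrite addr_ge0 // le_max c00.
move=> tau s t t01; have [Ss|sS] := ltP S s.
  have := Hp tau s t t01 Ss; have := mid tau (S + 1) t t01.
  rewrite lexx andbT => /(_ ltac:(lra)).
  have := ler_distD 0 (f tau s t) (f tau (S + 1) t); have := ler_normD (f tau s t - f tau (S + 1) t) (f tau (S + 1) t).
  rewrite subrK; lra.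
have [sS'|Ss] := ltP s (- S).
  have := Hm tau s t t01 sS'; have := mid tau (- (S + 1)) t t01.
  rewrite lexx => /(_ ltac:(lra)).
  have := ler_normD (f tau s t - f tau (- (S + 1)) t) (f tau (- (S + 1)) t).
  rewrite subrK; lra.
have := mid tau s t t01 _; lra.
Qed.

Lemma slice_partial (A : set 'cV[R]_2) (B : set 'cV[R]_3) (H : 'cV[R]_3 -> R) (a : 'cV[R]_2 -> 'cV[R]_3) z k D :
  cornered A -> A z -> (forall w, A w -> B (a w)) -> Ck 1 B H -> cornered B ->
  diff_within A a z D -> partial A (H \o a) k z = \sum_j D k j 0 * partial B H j (a z).
Proof.
move=> cA Az AB CH cB Da; have := diff_within_comp (Ck_diff cB CH (AB z Az)) Da AB.
by move/(partialE k cA Az).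
Qed.

Lemma diff_within_v3 (A : set 'cV[R]_2) (f0 f1 f2 : 'cV[R]_2 -> R) z D0 D1 D2 :
  diff_within A f0 z D0 -> diff_within A f1 z D1 -> diff_within A f2 z D2 ->
  diff_within A (fun w => v3 (f0 w) (f1 w) (f2 w)) z (fun k => v3 (D0 k) (D1 k) (D2 k)).
Proof.
move=> h0 h1 h2; apply/diff_within_mx => i j.
have E x y w : (v3 x y w) i j = [:: x; y; w]`_i by rewrite mxE.
have -> : (fun w => v3 (f0 w) (f1 w) (f2 w) i j) = (fun w => [:: f0 w; f1 w; f2 w]`_i) by apply/funext => w; rewrite E.
have -> : (fun k => v3 (D0 k) (D1 k) (D2 k) i j) = (fun k => [:: D0 k; D1 k; D2 k]`_i) by apply/funext => w; rewrite E.
by case: i {E} => [[|[|[|//]]] h].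
Qed.

End Limits.

(** * Test functions along a strip *)

Section BoundedTests.
Context {R : realType} {m : nat} {M : Type} (C : charted R m M).
Hypothesis nM : nice_charts C.
Hypothesis cover : forall y : M, exists i : cidx C, cdom i y.
Variable V : R -> R -> R -> M.
Let B : set 'cV[R]_3 := [set z : 'cV[R]_3 | unit_itv (z 0 0)].
Let Btt : set 'cV[R]_2 := [set z : 'cV[R]_2 | unit_itv (z 1 0)].
Let Bts : set 'cV[R]_2 := [set z : 'cV[R]_2 | unit_itv (z 0 0)].
Let V3 := fun z : 'cV[R]_3 => V (z 0 0) (z 1 0) (z 2 0).
Hypothesis HV : Ck_map C 2 B V3.
Variables (um up : R -> R -> M) (pm pp : M).
Hypothesis Hsm : C1_cvg C Btt Btt -oo (fun s z => V (z 1 0) s (z 0 0)) (fun z => um (z 0 0) (z 1 0)).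
Hypothesis Hsp : C1_cvg C Btt Btt +oo (fun s z => V (z 1 0) s (z 0 0)) (fun z => up (z 0 0) (z 1 0)).
Hypothesis Htm : C1_loc_cvg C Bts -oo (fun t z => V (z 0 0) (z 1 0) t) (fun=> pm).
Hypothesis Htp : C1_loc_cvg C Bts +oo (fun t z => V (z 0 0) (z 1 0) t) (fun=> pp).

Let cB : cornered B := @cornered_strip R 3 0.

Lemma Ck_map_leS d (A : set 'cV[R]_d) (u : 'cV[R]_d -> M) k : Ck_map C k.+1 A u -> Ck_map C k A u.
Proof.
by move=> H z i Az iz; have [r r0 [h1 h2]] := H z i Az iz; exists r => //; split=> //; exact: Ck_leS.
Qed.

Lemma Ck_test (h : M -> R) : smooth_fun C h -> Ck 1 B (h \o V3).
Proof. by move=> sh; apply: (comp_smooth_fun nM cB _ (Ck_map_leS HV) sh) => w _; exact: cover. Qed.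

Lemma slice_s (h : M -> R) s (z : 'cV[R]_2) : smooth_fun C h -> Btt z ->
  partial Btt (h \o (fun z => V (z 1 0) s (z 0 0))) 1 z = partial B (h \o V3) 0 (v3 (z 1 0) s (z 0 0)).
Proof.
move=> sh Bz.
have D := diff_within_v3 (diff_within_coord Btt 1 z) (diff_within_cst Btt s z) (diff_within_coord Btt 0 z).
have := @slice_partial R Btt B (h \o V3) (fun z => v3 (z 1 0) s (z 0 0)) z 1 _ (@cornered_strip R 2 1) Bz _ (Ck_test sh) cB D.
have -> : (h \o V3) \o (fun z : 'cV[R]_2 => v3 (z 1 0) s (z 0 0)) = h \o (fun z => V (z 1 0) s (z 0 0)).
  by apply/funext => w; rewrite /V3 /= !v3E.
move=> -> //; last by move=> w Bw; rewrite /B /= v3E.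
by rewrite sum3 !v3E /= !mul0r !addr0 mul1r.
Qed.

Lemma slice_t (h : M -> R) t (z : 'cV[R]_2) : smooth_fun C h -> Bts z ->
  partial Bts (h \o (fun z => V (z 0 0) (z 1 0) t)) 0 z = partial B (h \o V3) 0 (v3 (z 0 0) (z 1 0) t).
Proof.
move=> sh Bz.
have D := diff_within_v3 (diff_within_coord Bts 0 z) (diff_within_coord Bts 1 z) (diff_within_cst Bts t z).
have := @slice_partial R Bts B (h \o V3) (fun z => v3 (z 0 0) (z 1 0) t) z 0 _ (@cornered_strip R 2 0) Bz _ (Ck_test sh) cB D.
have -> : (h \o V3) \o (fun z : 'cV[R]_2 => v3 (z 0 0) (z 1 0) t) = h \o (fun z => V (z 0 0) (z 1 0) t).
  by apply/funext => w; rewrite /V3 /= !v3E.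
move=> -> //; last by move=> w Bw; rewrite /B /= v3E.
by rewrite sum3 !v3E /= !mul0r !addr0 mul1r.
Qed.

(** [tau] is a variable of the limit slices in both directions, so the C^1 convergence controls a
    test function together with its [tau]-derivative. Two values within 1 of the same limit differ
    by at most 2; that limit is not assumed bounded. *)
Lemma test_bounded (h : M -> R) : smooth_fun C h -> exists2 c : R, 0 <= c &
  forall z, B z -> `|h (V3 z)| <= c /\ `|partial B (h \o V3) 0 z| <= c.
Proof.
move=> sh; have CH := Ck_test sh.
have [S1 S10 H1] := near_pinfty (Hsp sh ltr01).
have [S2 S20 H2] := near_ninfty (Hsm sh ltr01).
pose S := Num.max S1 S2; have S0 : 0 <= S by rewrite le_max S10.
have S1S : S1 <= S by rewrite le_max lexx.
have S2S : S2 <= S by rewrite le_max lexx orbT.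
have tri (x y w : R) : `|x - w| <= 1 -> `|y - w| <= 1 -> `|x - y| <= 2.
  by rewrite !ler_norml => /andP[? ?] /andP[? ?]; apply/andP; split; lra.
have Bv tau t : 0 <= tau <= 1 -> Btt (vec2 t tau) by rewrite /Btt /= vec2E.
have HT (r : R) : exists T : R, forall tau s t, 0 <= tau <= 1 -> - r <= s <= r -> T < `|t| ->
    `|h (V tau s t)| <= Num.max `|h pm| `|h pp| + 1 /\ `|partial B (h \o V3) 0 (v3 tau s t)| <= Num.max `|h pm| `|h pp| + 1.
  have Ksub : [set z : 'cV[R]_2 | 0 <= z 0 0 <= 1 /\ - r <= z 1 0 <= r] `<=` Bts by move=> z [].
  have [T1 T10 H3] := near_pinfty (Htp (@compact_box R 0 1 (- r) r) Ksub sh ltr01).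
  have [T2 T20 H4] := near_ninfty (Htm (@compact_box R 0 1 (- r) r) Ksub sh ltr01).
  exists (Num.max T1 T2) => tau s t t01 sr; rewrite gt_max => /andP[tT1 tT2].
  have Kz : [set z : 'cV[R]_2 | 0 <= z 0 0 <= 1 /\ - r <= z 1 0 <= r] (vec2 tau s) by rewrite /= !vec2E.
  have c0 (p : M) : partial Bts (h \o (fun _ : 'cV[R]_2 => p)) 0 (vec2 tau s) = 0.
    exact: (partialE 0 (@cornered_strip R 2 0) (Ksub _ Kz) (diff_within_cst Bts (h p) (vec2 tau s))).
  have fin p : `|h (V tau s t) - h p| <= 1 -> `|partial B (h \o V3) 0 (v3 tau s t) - 0| <= 1 -> `|h p| <= Num.max `|h pm| `|h pp| ->
      `|h (V tau s t)| <= Num.max `|h pm| `|h pp| + 1 /\ `|partial B (h \o V3) 0 (v3 tau s t)| <= Num.max `|h pm| `|h pp| + 1.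
    move=> h1 h2 h3; rewrite subr0 in h2; have := ler_normD (h (V tau s t) - h p) (h p); rewrite subrK.
    have := normr_ge0 (h p); split; lra.
  have [t0|t0] := leP 0 t.
    rewrite ger0_norm // in tT1; have [h1 /(_ 0)] := H3 t tT1 _ Kz.
    rewrite (slice_t _ sh (Ksub _ Kz)) c0 !vec2E => h2; rewrite !vec2E in h1.
    by apply: fin h1 h2 _; rewrite le_max lexx orbT.
  rewrite ltr0_norm // in tT2; have tT2' : t < - T2 by lra.
  have [h1 /(_ 0)] := H4 t tT2' _ Kz.
  rewrite (slice_t _ sh (Ksub _ Kz)) c0 !vec2E => h2; rewrite !vec2E in h1.
  by apply: fin h1 h2 _; rewrite le_max lexx.
have m0 : 0 <= Num.max `|h pm| `|h pp| + 1 by rewrite addr_ge0 // le_max normr_ge0.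
have VE tau s t : V3 (v3 tau s t) = V tau s t by rewrite /V3 !v3E.
have [c1 c10 Hc1] : exists2 c : R, 0 <= c & forall tau s t, 0 <= tau <= 1 -> `|clf (h \o V3) tau s t| <= c.
  apply: (bounded_strip (jc_clf (Ck_cont CH)) S0 m0).
  - move=> tau s t t01 Ss; rewrite /clf cl_id //= !VE.
    have [h1 _] := H1 s (le_lt_trans S1S Ss) _ (Bv tau t t01).
    have [|h2 _] := H1 (S + 1) _ _ (Bv tau t t01); first by lra.
    by rewrite !vec2E in h1 h2; exact: tri h1 h2.
  - move=> tau s t t01 Ss; rewrite /clf cl_id //= !VE.
    have [|h1 _] := H2 s _ _ (Bv tau t t01); first by lra.
    have [|h2 _] := H2 (- (S + 1)) _ _ (Bv tau t t01); first by lra.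
    by rewrite !vec2E in h1 h2; exact: tri h1 h2.
  - move=> r; have [T HT'] := HT r; exists T => tau s t t01 sr tT; rewrite /clf cl_id //= VE.
    by have [] := HT' tau s t t01 sr tT.
have [c2 c20 Hc2] : exists2 c : R, 0 <= c & forall tau s t, 0 <= tau <= 1 -> `|clf (partial B (h \o V3) 0) tau s t| <= c.
  apply: (bounded_strip (jc_clf (Ck_cont (Ck_partial 0 CH))) S0 m0).
  - move=> tau s t t01 Ss; rewrite /clf cl_id //.
    have [_ /(_ 1)] := H1 s (le_lt_trans S1S Ss) _ (Bv tau t t01).
    have [|_ /(_ 1)] := H1 (S + 1) _ _ (Bv tau t t01); first by lra.
    rewrite !(slice_s _ sh (Bv tau t t01)) !vec2E => h2 h1; exact: tri h1 h2.
  - move=> tau s t t01 Ss; rewrite /clf cl_id //.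
    have [|_ /(_ 1)] := H2 s _ _ (Bv tau t t01); first by lra.
    have [|_ /(_ 1)] := H2 (- (S + 1)) _ _ (Bv tau t t01); first by lra.
    rewrite !(slice_s _ sh (Bv tau t t01)) !vec2E => h2 h1; exact: tri h1 h2.
  - move=> r; have [T HT'] := HT r; exists T => tau s t t01 sr tT; rewrite /clf cl_id //.
    by have [] := HT' tau s t t01 sr tT.
exists (c1 + c2); first exact: addr_ge0.
move=> z Bz; have := Hc1 _ (z 1 0) (z 2 0) Bz; have := Hc2 _ (z 1 0) (z 2 0) Bz.
rewrite /clf !cl_id // !v3_eta /= => h2 h1; split; lra.
Qed.

End BoundedTests.

(** * Boundedness of the energy density *)

Section EnergyBound.
Context {R : realType} {n : nat} {X : topologicalType} (C : charted R n X) (g I : tensor C).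
Hypothesis K : kahler_manifold g I.
Variable f : X -> R.
Hypothesis sf : smooth_fun C f.
Let mfd := kahler_mfd K.
Let nC := manifold_nice mfd.
Let MC := cotangent_charts C.
Let nM := cotangent_nice mfd.
Let B : set 'cV[R]_3 := [set z : 'cV[R]_3 | unit_itv (z 0 0)].
Let cB : cornered B := @cornered_strip R 3 0.
Variable V3 : 'cV[R]_3 -> cotangent C.
Hypothesis HV : Ck_map MC 2 B V3.
Notation bx := (bx V3).
Notation cv := (cv V3).
Notation dX := (dX V3).
Hypothesis Heq : forall w i, B w -> cdom i (bx w) ->
  It g I f (w 0 0) i (V3 w) *m partial B (cmap (c := MC) i \o V3) 0 w
  + Jt g f (w 0 0) i (V3 w) *m partial B (cmap (c := MC) i \o V3) 1 w
  + Kt g I f (w 0 0) i (V3 w) *m partial B (cmap (c := MC) i \o V3) 2 w = 0.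
Hypothesis Htest : forall h : cotangent C -> R, smooth_fun MC h -> exists2 c : R, 0 <= c &
  forall z, B z -> `|h (V3 z)| <= c /\ `|partial B (h \o V3) 0 z| <= c.

Section AtPoint.
Variables (x0 : X) (i : cidx C).
Hypothesis ix0 : cdom i x0.

(** Boundedness on the part of the strip lying over some neighbourhood of [x0]. It is stable under
    the algebraic operations that build the energy, and compactness of [X] globalises it. *)
Definition lbd (F : 'cV[R]_3 -> R) : Prop := exists c : R, exists Wx : set X,
  [/\ open Wx, Wx x0, Wx `<=` cdom i & forall z, B z -> Wx (bx z) -> `|F z| <= c].

Lemma lbd_bin F G H (op : R -> R -> R) : lbd F -> lbd G ->
  (forall z, B z -> cdom i (bx z) -> `|H z| <= op `|F z| `|G z|) ->
  (forall a b a' b', 0 <= a -> 0 <= b -> a <= a' -> b <= b' -> op a b <= op a' b') -> lbd H.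
Proof.
move=> [c [Wx [hW xO Oi HO]]] [c' [Wx' [hW' xO' Oi' HO']]] E mono.
exists (op c c'), (Wx `&` Wx'); split; [exact: openI|by []|by move=> y [/Oi]|].
move=> z Bz [Oz Oz']; apply: le_trans (E z Bz (Oi _ Oz)) _.
by apply: mono => //; [exact: HO|exact: HO'].
Qed.

Lemma lbd_ext F G : (forall z, B z -> cdom i (bx z) -> F z = G z) -> lbd F -> lbd G.
Proof.
move=> E [c [Wx [hW xO Oi HO]]]; exists c, Wx; split=> // z Bz Oz.
by rewrite -E ?HO //; exact: Oi.
Qed.

Lemma lbdD F G : lbd F -> lbd G -> lbd (fun z => F z + G z).
Proof.
move=> HF HG; apply: (lbd_bin (op := +%R) HF HG) => [z _ _|a b a' b' _ _]; first exact: ler_normD.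
exact: lerD.
Qed.

Lemma lbdM F G : lbd F -> lbd G -> lbd (fun z => F z * G z).
Proof.
move=> HF HG; apply: (lbd_bin (op := *%R) HF HG) => [z _ _|a b a' b' *]; first by rewrite normrM.
exact: ler_pM.
Qed.

Lemma lbdN F : lbd F -> lbd (fun z => - F z).
Proof. by move=> [c [Wx [hW xO Oi HO]]]; exists c, Wx; split=> // z Bz Oz; rewrite normrN HO. Qed.

Lemma lbd_cst (c : R) : lbd (fun=> c).
Proof.
have [r r0 _] := chart_ball_ex mfd ix0; have [Wx [hW xO Oi _]] := chart_cont mfd ix0 r0.
by exists `|c|, Wx; split.
Qed.

Lemma lbd_sum (J : finType) (F : J -> 'cV[R]_3 -> R) : (forall a, lbd (F a)) -> lbd (fun z => \sum_a F a z).
Proof.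
move=> H; elim: (index_enum J) => [|a s IH].
  by apply: lbd_ext (lbd_cst 0) => z _ _; rewrite big_nil.
by apply: lbd_ext (lbdD (H a) IH) => z _ _; rewrite big_cons.
Qed.

Lemma lbd_csm phi : csm i phi -> lbd (phi \o bx).
Proof.
move=> /(_ 0%N)/cont_withinP/(_ _ (cimg_in ix0) 1 ltr01)[r r0 Hr].
have [Wx [hW xO Oi HO]] := chart_cont mfd ix0 r0.
exists (`|phi x0| + 1), Wx; split=> // z Bz Oz.
have := Hr _ (cimg_in (Oi _ Oz)) (HO _ Oz); rewrite !(in_chartE nC) //; last exact: Oi.
have := ler_normD (phi (bx z) - phi x0) (phi x0); rewrite subrK /=; lra.
Qed.

Lemma lbd_tau : lbd (fun z => z 0 0).
Proof.
have [r r0 _] := chart_ball_ex mfd ix0; have [Wx [hW xO Oi _]] := chart_cont mfd ix0 r0.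
by exists 1, Wx; split=> // z /andP[t0 t1] _; rewrite ger0_norm.
Qed.

(** A chart function [phi] is not a test function, but the bump [b] and the product [T = b phi] are.
    Near [x0] the bump is bounded below, so [phi] is bounded by division, and its [tau]-derivative
    through [b phi' = T' - b' phi]. *)
Lemma lbd_test phi (F : 'cV[R]_3 -> R) : smooth (cimg (C := MC) i) (in_chart (C := MC) i phi) ->
  (forall z, B z -> cdom i (bx z) -> exists2 G, diff_within B (phi \o V3) z G & G 0 = F z) ->
  lbd (phi \o V3) /\ lbd F.
Proof.
move=> sphi HF; have [r r0 Hr] := chart_ball_ex mfd ix0.
have fib := cotangent_fibered mfd.
pose b := testfun (C := C) (C' := MC) (fun i => i) (@ct_pt _ _ _ C) i x0 r (fun=> 1).
pose T := testfun (C := C) (C' := MC) (fun i => i) (@ct_pt _ _ _ C) i x0 r phi.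
have sT : smooth_fun MC T by apply: (testfun_smooth mfd fib).
have sb : smooth_fun MC b.
  apply: (testfun_smooth mfd fib) => // k.
  by apply: Ck_ext (Ck_cst (cimgM_cornered mfd (i := i)) k (1 : R)) => z [y iy <-]; rewrite (in_chartE nM).
have Tb y : T y = b y * phi y.
  by rewrite /T /b /testfun; case: pselect => ?; rewrite ?mulr1 ?mul0r.
have [cT cT0 HT] := Htest sT; have [cb cb0 Hb] := Htest sb.
pose bump := cube_bump (cmap i x0) r.
have be0 : 0 < bump (cmap i x0) / 2 by rewrite divr_gt0 // cube_bump_gt0 // subrr normr0.
have CB : Ck 0 setT bump by apply: Ck_cube_bump; exact: cornered_setT.
have [r' r0' Hr'] := (cont_withinP _ _).1 CB (cmap i x0) Logic.I _ be0.
have [Wx [hW xO Oi HO]] := chart_cont mfd ix0 r0'.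
set be := bump (cmap i x0) / 2 in be0 Hr'.
have b_ge z : Wx (bx z) -> be <= b (V3 z).
  move=> Oz; rewrite /b /testfun; case: pselect => [iz|[]]; last exact: Oi.
  rewrite mulr1 -/bump; have := Hr' _ Logic.I (HO _ Oz).
  by rewrite -/bump ltr_norml -/(bx z) /be => /andP[]; lra.
have phi_le z : B z -> Wx (bx z) -> `|phi (V3 z)| <= cT / be.
  move=> Bz Oz; rewrite ler_pdivlMr //; have [h _] := HT z Bz; apply: le_trans h.
  rewrite Tb normrM mulrC ler_wpM2r // (le_trans (b_ge z Oz)) //; exact: ler_norm.
split; first by exists (cT / be), Wx.
exists ((cT + cb * (cT / be)) / be), Wx; split=> // z Bz Oz.
have [G DG <-] := HF z Bz (Oi _ Oz).
have cover y : exists i : cidx MC, cdom i y by exact: cdom_cover mfd (ct_pt y).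
have Db := Ck_diff cB (comp_smooth_fun nM cB (fun w _ => cover (V3 w)) (Ck_map_leS HV) sb) Bz.
have DT : diff_within B (T \o V3) z _ := diff_within_eq Bz (fun w _ => Tb (V3 w)) (diff_withinM Db DG).
have [_ hT] := HT z Bz; have [_ hb] := Hb z Bz.
rewrite (partialE 0 cB Bz DT) in hT; have hp := phi_le z Bz Oz.
rewrite ler_pdivlMr //.
have bz := b_ge z Oz; have bz0 : 0 <= b (V3 z) by exact: le_trans (ltW be0) bz.
have h1 : `|partial B (b \o V3) 0 z * phi (V3 z)| <= cb * (cT / be) by rewrite normrM; exact: ler_pM.
have h2 : `|b (V3 z) * G 0| <= cT + cb * (cT / be).
  have := ler_normB (partial B (b \o V3) 0 z * phi (V3 z) + b (V3 z) * G 0) (partial B (b \o V3) 0 z * phi (V3 z)).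
  rewrite addrAC subrr add0r => h; apply: le_trans h _; exact: lerD.
apply: le_trans h2; rewrite normrM mulrC ler_wpM2r // ger0_norm //.
Qed.

Lemma diff_pB z : B z -> cdom i (bx z) -> diff_within B (cv i) z (dp V3 i ^~ z).
Proof.
move=> Bz iz; have [A PA Az] := patch_ex HV Bz iz; have [_ _ _ H] := PA.
have [_ _ [r r0 lr]] := H z Az.
by apply: (diff_within_local r0) (diff_p PA Az) => // w wr Bw; split=> //; apply/lr.
Qed.

Lemma lbd_cov a : lbd (fun z => cv i z a 0) /\ lbd (fun z => dp V3 i 0 z a 0).
Proof.
apply: (lbd_test (phi := fun y => ct_cov y i a 0)).
  move=> k; apply: Ck_ext (Ck_coord (cimgM_cornered mfd (i := i)) k (rshift n a)) => w Aw.
  by rewrite (in_chartM_cov mfd) // mxE.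
move=> z Bz iz; exists (fun k => dp V3 i k z a 0) => //.
exact: ((diff_within_mx _ _ _ _).1 (diff_pB Bz iz) a 0).
Qed.

Lemma lbd_dX a : lbd (fun z => dX i 0 z a 0).
Proof.
apply: (lbd_test (phi := fun y => cmap i (ct_pt y) a 0) _ _).2.
  move=> k; have cA := cimgM_cornered mfd (i := i).
  apply: Ck_ext (Ck_coord cA k (lshift n a)) => w [y iy <-].
  by rewrite (in_chartE nM) //= col_mxEu.
move=> z Bz iz; exists (fun k => dX i k z a 0) => //.
exact: ((diff_within_mx _ _ _ _).1 (diff_xB HV Bz iz) a 0).
Qed.

Lemma lbd_bf (N : cidx C -> X -> 'M[R]_n) (u : 'cV[R]_3 -> 'cV[R]_n) :
  (forall a b, csm i (fun x => N i x a b)) -> (forall a, lbd (fun z => u z a 0)) ->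
  lbd (fun z => bf (N i (bx z)) (u z) (u z)).
Proof.
move=> HN Hu; apply: (@lbd_ext (fun z => \sum_a \sum_b u z a 0 * N i (bx z) a b * u z b 0)).
  by move=> z _ _; rewrite bfE.
apply: lbd_sum => a; apply: lbd_sum => b; apply: lbdM => //; apply: lbdM => //.
exact: (lbd_csm (HN a b)).
Qed.

Lemma lbd_th a : lbd (fun z => (differential f i (bx z) - (dp V3 i 0 z - Nmx g f (z 0 0) i (bx z) (cv i z) *m dX i 0 z)) a 0).
Proof.
apply: (@lbd_ext (fun z => cpartial i f a (bx z) + (- dp V3 i 0 z a 0 +
   \sum_b ((\sum_c cv i z c 0 * christoffel g i (bx z) c a b) + z 0 0 * hessian g f i (bx z) a b) * dX i 0 z b 0))).
  move=> z _ _; rewrite [RHS]mxE [differential f i (bx z) a 0]mxE; congr (_ + _).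
  rewrite [RHS]mxE [X in _ = - X]mxE opprD; congr (_ + _); rewrite [X in _ = - X]mxE opprK mxE.
  by apply: eq_bigr => b _; congr (_ * _); rewrite /Nmx [RHS]mxE [X in _ = X + _]mxE [X in _ = _ + X]mxE.
apply: lbdD; first by apply: (lbd_csm (phi := cpartial i f a)); exact: (csm_df K sf).
apply: lbdD; first by apply: lbdN; exact: (lbd_cov a).2.
apply: lbd_sum => b; apply: lbdM; last exact: lbd_dX.
apply: lbdD; last by apply: lbdM; [exact: lbd_tau|by apply: (lbd_csm (phi := fun x => hessian g f i x a b)); exact: (csm_hess K sf)].
apply: lbd_sum => c; apply: lbdM; first exact: (lbd_cov c).1.
by apply: (lbd_csm (phi := fun x => christoffel g i x c a b)); exact: (csm_christoffel K).
Qed.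

(** The equation [E0] rewrites [mu] as the dual vector of [df] minus the vertical part of the
    [tau]-derivative. The energy thus becomes an expression in [tau]-derivatives only, the
    derivatives that [lbd_test] controls. *)
Lemma lbd_fE : lbd (fE g I f V3 i).
Proof.
apply: (@lbd_ext (fun z => bf (g i (bx z)) (dX i 0 z) (dX i 0 z) +
  bf (invmx (g i (bx z))) (differential f i (bx z) - (dp V3 i 0 z - Nmx g f (z 0 0) i (bx z) (cv i z) *m dX i 0 z))
     (differential f i (bx z) - (dp V3 i 0 z - Nmx g f (z 0 0) i (bx z) (cv i z) *m dX i 0 z)))).
  move=> z Bz iz; have [A PA Az] := patch_ex HV Bz iz; have gP := kahler_posdef K iz.
  have [_ E0] := fueter_frame K PA (fun w Bw iw => Heq Bw iw) Az.
  have Em y : invmx (g i (bx z)) *m (differential f i (bx z) + g i (bx z) *m y) = y + gradient g f i (bx z).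
    by rewrite mulmxDr mulKmx ?(posdef_unit gP) // addrC.
  by rewrite E0 opprK /fE bf_inv // Em.
apply: lbdD.
  by apply: (lbd_bf (N := g)) => [a b|]; [apply: (csm_tensor K); exact: (g_smooth K)|exact: lbd_dX].
by apply: (lbd_bf (N := fun i x => invmx (g i x))) => [a b|]; [exact: (csm_inv K)|exact: lbd_th].
Qed.

End AtPoint.

Lemma energy_bounded (E : 'cV[R]_3 -> R) : compact [set: X] ->
  (forall z i, B z -> cdom i (bx z) -> E z = fE g I f V3 i z) -> exists c : R, forall z, B z -> E z <= c.
Proof.
move=> cX HE.
have Hx x : exists c : R, exists Wx : set X, [/\ open Wx, Wx x &
    forall x', Wx x' -> forall z, B z -> bx z = x' -> E z <= c].
  have [i ix] := cdom_cover mfd x.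
  have [c [Wx [hW xO Oi HO]]] := lbd_fE ix; exists c, Wx; split=> // x' Ox' z Bz zx.
  rewrite (HE z i Bz); last by rewrite zx; exact: Oi.
  by apply: le_trans (ler_norm _) _; apply: HO => //; rewrite zx.
have [c c0 Hc] := compact_uniform cX (Q := fun c x => forall z, B z -> bx z = x -> E z <= c)
  (fun c c' x cc' H z Bz zx => le_trans (H z Bz zx) cc') Hx.
by exists c => z Bz; exact: Hc.
Qed.

End EnergyBound.

(** * Rigidity of Fueter strips *)

Section StripRigidity.
Context {R : realType} {n : nat} {X : topologicalType} (C : charted R n X) (g I : tensor C).
Hypothesis K : kahler_manifold g I.
Variable f : X -> R.
Hypothesis sf : smooth_fun C f.
Let mfd := kahler_mfd K.
Let nC := manifold_nice mfd.
Let MC := cotangent_charts C.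
Let nM := cotangent_nice mfd.
Let B : set 'cV[R]_3 := [set z : 'cV[R]_3 | unit_itv (z 0 0)].
Let cB : cornered B := @cornered_strip R 3 0.
Hypothesis cX : compact [set: X].
Variable kap : R.
Hypothesis kap_ge0 : 0 <= kap.
Hypothesis kap_n : kap * n%:R <= 4^-1.
Hypothesis Hkap : forall i x, cdom i x -> Num.sqrt (sqnorm2 g f i x) <= kap.

Lemma cover_M (y : cotangent C) : exists i : cidx MC, cdom i y.
Proof. exact: cdom_cover mfd (ct_pt y). Qed.

Lemma const_tau (F : 'cV[R]_3 -> R) : Ck 1 B F -> (forall z, B z -> partial B F 0 z = 0) ->
  forall tau s t, 0 <= tau <= 1 -> F (v3 tau s t) = F (v3 0 s t).
Proof.
move=> CF H tau s t /andP[t0 t1].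
have inB (u : R) : 0 <= u <= 1 -> B (v3 0 s t + u *: (tau *: delta_mx 0 0)).
  move=> /andP[u0 u1]; rewrite scalerA v3_shift0 add0r /B /= v3E /unit_itv /= mulr_ge0 //=.
  by rewrite mulr_ile1.
have [u u01] := segment_mvt inB (fun w Bw => Ck_diff cB CF Bw).
rewrite (sum_delta 0 tau (fun j => partial B F j _)) H ?mulr0; last exact: inB.
by rewrite v3_shift0 add0r => /eqP; rewrite subr_eq0 => /eqP.
Qed.

(** On the graph of [tau df] the Christoffel symbols in the connection and in the Hessian cancel:
    the horizontal space is the tangent space of the graph. *)
Lemma Nmx_graph tau i x : Nmx g f tau i x (tau *: differential f i x) = tau *: d2 f i x.
Proof.
apply: bf_inj => u v; rewrite bf_Nmx hess_bf bfZm dotZl; ring.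
Qed.

(** Vanishing energy means [x_tau = 0] and [mu = 0]. The first makes the base point independent of
    [tau]. The second makes [|q|^2] constant in [tau]; it is 0 at [tau = 0], whence [q = 0] and
    [p = tau df]. *)
Theorem fueter_graph U :
  fueter_strip (It g I f) (Jt g f) (Kt g I f) (zero_section (C := C)) (differential_graph (C := C) f) U ->
  exists w : R -> R -> X, [/\
    forall (tau : interval01 R) s t, U tau s t = dgraph mfd sf (val tau) (w s t),
    Ck_map MC 2 B (fun z : 'cV[R]_3 => U (clamp (z 0 0)) (z 1 0) (z 2 0)) &
    forall z i, B z -> cdom i (w (z 1 0) (z 2 0)) ->
      let V3 := fun z : 'cV[R]_3 => U (clamp (z 0 0)) (z 1 0) (z 2 0) in
      dX V3 i 0 z = 0 /\ fmu g I f V3 i z = 0].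
Proof.
move=> [HV Heq Hbd _ [pm [pp [um [up [_ _ [Hsm Hsp] [Htm Htp]]]]]]].
set V := fun tau => U (clamp tau) in Hbd Hsm Hsp Htm Htp.
set V3 := fun z : 'cV[R]_3 => U (clamp (z 0 0)) (z 1 0) (z 2 0) in HV Heq.
have Heq' w i : B w -> cdom i (bx V3 w) ->
  It g I f (w 0 0) i (V3 w) *m partial B (cmap (c := MC) i \o V3) 0 w
  + Jt g f (w 0 0) i (V3 w) *m partial B (cmap (c := MC) i \o V3) 1 w
  + Kt g I f (w 0 0) i (V3 w) *m partial B (cmap (c := MC) i \o V3) 2 w = 0.
  by move=> Bw iw; exact: Heq.
have c0 : cl 0 = 0 :> R by rewrite cl_id // lexx ler01.
have Hq z i : B z -> cdom i (bx V3 z) -> z 0 0 = 0 \/ z 0 0 = 1 -> fq f V3 i z = 0.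
  move=> Bz iz [E|E]; have [H0 H1] := Hbd (z 1 0) (z 2 0); rewrite /fq /cv /bx /V3 E.
    by rewrite scale0r subr0; apply: H0; rewrite /V -E.
  by rewrite scale1r H1 ?subrr // /V -E.
have [E [P [Q [Z [S [HC HE HPQ H01 HEi]]]]]] := strip_estimates K sf HV Heq' kap_ge0 kap_n Hkap Hq.
have Htest (h : cotangent C -> R) : smooth_fun MC h -> exists2 c : R, 0 <= c &
    forall z, B z -> `|h (V3 z)| <= c /\ `|partial B (h \o V3) 0 z| <= c.
  by move=> sh; exact: (@test_bounded R (n + n) (cotangent C) MC nM cover_M V HV um up pm pp Hsm Hsp Htm Htp h sh).
have [c Hc] := energy_bounded K sf HV Heq' Htest cX (fun z i Bz iz => (HEi z i Bz iz).1).
have E0 := strip_zero HC HE HPQ H01 Hc.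
have X0 z i : B z -> cdom i (bx V3 z) -> dX V3 i 0 z = 0 /\ fmu g I f V3 i z = 0.
  by move=> Bz iz; apply: (HEi z i Bz iz).2; exact: E0.
pose w s t := bx V3 (v3 0 s t).
(* Base points are compared through test functions, since a path in [tau] need not be known to stay
   in one chart. *)
have bw tau s t : 0 <= tau <= 1 -> bx V3 (v3 tau s t) = w s t.
  move=> t01; apply: (test_separate mfd) => h sh.
  apply: (const_tau (F := h \o (@ct_pt _ _ _ C) \o V3)) => //.
    apply: (comp_smooth_fun nM cB _ (Ck_map_leS HV) (smooth_fun_base mfd sh)) => y _; exact: cover_M.
  move=> z Bz; have [i iz] := cdom_cover mfd (bx V3 z); have [A PA Az] := patch_ex HV Bz iz.
  rewrite (comp_smooth_partial nM (i := i) 0 cB (Ck_map_leS HV) (smooth_fun_base mfd sh) Bz iz).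
  rewrite (full_partial PA) // (X0 z i Bz iz).1 big_split_ord /= big1 ?add0r; last first.
    by move=> a _; rewrite col_mxEu mxE mul0r.
  (* A test function pulled back from the base has no derivative in the fibre coordinates, so the
     unknown velocity of the covector does not contribute. *)
  apply: big1 => a _; apply/eqP; rewrite mulf_eq0; apply/orP; right; apply/eqP.
  have cA := cimgM_cornered mfd (i := i).
  have Az' : cimg (C := MC) i (cmap (c := MC) i (V3 z)) by exact: (cimg_in (C := MC)).
  have D := lift_diff (V := cimg (C := MC) i) (Ck_diff (nice_cornered nC (i := i)) (sh i 1%N)
     (_ : cimg i (usubmx (cmap (c := MC) i (V3 z))))) (fun v Hv => (cimgM mfd i v).1 Hv).
  have {}D := D ((cimgM mfd i _).1 Az').
  rewrite /cpartial (partialE (rshift n a) cA Az' (diff_within_eq Az' (fun v Hv => in_chartM_base mfd h Hv) D)).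
  by rewrite -[rshift n a]/(unsplit (inr a)) unsplitK.
have q0 z i : B z -> cdom i (bx V3 z) -> fq f V3 i z = 0.
  move=> Bz iz; have N0 : glob K V3 (fN g f V3) z = 0.
    rewrite -[z]v3_eta (const_tau (F := glob K V3 (fN g f V3))) //.
    - have Bz0 : B (v3 0 (z 1 0) (z 2 0)) by rewrite -c0; exact: cl_B.
      rewrite /glob /fN Hq //; [by rewrite -bf1 bf0l|exact: chP|by left; rewrite v3E].
    - exact: (glob_Ck K HV (fN_free K sf V3)).
    - move=> y By; have [A PA Ay] := patch_ex HV By (chP K V3 y).
      rewrite (glob_partial K 0 (fN_free K sf V3) PA Ay).
      rewrite (patch_norm K sf PA (fun w Bw iw => Heq' w _ Bw iw) Ay) /fY.
      by rewrite (X0 y _ By (chP K V3 y)).2 -bf1 bf0r oppr0 mulr0.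
  rewrite (globE K (fN_free K sf V3) Bz iz) /fN /frho -bf_dot in N0.
  exact: (posdef_eq0 (posdef_inv (kahler_posdef K iz)) N0).
exists w; split => //.
- move=> tau s t; have t01 : 0 <= val tau <= 1 := valP tau.
  have Bz : B (v3 (val tau) s t) by rewrite /B /= v3E.
  have VE : V3 (v3 (val tau) s t) = U tau s t by rewrite /V3 !v3E clampK.
  have [i iz] := cdom_cover mfd (bx V3 (v3 (val tau) s t)).
  have wE := bw _ s t t01; have iz' := iz; rewrite /bx VE in iz'.
  apply: (cotangent_ext iz'); first by rewrite -VE.
  rewrite (dgraph_cov mfd) -?wE //; have := q0 _ i Bz iz.
  by rewrite /fq /cv VE v3E => /eqP; rewrite subr_eq0 => /eqP.
- move=> z i Bz iz; apply: X0 => //.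
  by rewrite -[z]v3_eta bw.
Qed.

End StripRigidity.

(** * From strips to trajectories *)

Section PlaneMeasure.
Context {R : realType}.
Notation T := (measurableTypeR R).
Notation mu := (@lebesgue_measure R).
Notation mu2 := (mu \x mu)%E.

(** The sets [f > a] are open, hence countable unions of squares with rational centres and radii,
    and each square is a measurable rectangle. *)
Lemma plane_measurable (f : R * R -> R) : continuous f ->
  measurable_fun [set: T * T] (f : T * T -> T).
Proof.
move=> cf; apply: (measurability _ (RGenOInfty.measurableE R)) => //.
move=> _ [_ [a ->] <-]; rewrite setTI.
pose ok (p q e : rat) := forall z : R * R, ball (ratr p : R) (ratr e) z.1 -> ball (ratr q : R) (ratr e) z.2 -> a < f z.
rewrite (_ : _ @^-1` _ = \bigcup_(p : rat) \bigcup_(q : rat) \bigcup_(e : rat)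
  [set z : T * T | ok p q e /\ ball (ratr p : R) (ratr e) z.1 /\ ball (ratr q : R) (ratr e) z.2]); last first.
  apply/seteqP; split => [[x y]|z [p _ [q _ [e _ [H [h1 h2]]]]]]; last by rewrite /= in_itv /= andbT; exact: H.
  rewrite /= in_itv /= andbT => axy.
  have e0 : 0 < f (x, y) - a by rewrite subr_gt0.
  have /cvgrPdist_lt /(_ _ e0) := cf (x, y).
  move=> /nbhs_ballP[d /= d0 Hd].
  have [e] : exists e : rat, ratr e \in `](0 : R), (d / 2)[%R by apply: rat_in_itvoo; rewrite divr_gt0.
  rewrite in_itv /= => /andP[ep ed].
  have dense (u : R) : exists p : rat, `|ratr p - u| < ratr e.
    have [p] : exists p : rat, ratr p \in `](u - ratr e), (u + ratr e)[%R by apply: rat_in_itvoo; lra.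
    by rewrite in_itv /= => /andP[? ?]; exists p; rewrite ltr_norml; apply/andP; split; lra.
  have [p hp] := dense x; have [q hq] := dense y.
  exists p => //; exists q => //; exists e => //; split; last by rewrite -!ball_normE.
  move=> z; rewrite -!ball_normE /= => h1 h2.
  have tri (u v w : R) : `|v - u| < ratr e -> `|v - w| < ratr e -> `|u - w| < d.
    by rewrite !ltr_norml => /andP[? ?] /andP[? ?]; apply/andP; split; lra.
  have : `|f (x, y) - f z| < f (x, y) - a.
    by apply: Hd; split; rewrite -ball_normE /=; [exact: tri hp h1|exact: tri hq h2].
  by rewrite ltr_norml => /andP[_]; rewrite ltrD2l ltrN2.
apply: bigcupT_measurable_rat => p; apply: bigcupT_measurable_rat => q; apply: bigcupT_measurable_rat => e.
have [H|H] := pselect (ok p q e); last first.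
  by rewrite (_ : mkset _ = set0) //; apply/seteqP; split => // z [].
rewrite (_ : mkset _ = (ball (ratr p : R) (ratr e) : set T) `*` (ball (ratr q : R) (ratr e) : set T)).
  by apply: measurableX; exact: measurable_ball.
by apply/seteqP; split => z [].
Qed.

Let oppT : T -> T := fun x => - x.
Let moppT : measurable_fun setT oppT.
Proof. exact: oppr_measurable. Qed.

Lemma lebesgue_opp (A : set T) : measurable A -> mu (oppT @^-1` A) = mu A.
Proof.
move=> mA; pose N : {mfun T >-> T} := HB.pack oppT (isMeasurableFun.Build _ _ _ _ _ moppT).
apply/esym; apply: (@lebesgue_measure_unique R (pushforward mu N)) => // _ [[a b] _ <-].
change (mu `]a, b] = mu (oppT @^-1` `]a, b])).
have -> : oppT @^-1` `]a, b]%classic = `[- b, - a[%classic.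
  apply/seteqP; split => x; rewrite /= !in_itv /= /oppT => /andP[h1 h2]; apply/andP; split;
    move: (x : R) h1 h2 => y h1 h2; lra.
have -> := lebesgue_measure_itv `]a, b]; have -> := lebesgue_measure_itv `[- b, - a[.
by rewrite /= !lte_fin ltrN2; case: ifP => // _; rewrite -!EFinB; congr EFin; ring.
Qed.

Let refl : T * T -> T * T := fun z => (z.1, oppT z.2).
Let mrefl : measurable_fun setT refl.
Proof. by apply: measurable_fun_pair; [exact: measurable_fst|exact: measurableT_comp moppT measurable_snd]. Qed.

Lemma plane_refl (A : set (T * T)) : measurable A -> mu2 (refl @^-1` A) = mu2 A.
Proof.
move=> mA; pose N : {mfun (T * T)%type >-> (T * T)%type} := HB.pack refl (isMeasurableFun.Build _ _ _ _ _ mrefl).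
apply/esym; apply: (@product_measure_unique _ _ _ _ R mu mu (pushforward mu2 N)) => // P Q mP mQ.
change (mu2 (P `*` (oppT @^-1` Q)) = (mu P * mu Q)%E).
rewrite product_measure1E //; last by rewrite -[X in measurable X]setTI; exact: moppT.
by congr (_ * _)%E; exact: lebesgue_opp.
Qed.

(** The reflection of [t] preserves the product measure, by uniqueness of Lebesgue measure on the
    line and of the product measure. Strips and trajectories differ by this reflection. *)
Lemma integrable_refl (f : T * T -> \bar R) : mu2.-integrable setT f ->
  mu2.-integrable setT (fun z => f (z.1, - z.2)).
Proof.
move=> /integrableP[mf fin]; apply/integrableP; split.
  exact: (measurableT_comp mf mrefl).
apply: le_lt_trans fin; rewrite le_eqVlt; apply/orP; left; apply/eqP.
pose N : {mfun (T * T)%type >-> (T * T)%type} := HB.pack refl (isMeasurableFun.Build _ _ _ _ _ mrefl).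
transitivity (\int[pushforward mu2 N]_z `|f z|)%E.
  rewrite ge0_integral_pushforward //; exact: measurableT_comp.
by apply: eq_measure_integral => A mA _; exact: plane_refl.
Qed.

End PlaneMeasure.

(** * Composition of maps and of C^1 convergence with affine maps *)

Section MapTools.
Context {R : realType} {n : nat} {Y : Type} (C : charted R n Y).
Hypothesis nC : nice_charts C.

Lemma ball_locally_eq d (A : set 'cV[R]_d) z r w : (A `&` ball z r) w -> locally_eq A (A `&` ball z r) w.
Proof.
move=> [Aw zw]; have zw' : `|z - w| < r by move: zw; rewrite -ball_normE.
exists (r - `|z - w|); first by rewrite subr_gt0.
move=> w' H; split; [move=> Aw'; split=> //|by case].
rewrite -ball_normE /=; apply: le_lt_trans (ler_distD w z w') _.
by rewrite [`|w - w'|]distrC; lra.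
Qed.

Lemma cornered_ball d (A : set 'cV[R]_d) z r : cornered A -> cornered (A `&` ball z r).
Proof. by move=> cA; apply: (cornered_sub cA) => w Aw; split; [case: Aw|exact: ball_locally_eq]. Qed.

Lemma Ck_map_comp k d e (B : set 'cV[R]_d) (A : set 'cV[R]_e) (u : 'cV[R]_d -> Y) (a : 'cV[R]_e -> 'cV[R]_d) :
  cornered A -> cornered B -> (forall w, A w -> B (a w)) -> Ck k A a -> Ck_map C k B u -> Ck_map C k A (u \o a).
Proof.
move=> cA cB AB Ca Cu z i Az iz; have [r r0 [Hi HC]] := Cu (a z) i (AB z Az) iz.
have [r' r0' Hr'] := (cont_withinP _ _).1 (Ck_cont Ca) z Az r r0.
have sub w : (A `&` ball z r') w -> (B `&` ball (a z) r) (a w).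
  move=> [Aw]; rewrite -!ball_normE /= distrC => zw; split; first exact: AB.
  by rewrite distrC; exact: Hr'.
exists r' => //; split; first by move=> w Aw; apply: Hi; exact: sub.
have cA' := cornered_ball (z := z) (r := r') cA; have cB' := cornered_ball (z := a z) (r := r) cB.
apply/(Ck_mx _ _ cA') => x y.
have Ca' : Ck k (A `&` ball z r') a.
  by apply: Ck_subset Ca => w Aw; split; [case: Aw|exact: ball_locally_eq].
exact: (Ck_comp cB' cA' sub ((Ck_mx _ _ cB').1 HC x y) Ca').
Qed.

(** The reparametrisations are affine, with the constant derivative [D]. As the sums of the absolute
    values of its coefficients are at most 1, the same tolerance works before and after
    composition. *)
Lemma C1_pull d e (B K : set 'cV[R]_d) (A K' : set 'cV[R]_e) (F : set_system R)
    (us : R -> 'cV[R]_d -> Y) (u : 'cV[R]_d -> Y) (a : 'cV[R]_e -> 'cV[R]_d) (D : 'I_e -> 'cV[R]_d) :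
  Filter F -> (forall y, exists i, cdom (c := C) i y) -> cornered A -> cornered B ->
  (forall w, A w -> B (a w)) -> (forall w, K' w -> A w /\ K (a w)) ->
  (forall w, A w -> diff_within A a w D) -> (forall k, \sum_j `|D k j 0| <= 1) ->
  (forall s, Ck_map C 1 B (us s)) -> Ck_map C 1 B u ->
  C1_cvg C B K F us u -> C1_cvg C A K' F (fun s => us s \o a) (u \o a).
Proof.
move=> FF cover cA cB AB KK Da D1 Cus Cu H h sh e0 e00.
have PE (w : 'cV[R]_d -> Y) k z : Ck_map C 1 B w -> A z ->
   partial A (h \o (w \o a)) k z = \sum_j D k j 0 * partial B (h \o w) j (a z).
  move=> Cw Az; have CH := comp_smooth_fun nC cB (fun v _ => cover (w v)) Cw sh.
  have := diff_within_comp (Ck_diff cB CH (AB z Az)) (Da z Az) AB.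
  by move/(partialE k cA Az).
apply: filterS (H h sh e0 e00) => s Hs z Kz; have [Az Kaz] := KK z Kz; have [h1 h2] := Hs _ Kaz.
split=> // k; rewrite !PE // -sumrB.
apply: le_trans (ler_norm_sum _ _ _) _.
apply: (@le_trans _ _ (\sum_j `|D k j 0| * e0)).
  by apply: ler_sum => j _; rewrite -mulrBr normrM ler_wpM2l.
by rewrite -mulr_suml ler_piMl // ltW.
Qed.

Lemma near_flipN (P : R -> Prop) : (\forall t \near +oo, P t) -> \forall t \near -oo, P (- t).
Proof.
move=> /near_pinfty[S _ H]; exists (- S); split; first exact: num_real.
by move=> t tS; apply: H; rewrite ltrNr.
Qed.

Lemma near_flipP (P : R -> Prop) : (\forall t \near -oo, P t) -> \forall t \near +oo, P (- t).
Proof.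
move=> /near_ninfty[S _ H]; exists S; split; first exact: num_real.
by move=> t tS; apply: H; rewrite ltrN2.
Qed.

End MapTools.

Section AffineMaps.
Context {R : realType}.

Lemma Ck_v3 k d (A : set 'cV[R]_d) (f0 f1 f2 : 'cV[R]_d -> R) : cornered A ->
  Ck k A f0 -> Ck k A f1 -> Ck k A f2 -> Ck k A (fun w => v3 (f0 w) (f1 w) (f2 w)).
Proof.
move=> cA h0 h1 h2; apply/(Ck_mx _ _ cA) => i j.
apply: (Ck_ext (f := fun w => [:: f0 w; f1 w; f2 w]`_i)) => [w _|]; first by rewrite mxE.
by case: i => [[|[|[|//]]] h].
Qed.

Lemma Ck_vec2 k d (A : set 'cV[R]_d) (f0 f1 : 'cV[R]_d -> R) : cornered A ->
  Ck k A f0 -> Ck k A f1 -> Ck k A (fun w => vec2 (f0 w) (f1 w)).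
Proof.
move=> cA h0 h1; apply/(Ck_mx _ _ cA) => i j.
apply: (Ck_ext (f := fun w => [:: f0 w; f1 w]`_i)) => [w _|]; first by rewrite mxE.
by case: i => [[|[|//]] h].
Qed.

Lemma diff_within_vec d m (A : set 'cV[R]_d) (F : 'cV[R]_d -> seq R) z (D : 'I_d -> seq R) :
  (forall i : 'I_m, diff_within A (fun w => (F w)`_i) z (fun k => (D k)`_i)) ->
  diff_within A (fun w => \col_(i < m) (F w)`_i) z (fun k => \col_(i < m) (D k)`_i).
Proof.
move=> H; apply/diff_within_mx => i j.
have -> : (fun w => (\col_(i < m) (F w)`_i) i j) = (fun w => (F w)`_i) by apply/funext => w; rewrite mxE.
have -> : (fun k => (\col_(i < m) (D k)`_i) i j) = (fun k => (D k)`_i) by apply/funext => w; rewrite mxE.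
exact: H.
Qed.

Lemma diff_v3 d (A : set 'cV[R]_d) (f0 f1 f2 : 'cV[R]_d -> R) z D0 D1 D2 :
  diff_within A f0 z D0 -> diff_within A f1 z D1 -> diff_within A f2 z D2 ->
  diff_within A (fun w => v3 (f0 w) (f1 w) (f2 w)) z (fun k => v3 (D0 k) (D1 k) (D2 k)).
Proof.
by move=> h0 h1 h2; apply: diff_within_vec; case=> [[|[|[|//]]] h].
Qed.

Lemma diff_vec2 d (A : set 'cV[R]_d) (f0 f1 : 'cV[R]_d -> R) z D0 D1 :
  diff_within A f0 z D0 -> diff_within A f1 z D1 ->
  diff_within A (fun w => vec2 (f0 w) (f1 w)) z (fun k => vec2 (D0 k) (D1 k)).
Proof. by move=> h0 h1; apply: diff_within_vec; case=> [[|[|//]] h]. Qed.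

Lemma sum3v (W : zmodType) (F : 'I_3 -> W) : \sum_j F j = F 0 + F 1 + F 2.
Proof. by rewrite !big_ord_recl big_ord0 addr0 addrA; congr (_ + F _ + F _); exact: val_inj. Qed.

Lemma sum2v (W : zmodType) (F : 'I_2 -> W) : \sum_j F j = F 0 + F 1.
Proof. by rewrite !big_ord_recl big_ord0 addr0; congr (_ + F _); exact: val_inj. Qed.

Lemma compact_image d e (K : set 'cV[R]_d) (a : 'cV[R]_d -> 'cV[R]_e) : compact K -> Ck 0 setT a -> compact (a @` K).
Proof. by move=> cK Ca; apply: continuous_compact => //; exact: continuous_subspaceW (@subsetT _ K) Ca. Qed.

Lemma Ck_map_diff n (Y : Type) (C : charted R n Y) d (A : set 'cV[R]_d) (u : 'cV[R]_d -> Y) z (i : cidx C) :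
  cornered A -> Ck_map C 1 A u -> A z -> cdom i (u z) ->
  diff_within A (cmap i \o u) z (fun k => partial A (cmap i \o u) k z).
Proof.
move=> cA Cu Az iz; have [A' [A'z A'i lA cA' CA']] := Ck_map_near cA Cu Az iz.
have D := Ck_diff cA' CA' A'z; have [r r0 Hr] := lA.
have -> : (fun k => partial A (cmap i \o u) k z) = (fun k => partial A' (cmap i \o u) k z).
  by apply/funext => k; exact: partial_locally_eq.
by apply: (diff_within_local r0) D => // w wr Aw; split=> //; exact/Hr.
Qed.

Lemma Ck_map_dom n (Y : Type) (C : charted R n Y) d (A : set 'cV[R]_d) (u : 'cV[R]_d -> Y) z (i : cidx C) k :
  Ck_map C k A u -> A z -> cdom i (u z) ->
  exists2 r : R, 0 < r & forall w, A w -> `|w - z| < r -> cdom i (u w).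
Proof.
move=> Cu Az iz; have [r r0 [H _]] := Cu z i Az iz; exists r => // w Aw wz; apply: H; split=> //.
by rewrite -ball_normE /= distrC.
Qed.

End AffineMaps.

(** * Graphs of [tau df] and their limits *)

Section Graphs.
Context {R : realType} {n : nat} {X : topologicalType} (C : charted R n X) (g I : tensor C).
Hypothesis K : kahler_manifold g I.
Variable f : X -> R.
Hypothesis sf : smooth_fun C f.
Let mfd := kahler_mfd K.
Let nC := manifold_nice mfd.
Let MC := cotangent_charts C.
Let nM := cotangent_nice mfd.

Lemma base_Ck_map d k (A : set 'cV[R]_d) (V : 'cV[R]_d -> cotangent C) : cornered A ->
  Ck_map MC k A V -> Ck_map C k A (@ct_pt _ _ _ C \o V).
Proof.
move=> cA HV z i Az iz; have [r r0 [Hi HC]] := HV z i Az iz; exists r => //; split=> //.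
have cA' := cornered_ball (z := z) (r := r) cA.
apply/(Ck_mx _ _ cA') => a b; rewrite ord1.
by have := (Ck_mx _ _ cA').1 HC (lshift n a) 0; apply: Ck_ext => w _; rewrite /= col_mxEu.
Qed.

Lemma graph_Ck_map d k (A : set 'cV[R]_d) (tau : 'cV[R]_d -> R) (u : 'cV[R]_d -> X) : cornered A ->
  Ck k A tau -> Ck_map C k A u -> Ck_map MC k A (fun z => dgraph mfd sf (tau z) (u z)).
Proof.
move=> cA Ct Cu z i Az iz; have [r r0 [Hi HC]] := Cu z i Az iz; exists r => //; split=> //.
have cA' := cornered_ball (z := z) (r := r) cA.
have Ct' : Ck k (A `&` ball z r) tau.
  by apply: Ck_subset Ct => w Aw; split; [case: Aw|exact: ball_locally_eq].
apply/(Ck_mx _ _ cA') => a b; rewrite ord1 -[a]splitK; case: (fintype.split a) => {}a /=.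
  by have := (Ck_mx _ _ cA').1 HC a 0; apply: Ck_ext => w _; rewrite /= col_mxEu.
have Cf : Ck k (A `&` ball z r) (cpartial (C := C) i f a \o u).
  by apply: (Ck_along K cA' Hi (phi := cpartial (C := C) i f a)) => //; exact: (csm_df K sf).
apply: Ck_ext (CkM cA' Ct' Cf) => w Aw.
by rewrite /= col_mxEd; case: pselect => [_|[]]; [rewrite !mxE|exact: Hi].
Qed.

Lemma graph_diff d (A : set 'cV[R]_d) (tau : 'cV[R]_d -> R) (u : 'cV[R]_d -> X) z i Xk T (r : R) :
  A z -> 0 < r -> (forall w, A w -> `|w - z| < r -> cdom i (u w)) ->
  diff_within A (cmap i \o u) z Xk -> diff_within A tau z T ->
  diff_within A (cmap (c := MC) i \o (fun w => dgraph mfd sf (tau w) (u w))) z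
    (fun k => col_mx (Xk k) (T k *: differential f i (u z) + tau z *: (d2 f i (u z) *m Xk k))).
Proof.
move=> Az r0 Hi dx dt; pose A' := A `&` ball z r.
have A'z : A' z by split=> //; exact: ballxx.
have Ai w : A' w -> cdom i (u w).
  by move=> [Aw]; rewrite -ball_normE /= distrC; exact: Hi.
have sub (W : normedModType R) (h : 'cV[R]_d -> W) G : diff_within A h z G -> diff_within A' h z G.
  by apply: (diff_within_local ltr01) => // w _ [].
have D1 := diff_within_scale (sub _ _ _ dt) (differential_along K sf Ai A'z (sub _ _ _ dx)).
have D0 := sub _ _ _ dx.
have D : diff_within A' (cmap (c := MC) i \o (fun w => dgraph mfd sf (tau w) (u w))) z
    (fun k => col_mx (Xk k) (T k *: differential f i (u z) + tau z *: (d2 f i (u z) *m Xk k))).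
  apply/diff_within_mx => a b; rewrite ord1 -[a]splitK; case: (fintype.split a) => {}a /=.
    have := (diff_within_mx _ _ _ _).1 D0 a 0.
    have -> : (fun k => col_mx (Xk k) (T k *: differential f i (u z) + tau z *: (d2 f i (u z) *m Xk k)) (lshift n a) 0) = (fun k => Xk k a 0).
      by apply/funext => k; rewrite col_mxEu.
    by apply: diff_within_eq => // w _; rewrite /= col_mxEu.
  have := (diff_within_mx _ _ _ _).1 D1 a 0.
  have -> : (fun k => col_mx (Xk k) (T k *: differential f i (u z) + tau z *: (d2 f i (u z) *m Xk k)) (rshift n a) 0)
     = (fun k => (T k *: differential f i (u z) + tau z *: (d2 f i (u z) *m Xk k)) a 0).
    by apply/funext => k; rewrite col_mxEd.
  by apply: diff_within_eq => // w Aw; rewrite /= col_mxEd; case: pselect => [//|[]]; exact: Ai.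
apply: (diff_within_local r0) D => // w wr Aw; split=> //; split=> //.
by rewrite -ball_normE /= distrC.
Qed.

(** In the split frame the velocity of the graph has vertical part [T df], where [T] is the velocity
    of [tau]; moving the base point alone is horizontal. Both directions of the correspondence are
    computed with this. *)
Lemma frame_graph tau i x (Xk : 'cV[R]_n) (T : R) : cdom i x ->
  FM g f tau i (dgraph mfd sf tau x) *m
    col_mx Xk (T *: differential f i x + tau *: (d2 f i x *m Xk)) = col_mx Xk (T *: differential f i x).
Proof.
move=> ix; rewrite /FM (dgraph_cov mfd sf) // Nmx_graph.
by rewrite mul_frame -scalemxAl addrK.
Qed.

Section End.
Variables (F : set_system R) (w : R -> R -> X) (u : R -> R -> cotangent C) (pm pp : cotangent C).
Hypothesis FF : ProperFilter F.
Let Btt : set 'cV[R]_2 := [set z : 'cV[R]_2 | unit_itv (z 1 0)].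
Let cB : cornered Btt := @cornered_strip R 2 1.
Let u2 := fun z : 'cV[R]_2 => u (z 0 0) (z 1 0).
Hypothesis Hu : holomorphic_strip (Jt g f) (zero_section (C := C)) (differential_graph (C := C) f) u pm pp.
Hypothesis Hlim : C1_cvg MC Btt Btt F (fun s z => dgraph mfd sf (cl (z 1 0)) (w s (z 0 0))) u2.

Lemma Btt_vec2 t tau : 0 <= tau <= 1 -> Btt (vec2 t tau).
Proof. by rewrite /Btt /= vec2E. Qed.

Lemma end_lim (h : cotangent C -> R) t tau (e : R) : smooth_fun MC h -> 0 <= tau <= 1 -> 0 < e ->
  \forall s \near F, `|h (dgraph mfd sf tau (w s t)) - h (u t tau)| <= e.
Proof.
move=> sh t01 e0; apply: filterS (Hlim sh e0) => s /(_ _ (Btt_vec2 t t01))[+ _].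
by rewrite /u2 !vec2E cl_id.
Qed.

Lemma end_base t tau : 0 <= tau <= 1 -> ct_pt (u t tau) = ct_pt (u t 0).
Proof.
move=> t01; apply: (test_separate mfd) => h sh; apply: eq_by_le => e e0.
have e2 : 0 < e / 2 by rewrite divr_gt0.
have h0 : 0 <= (0 : R) <= 1 by rewrite lexx ler01.
have H1 := end_lim t (smooth_fun_base mfd sh) t01 e2.
have H2 := end_lim t (smooth_fun_base mfd sh) h0 e2.
have [s [h1 h2]] := filter_ex (filterI H1 H2).
rewrite /= in h1 h2; rewrite distrC in h1.
by have := ler_distD (h (w s t)) (h (ct_pt (u t tau))) (h (ct_pt (u t 0))); lra.
Qed.

(** The limit strips of a strip of graphs are again graphs, which must be derived from convergence
    of test functions alone. *)
Lemma end_graph t tau : 0 <= tau <= 1 -> u t tau = dgraph mfd sf tau (ct_pt (u t 0)).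
Proof.
move=> t01; have [i iy] := cdom_cover mfd (ct_pt (u t tau)).
apply: (cotangent_ext iy); first by rewrite /= end_base.
rewrite (dgraph_cov mfd sf) -?end_base // -?(end_base t t01) //.
apply/matrixP => a b; rewrite ord1 [RHS]mxE [X in _ = _ * X]mxE.
set x := ct_pt (u t tau) in iy *.
have [r r0 Hr] := chart_ball_ex mfd iy.
(* A component of [p - tau df], which is 0 on every graph. Cut off in the base it becomes a test
   function, so its value at the limit is 0, while the bump is positive there. *)
pose phi y := ct_cov y i a 0 - tau * cpartial i f a (ct_pt y).
have fib := cotangent_fibered mfd.
pose T := testfun (C := C) (C' := MC) (fun i => i) (@ct_pt _ _ _ C) i x r phi.
have sT : smooth_fun MC T.
  apply: (testfun_smooth mfd fib) => // k; have cA := cimgM_cornered mfd (i := i).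
  apply: (Ck_ext (f := fun z => z (rshift n a) 0 - tau * in_chart i (cpartial i f a) (usubmx z))).
    move=> z [y iy' <-]; rewrite (in_chartE nM) // /phi /= col_mxEd col_mxKu (in_chartE nC) //.
  apply: CkB => //; first exact: Ck_coord.
  apply: CkM => //; first exact: Ck_cst.
  apply: (Ck_lift (nice_cornered nC (i := i)) cA (fun z Hz => (cimgM mfd i z).1 Hz)).
  exact: (csm_df K sf).
have T0 s : T (dgraph mfd sf tau (w s t)) = 0.
  rewrite /T /testfun; case: pselect => // iy'.
  by rewrite /phi (dgraph_cov mfd sf) //= !mxE subrr mulr0.
have : T (u t tau) = 0.
  apply: eq_by_le => e e0; have [s] := filter_ex (end_lim t sT t01 e0).
  by rewrite T0 sub0r subr0 normrN.
rewrite /T /testfun; case: pselect => // _ /eqP; rewrite mulf_eq0 gt_eqF /=; last by rewrite cube_bump_gt0 // subrr normr0.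
by rewrite subr_eq0 => /eqP.
Qed.

Lemma end_Ck : Ck_map C 1 Btt (@ct_pt _ _ _ C \o u2).
Proof. by case: Hu => Cu _ _ _ _; exact: base_Ck_map. Qed.

Let a2 := fun z : 'cV[R]_2 => vec2 (z 0 0) (0 : R).
Let a2B z : Btt (a2 z).
Proof. by apply: Btt_vec2; rewrite lexx ler01. Qed.

(** In the frame at [tau = 0] the graph has velocity [(x_t, 0)] in [t] and [(0, df)] in [tau]. The
    structure [J] sends the latter to [(-grad f, 0)], so holomorphicity says [x_t = -grad f]; hence
    the reversal of [t] in the correspondence. *)
Lemma end_velocity t i : cdom i (ct_pt (u t 0)) ->
  partial Btt (cmap i \o (@ct_pt _ _ _ C \o u2)) 0 (vec2 t 0) = - gradient g f i (ct_pt (u t 0)).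
Proof.
move=> iz; have [Cu Eu _ _ _] := Hu.
have B0 : Btt (vec2 t 0) by apply: Btt_vec2; rewrite lexx ler01.
have Da : diff_within Btt a2 (vec2 t 0) (fun k => vec2 (0 == k)%:R 0).
  by apply: diff_vec2; [exact: diff_within_coord|exact: diff_within_cst].
have iz2 : cdom i ((@ct_pt _ _ _ C \o u2) (a2 (vec2 t 0))) by rewrite /= /u2 /a2 !vec2E.
have a2E : a2 (vec2 t 0) = vec2 t 0 by rewrite /a2 vec2E.
have D1 := Ck_map_diff cB end_Ck (a2B (vec2 t 0)) iz2.
set Xv := fun k : 'I_2 => partial Btt (cmap i \o (@ct_pt _ _ _ C \o u2)) k (a2 (vec2 t 0)) in D1.
have D2 := diff_within_comp D1 Da (fun z _ => a2B z).
have {}D2 : diff_within Btt (cmap i \o (fun z : 'cV[R]_2 => ct_pt (u (z 0 0) 0))) (vec2 t 0) (fun k => (0 == k)%:R *: Xv 0).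
  have -> : (fun k : 'I_2 => (0 == k)%:R *: Xv 0) = (fun k => \sum_j vec2 (0 == k)%:R 0 j 0 *: Xv j).
    by apply/funext => k; rewrite sum2v !vec2E scale0r addr0.
  by apply: diff_within_eq D2 => // z _; rewrite /= /u2 !vec2E.
have iz3 : cdom i ((@ct_pt _ _ _ C \o u2) (vec2 t 0)) by rewrite /= /u2 !vec2E.
have [r r0 Hr] := Ck_map_dom end_Ck B0 iz3.
have dom : forall z : 'cV[R]_2, Btt z -> `|z - vec2 t 0| < r -> cdom i (ct_pt (u (z 0 0) 0)).
  move=> z Bz zr; rewrite -(end_base _ Bz); exact: Hr.
have D3 := graph_diff B0 r0 dom D2 (diff_within_coord Btt 1 (vec2 t 0)).
rewrite !vec2E /= in D3.
have D4 : diff_within Btt (cmap (c := MC) i \o u2) (vec2 t 0) _ := diff_within_eq B0 (fun z Bz => congr1 (cmap (c := MC) i) (end_graph _ Bz)) D3.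
have := Eu (vec2 t 0) i B0; rewrite -/u2 (partialE 0 cB B0 D4) (partialE 1 cB B0 D4) /= !vec2E => /(_ iz).
have y0 : 0 <= (0 : R) <= 1 by rewrite lexx ler01.
have ue := end_graph t y0; rewrite ue => /(congr1 (mulmx (FM g f 0 i (dgraph mfd sf 0 (ct_pt (u t 0)))))).
rewrite mulmx0 mulmxBr /Jt !mulmxA FM_K mul1mx -!mulmxA.
rewrite (frame_graph 0 (1 *: Xv 0) 0 iz) (frame_graph 0 (0 *: Xv 0) 1 iz) !scale0r !scale1r.
rewrite /DJ mul_block_col !mul0mx !mulmx0 add0r addr0 opp_col_mx add_col_mx -col_mx0 => /eq_col_mx[+ _].
move=> /eqP; rewrite subr_eq0 => /eqP; rewrite /Xv a2E => ->.
by rewrite mulNmx.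
Qed.

End End.
End Graphs.

(** * The trajectory of a strip *)

Section Forward.
Context {R : realType} {n : nat} {X : topologicalType} (C : charted R n X) (g I : tensor C).
Hypothesis K : kahler_manifold g I.
Variable F : X -> R[i].
Hypothesis hol : holomorphic I F.
Let f := Fre F.
Hypothesis sf : smooth_fun C f.
Let mfd := kahler_mfd K.
Let nC := manifold_nice mfd.
Let MC := cotangent_charts C.
Let nM := cotangent_nice mfd.
Let B : set 'cV[R]_3 := [set z : 'cV[R]_3 | unit_itv (z 0 0)].
Let Btt : set 'cV[R]_2 := [set z : 'cV[R]_2 | unit_itv (z 1 0)].
Let Bts : set 'cV[R]_2 := [set z : 'cV[R]_2 | unit_itv (z 0 0)].
Let cB : cornered B := @cornered_strip R 3 0.
Let cT {d} : cornered [set: 'cV[R]_d] := @cornered_setT R d.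
Let h0 : 0 <= (0 : R) <= 1. Proof. by rewrite lexx ler01. Qed.

Lemma C1_base d (A Kc : set 'cV[R]_d) (FF : set_system R) (us : R -> 'cV[R]_d -> cotangent C) u :
  C1_cvg MC A Kc FF us u -> C1_cvg C A Kc FF (fun s => @ct_pt _ _ _ C \o us s) (@ct_pt _ _ _ C \o u).
Proof. by move=> H h sh; exact: (H _ (smooth_fun_base mfd sh)). Qed.

(** A point in both Lagrangians has [df = 0] for the real part; the Cauchy-Riemann equations give
    the same for the imaginary part. *)
Lemma critical_pt (y : cotangent C) : (zero_section (C := C) `&` differential_graph (C := C) f) y ->
  critical C F (ct_pt y).
Proof.
move=> [y0 y1] i iy; have [_ _ CR] := hol.
have d0 : differential (Fre F) i (ct_pt y) = 0 by rewrite /differential -(y1 i iy) (y0 i iy).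
by split=> //; have [H _] := CR i _ iy; move: H; rewrite d0 mulmx0 => /esym/eqP; rewrite oppr_eq0 => /eqP.
Qed.

Lemma end_trajectory FF (w : R -> R -> X) (u : R -> R -> cotangent C) (pm pp : cotangent C) :
  ProperFilter FF ->
  holomorphic_strip (Jt g f) (zero_section (C := C)) (differential_graph (C := C) f) u pm pp ->
  C1_cvg MC Btt Btt FF (fun s z => dgraph mfd sf (cl (z 1 0)) (w s (z 0 0))) (fun z => u (z 0 0) (z 1 0)) ->
  gradient_trajectory (C := C) g f (fun t => ct_pt (u (- t) 0)) (ct_pt pp) (ct_pt pm).
Proof.
move=> PF Hu Hlim; have [Cu _ _ Hm Hp] := Hu.
have Cb := end_Ck Hu.
have CN : Ck 2 setT (fun z : 'cV[R]_1 => - z 0 0) by apply: CkN => //; exact: Ck_coord.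
have Ca k : (k <= 2)%N -> Ck k setT (fun z : 'cV[R]_1 => vec2 (- z 0 0) (0 : R)).
  by move=> k2; apply: Ck_vec2 => //; [exact: Ck_le k2 CN|exact: Ck_cst].
have aB (z : 'cV[R]_1) : setT z -> Btt (vec2 (- z 0 0) 0) by move=> _; apply: Btt_vec2.
have E : (fun z : 'cV[R]_1 => ct_pt (u (- z 0 0) 0)) =
   (@ct_pt _ _ _ C \o (fun z : 'cV[R]_2 => u (z 0 0) (z 1 0))) \o (fun z : 'cV[R]_1 => vec2 (- z 0 0) (0 : R)).
  by apply/funext => z; rewrite /= !vec2E.
split.
- rewrite E; exact: (Ck_map_comp cT (@cornered_strip R 2 1) aB (Ca 1%N isT) Cb).
- move=> z i iz.
  have iz2 : cdom i ((@ct_pt _ _ _ C \o (fun z : 'cV[R]_2 => u (z 0 0) (z 1 0))) (vec2 (- z 0 0) 0)) by rewrite /= !vec2E.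
  have D1 := Ck_map_diff (@cornered_strip R 2 1) Cb (aB z Logic.I) iz2.
  have Da : diff_within setT (fun z : 'cV[R]_1 => vec2 (- z 0 0) (0 : R)) z (fun k => vec2 (- (0 == k)%:R) 0).
    by apply: diff_vec2; [apply: diff_withinN; exact: diff_within_coord|exact: diff_within_cst].
  have D := diff_within_comp D1 Da aB.
  have := partialE 0 cT (Logic.I : setT z) D.
  rewrite sum2v !vec2E scale0r addr0 scaleN1r (end_velocity PF Hu Hlim iz) opprK => <-.
  by congr (partial _ _ _ _); apply/funext => v; rewrite /= !vec2E.
- apply: (test_cvg mfd) => h sh e e0.
  have := near_flipN (Hp _ (smooth_fun_base mfd sh) e e0).
  by apply: filterS => t; apply.
- apply: (test_cvg mfd) => h sh e e0.
  have := near_flipP (Hm _ (smooth_fun_base mfd sh) e e0).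
  by apply: filterS => t; apply.
Qed.

(** Multiplying [mu = 0] by [I] gives [w_s = I (w_t + grad f)], which is the complex gradient
    equation after [t] is replaced by [-t]. *)
Lemma strip_to_trajectory U w :
  fueter_strip (It g I f) (Jt g f) (Kt g I f) (zero_section (C := C)) (differential_graph (C := C) f) U ->
  (forall (tau : interval01 R) s t, U tau s t = dgraph mfd sf (val tau) (w s t)) ->
  (forall z i, B z -> cdom i (w (z 1 0) (z 2 0)) ->
     fmu g I f (fun z : 'cV[R]_3 => U (clamp (z 0 0)) (z 1 0) (z 2 0)) i z = 0) ->
  complex_gradient_trajectory g I F (fun s t => w s (- t)).
Proof.
move=> [HV _ _ HG [pm [pp [um [up [[Lm Lp] [Hum Hup] [Hsm Hsp] [Htm Htp]]]]]]] HU Hmu.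
set V3 := fun z : 'cV[R]_3 => U (clamp (z 0 0)) (z 1 0) (z 2 0) in HV Hmu.
have Cb := base_Ck_map cB HV.
have bE (z : 'cV[R]_3) : (@ct_pt _ _ _ C \o V3) z = w (z 1 0) (z 2 0) by rewrite /V3 /= HU.
pose av := fun z : 'cV[R]_2 => v3 0 (z 0 0) (- z 1 0).
pose a0 := fun z : 'cV[R]_2 => v3 0 (z 0 0) (z 1 0).
have Bv3 (s t : R) : B (v3 0 s t) by rewrite /B /= v3E.
have Cav : Ck 2 setT av.
  by apply: Ck_v3 => //; [exact: Ck_cst|exact: Ck_coord|apply: CkN => //; exact: Ck_coord].
have vE : (fun z : 'cV[R]_2 => w (z 0 0) (- z 1 0)) = (@ct_pt _ _ _ C \o V3) \o av.
  by apply/funext => z; transitivity (w (av z 1 0) (av z 2 0)); [rewrite /av !v3E|rewrite -bE].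
have wE : (fun z : 'cV[R]_2 => w (z 0 0) (z 1 0)) = (@ct_pt _ _ _ C \o V3) \o a0.
  by apply/funext => z; transitivity (w (a0 z 1 0) (a0 z 2 0)); [rewrite /a0 !v3E|rewrite -bE].
have Dav (z : 'cV[R]_2) : diff_within setT av z (fun k => v3 0 (0 == k)%:R (- (1 == k)%:R)).
  by apply: diff_v3; [exact: diff_within_cst|exact: diff_within_coord|apply: diff_withinN; exact: diff_within_coord].
have Da0 (z : 'cV[R]_2) : diff_within setT a0 z (fun k => v3 0 (0 == k)%:R (1 == k)%:R).
  by apply: diff_v3; [exact: diff_within_cst|exact: diff_within_coord|exact: diff_within_coord].
have dv (z : 'cV[R]_2) (i : cidx C) : cdom i (w (z 0 0) (- z 1 0)) ->
    partial setT (cmap i \o (fun z : 'cV[R]_2 => w (z 0 0) (- z 1 0))) 0 z = dX V3 i 1 (av z) /\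
    partial setT (cmap i \o (fun z : 'cV[R]_2 => w (z 0 0) (- z 1 0))) 1 z = - dX V3 i 2 (av z).
  move=> iz; have iz' : cdom i (bx V3 (av z)) by rewrite -[bx V3 (av z)]/((_ \o V3) (av z)) bE /av !v3E.
  have D := diff_within_comp (diff_xB HV (Bv3 _ _) iz') (Dav z) (fun v _ => Bv3 _ _).
  rewrite vE; split.
    by rewrite (partialE 0 cT (Logic.I : setT z) D) sum3v !v3E /= oppr0 !scale0r scale1r add0r addr0.
  by rewrite (partialE 1 cT (Logic.I : setT z) D) sum3v !v3E /= !scale0r scaleN1r !add0r.
have dw (s t : R) (i : cidx C) : cdom i (w s t) ->
    diff_within setT (cmap i \o (fun z : 'cV[R]_2 => w (z 0 0) (z 1 0))) (vec2 s t)
      (fun k => \sum_j v3 0 (0 == k)%:R (1 == k)%:R j 0 *: dX V3 i j (v3 0 s t)).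
  move=> iz; have iz' : cdom i (bx V3 (a0 (vec2 s t))) by rewrite -[bx V3 _]/((_ \o V3) (a0 (vec2 s t))) bE /a0 !v3E !vec2E.
  have D := diff_within_comp (diff_xB HV (Bv3 _ _) iz') (Da0 (vec2 s t)) (fun v _ => Bv3 _ _).
  by rewrite wE; rewrite /a0 !vec2E in D.
split.
- by rewrite vE; exact: (Ck_map_comp cT cB (fun v _ => Bv3 _ _) Cav Cb).
- move=> z i iz; have [-> ->] := dv z i iz.
  have iz' : cdom i (w (av z 1 0) (av z 2 0)) by rewrite /av !v3E.
  have := Hmu (av z) i (Bv3 _ _) iz'; rewrite /fmu -[bx V3 _]/((_ \o V3) (av z)) bE /av !v3E -/(av z).
  set X1 := dX _ _ 1 _; set X2 := dX _ _ 2 _; set gr := gradient _ _ _ _ => E.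
  have {}E : I i (w (z 0 0) (- z 1 0)) *m X1 = - X2 - gr.
    by move: E => /eqP; rewrite -addrA addr_eq0 opprD => /eqP.
  have := congr1 (mulmx (I i (w (z 0 0) (- z 1 0)))) E; rewrite mulmxA (I_sqr K) // mulNmx mul1mx => <-.
  by rewrite subrr.
(* At [tau = 0] the strip lies in the zero section, and by [frame_graph] its [s]-derivative is
   horizontal there; its norm for [GM] is the norm of [w_s] for [g]. *)
- have [rho [rhoE r1 r2]] := HG _ (GM_riemannian K sf) (clamp 0).
  exists (fun s t => rho s (- t)); split; last 2 first.
  + exact: (integrable_refl r1).
  + exact: (integrable_refl r2).
  move=> s t i iz.
  have iU : cdom i (ct_pt (U (clamp 0) s (- t))) by rewrite HU.
  rewrite (rhoE s (- t) i iU) /tnorm.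
  have iz' : cdom i (w ((vec2 s t) 0 0) (- (vec2 s t) 1 0)) by rewrite !vec2E.
  have [] := dv (vec2 s t) i iz'; rewrite /av !vec2E /comp => -> _.
  have W := dw s (- t) i iz.
  have c0 : cl 0 = 0 :> R by rewrite cl_id.
    have [r rr Hr] : exists2 r : R, 0 < r & forall v : 'cV[R]_2, setT v -> `|v - vec2 s (- t)| < r -> cdom i (w (v 0 0) (v 1 0)).
    have CW : Ck_map C 2 setT (fun z : 'cV[R]_2 => w (z 0 0) (z 1 0)).
      rewrite wE; apply: (Ck_map_comp cT cB (fun v _ => Bv3 _ _) _ Cb).
      by apply: Ck_v3 => //; [exact: Ck_cst|exact: Ck_coord|exact: Ck_coord].
    by apply: (Ck_map_dom CW) => //; rewrite !vec2E.
  have D := graph_diff K sf (Logic.I : setT (vec2 s (- t))) rr Hr W (diff_within_cst setT (0 : R) (vec2 s (- t))).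
  have UE : (fun z : 'cV[R]_2 => U (clamp 0) (z 0 0) (z 1 0)) = (fun z : 'cV[R]_2 => dgraph mfd sf 0 (w (z 0 0) (z 1 0))).
    by apply/funext => z; rewrite HU -/(cl 0) c0.
  have -> : (fun z : 'cV[R]_2 => cmap (c := MC) i (U (clamp 0) (z 0 0) (z 1 0))) = cmap (c := MC) i \o (fun z : 'cV[R]_2 => dgraph mfd sf 0 (w (z 0 0) (z 1 0))).
    by apply/funext => z /=; rewrite -[U _ _ _]/((fun z : 'cV[R]_2 => U (clamp 0) (z 0 0) (z 1 0)) z) UE.
  rewrite (partialE 0 cT (Logic.I : setT (vec2 s (- t))) D) !vec2E.
  have -> : U (clamp 0) s (- t) = dgraph mfd sf 0 (w s (- t)) by rewrite HU -/(cl 0) c0.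
  rewrite -[X in Num.sqrt X]/(bf (GM g f i (dgraph mfd sf 0 (w s (- t)))) _ _) GM_bf frame_graph //.
  rewrite col_mxKu col_mxKd scale0r bf0l addr0 sum3v !v3E /= !scale0r scale1r add0r addr0.
  by [].
- have HlimE (FF : set_system R) u : C1_cvg MC Btt Btt FF (fun s z => U (clamp (z 1 0)) s (z 0 0)) u ->
      C1_cvg MC Btt Btt FF (fun s z => dgraph mfd sf (cl (z 1 0)) (w s (z 0 0))) u.
    suff -> : (fun s (z : 'cV[R]_2) => U (clamp (z 1 0)) s (z 0 0)) = (fun s z => dgraph mfd sf (cl (z 1 0)) (w s (z 0 0))) by [].
    by apply/funext => s; apply/funext => z; rewrite HU.
  (* The reversal of [t] exchanges the two limit points. *)
  exists (ct_pt pp), (ct_pt pm), (fun t => ct_pt (um (- t) 0)), (fun t => ct_pt (up (- t) 0)).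
  have sums (x y : R) : \sum_j `|(vec2 x y) j 0| = `|x| + `|y| by rewrite sum2v !vec2E.
  have CsW (t : R) : Ck_map C 1 Bts (fun z : 'cV[R]_2 => ct_pt (U (clamp (z 0 0)) (z 1 0) t)).
    have -> : (fun z : 'cV[R]_2 => ct_pt (U (clamp (z 0 0)) (z 1 0) t)) = (@ct_pt _ _ _ C \o V3) \o (fun z : 'cV[R]_2 => v3 (z 0 0) (z 1 0) t).
      by apply/funext => z; rewrite /V3 /= !v3E.
    apply: (Ck_map_comp (@cornered_strip R 2 0) cB _ _ (Ck_map_leS Cb)) => [z Bz|]; first by rewrite /B /= v3E.
    by apply: Ck_v3; [exact: cornered_strip|exact: (Ck_coord (@cornered_strip R 2 0))|exact: (Ck_coord (@cornered_strip R 2 0))|exact: (Ck_cst (@cornered_strip R 2 0))].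
  have CsT (s : R) : Ck_map C 1 Btt (fun z : 'cV[R]_2 => ct_pt (U (clamp (z 1 0)) s (z 0 0))).
    have -> : (fun z : 'cV[R]_2 => ct_pt (U (clamp (z 1 0)) s (z 0 0))) = (@ct_pt _ _ _ C \o V3) \o (fun z : 'cV[R]_2 => v3 (z 1 0) s (z 0 0)).
      by apply/funext => z; rewrite /V3 /= !v3E.
    apply: (Ck_map_comp (@cornered_strip R 2 1) cB _ _ (Ck_map_leS Cb)) => [z Bz|]; first by rewrite /B /= v3E.
    by apply: Ck_v3; [exact: cornered_strip|exact: (Ck_coord (@cornered_strip R 2 1))|exact: (Ck_cst (@cornered_strip R 2 1))|exact: (Ck_coord (@cornered_strip R 2 1))].
  have Cconst (p : X) : Ck_map C 1 Bts (fun _ : 'cV[R]_2 => p).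
    move=> z i Bz ip; exists 1 => //; split=> //.
    by apply: Ck_cst; apply: cornered_ball; exact: cornered_strip.
  have tloc (FF : set_system R) (p : cotangent C) : Filter FF ->
      C1_loc_cvg MC Bts FF (fun t z => U (clamp (z 0 0)) (z 1 0) t) (fun=> p) ->
      C1_loc_cvg C setT FF (fun t (z : 'cV[R]_1) => w (z 0 0) t) (fun=> ct_pt p).
    move=> PF H Kc cK _; pose a3 := fun z : 'cV[R]_1 => vec2 (0 : R) (z 0 0).
    have Ca3 k : Ck k setT a3 by apply: Ck_vec2 => //; [exact: Ck_cst|exact: Ck_coord].
    have sub : a3 @` Kc `<=` Bts by move=> _ [z _ <-]; rewrite /Bts /= /a3 vec2E.
    have H1 := C1_base (H _ (compact_image cK (Ca3 0%N)) sub).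
    have aB (z : 'cV[R]_1) : setT z -> Bts (a3 z) by move=> _; rewrite /Bts /= /a3 vec2E.
    have Da (z : 'cV[R]_1) : setT z -> diff_within setT a3 z (fun k => vec2 0 (0 == k)%:R).
      by move=> _; apply: diff_vec2; [exact: diff_within_cst|exact: diff_within_coord].
    have := C1_pull nC PF (cdom_cover mfd) cT (@cornered_strip R 2 0) aB
      (fun z (Kz : Kc z) => conj Logic.I (ex_intro2 _ _ z Kz erefl)) Da _ CsW (Cconst (ct_pt p)) H1.
    have -> : (fun s : R => (@ct_pt _ _ _ C \o (fun z : 'cV[R]_2 => U (clamp (z 0 0)) (z 1 0) s)) \o a3) = (fun t (z : 'cV[R]_1) => w (z 0 0) t).
      by apply/funext => s; apply/funext => z; rewrite /a3 /= !vec2E HU.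
    by apply=> k; rewrite sums normr0 add0r; case: (_ == k); rewrite ?normr1 ?normr0.
  have slim (FF : set_system R) u pm' pp' : Filter FF ->
      holomorphic_strip (Jt g f) (zero_section (C := C)) (differential_graph (C := C) f) u pm' pp' ->
      C1_cvg MC Btt Btt FF (fun s z => U (clamp (z 1 0)) s (z 0 0)) (fun z => u (z 0 0) (z 1 0)) ->
      C1_cvg C setT setT FF (fun s (z : 'cV[R]_1) => w s (- z 0 0)) (fun z => ct_pt (u (- z 0 0) 0)).
    move=> PF Hu H; pose a3 := fun z : 'cV[R]_1 => vec2 (- z 0 0) (0 : R).
    have aB (z : 'cV[R]_1) : setT z -> Btt (a3 z) by move=> _; exact: Btt_vec2.
    have Da (z : 'cV[R]_1) : setT z -> diff_within setT a3 z (fun k => vec2 (- (0 == k)%:R) 0).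
      by move=> _; apply: diff_vec2; [apply: diff_withinN; exact: diff_within_coord|exact: diff_within_cst].
    have := C1_pull nC PF (cdom_cover mfd) cT (@cornered_strip R 2 1) aB
      (fun z (Kz : setT z) => conj Logic.I (aB z Kz)) Da _ CsT (end_Ck Hu) (C1_base H).
    have -> : (fun s : R => (@ct_pt _ _ _ C \o (fun z : 'cV[R]_2 => U (clamp (z 1 0)) s (z 0 0))) \o a3) = (fun s (z : 'cV[R]_1) => w s (- z 0 0)).
      by apply/funext => s; apply/funext => z; rewrite /a3 /= !vec2E HU.
    have -> : (@ct_pt _ _ _ C \o (fun z : 'cV[R]_2 => u (z 0 0) (z 1 0))) \o a3 = (fun z => ct_pt (u (- z 0 0) 0)).
      by apply/funext => z; rewrite /a3 /= !vec2E.
    by apply=> k; rewrite sums normr0 addr0 normrN; case: (_ == k); rewrite ?normr1 ?normr0.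
  split.
  + by split; exact: critical_pt.
  + by split; [exact: end_trajectory Hum (HlimE _ _ Hsm)|exact: end_trajectory Hup (HlimE _ _ Hsp)].
  + split=> Kc cK sub h sh e e0.
      exact: (near_flipN (tloc _ _ _ Htp Kc cK sub h sh e e0)).
    exact: (near_flipP (tloc _ _ _ Htm Kc cK sub h sh e e0)).
  + by split; [exact: slim Hum Hsm|exact: slim Hup Hsp].
Qed.

End Forward.

(** * From trajectories to strips *)

Lemma near_fin (T : Type) (F : set_system T) (J : finType) (P : J -> T -> Prop) : Filter F ->
  (forall j, \forall p \near F, P j p) -> \forall p \near F, forall j, P j p.
Proof.
move=> FF H; suff Hs (s : seq J) : \forall p \near F, forall j, j \in s -> P j p.
  by apply: filterS (Hs (enum J)) => p Hp j; apply: Hp; rewrite mem_enum.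
elim: s => [|a s IH]; first by apply: nearW => p j; rewrite in_nil.
by apply: filterS2 (H a) IH => p pa ps j; rewrite inE => /predU1P[->//|]; exact: ps.
Qed.

Lemma cvg_fin_sum (R : realType) (T : Type) (F : set_system T) (J : finType) (G : J -> T -> R) (l : J -> R) :
  Filter F -> (forall j, G j p @[p --> F] --> l j) -> \sum_j G j p @[p --> F] --> \sum_j l j.
Proof.
by move=> FF H; apply: cvg_big => [|j _]; [exact: add_continuous|exact: H].
Qed.

(** * Lifting C^1 convergence from the base to the graphs, uniformly in [tau] *)

Section UniformGraphs.
Context {R : realType} {n : nat} {X : topologicalType} (C : charted R n X) (g I : tensor C).
Hypothesis K : kahler_manifold g I.
Variable f : X -> R.
Hypothesis sf : smooth_fun C f.
Let mfd := kahler_mfd K.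
Let nC := manifold_nice mfd.
Let MC := cotangent_charts C.
Let nM := cotangent_nice mfd.
Notation dg := (dgraph mfd sf).

Lemma csm_cont (i : cidx C) (phi : X -> R) x : csm i phi -> cdom i x -> phi y @[y --> x] --> phi x.
Proof.
move=> H ix; apply/cvgrPdist_lt => e e0.
have /cont_withinP/(_ _ (cimg_in ix) e e0)[r r0 Hr] := H 0%N.
have [W [oW xW Wi HW]] := chart_cont mfd ix r0.
apply: filterS (open_nbhs_nbhs (conj oW xW)) => y Wy; have iy := Wi _ Wy.
by have := Hr _ (cimg_in iy) (HW _ Wy); rewrite !(in_chartE nC) // distrC.
Qed.

Lemma csm_cont_fst (i : cidx C) (phi : X -> R) x (tau : R) : csm i phi -> cdom i x ->
  phi p.1 @[p --> (x, tau)] --> phi x.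
Proof.
move=> H ix; apply: (@cvg_comp _ _ _ fst phi _ (nbhs x) _ _ (csm_cont H ix)).
exact: (@cvg_fst _ _ (nbhs x) (nbhs tau)).
Qed.

Lemma smooth_fun_cont (h : X -> R) x : smooth_fun C h -> h y @[y --> x] --> h x.
Proof. by move=> sh; have [i ix] := cdom_cover mfd x; exact: (csm_cont (sh i) ix). Qed.

Lemma dgraph_cont (i : cidx C) (phi : cotangent C -> R) x tau :
  Ck 0 (cimg (C := MC) i) (in_chart (C := MC) i phi) -> cdom i x ->
  phi (dg p.2 p.1) @[p --> (x, tau)] --> phi (dg tau x).
Proof.
move=> H ix; apply/cvgrPdist_lt => e e0.
have iM (y : X) (t : R) : cdom i y -> cimg (C := MC) i (cmap (c := MC) i (dg t y)) by move=> iy; exact: (cimg_in (C := MC)).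
have /cont_withinP/(_ _ (iM x tau ix) e e0)[r r0 Hr] := H.
have [W [oW xW Wi HW]] := chart_cont mfd ix r0.
have Hc a : (p.2 * cpartial i f a p.1) @[p --> (x, tau)] --> tau * cpartial i f a x.
  apply: (@cvgM _ _ _ _ (fun p : X * R => p.2) (fun p => cpartial i f a p.1)); first exact: cvg_snd.
  exact: (csm_cont_fst tau (csm_df K sf i a) ix).
have N1 : \forall p \near (x, tau), W p.1.
  by apply: (cvg_fst (F := nbhs x) (G := nbhs tau)); exact: open_nbhs_nbhs.
have N2 : \forall p \near (x, tau), forall a, `|tau * cpartial i f a x - p.2 * cpartial i f a p.1| < r.
  by apply: (near_fin (P := fun a p => `|tau * cpartial i f a x - p.2 * cpartial i f a p.1| < r) (nbhs_filter (x, tau))) => a; have /cvgrPdist_lt/(_ r r0) := Hc a.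
apply: filterS2 N1 N2 => p Wp Hp; have ip := Wi _ Wp.
rewrite distrC; have := Hr _ (iM _ p.2 ip); rewrite !(in_chartE nM) //; apply.
apply: mxnorm_lt => // a b; rewrite ord1 !mxE -[a]splitK; case: (fintype.split a) => {}a.
  rewrite !unsplitK; apply: le_lt_trans (HW _ Wp).
  by have := ler_coord (cmap i p.1 - cmap i x) a 0; rewrite !mxE.
rewrite !unsplitK /=; do 2 (case: pselect => // _); rewrite !mxE distrC; exact: Hp.
Qed.

Section Test.
Variable h : cotangent C -> R.
Hypothesis sh : smooth_fun MC h.

(** The derivative of a test function along [tau df(x)] in the variable [tau]. It does not refer to
    a chart, unlike [base_rate], the coefficients of its derivative when [x] moves and [tau] is
    fixed. *)
Definition fibre_rate (tau : R) (x : X) : R :=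
  partial setT (fun z : 'cV[R]_1 => h (dg (z 0 0) x)) 0 (const_mx tau).
Definition base_rate (i : cidx C) (p : X * R) (b : 'I_n) : R :=
  cpartial (C := MC) i h (lshift n b) (dg p.2 p.1) +
  p.2 * \sum_a d2 f i p.1 a b * cpartial (C := MC) i h (rshift n a) (dg p.2 p.1).
Definition fibre_rate_in (i : cidx C) (p : X * R) : R :=
  \sum_a differential f i p.1 a 0 * cpartial (C := MC) i h (rshift n a) (dg p.2 p.1).

Lemma graph_partial_in d (A : set 'cV[R]_d) (tau : 'cV[R]_d -> R) (u : 'cV[R]_d -> X) z (i : cidx C) T k :
  cornered A -> Ck 1 A tau -> Ck_map C 1 A u -> A z -> cdom i (u z) -> diff_within A tau z T ->
  partial A (fun w => h (dg (tau w) (u w))) k z =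
  T k * fibre_rate_in i (u z, tau z) + \sum_b partial A (cmap i \o u) k z b 0 * base_rate i (u z, tau z) b.
Proof.
move=> cA Ct Cu Az iz dt; have [r r0 Hr] := Ck_map_dom Cu Az iz.
have := comp_smooth_partial nM k cA (graph_Ck_map cA Ct Cu) sh Az (iz : cdom (c := MC) i (dg (tau z) (u z))).
rewrite /comp => ->.
have D := graph_diff K sf Az r0 Hr (Ck_map_diff cA Cu Az iz) dt.
rewrite (partialE k cA Az D) big_split_ord /= /fibre_rate_in /base_rate /=.
under eq_bigr do rewrite col_mxEu.
rewrite addrC.
under eq_bigr do rewrite col_mxEd !mxE mulrDl -mulrA.
rewrite big_split /= -mulr_sumr -addrA; congr (_ * _ + _).
  by apply: eq_bigr => a _; rewrite mxE.
under [RHS]eq_bigr do rewrite mulrDr.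
rewrite big_split /= addrC; congr (_ + _).
rewrite (eq_bigr (fun a => \sum_b tau z * (d2 f i (u z) a b * partial A (cmap i \o u) k z b 0) *
   cpartial (C := MC) i h (rshift n a) (dg (tau z) (u z)))).
  rewrite exchange_big; apply: eq_bigr => b _; rewrite !mulr_sumr; apply: eq_bigr => a _.
  by ring.
by move=> a _; rewrite -mulr_suml -mulr_sumr; congr (_ * _ * _).
Qed.

Let cst_Ck_map d k (A : set 'cV[R]_d) (x : X) : cornered A -> Ck_map C k A (fun=> x).
Proof.
move=> cA z i Az ip; exists 1 => //; split=> //; apply: Ck_cst; exact: cornered_ball.
Qed.

Lemma fibre_rateE i tau x : cdom i x -> fibre_rate tau x = fibre_rate_in i (x, tau).
Proof.
move=> ix; have cA := @cornered_setT R 1.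
rewrite /fibre_rate (graph_partial_in (tau := fun z : 'cV[R]_1 => z 0 0) (u := fun=> x) (i := i) 0 cA
  (Ck_coord cA 1 0) (cst_Ck_map 1%N cA) Logic.I ix (diff_within_coord _ _ _)) mxE eqxx mul1r.
rewrite big1 ?addr0 // => b _.
by rewrite (partialE 0 cA (Logic.I : setT (const_mx tau)) (diff_within_cst _ (cmap i x) _)) mxE mul0r.
Qed.

Lemma graph_partial d (A : set 'cV[R]_d) (tau : 'cV[R]_d -> R) (u : 'cV[R]_d -> X) z T k :
  cornered A -> Ck 1 A tau -> Ck_map C 1 A u -> A z -> diff_within A tau z T ->
  partial A (fun w => h (dg (tau w) (u w))) k z =
  T k * fibre_rate (tau z) (u z) + partial A (fun w => h (dg (tau z) (u w))) k z.
Proof.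
move=> cA Ct Cu Az dt; have [i iz] := cdom_cover mfd (u z).
rewrite (graph_partial_in k cA Ct Cu Az iz dt) (fibre_rateE _ iz).
by rewrite (graph_partial_in k cA (Ck_cst cA 1 (tau z)) Cu Az iz (diff_within_cst _ _ _)) mul0r add0r.
Qed.

Let dh_Ck (i : cidx C) c : Ck 0 (cimg (C := MC) i) (in_chart (C := MC) i (cpartial (C := MC) i h c)).
Proof.
apply: Ck_ext (Ck_partial c (sh (i : cidx MC) 1)) => z [y iy <-].
by rewrite (in_chartE nM).
Qed.

Lemma fibre_rate_cont tau x : fibre_rate p.2 p.1 @[p --> (x, tau)] --> fibre_rate tau x.
Proof.
have [i ix] := cdom_cover mfd x; rewrite (fibre_rateE _ ix).
have N1 : \forall p \near (x, tau), cdom i p.1.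
  by apply: (cvg_fst (F := nbhs x) (G := nbhs tau)); apply: open_nbhs_nbhs; split=> //; exact: cdom_open.
suff H : fibre_rate_in i p @[p --> (x, tau)] --> fibre_rate_in i (x, tau).
  apply/cvgrPdist_lt => e e0; have /cvgrPdist_lt/(_ e e0) He := H.
  by apply: filterS2 N1 He => p ip; rewrite (fibre_rateE p.2 ip); case: p ip.
rewrite /fibre_rate_in /=.
apply: (cvg_fin_sum (G := fun a p => differential f i p.1 a 0 * cpartial (C := MC) i h (rshift n a) (dg p.2 p.1))) => a.
apply: cvgM; last exact: dgraph_cont.
apply: (csm_cont_fst (phi := fun y => differential f i y a 0) tau _ ix).
by apply: (csm_ext K (phi := cpartial i f a)) (csm_df K sf i a) => y _; rewrite mxE.
Qed.

Lemma base_rate_cont (i : cidx C) tau x b : cdom i x ->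
  base_rate i p b @[p --> (x, tau)] --> base_rate i (x, tau) b.
Proof.
move=> ix; rewrite /base_rate /=; apply: cvgD; first exact: dgraph_cont.
apply: cvgM; first exact: cvg_snd.
apply: (cvg_fin_sum (G := fun a p => d2 f i p.1 a b * cpartial (C := MC) i h (rshift n a) (dg p.2 p.1))) => a.
apply: cvgM; last exact: dgraph_cont.
apply: (csm_cont_fst (phi := fun y => d2 f i y a b) tau _ ix).
by apply: (csm_ext K (phi := cpartial2 i f a b)) (csm_d2f K sf i a b) => y _; rewrite mxE.
Qed.

(** For one fixed [tau] the pulled-back test function is a test function on [X], so convergence for
    that [tau] is part of the hypothesis. Only uniformity in [tau] needs an argument. *)
Lemma smooth_fun_dgraph tau : smooth_fun C (fun x => h (dg tau x)).
Proof.
move=> i k; have cI := nice_cornered nC (i := i).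
pose a := fun w : 'cV[R]_n => col_mx w (tau *: in_chart i (differential f i) w).
have Ca : Ck k (cimg i) a.
  apply/(Ck_mx _ _ cI) => r c; rewrite ord1 -[r]splitK; case: (fintype.split r) => {}r /=.
    by apply: Ck_ext (Ck_coord cI k r) => w _; rewrite col_mxEu.
  apply: Ck_ext (CkM cI (Ck_cst cI k tau) (csm_df K sf i r k)) => w [x ix <-].
  by rewrite col_mxEd !(in_chartE nC) // !mxE.
have aI w : cimg i w -> cimg (C := MC) i (a w) by move=> Hw; apply/(cimgM mfd i (a w)); rewrite /a col_mxKu.
apply: Ck_ext (Ck_comp (cimgM_cornered mfd (i := i)) cI aI (sh (i : cidx MC) k) Ca) => w [x ix <-].
rewrite [LHS]/=; have -> : a (cmap i x) = cmap (c := MC) i (dg tau x).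
  by rewrite /a (in_chartE nC) //=; case: pselect.
rewrite (in_chartE nC) //; exact: (in_chartE nM h (ix : cdom (c := MC) i (dg tau x))).
Qed.

End Test.

(** The chart velocity of any map is bounded by derivatives of finitely many test functions, the
    bump and the cut-off coordinates, with a constant that does not depend on the map. Coordinates
    are centred at [x0], so that they are at most 1 nearby. *)
Lemma velocity_bound (i : cidx C) x0 : cdom i x0 ->
  exists (b : X -> R) (T : 'I_n -> X -> R) (W : set X) (c : R),
  [/\ smooth_fun C b, forall a, smooth_fun C (T a), [/\ open W, W x0 & W `<=` cdom i], 0 <= c &
    forall d (A : set 'cV[R]_d) (u : 'cV[R]_d -> X) z k a, cornered A -> Ck_map C 1 A u -> A z -> W (u z) ->
      `|partial A (cmap i \o u) k z a 0| <= c * (`|partial A (T a \o u) k z| + `|partial A (b \o u) k z|)].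
Proof.
move=> ix0; have [r r0 Hr] := chart_ball_ex mfd ix0; have fib := base_fibered mfd.
pose phi a x := cmap i x a 0 - cmap i x0 a 0.
pose b := testfun (C := C) (C' := C) (fun i => i) (fun x => x) i x0 r (fun=> 1).
pose T a := testfun (C := C) (C' := C) (fun i => i) (fun x => x) i x0 r (phi a).
have cI := nice_cornered nC (i := i).
have sT a : smooth_fun C (T a).
  apply: (testfun_smooth mfd fib) => // k.
  by apply: Ck_ext (CkB cI (Ck_coord cI k a) (Ck_cst cI k (cmap i x0 a 0))) => z [y iy <-]; rewrite (in_chartE nC).
have sb : smooth_fun C b.
  by apply: (testfun_smooth mfd fib) => // k; apply: Ck_ext (Ck_cst cI k (1 : R)) => z [y iy <-]; rewrite (in_chartE nC).
have Tb a y : T a y = b y * phi a y.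
  by rewrite /T /b /testfun; case: pselect => ?; rewrite ?mulr1 ?mul0r.
have b0 : 0 < b x0 by rewrite /b testfunE // mulr1 cube_bump_gt0 // subrr normr0.
have b2 : 0 < b x0 / 2 by rewrite divr_gt0.
have [W1 [oW1 xW1 Wi1 HW1]] := chart_cont mfd ix0 (ltr01 : 0 < 1 :> R).
have [W2 [oW2 xW2] HW2] : exists2 W2, open W2 /\ W2 x0 & forall y, W2 y -> b x0 / 2 < b y.
  have /cvgrPdist_lt/(_ _ b2) := smooth_fun_cont (x := x0) sb.
  rewrite -/(nbhs _ _) nbhsE => -[U [oU Ux] HU]; exists U => // y /HU /=.
  by rewrite ltr_norml => /andP[_]; lra.
exists b, T, (W1 `&` W2), (b x0 / 2)^-1; split=> //.
- by split; [exact: openI|split|move=> y [/Wi1]].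
- by rewrite invr_ge0 ltW.
move=> d A u z k a cA Cu Az [Wz1 Wz2]; have iz := Wi1 _ Wz1.
have Db := Ck_diff cA (comp_smooth_fun nC cA (fun w _ => cdom_cover mfd (u w)) Cu sb) Az.
have Dx := (diff_within_mx _ _ _ _).1 (Ck_map_diff cA Cu Az iz) a 0.
have Dphi : diff_within A (phi a \o u) z (fun k => partial A (cmap i \o u) k z a 0 + - 0).
  exact: (diff_withinD Dx (diff_withinN (diff_within_cst A (cmap i x0 a 0) z))).
have DT := diff_within_eq (f' := T a \o u) Az (fun w _ => Tb a (u w)) (diff_withinM Db Dphi).
rewrite (partialE k cA Az DT) /= oppr0 addr0.
have phi1 : `|phi a (u z)| <= 1.
  by have := ler_coord (cmap i (u z) - cmap i x0) a 0; rewrite !mxE => /le_trans; apply; exact: ltW (HW1 _ Wz1).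
have := HW2 _ Wz2.
set v := partial A (cmap i \o u) k z a 0; set B := partial A (b \o u) k z; set bz := b (u z).
move=> hb; rewrite ler_pdivlMl //.
have h1 : `|bz * v| <= `|B * phi a (u z) + bz * v| + `|B|.
  have := ler_normB (B * phi a (u z) + bz * v) (B * phi a (u z)).
  rewrite addrAC subrr add0r => /le_trans; apply; rewrite lerD2l normrM.
  by rewrite -[leRHS]mulr1 ler_wpM2l.
apply: le_trans h1; rewrite normrM ler_wpM2r // (ger0_norm (ltW (lt_trans b2 hb))); exact: ltW.
Qed.

Hypothesis cX : compact [set: X].

Let margin (e N L dl : R) : 0 < e -> 0 <= N -> 0 <= L -> dl = e / (8 * (N * L + 1)) ->
  [/\ 0 < dl, dl + dl <= e & dl * 2 * (N * L) * 2 + e / 2 <= e].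
Proof.
move=> e0 N0 L0 ->; have NL : 0 <= N * L by exact: mulr_ge0.
have D : 0 < 8 * (N * L + 1) by rewrite mulr_gt0 // ltr_wpDl.
set q := e / _; have qE : q * (8 * (N * L + 1)) = e by rewrite /q mulfVK // gt_eqF.
have q0 : 0 < q by rewrite divr_gt0.
have qNL : 0 <= q * (N * L) by rewrite mulr_ge0 // ltW.
split=> //; move: qE qNL; rewrite mulrCA mulrDr mulr1; set y := N * L; set m := q * y; move=> qE qNL; first lra.
have -> : q * 2 * y * 2 = 4 * m by rewrite /m; ring.
by lra.
Qed.

Let near_pos (a b k : R) : `|a - b| <= k / 4 -> k / 2 < b -> 0 < k -> 0 < a.
Proof. by rewrite ler_norml => /andP[h _]; lra. Qed.

Let tri (a m m' dd : R) : `|a - m| <= dd -> `|m' - m| <= dd -> `|a - m'| <= dd * 2.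
Proof. by rewrite !ler_norml => /andP[? ?] /andP[? ?]; apply/andP; split; lra. Qed.

Let grow (a a' m : R) : `|a' - a| <= 1 -> `|a| <= m -> `|a'| <= m + 1.
Proof. by move=> ha hm; have := ler_normD (a' - a) a; rewrite subrK; lra. Qed.

Let combine (a a' b b' y q e : R) : `|a - a'| <= y -> `|b - b'| <= y -> `|a' - b'| <= q -> y * 2 + q <= e ->
  `|a - b| <= e.
Proof. by rewrite !ler_norml => /andP[? ?] /andP[? ?] /andP[? ?] ?; apply/andP; split; lra. Qed.

Let osc (J : finType) (x y c : J -> R) (dl L : R) : 0 <= L ->
  (forall j, `|c j| <= L) -> (forall j, `|x j - y j| <= dl) ->
  `|\sum_j c j * x j - \sum_j c j * y j| <= dl * (#|J|%:R * L).
Proof.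
move=> L0 Hc H; rewrite -sumrB; apply: le_trans (ler_norm_sum _ _ _) _.
apply: (@le_trans _ _ (\sum_(j : J) (L * dl))).
  by apply: ler_sum => j _; rewrite -mulrBr normrM; apply: ler_pM.
by rewrite le_eqVlt; apply/orP; left; apply/eqP; rewrite sumr_const -[(L * dl) *+ _]mulr_natl; ring.
Qed.

(** By compactness it suffices to work near one [(x0, t0)]. There the derivative is the velocity
    paired with [base_rate]; the velocities are bounded and [base_rate] hardly varies, so [tau] may
    be replaced by [t0], for which convergence is known. *)
Lemma graph_uniform (h : cotangent C -> R) d (A Kz : set 'cV[R]_d) (F : set_system R)
    (us : R -> 'cV[R]_d -> X) (u : 'cV[R]_d -> X) (e : R) :
  Filter F -> smooth_fun MC h -> cornered A -> Kz `<=` A -> (forall s, Ck_map C 1 A (us s)) -> Ck_map C 1 A u ->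
  C1_cvg C A Kz F us u ->
  (forall T : X -> R, smooth_fun C T -> exists2 c : R, 0 <= c & forall z k, Kz z -> `|partial A (T \o u) k z| <= c) ->
  0 < e -> \forall s \near F, forall z tau, Kz z -> 0 <= tau <= 1 ->
    [/\ `|h (dg tau (us s z)) - h (dg tau (u z))| <= e,
        `|fibre_rate h tau (us s z) - fibre_rate h tau (u z)| <= e &
        forall k, `|partial A (fun w => h (dg tau (us s w))) k z - partial A (fun w => h (dg tau (u w))) k z| <= e].
Proof.
move=> FF sh cA KA Cus Cu H Hb e0.
pose P s (p : X * R) := forall z, Kz z -> u z = p.1 ->
    [/\ `|h (dg p.2 (us s z)) - h (dg p.2 (u z))| <= e,
        `|fibre_rate h p.2 (us s z) - fibre_rate h p.2 (u z)| <= e &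
        forall k, `|partial A (fun w => h (dg p.2 (us s w))) k z - partial A (fun w => h (dg p.2 (u w))) k z| <= e].
have cXI := compact_setX cX (@segment_compact R 0 1).
suff HP : forall p : X * R, ([set: X] `*` `[0, 1]%classic) p -> \near p & F, P F p.
  have := (compact_near_coveringP _).1 cXI R F P FF HP.
  by apply: filterS => s Hs z tau Kz' t01; apply: (Hs (u z, tau)) => //; split=> //=; rewrite in_itv.
move=> [x0 t0] _; have [i ix0] := cdom_cover mfd x0.
have [b [T [W [c [sb sT [oW Wx0 Wi] c0 HV]]]]] := velocity_bound ix0.
have [cb cb0 Hcb] := Hb _ sb.
have /choice[cT HcT] : forall a, exists c : R, 0 <= c /\ forall z k, Kz z -> `|partial A (T a \o u) k z| <= c.
  by move=> a; have [c' ? ?] := Hb _ (sT a); exists c'.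
pose L := c * ((\sum_a cT a + 1) + (cb + 1)).
have cTa a : cT a <= \sum_a cT a.
  by rewrite (bigD1 a) //= lerDl; apply: sumr_ge0 => j _; have [] := HcT j.
have L0 : 0 <= L.
  by apply: mulr_ge0 => //; rewrite !addr_ge0 //; apply: sumr_ge0 => j _; have [] := HcT j.
(* With this [dl] the two replacements of [tau] by [t0], for the map and for its limit, cost
   together at most [e / 2]; the other half is spent at [t0]. *)
set dl := e / (8 * (#|'I_n|%:R * L + 1)).
have [dl0 dle dlL] := margin e0 (ler0n R #|'I_n|) L0 (erefl dl).
have N1 : \forall p \near (x0, t0), [/\ W p.1, `|h (dg p.2 p.1) - h (dg t0 x0)| <= dl / 2,
    `|fibre_rate h p.2 p.1 - fibre_rate h t0 x0| <= dl / 2 & forall a, `|base_rate h i p a - base_rate h i (x0, t0) a| <= dl].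
  have N0 : \forall p \near (x0, t0), W p.1.
    by apply: (cvg_fst (F := nbhs x0) (G := nbhs t0)); exact: open_nbhs_nbhs.
  have dl2 : 0 < dl / 2 by rewrite divr_gt0.
  have /cvgrPdist_lt/(_ _ dl2) Nh := dgraph_cont (tau := t0) (sh (i : cidx MC) 0%N) ix0.
  have /cvgrPdist_lt/(_ _ dl2) Nf := fibre_rate_cont sh (tau := t0) (x := x0).
  have Nb : \forall p \near (x0, t0), forall a, `|base_rate h i (x0, t0) a - base_rate h i p a| < dl.
    apply: (near_fin (P := fun a p => `|base_rate h i (x0, t0) a - base_rate h i p a| < dl) (nbhs_filter (x0, t0))) => a.
    by have /cvgrPdist_lt/(_ _ dl0) := base_rate_cont sh (tau := t0) (b := a) ix0.
  apply: filterS2 (filterI N0 Nh) (filterI Nf Nb) => p [h1 h2] [h3 h4].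
  by split=> // [||a]; rewrite distrC ltW.
case: N1 => -[ O1 O2] /= [nO1 nO2] sub; move: (nO1); rewrite nbhsE => -[W0 [hW0 W0x] OO1].
(* The test function [kap] keeps the approximating map near [x0]: closeness of its values to those
   at the limit map leaves it positive. *)
have [kap [sk k0 kO]] := test_in mfd hW0 W0x.
have k4 : 0 < kap x0 / 4 by rewrite divr_gt0.
have e2 : 0 < e / 2 by rewrite divr_gt0.
have NT : \forall s \near F, forall a, forall z, Kz z -> `|T a (us s z) - T a (u z)| <= 1 /\
      forall j : 'I_d, `|partial A (T a \o us s) j z - partial A (T a \o u) j z| <= 1.
  by apply: (near_fin (P := fun a s => forall z, Kz z -> `|T a (us s z) - T a (u z)| <= 1 /\
      forall j : 'I_d, `|partial A (T a \o us s) j z - partial A (T a \o u) j z| <= 1)) => a; exact: H.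
have NK : \forall x \near x0, kap x0 / 2 < kap x.
  have k2 : 0 < kap x0 / 2 by rewrite divr_gt0.
  have /cvgrPdist_lt/(_ _ k2) := smooth_fun_cont (x := x0) sk.
  by apply: filterS => y; rewrite ltr_norml => /andP[_]; lra.
exists ([set p | (O1 p.1 /\ kap x0 / 2 < kap p.1) /\ O2 p.2], [set s | forall z, Kz z ->
   [/\ `|kap (us s z) - kap (u z)| <= kap x0 / 4,
       forall k, `|partial A (b \o us s) k z - partial A (b \o u) k z| <= 1,
       forall a k, `|partial A (T a \o us s) k z - partial A (T a \o u) k z| <= 1 &
       forall k, `|partial A (fun w => h (dg t0 (us s w))) k z - partial A (fun w => h (dg t0 (u w))) k z| <= e / 2]]).
  split=> /=.
    exists ([set x | O1 x /\ kap x0 / 2 < kap x], O2); first by split=> //; exact: filterI nO1 NK.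
    by move=> p [].
  apply: filterS2 (filterI (H _ sk _ k4) (H _ sb _ ltr01)) (filterI NT (H _ (smooth_fun_dgraph sh t0) _ e2)).
  move=> s [h1 h2] [h3 h4] z Kz'; split=> [|k|a k|k].
  - by have [] := h1 z Kz'.
  - by have [_] := h2 z Kz'; apply.
  - by have [_] := h3 a z Kz'; apply.
  - by have [_] := h4 z Kz'; apply.
case=> -[x tau] s /= [[[hO1 kx] O2t] Hs] z Kz' /= uz; have [h1 h2 h3 h4] := Hs z Kz'.
have O1u : O1 (u z) by rewrite uz.
have O1s : O1 (us s z).
  by apply: OO1; apply: kO; rewrite gt_eqF //; apply: near_pos h1 _ k0; rewrite uz.
have O2t0 : O2 t0 := nbhs_singleton nO2.
have [Wu p1 p2 p3] := sub (u z, tau) (conj O1u O2t); have [Ws q1 q2 q3] := sub (us s z, tau) (conj O1s O2t).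
have [_ _ _ p4] := sub (u z, t0) (conj O1u O2t0); have [_ _ _ q4] := sub (us s z, t0) (conj O1s O2t0).
have dl22 : dl / 2 * 2 <= e by move: dle dl0; rewrite divfK //; lra.
split; [exact: (le_trans (tri q1 p1) dl22)|exact: (le_trans (tri q2 p2) dl22)|move=> k].
have Az := KA _ Kz'.
have PE (v : 'cV[R]_d -> X) (t : R) : Ck_map C 1 A v -> cdom i (v z) ->
    partial A (fun w => h (dg t (v w))) k z = \sum_a partial A (cmap i \o v) k z a 0 * base_rate h i (v z, t) a.
  move=> Cv iv; rewrite (graph_partial_in (tau := fun=> t) sh k cA (Ck_cst cA 1 t) Cv Az iv (diff_within_cst _ _ _)).
  by rewrite mul0r add0r.
have vel (v : 'cV[R]_d -> X) : Ck_map C 1 A v -> W (v z) -> `|partial A (b \o v) k z| <= cb + 1 ->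
    (forall a, `|partial A (T a \o v) k z| <= cT a + 1) -> forall a, `|partial A (cmap i \o v) k z a 0| <= L.
  move=> Cv Wv hb hT a; apply: le_trans (HV _ _ _ _ k a cA Cv Az Wv) _; apply: ler_wpM2l => //.
  by apply: lerD => //; apply: le_trans (hT a) _; rewrite lerD2r.
have velu : forall a, `|partial A (cmap i \o u) k z a 0| <= L.
  apply: vel => // [|a]; first by apply: le_trans (Hcb z k Kz') _; rewrite lerDl.
  by have [_ hm] := HcT a; apply: le_trans (hm z k Kz') _; rewrite lerDl.
have vels : forall a, `|partial A (cmap i \o us s) k z a 0| <= L.
  apply: vel => // [|a]; first exact: grow (h2 k) (Hcb z k Kz').
  by have [_ hm] := HcT a; exact: grow (h3 a k) (hm z k Kz').
have Ou := osc (x := base_rate h i (u z, tau)) (y := base_rate h i (u z, t0)) L0 velu (fun a => tri (p3 a) (p4 a)).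
have Os := osc (x := base_rate h i (us s z, tau)) (y := base_rate h i (us s z, t0)) L0 vels (fun a => tri (q3 a) (q4 a)).
have := h4 k; rewrite !(PE _ _ (Cus s) (Wi _ Ws)) !(PE _ _ Cu (Wi _ Wu)).
move=> hm; exact: (combine Os Ou hm dlL).
Qed.

End UniformGraphs.

Section Affine.
Context {R : realType}.

Lemma cl_coord_Ck d (j : 'I_d) k : Ck k [set z : 'cV[R]_d | unit_itv (z j 0)] (fun z => cl (z j 0)).
Proof.
by apply: Ck_ext (Ck_coord (cornered_strip (i := j)) k j) => z Bz; rewrite cl_id.
Qed.

Lemma cl_coord_diff d (j : 'I_d) (z : 'cV[R]_d) : unit_itv (z j 0) ->
  diff_within [set z : 'cV[R]_d | unit_itv (z j 0)] (fun z => cl (z j 0)) z (fun k => (j == k)%:R).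
Proof.
move=> Bz; apply: diff_within_eq (diff_within_coord _ j z) => // w Bw; exact: cl_id.
Qed.

Lemma Ck_vec1 k d (A : set 'cV[R]_d) (q : 'cV[R]_d -> R) : cornered A ->
  Ck k A q -> Ck k A (fun z => const_mx (q z) : 'cV[R]_1).
Proof. by move=> cA Cq; apply/(Ck_mx _ _ cA) => i j; apply: Ck_ext Cq => z _; rewrite mxE. Qed.

Lemma diff_vec1 d (A : set 'cV[R]_d) (q : 'cV[R]_d -> R) z D : diff_within A q z D ->
  diff_within A (fun z => const_mx (q z) : 'cV[R]_1) z (fun k => const_mx (D k)).
Proof.
move=> H; apply/diff_within_mx => i j.
have -> : (fun w => (const_mx (q w) : 'cV[R]_1) i j) = q by apply/funext => w; rewrite mxE.
by have -> : (fun k => (const_mx (D k) : 'cV[R]_1) i j) = D by apply/funext => w; rewrite mxE.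
Qed.

End Affine.

Section GraphLimits.
Context {R : realType} {n : nat} {X : topologicalType} (C : charted R n X) (g I : tensor C).
Hypothesis K : kahler_manifold g I.
Variable f : X -> R.
Hypothesis sf : smooth_fun C f.
Let mfd := kahler_mfd K.
Let nC := manifold_nice mfd.
Let MC := cotangent_charts C.
Let nM := cotangent_nice mfd.
Notation dg := (dgraph mfd sf).
Hypothesis cX : compact [set: X].

Lemma graph_C1_cvg d (A Kz : set 'cV[R]_d) (F : set_system R)
    (us : R -> 'cV[R]_d -> X) (u : 'cV[R]_d -> X) (tau : 'cV[R]_d -> R) (T : 'I_d -> R) :
  Filter F -> cornered A -> Kz `<=` A -> (forall s, Ck_map C 1 A (us s)) -> Ck_map C 1 A u ->
  C1_cvg C A Kz F us u ->
  (forall h : X -> R, smooth_fun C h -> exists2 c : R, 0 <= c & forall z k, Kz z -> `|partial A (h \o u) k z| <= c) ->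
  Ck 1 A tau -> (forall z, A z -> 0 <= tau z <= 1 /\ diff_within A tau z T) -> (forall k, `|T k| <= 1) ->
  C1_cvg MC A Kz F (fun s z => dg (tau z) (us s z)) (fun z => dg (tau z) (u z)).
Proof.
move=> FF cA KA Cus Cu H Hb Ct Dt T1 h sh e e0.
have e2 : 0 < e / 2 by rewrite divr_gt0.
apply: filterS (graph_uniform K sf cX FF sh cA KA Cus Cu H Hb e2) => s Hs z Kz'.
have Az := KA z Kz'; have [t01 dt] := Dt z Az; have [h1 h2 h3] := Hs z _ Kz' t01.
split=> [|k]; first by apply: le_trans h1 _; lra.
rewrite /comp (graph_partial K sf sh k cA Ct (Cus s) Az dt) (graph_partial K sf sh k cA Ct Cu Az dt).
move: h2 (h3 k); set a := fibre_rate _ _ _ _ _; set b := fibre_rate _ _ _ _ _; set c := partial _ _ _ _; set c' := partial _ _ _ _.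
have -> : T k * a + c - (T k * b + c') = T k * (a - b) + (c - c') by ring.
move=> h2 h4; rewrite (splitr e); apply: le_trans (ler_normD _ _) _; apply: lerD => //.
by rewrite normrM; apply: le_trans h2; rewrite ler_piMl.
Qed.

Lemma dgraph_critical (tau : R) (p : X) : (forall i : cidx C, cdom i p -> differential f i p = 0) -> dg tau p = dg 0 p.
Proof.
move=> H; have [i ip] := cdom_cover mfd p; apply: (cotangent_ext (i := i)) => //.
by rewrite !(dgraph_cov mfd sf) // H // !scaler0.
Qed.

(** Over a critical point all the graphs pass through the same covector 0, so the limit does not
    depend on [tau]; compactness of the interval gives uniformity. *)
Lemma graph_tends (F : set_system R) (gam : R -> X) (p : X) (h : cotangent C -> R) (e : R) : Filter F ->
  (forall i : cidx C, cdom i p -> differential f i p = 0) -> gam t @[t --> F] --> p -> smooth_fun MC h -> 0 < e ->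
  \forall t \near F, forall tau, unit_itv tau -> `|h (dg (cl tau) (gam t)) - h (dg 0 p)| <= e.
Proof.
move=> FF dp lim sh e0; have [i ip] := cdom_cover mfd p.
suff HP : forall t0 : R, `[0, 1]%classic t0 -> \near t0 & F, `|h (dg t0 (gam F)) - h (dg 0 p)| <= e.
  have := (compact_near_coveringP _).1 (@segment_compact R 0 1) R F (fun t tau => `|h (dg tau (gam t)) - h (dg 0 p)| <= e) FF HP.
  by apply: filterS => t Ht tau t01; rewrite cl_id //; apply: Ht; rewrite /= in_itv.
move=> t0 _; rewrite -(dgraph_critical t0 dp).
have /cvgrPdist_lt/(_ _ e0) := dgraph_cont (K := K) (sf := sf) (tau := t0) (sh (i : cidx MC) 0%N) ip.
move=> [[ O1 O2] /= [nO1 nO2] sub]; exists (O2, [set t | O1 (gam t)]); first by split=> //; exact: lim.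
by move=> [tau t] /= [h1 h2]; rewrite distrC ltW //; exact: (sub (gam t, tau)).
Qed.

(** Supplies the bound on derivatives of the limit map required by [graph_C1_cvg] when that map is a
    gradient trajectory, whose velocity is [grad f] on a compact space. *)
Lemma gradient_rate_bound (h : X -> R) : smooth_fun C h -> exists2 c : R, 0 <= c & forall x, exists2 i : cidx C, cdom i x &
  `|\sum_a gradient g f i x a 0 * cpartial i h a x| <= c.
Proof.
move=> sh; pose Q c x := exists2 i : cidx C, cdom i x & `|\sum_a gradient g f i x a 0 * cpartial i h a x| <= c.
have [||c c0 Hc] := compact_uniform cX (Q := Q); last by exists c => //; exact: ltW.
  by move=> c c' x cc [i ix Hi]; exists i => //; exact: le_trans cc.
move=> x; have [i ix] := cdom_cover mfd x.
pose phi y := \sum_a (\sum_b invmx (g i y) a b * cpartial i f b y) * cpartial i h a y.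
have sphi : csm i phi.
  apply: (csm_sum K (F := fun a y => (\sum_b invmx (g i y) a b * cpartial i f b y) * cpartial i h a y)) => a.
  apply: (csm_mul K (phi := fun y => \sum_b invmx (g i y) a b * cpartial i f b y)); last exact: (csm_df K sh).
  apply: (csm_sum K (F := fun b y => invmx (g i y) a b * cpartial i f b y)) => b.
  by apply: (csm_mul K (phi := fun y => invmx (g i y) a b)); [exact: (csm_inv K i a b)|exact: (csm_df K sf)].
have phiE y : phi y = \sum_a gradient g f i y a 0 * cpartial i h a y.
  by apply: eq_bigr => a _; rewrite mxE; congr (_ * _); apply: eq_bigr => b _; rewrite [differential _ _ _ _ _]mxE.
have /cvgrPdist_lt/(_ _ ltr01) := csm_cont K sphi ix.
rewrite -/(nbhs _ _) nbhsE => -[V [oV Vx] HV].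
exists (`|phi x| + 1), (V `&` cdom i); split; [by apply: openI => //; exact: cdom_open|by []|].
move=> y [/HV /= Vy iy]; exists i => //; rewrite -phiE.
by have := ler_normB (phi x) (phi x - phi y); rewrite opprB addrC subrK; move: Vy; lra.
Qed.

End GraphLimits.

Section Backward.
Context {R : realType} {n : nat} {X : topologicalType} (C : charted R n X) (g I : tensor C).
Hypothesis K : kahler_manifold g I.
Variable F : X -> R[i].
Hypothesis hol : holomorphic I F.
Let f := Fre F.
Hypothesis sf : smooth_fun C f.
Let mfd := kahler_mfd K.
Let nC := manifold_nice mfd.
Let MC := cotangent_charts C.
Let nM := cotangent_nice mfd.
Notation dg := (dgraph mfd sf).
Hypothesis cX : compact [set: X].
Let B : set 'cV[R]_3 := [set z : 'cV[R]_3 | unit_itv (z 0 0)].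
Let Btt : set 'cV[R]_2 := [set z : 'cV[R]_2 | unit_itv (z 1 0)].
Let Bts : set 'cV[R]_2 := [set z : 'cV[R]_2 | unit_itv (z 0 0)].
Let cB : cornered B := @cornered_strip R 3 0.
Let cT {d} : cornered [set: 'cV[R]_d] := @cornered_setT R d.
Let cBtt : cornered Btt := @cornered_strip R 2 1.
Let cBts : cornered Bts := @cornered_strip R 2 0.

Let FM_inj tau (i : cidx C) y (v : 'cV[R]_(n + n)) : FM g f tau i y *m v = 0 -> v = 0.
Proof. by move=> /(congr1 (mulmx (FMi g f tau i y))); rewrite mulmxA FMi_K mul1mx mulmx0. Qed.

Let mulFI tau (i : cidx C) y (v : 'cV[R]_(n + n)) :
  FM g f tau i y *m (It g I f tau i y *m v) = DI I i (ct_pt y) *m (FM g f tau i y *m v).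
Proof. by rewrite /It !mulmxA FM_K mul1mx. Qed.

Let mulFJ tau (i : cidx C) y (v : 'cV[R]_(n + n)) :
  FM g f tau i y *m (Jt g f tau i y *m v) = DJ g i (ct_pt y) *m (FM g f tau i y *m v).
Proof. by rewrite /Jt !mulmxA FM_K mul1mx. Qed.

Let mulDI (i : cidx C) x (a b : 'cV[R]_n) : DI I i x *m col_mx a b = col_mx (I i x *m a) ((I i x)^T *m b).
Proof. by rewrite /DI mul_block_col !mul0mx addr0 add0r. Qed.

Let mulDJ (i : cidx C) x (a b : 'cV[R]_n) : DJ g i x *m col_mx a b = col_mx (- (invmx (g i x) *m b)) (g i x *m a).
Proof. by rewrite /DJ mul_block_col !mul0mx addr0 add0r mulNmx. Qed.

Lemma end_strip (gam : R -> X) pm pp : gradient_trajectory (C := C) g f gam pp pm ->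
  (forall i : cidx C, cdom i pm -> differential f i pm = 0) -> (forall i : cidx C, cdom i pp -> differential f i pp = 0) ->
  holomorphic_strip (Jt g f) (zero_section (C := C)) (differential_graph (C := C) f)
    (fun t tau => dg (cl tau) (gam (- t))) (dg 0 pm) (dg 0 pp).
Proof.
move=> [Cg Eg lm lp] dm dp.
pose a2 := fun z : 'cV[R]_2 => const_mx (- z 0 0) : 'cV[R]_1.
have Ca2 : Ck 1 Btt a2 by apply: Ck_vec1 => //; apply: CkN => //; exact: Ck_coord.
have uE : (fun z : 'cV[R]_2 => gam (- z 0 0)) = (fun z : 'cV[R]_1 => gam (z 0 0)) \o a2.
  by apply/funext => z; rewrite /= mxE.
have Cu : Ck_map C 1 Btt (fun z : 'cV[R]_2 => gam (- z 0 0)).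
  by rewrite uE; exact: (Ck_map_comp cBtt cT (fun z _ => Logic.I) Ca2 Cg).
split.
- by apply: graph_Ck_map => //; exact: cl_coord_Ck.
- move=> z ix Bz iz0; pose i : cidx C := ix; have iz : cdom i (gam (- z 0 0)) := iz0.
  have [r r0 Hr] := Ck_map_dom Cu Bz iz; rewrite -[ix]/i.
  have iz2 : cdom i (gam ((a2 z) 0 0)) by rewrite mxE.
  have D1 := Ck_map_diff cT Cg (Logic.I : setT (a2 z)) iz2.
  have Da : diff_within Btt a2 z (fun k => const_mx (- (0 == k)%:R)).
    by apply: diff_vec1; apply: diff_withinN; exact: diff_within_coord.
  have Dx := diff_within_comp D1 Da (fun _ _ => Logic.I).
  have D := graph_diff K sf Bz r0 Hr (diff_within_eq (f' := cmap i \o (fun z : 'cV[R]_2 => gam (- z 0 0))) Bz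
    (fun w _ => congr1 (fun u : 'cV[R]_2 -> X => cmap i (u w)) uE) Dx) (cl_coord_diff Bz).
  rewrite /comp in D; rewrite (partialE 0 cBtt Bz D) (partialE 1 cBtt Bz D) cl_id // !big_ord1 !mxE.
  have -> : partial setT (fun w : 'cV[R]_1 => cmap i (gam (w 0 0))) 0 (a2 z) = gradient g f i (gam (- z 0 0)).
    by rewrite Eg // mxE.
  apply: (FM_inj (tau := z 1 0) (i := i) (y := dg (z 1 0) (gam (- z 0 0)))).
  rewrite mulmxBr mulFJ !(frame_graph K sf) // mulDJ /= ?mulr1n ?mulr0n oppr0 !scale0r !scale1r scaleN1r mulmx0.
  by rewrite opp_col_mx oppr0 opprK add_col_mx addNr addr0 col_mx0.
- move=> t; split=> i iy; rewrite (dgraph_cov mfd sf) //.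
    by rewrite cl_id ?scale0r // lexx ler01.
  by rewrite cl_id ?scale1r // lexx ler01.
- move=> h sh e e0; apply: (near_flipN (P := fun t => forall tau, unit_itv tau -> `|h (dg (cl tau) (gam t)) - _| <= e)).
  exact: graph_tends.
- move=> h sh e e0; apply: (near_flipP (P := fun t => forall tau, unit_itv tau -> `|h (dg (cl tau) (gam t)) - _| <= e)).
  exact: graph_tends.
Qed.

(** In the split frame the three velocities are [(0, df)], [(w_s, 0)] and [(w_t, 0)], so the
    horizontal component of the equation is trivial. The vertical one is the complex gradient
    equation lowered by [g]. *)
Lemma trajectory_strip_eq (v : R -> R -> X) (z : 'cV[R]_3) (i : cidx C) :
  Ck_map C 2 setT (fun z : 'cV[R]_2 => v (z 0 0) (z 1 0)) -> B z -> cdom i (v (z 1 0) (- z 2 0)) ->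
  (forall (z : 'cV[R]_2) (i : cidx C), cdom i (v (z 0 0) (z 1 0)) ->
     partial setT (cmap i \o (fun z : 'cV[R]_2 => v (z 0 0) (z 1 0))) 0 z
     + I i (v (z 0 0) (z 1 0)) *m (partial setT (cmap i \o (fun z : 'cV[R]_2 => v (z 0 0) (z 1 0))) 1 z
       - gradient g f i (v (z 0 0) (z 1 0))) = 0) ->
  let V3 := fun z : 'cV[R]_3 => dg (cl (z 0 0)) (v (z 1 0) (- z 2 0)) in
  It g I f (z 0 0) i (V3 z) *m partial B (cmap (c := MC) i \o V3) 0 z
  + Jt g f (z 0 0) i (V3 z) *m partial B (cmap (c := MC) i \o V3) 1 z
  + Kt g I f (z 0 0) i (V3 z) *m partial B (cmap (c := MC) i \o V3) 2 z = 0.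
Proof.
move=> Cv Bz iz Ev V3; pose a3 := fun z : 'cV[R]_3 => vec2 (z 1 0) (- z 2 0).
set v2 := fun z : 'cV[R]_2 => v (z 0 0) (z 1 0) in Cv Ev.
have Ca3 k : Ck k B a3 by apply: Ck_vec2 => //; [exact: Ck_coord|apply: CkN => //; exact: Ck_coord].
have uE : (fun z : 'cV[R]_3 => v (z 1 0) (- z 2 0)) = v2 \o a3 by apply/funext => w; rewrite /v2 /a3 /= !vec2E.
have Cw : Ck_map C 2 B (fun z : 'cV[R]_3 => v (z 1 0) (- z 2 0)).
  by rewrite uE; exact: (Ck_map_comp cB cT (fun z _ => Logic.I) (Ca3 2) Cv).
have iz2 : cdom i (v2 (a3 z)) by rewrite /v2 /a3 !vec2E.
have D1 := Ck_map_diff cT (Ck_map_leS Cv) (Logic.I : setT (a3 z)) iz2.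
have Da : diff_within B a3 z (fun k => vec2 (1 == k)%:R (- (2 == k)%:R)).
  by apply: diff_vec2; [|apply: diff_withinN]; exact: diff_within_coord.
have Dx := diff_within_comp D1 Da (fun _ _ => Logic.I).
have [r r0 Hr] := Ck_map_dom Cw Bz iz.
have D := graph_diff K sf Bz r0 Hr (diff_within_eq (f' := cmap i \o (fun z : 'cV[R]_3 => v (z 1 0) (- z 2 0))) Bz
    (fun w _ => congr1 (fun u : 'cV[R]_3 -> X => cmap i (u w)) uE) Dx) (cl_coord_diff Bz).
rewrite (partialE 0 cB Bz D) (partialE 1 cB Bz D) (partialE 2 cB Bz D) !sum2v !vec2E.
have := Ev (a3 z) i iz2; set P0 := partial _ _ 0 _; set P1 := partial _ _ 1 _.
have -> : v ((a3 z) 0 0) ((a3 z) 1 0) = v (z 1 0) (- z 2 0) by rewrite /a3 !vec2E.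
rewrite /V3 cl_id //; set x := v (z 1 0) (- z 2 0) in iz *; set y := dg (z 0 0) x => E.
apply: (FM_inj (tau := z 0 0) (i := i) (y := y)).
have fr (Y : 'cV[R]_n) (T : R) := frame_graph K sf (z 0 0) Y T iz.
rewrite -/y in fr; rewrite !(mulmxDr (FM g f (z 0 0) i y)) /Kt -[It g I f _ _ _ *m Jt g f _ _ _ *m _]mulmxA !mulFI !mulFJ !fr.
rewrite /= ?mulr1n ?mulr0n oppr0 !scale0r !scale1r !scaleN1r !add0r !addr0 !mulDJ !mulDI !mulmx0 oppr0 !mulmx0.
rewrite !add_col_mx !addr0 -col_mx0; congr col_mx.
have -> : P0 = - (I i x *m (P1 - gradient g f i x)) by apply/eqP; rewrite -addr_eq0 E.
have gI (u : 'cV[R]_n) : g i x *m - (I i x *m u) = (I i x)^T *m (g i x *m u).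
  by rewrite [RHS]mulmxA (Ig_skew K iz) mulNmx mulmxN mulmxA.
rewrite gI -!mulmxDr mulmxBr /gradient mulmxA mulmxV ?mul1mx; last exact: posdef_unit (kahler_posdef K iz).
by rewrite mulmxN addrCA subrr addr0 subrr mulmx0.
Qed.

End Backward.

Lemma bf_entries_le (R : realType) n (S : 'M[R]_n) (v : 'cV[R]_n) (s q : R) : 0 <= s ->
  (forall a b, `|S a b| <= s) -> (forall a, v a 0 ^+ 2 <= q) -> bf S v v <= s * q * (n * n)%:R.
Proof.
move=> s0 HS Hv; rewrite bfE.
apply: (@le_trans _ _ (\sum_(a < n) \sum_(b < n) (s * q))); last first.
  by rewrite !sumr_const !card_ord -mulrnA -[(s * q) *+ _]mulr_natr.
apply: ler_sum => a _; apply: ler_sum => b _.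
apply: le_trans (ler_norm _) _; rewrite !normrM mulrAC mulrC; apply: ler_pM => //.
have := sqr_ge0 (`|v a 0| - `|v b 0|); rewrite sqrrB !real_normK ?num_real //.
by have := Hv a; have := Hv b; lra.
Qed.

Lemma sqrt_le_mul (R : realType) (a c r : R) : 0 <= c -> a <= c * r ^+ 2 -> Num.sqrt a <= Num.sqrt c * `|r|.
Proof. by move=> c0 h; rewrite -sqrtr_sqr -sqrtrM //; exact: ler_wsqrtr. Qed.

(** * Integrability of the [s]-derivative of a graph *)

Section SquareIntegrability.
Context {R : realType} {n : nat} {X : topologicalType} (C : charted R n X) (g I : tensor C).
Hypothesis K : kahler_manifold g I.
Variable f : X -> R.
Hypothesis sf : smooth_fun C f.
Let mfd := kahler_mfd K.
Let nC := manifold_nice mfd.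
Let MC := cotangent_charts C.
Let nM := cotangent_nice mfd.
Notation dg := (dgraph mfd sf).
Hypothesis cX : compact [set: X].
Let cT {d} : cornered [set: 'cV[R]_d] := @cornered_setT R d.

(** For fixed [tau] the graph is a smooth section over a compact base, so every metric on the bundle
    restricts to it as a form bounded by a multiple of [g]. *)
Lemma graph_metric_le (G : tensor MC) (tau : R) : riemannian G ->
  exists2 c : R, 0 < c & forall x, exists2 i : cidx C, cdom i x & forall Y : 'cV[R]_n,
    bf (G i (dg tau x)) (col_mx Y (tau *: (d2 f i x *m Y))) (col_mx Y (tau *: (d2 f i x *m Y)))
      <= c * bf (g i x) Y Y.
Proof.
move=> [_ sG _].
apply: (compact_uniform cX (Q := fun c x => exists2 i : cidx C, cdom i x & forall Y : 'cV[R]_n,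
    bf (G i (dg tau x)) (col_mx Y (tau *: (d2 f i x *m Y))) (col_mx Y (tau *: (d2 f i x *m Y)))
      <= c * bf (g i x) Y Y)).
  move=> c c' x cc [i ix H]; exists i => // Y; apply: le_trans (H Y) _; apply: ler_wpM2r => //.
  exact: posdef_ge0 (kahler_posdef K ix).
move=> x0; have [i ix0] := cdom_cover mfd x0.
pose A (p : X * R) : 'M[R]_(n + n) := block_mx 1%:M 0 (p.2 *: d2 f i p.1) 1%:M.
(* The matrix [A] maps [(Y, 0)] to the graph velocity [(Y, tau d2 Y)], so [S] is the metric pulled
   back along it. Its entries are continuous near [x0], and the coordinates of [Y] are bounded by
   its [g]-norm. *)
pose S (p : X * R) := (A p)^T *m G i (dg p.2 p.1) *m A p.
have cA k l : A p k l @[p --> (x0, tau)] --> A (x0, tau) k l.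
  rewrite -[k]splitK -[l]splitK; case: (fintype.split k) => {}k; case: (fintype.split l) => {}l /=.
  - by under eq_fun do rewrite block_mxEul; rewrite block_mxEul; exact: cvg_cst.
  - by under eq_fun do rewrite block_mxEur; rewrite block_mxEur; exact: cvg_cst.
  - under eq_fun do rewrite block_mxEdl mxE; rewrite block_mxEdl mxE.
    apply: cvgM; first exact: cvg_snd.
    apply: (csm_cont_fst K (phi := fun y => d2 f i y k l) tau _ ix0).
    by apply: (csm_ext K (phi := cpartial2 i f k l)) (csm_d2f K sf i k l) => y _; rewrite mxE.
  - by under eq_fun do rewrite block_mxEdr; rewrite block_mxEdr; exact: cvg_cst.
have cG k l : G i (dg p.2 p.1) k l @[p --> (x0, tau)] --> G i (dg tau x0) k l.
  apply: (dgraph_cont (K := K) (sf := sf) (phi := fun y => G i y k l) _ ix0).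
  apply: Ck_ext ((Ck_mx _ _ (nice_cornered nM (i := i))).1 (sG i 0%N) k l) => z [y iy <-].
  by rewrite !(in_chartE nM).
have cS k l : S p k l @[p --> (x0, tau)] --> S (x0, tau) k l.
  have SE p : S p k l = \sum_b (\sum_a A p a k * G i (dg p.2 p.1) a b) * A p b l.
    by rewrite mxE; apply: eq_bigr => b _; rewrite mxE; congr (_ * _); apply: eq_bigr => a _; rewrite mxE.
  rewrite SE; under eq_fun do rewrite SE.
  apply: (cvg_fin_sum (G := fun b p => (\sum_a A p a k * G i (dg p.2 p.1) a b) * A p b l)) => b.
  apply: cvgM; last exact: cA.
  by apply: (cvg_fin_sum (G := fun a p => A p a k * G i (dg p.2 p.1) a b)) => a; apply: cvgM; [exact: cA|exact: cG].
pose q := \sum_a (`|invmx (g i x0) a a| + 1); pose s := \sum_k \sum_l (`|S (x0, tau) k l| + 1).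
have q0 : 0 <= q by apply: sumr_ge0 => a _; rewrite addr_ge0.
have s0 : 0 <= s by apply: sumr_ge0 => a _; apply: sumr_ge0 => b _; rewrite addr_ge0.
have le_sum (J : finType) (F : J -> R) j : (forall j, 0 <= F j) -> F j <= \sum_j F j.
  by move=> F0; rewrite (bigD1 j) //= lerDl; apply: sumr_ge0 => k _.
have close (a b : R) : `|a - b| < 1 -> `|b| <= `|a| + 1.
  by move=> h; have := ler_normB a (a - b); rewrite opprB addrC subrK; move: h; lra.
have Nq : \forall x \near x0, forall a, `|invmx (g i x) a a| <= q.
  apply: (near_fin (P := fun a x => `|invmx (g i x) a a| <= q) (nbhs_filter x0)) => a.
  have /cvgrPdist_lt/(_ _ ltr01) := csm_cont K (csm_inv K i a a) ix0.
  apply: filterS => x /close /le_trans; apply.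
  by apply: (le_sum _ (fun a => `|invmx (g i x0) a a| + 1)) => b; rewrite addr_ge0.
have Ns : \forall p \near (x0, tau), forall k l, `|S p k l| <= s.
  apply: (near_fin (P := fun k p => forall l, `|S p k l| <= s) (nbhs_filter (x0, tau))) => k.
  apply: (near_fin (P := fun l p => `|S p k l| <= s) (nbhs_filter (x0, tau))) => l.
  have /cvgrPdist_lt/(_ _ ltr01) := cS k l.
  apply: filterS => p /close /le_trans; apply.
  apply: (@le_trans _ _ (\sum_l (`|S (x0, tau) k l| + 1))).
    by apply: (le_sum _ (fun l => `|S (x0, tau) k l| + 1)) => b; rewrite addr_ge0.
  apply: (le_sum _ (fun k => \sum_l (`|S (x0, tau) k l| + 1))) => b.
  by apply: sumr_ge0 => b' _; rewrite addr_ge0.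
case: Ns => -[ O1 O2] /= [nO1 nO2] sub.
have NW : nbhs x0 (O1 `&` [set x | forall a, `|invmx (g i x) a a| <= q]) :=
  @filterI _ _ (nbhs_filter x0) _ _ nO1 Nq.
move: NW; rewrite nbhsE => -[W0 [hW0 W0x] HW].
exists (s * q * ((n + n) * (n + n))%:R), (W0 `&` cdom i); split; [by apply: openI => //; exact: cdom_open|by []|].
move=> x [/HW [hO1 hq] ix]; exists i => // Y.
have -> : col_mx Y (tau *: (d2 f i x *m Y)) = A (x, tau) *m col_mx Y 0.
  by rewrite /A mul_block_col !mul1mx mul0mx !addr0 -scalemxAl.
rewrite -bf_conj -/(S (x, tau)); have gY := posdef_ge0 Y (kahler_posdef K ix).
have Hv (a : 'I_(n + n)) : (col_mx Y 0 : 'cV[R]_(n + n)) a 0 ^+ 2 <= q * bf (g i x) Y Y.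
  rewrite -[a]splitK; case: (fintype.split a) => {}a /=; last first.
    by rewrite col_mxEd mxE expr0n /=; exact: mulr_ge0.
  rewrite col_mxEu; apply: le_trans (coord_bf_le _ a (kahler_posdef K ix)) _.
  by apply: ler_wpM2r => //; exact: le_trans (ler_norm _) (hq a).
have := bf_entries_le s0 (sub (x, tau) (conj hO1 (nbhs_singleton nO2))) Hv.
by move/le_trans; apply; rewrite le_eqVlt; apply/orP; left; apply/eqP; rewrite /=; ring.
Qed.

Let W2 (w : R -> R -> X) := fun z : 'cV[R]_2 => w (z 0 0) (z 1 0).

(** The squared norm of the velocity is defined with a chosen chart, shown to be independent of it
    and continuous, hence measurable, and dominated by a multiple of [rho^2]. *)
Lemma graph_L1_L2 (G : tensor MC) (tau : R) (w : R -> R -> X) : riemannian G ->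
  Ck_map C 2 setT (W2 w) -> ds_L1_L2 g w -> ds_L1_L2 G (fun s t => dg tau (w s t)).
Proof.
move=> HG Cw [rho [rhoE r1 r2]]; have [c c0 Hc] := graph_metric_le tau HG.
have [lawG sG posG] := HG.
pose V2 z := dg tau (W2 w z).
have CV : Ck_map MC 2 setT V2 by apply: graph_Ck_map => //; exact: Ck_cst.
have CV1 := Ck_map_leS CV; have Cw1 := Ck_map_leS Cw.
pose vel (i : cidx C) z : 'cV[R]_(n + n) := partial setT (cmap (c := MC) i \o V2) 0 z.
pose N (i : cidx C) z := bf (G i (V2 z)) (vel i z) (vel i z).
have lawN (i j : cidx C) z : cdom i (W2 w z) -> cdom j (W2 w z) -> N i z = N j z.
  move=> iz jz; have [r r0 Hr] := Ck_map_dom Cw (Logic.I : setT z) iz; have [r' r0' Hr'] := Ck_map_dom Cw (Logic.I : setT z) jz.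
  have D := curve_chain (u := V2) nM (r := Num.min r r') (i := i) (j := j) _ _ iz jz (Ck_map_diff cT CV1 (Logic.I : setT z) (iz : cdom (c := MC) i (V2 z))).
  have {}D : diff_within setT (cmap (c := MC) j \o V2) z (fun k => jac (C := MC) i j (V2 z) *m partial setT (cmap (c := MC) i \o V2) k z).
    apply: D; first by rewrite lt_min r0.
    by move=> v _; rewrite lt_min => /andP[vr vr']; split; [exact: Hr|exact: Hr'].
  by rewrite /N /vel (partialE 0 cT (Logic.I : setT z) D) -bf_conj lawG.
pose nn z := N (sval (cid (cdom_cover mfd (W2 w z)))) z.
have nnE (i : cidx C) z : cdom i (W2 w z) -> nn z = N i z.
  by move=> iz; apply: lawN => //; case: cid.
have nn0 z : 0 <= nn z.
  rewrite /nn; case: cid => i iz /=; apply: posdef_ge0; exact: (posG i (V2 z) iz).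
have nn_le s t : nn (vec2 s t) <= c * rho s t ^+ 2.
  have [i iz Hi] := Hc (w s t); have iz2 : cdom i (W2 w (vec2 s t)) by rewrite /W2 !vec2E.
  rewrite (nnE i) // (rhoE s t i iz) /tnorm.
  have [r r0 Hr] := Ck_map_dom Cw (Logic.I : setT (vec2 s t)) iz2.
  have D := graph_diff K sf (Logic.I : setT (vec2 s t)) r0 Hr (Ck_map_diff cT Cw1 (Logic.I : setT (vec2 s t)) iz2)
    (diff_within_cst setT tau (vec2 s t)).
  rewrite sqr_sqrtr; last exact: posdef_ge0 (kahler_posdef K iz).
  rewrite /N /vel (partialE 0 cT (Logic.I : setT (vec2 s t)) D) scale0r add0r /V2.
  have -> : W2 w (vec2 s t) = w s t by rewrite /W2 !vec2E.
  exact: Hi.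
have nn_cont : continuous (fun z : R * R => nn (vec2 z.1 z.2)).
  move=> -[s t]; apply/cvgrPdist_lt => e e0 /=.
  have [i iz] := cdom_cover mfd (W2 w (vec2 s t)).
  have [r r0 [Hi HC]] := CV (vec2 s t) i Logic.I iz.
  set A := setT `&` ball (vec2 s t) r in Hi HC; have cA : cornered A := cornered_ball (z := vec2 s t) (r := r) cT.
  have Az : A (vec2 s t) by split=> //; exact: ballxx.
  have Cp : Ck 1 A (vel i).
    apply: Ck_ext (Ck_partial 0 HC) => v Av.
    exact/esym/partial_locally_eq/ball_locally_eq.
  have CG a b : Ck 1 A (fun v => G i (V2 v) a b).
    have := Ck_comp (nice_cornered nM (i := i)) cA (fun v Av => cimg_in (C := MC) (Hi v Av))
       ((Ck_mx _ _ (nice_cornered nM (i := i))).1 (sG i 1%N) a b) (Ck_leS HC).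
    by apply: Ck_ext => v Av; rewrite /comp (in_chartE nM (G i) (Hi v Av)).
  have CN : Ck 1 A (N i).
    apply: (Ck_ext (f := fun v => dot (vel i v) (G i (V2 v) *m vel i v))) => [v _|]; first by rewrite /N bf_dot.
    have Cpa a : Ck 1 A (fun v => vel i v a 0) := (Ck_mx _ _ cA).1 Cp a 0.
    apply: (Ck_dot (F := vel i) (G := fun v => G i (V2 v) *m vel i v) cA Cpa) => a.
    exact: (Ck_mulv (M := fun v => G i (V2 v)) (F := vel i) cA CG Cpa).
  have [r' r0' Hr'] := (cont_withinP _ _).1 (Ck_cont CN) _ Az e e0.
  have [r2' [r20 h1 h2 _]] := lt_min3 r0 r0' r0'.
  have /cvgrPdist_lt/(_ _ r20) := @cont_vec2 R (s, t).
  apply: filterS => -[s' t'] /= hv.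
  have Av : A (vec2 s' t') by split=> //; rewrite -ball_normE /=; exact: lt_trans hv h1.
  rewrite (nnE i) // (nnE i) //; last exact: Hi.
  by rewrite distrC; apply: Hr' => //; rewrite distrC; exact: lt_trans hv h2.
have sq_cont : continuous (fun z : R * R => Num.sqrt (nn (vec2 z.1 z.2))).
  by move=> z; exact: (continuous_comp (f := fun z : R * R => nn (vec2 z.1 z.2)) (nn_cont z) (@sqrt_continuous R _)).
exists (fun s t => Num.sqrt (nn (vec2 s t))); split.
- move=> s t i iz; have iz2 : cdom (c := C) i (W2 w (vec2 s t)) by rewrite /W2 !vec2E.
  rewrite (nnE i) // /N /tnorm /V2 (_ : W2 w (vec2 s t) = w s t) //; by rewrite /W2 !vec2E.
- apply: (le_integrable measurableT _ _ (integrableZl measurableT (Num.sqrt c) r1)).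
    by apply/measurable_EFinP; exact: (plane_measurable sq_cont).
  move=> z _ /=; rewrite lee_fin normrM (ger0_norm (sqrtr_ge0 _)) (ger0_norm (sqrtr_ge0 _)).
  exact: sqrt_le_mul (ltW c0) (nn_le _ _).
- apply: (le_integrable measurableT _ _ (integrableZl measurableT c r2)).
    apply/measurable_EFinP; apply: (plane_measurable (f := fun z => Num.sqrt (nn (vec2 z.1 z.2)) ^+ 2)).
    have -> : (fun z : R * R => Num.sqrt (nn (vec2 z.1 z.2)) ^+ 2) = (fun z => nn (vec2 z.1 z.2)).
      by apply/funext => z; rewrite sqr_sqrtr.
    exact: nn_cont.
  move=> z _ /=; rewrite lee_fin sqr_sqrtr // (ger0_norm (nn0 _)); apply: le_trans (nn_le _ _) _; exact: ler_norm.
Qed.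

End SquareIntegrability.

(** * The strip of a trajectory *)

Section Backward2.
Context {R : realType} {n : nat} {X : topologicalType} (C : charted R n X) (g I : tensor C).
Hypothesis K : kahler_manifold g I.
Variable F : X -> R[i].
Hypothesis hol : holomorphic I F.
Let f := Fre F.
Hypothesis sf : smooth_fun C f.
Let mfd := kahler_mfd K.
Let nC := manifold_nice mfd.
Let MC := cotangent_charts C.
Notation dg := (dgraph mfd sf).
Hypothesis cX : compact [set: X].
Let B : set 'cV[R]_3 := [set z : 'cV[R]_3 | unit_itv (z 0 0)].
Let Btt : set 'cV[R]_2 := [set z : 'cV[R]_2 | unit_itv (z 1 0)].
Let Bts : set 'cV[R]_2 := [set z : 'cV[R]_2 | unit_itv (z 0 0)].
Let cB : cornered B := @cornered_strip R 3 0.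
Let cT {d} : cornered [set: 'cV[R]_d] := @cornered_setT R d.
Let cBtt : cornered Btt := @cornered_strip R 2 1.
Let cBts : cornered Bts := @cornered_strip R 2 0.

Lemma reflect_L1_L2 (v : R -> R -> X) : Ck_map C 2 setT (fun z : 'cV[R]_2 => v (z 0 0) (z 1 0)) ->
  ds_L1_L2 g v -> ds_L1_L2 g (fun s t => v s (- t)).
Proof.
move=> Cv [rho [rhoE r1 r2]]; exists (fun s t => rho s (- t)); split; last 2 first.
- exact: (integrable_refl r1).
- exact: (integrable_refl r2).
move=> s t i iz; rewrite (rhoE s (- t) i iz) /tnorm.
suff -> : partial setT (fun z : 'cV[R]_2 => cmap i (v (z 0 0) (- z 1 0))) 0 (vec2 s t) =
   partial setT (fun z : 'cV[R]_2 => cmap i (v (z 0 0) (z 1 0))) 0 (vec2 s (- t)) by [].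
pose a := fun z : 'cV[R]_2 => vec2 (z 0 0) (- z 1 0).
have aE : a (vec2 s t) = vec2 s (- t) by rewrite /a !vec2E.
have iz2 : cdom i (v ((vec2 s (- t)) 0 0) ((vec2 s (- t)) 1 0)) by rewrite !vec2E.
have D1 := Ck_map_diff cT (Ck_map_leS Cv) (Logic.I : setT (vec2 s (- t))) iz2.
rewrite -aE in D1.
have Da : diff_within setT a (vec2 s t) (fun k => vec2 (0 == k)%:R (- (1 == k)%:R)).
  by apply: diff_vec2; [|apply: diff_withinN]; exact: diff_within_coord.
have D := diff_within_comp D1 Da (fun _ _ => Logic.I).
have -> : (fun z : 'cV[R]_2 => cmap i (v (z 0 0) (- z 1 0))) = (cmap i \o (fun z : 'cV[R]_2 => v (z 0 0) (z 1 0))) \o a.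
  by apply/funext => z; rewrite /= /a !vec2E.
by rewrite (partialE 0 cT (Logic.I : setT (vec2 s t)) D) sum2v !vec2E /= oppr0 scale0r scale1r addr0 aE.
Qed.

Lemma trajectory_to_strip (v : R -> R -> X) : complex_gradient_trajectory g I F v ->
  fueter_strip (It g I f) (Jt g f) (Kt g I f) (zero_section (C := C)) (differential_graph (C := C) f)
    (fun tau s t => dg (val tau) (v s (- t))).
Proof.
move=> [Cv Ev Lv [pm [pp [gm [gp [[crm crp] [Hgm Hgp] [Htm Htp] [Hsm Hsp]]]]]]].
have dpm (i : cidx C) : cdom i pm -> differential f i pm = 0 by move=> /crm[].
have dpp (i : cidx C) : cdom i pp -> differential f i pp = 0 by move=> /crp[].
pose a3 := fun z : 'cV[R]_3 => vec2 (z 1 0) (- z 2 0).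
pose ar := fun z : 'cV[R]_2 => vec2 (z 0 0) (- z 1 0).
set v2 := fun z : 'cV[R]_2 => v (z 0 0) (z 1 0) in Cv Ev.
have Cw : Ck_map C 2 B (fun z : 'cV[R]_3 => v (z 1 0) (- z 2 0)).
  have -> : (fun z : 'cV[R]_3 => v (z 1 0) (- z 2 0)) = v2 \o a3 by apply/funext => w; rewrite /v2 /a3 /= !vec2E.
  apply: (Ck_map_comp cB cT (fun z _ => Logic.I) _ Cv).
  by apply: Ck_vec2 => //; [exact: Ck_coord|apply: CkN => //; exact: Ck_coord].
have Cr : Ck_map C 2 setT (fun z : 'cV[R]_2 => v (z 0 0) (- z 1 0)).
  have -> : (fun z : 'cV[R]_2 => v (z 0 0) (- z 1 0)) = v2 \o ar by apply/funext => w; rewrite /v2 /ar /= !vec2E.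
  apply: (Ck_map_comp cT cT (fun z _ => Logic.I) _ Cv).
  by apply: Ck_vec2 => //; [exact: Ck_coord|apply: CkN => //; exact: Ck_coord].
split.
- by apply: (graph_Ck_map (tau := fun z : 'cV[R]_3 => cl (z 0 0))) => //; exact: cl_coord_Ck.
- by move=> z i Bz iz; exact: (trajectory_strip_eq K sf Cv Bz iz Ev).
- move=> s t; split=> i iy; rewrite (dgraph_cov mfd sf) // -/(cl _).
    by rewrite cl_id ?scale0r // lexx ler01.
  by rewrite cl_id ?scale1r // lexx ler01.
- move=> G HG tau; exact: (graph_L1_L2 K sf cX (val tau) HG Cr (reflect_L1_L2 Cv Lv)).
exists (dg 0 pp), (dg 0 pm), (fun t tau => dg (cl tau) (gm (- t))), (fun t tau => dg (cl tau) (gp (- t))).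
have inL p : (forall i : cidx C, cdom i p -> differential f i p = 0) ->
    (zero_section (C := C) `&` differential_graph (C := C) f) (dg 0 p).
  by move=> dp; split=> i ip; rewrite (dgraph_cov mfd sf) // scale0r //; rewrite -[RHS]/(differential f i p) dp.
have slice_s s : Ck_map C 1 setT (fun z : 'cV[R]_1 => v s (z 0 0)).
  have -> : (fun z : 'cV[R]_1 => v s (z 0 0)) = v2 \o (fun z : 'cV[R]_1 => vec2 s (z 0 0)).
    by apply/funext => w; rewrite /v2 /= !vec2E.
  apply: (Ck_map_comp cT cT (fun z _ => Logic.I) _ (Ck_map_leS Cv)).
  by apply: Ck_vec2 => //; [exact: Ck_cst|exact: Ck_coord].
have slice_t t : Ck_map C 1 setT (fun z : 'cV[R]_1 => v (z 0 0) t).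
  have -> : (fun z : 'cV[R]_1 => v (z 0 0) t) = v2 \o (fun z : 'cV[R]_1 => vec2 (z 0 0) t).
    by apply/funext => w; rewrite /v2 /= !vec2E.
  apply: (Ck_map_comp cT cT (fun z _ => Logic.I) _ (Ck_map_leS Cv)).
  by apply: Ck_vec2 => //; [exact: Ck_coord|exact: Ck_cst].
have cst_map d (A : set 'cV[R]_d) (p : X) : cornered A -> Ck_map C 1 A (fun=> p).
  by move=> cA z i Az ip; exists 1 => //; split=> //; apply: Ck_cst; exact: cornered_ball.
have bool_le (b : bool) : `|b%:R : R| <= 1 by case: b; rewrite ?normr1 ?normr0.
pose as_ := fun z : 'cV[R]_2 => const_mx (- z 0 0) : 'cV[R]_1.
pose at_ := fun z : 'cV[R]_2 => const_mx (z 1 0) : 'cV[R]_1.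
have send (FF : set_system R) (gam : R -> X) p q : Filter FF -> gradient_trajectory (C := C) g f gam p q ->
    C1_cvg C setT setT FF (fun s (z : 'cV[R]_1) => v s (z 0 0)) (fun z => gam (z 0 0)) ->
    C1_cvg MC Btt Btt FF (fun s z => dg (cl (z 1 0)) (v s (- z 0 0))) (fun z => dg (cl (z 1 0)) (gam (- z 0 0))).
  move=> PF [Cg Eg _ _] H.
  have Da (z : 'cV[R]_2) : Btt z -> diff_within Btt as_ z (fun k => const_mx (- (0 == k)%:R)).
    by move=> _; apply: diff_vec1; apply: diff_withinN; exact: diff_within_coord.
  have Cas : Ck 1 Btt as_ by apply: Ck_vec1 => //; apply: CkN => //; exact: Ck_coord.
  have H1 := C1_pull nC PF (cdom_cover mfd) cBtt cT (fun _ _ => Logic.I) (fun z (Kz : Btt z) => conj Kz Logic.I) Da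
    _ slice_s Cg H.
  have D1 (k : 'I_2) : \sum_j `|(const_mx (- (0 == k)%:R) : 'cV[R]_1) j 0| <= 1.
    by rewrite big_ord1 mxE normrN.
  have {}H1 := H1 D1.
  have E1 : (fun s : R => (fun z : 'cV[R]_1 => v s (z 0 0)) \o as_) = (fun s z => v s (- z 0 0)).
    by apply/funext => s; apply/funext => z; rewrite /= mxE.
  have E2 : (fun z : 'cV[R]_1 => gam (z 0 0)) \o as_ = (fun z => gam (- z 0 0)).
    by apply/funext => z; rewrite /= mxE.
  rewrite E1 E2 in H1.
  have C1s s : Ck_map C 1 Btt (fun z : 'cV[R]_2 => v s (- z 0 0)).
    have -> : (fun z : 'cV[R]_2 => v s (- z 0 0)) = (fun z : 'cV[R]_1 => v s (z 0 0)) \o as_.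
      by apply/funext => z; rewrite /= mxE.
    exact: (Ck_map_comp cBtt cT (fun _ _ => Logic.I) Cas (slice_s s)).
  have C2 : Ck_map C 1 Btt (fun z : 'cV[R]_2 => gam (- z 0 0)).
    by rewrite -E2; exact: (Ck_map_comp cBtt cT (fun _ _ => Logic.I) Cas Cg).
  apply: (graph_C1_cvg (tau := fun z : 'cV[R]_2 => cl (z 1 0)) K sf cX PF cBtt (fun z Kz => Kz) C1s C2 H1 _ (cl_coord_Ck 1 1) (T := fun k => (1 == k)%:R)).
  - move=> h sh; have [c c0 Hc] := gradient_rate_bound K sf cX sh; exists c => // z k Bz.
    have [i iz Hi] := Hc (gam ((as_ z) 0 0)).
    have Ch := comp_smooth_fun nC cT (fun v _ => cdom_cover mfd _) Cg sh.
    have := diff_within_comp (Ck_diff cT Ch (Logic.I : setT (as_ z))) (Da z Bz) (fun _ _ => Logic.I).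
    rewrite -[(h \o (fun z : 'cV[R]_1 => gam (z 0 0))) \o as_]/(h \o ((fun z : 'cV[R]_1 => gam (z 0 0)) \o as_)) E2.
    move=> D; rewrite (partialE k cBtt Bz D) big_ord1 mxE.
    rewrite (comp_smooth_partial nC 0 cT Cg sh (Logic.I : setT (as_ z)) iz) (Eg (as_ z) i iz).
    rewrite -[_ *: _]/(_ * _) normrM normrN; apply: le_trans Hi; rewrite ler_piMl //.
  - by move=> z Bz; split; [rewrite cl_id|exact: cl_coord_diff].
  - by move=> k; exact: bool_le.
have tend (FF : set_system R) (p : X) : Filter FF -> (forall i : cidx C, cdom i p -> differential f i p = 0) ->
    C1_loc_cvg C setT FF (fun t (z : 'cV[R]_1) => v (z 0 0) t) (fun=> p) ->
    C1_loc_cvg MC Bts FF (fun t z => dg (cl (z 0 0)) (v (z 1 0) t)) (fun=> dg 0 p).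
  move=> PF dp H Kc cK sub.
  have Cat k : Ck k setT at_ by apply: Ck_vec1 => //; exact: Ck_coord.
  have Cat' : Ck 1 Bts at_ by apply: Ck_vec1 => //; exact: Ck_coord.
  have Da (z : 'cV[R]_2) : Bts z -> diff_within Bts at_ z (fun k => const_mx ((1 == k)%:R)).
    by move=> _; apply: diff_vec1; exact: diff_within_coord.
  have H0 := H _ (compact_image cK (Cat 0%N)) (@subsetT _ _).
  have H1 := C1_pull (A := Bts) (K' := Kc) nC PF (cdom_cover mfd) cBts cT (fun _ _ => Logic.I)
    (fun z (Kz : Kc z) => conj (sub z Kz) (ex_intro2 _ _ z Kz erefl)) Da _ slice_t (cst_map _ _ p cT) H0.
  have D1 (k : 'I_2) : \sum_j `|(const_mx ((1 == k)%:R) : 'cV[R]_1) j 0| <= 1 by rewrite big_ord1 mxE.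
  have {}H1 := H1 D1.
  have E1 : (fun t : R => (fun z : 'cV[R]_1 => v (z 0 0) t) \o at_) = (fun t z => v (z 1 0) t).
    by apply/funext => s; apply/funext => z; rewrite /= mxE.
  rewrite E1 in H1.
  have C1t t : Ck_map C 1 Bts (fun z : 'cV[R]_2 => v (z 1 0) t).
    have -> : (fun z : 'cV[R]_2 => v (z 1 0) t) = (fun z : 'cV[R]_1 => v (z 0 0) t) \o at_.
      by apply/funext => z; rewrite /= mxE.
    exact: (Ck_map_comp cBts cT (fun _ _ => Logic.I) Cat' (slice_t t)).
  have -> : (fun _ : 'cV[R]_2 => dg 0 p) = (fun z : 'cV[R]_2 => dg (cl (z 0 0)) p).
    by apply/funext => z; rewrite [RHS]dgraph_critical.
  apply: (graph_C1_cvg (tau := fun z : 'cV[R]_2 => cl (z 0 0)) K sf cX PF cBts sub C1t (cst_map _ _ p cBts) H1 _ (cl_coord_Ck 0 1) (T := fun k => (0 == k)%:R)).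
  - move=> h sh; exists 0 => // z k Kz.
    by rewrite (partialE k cBts (sub z Kz) (diff_within_cst Bts (h p) z)) normr0.
  - by move=> z Bz; split; [rewrite cl_id|exact: cl_coord_diff].
  - by move=> k; exact: bool_le.
split.
- by split; exact: inL.
- by split; [exact: (end_strip K sf Hgm)|exact: (end_strip K sf Hgp)].
- by split; [exact: (send _ _ _ _ _ Hgm Hsm)|exact: (send _ _ _ _ _ Hgp Hsp)].
- split=> Kc cK sub h sh e e0.
    exact: (near_flipN (tend _ _ _ dpp Htp Kc cK sub h sh e e0)).
  exact: (near_flipP (tend _ _ _ dpm Htm Kc cK sub h sh e e0)).
Qed.

End Backward2.

(** * The size of the Hessian and the final correspondence *)

Lemma sqnorm2_ge0 (R : realType) (n : nat) (X : topologicalType) (C : charted R n X) (g I : tensor C)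
    (K : kahler_manifold g I) (f : X -> R) (i : cidx C) (x : X) :
  smooth_fun C f -> cdom i x -> 0 <= sqnorm2 g f i x.
Proof.
move=> sf ix; have [P _ PE] := orthonormal_basis (kahler_posdef K ix).
rewrite /sqnorm2 (trace_frame (kahler_posdef K ix) (hess_sym K sf ix) PE).
by apply: sumr_ge0 => a _; apply: sumr_ge0 => b _; exact: sqr_ge0.
Qed.

Lemma C2_norm_hessian (R : realType) (n : nat) (X : topologicalType) (C : charted R n X) (g I : tensor C)
    (F : X -> R[i]) (eps : R) (i : cidx C) (x : X) :
  kahler_manifold g I -> holomorphic I F -> (C2_norm g F < eps%:E)%E -> cdom i x ->
  Num.sqrt (sqnorm2 g (Fre F) i x) <= eps.
Proof.
move=> K [sf sfi _] HF ix.
pose e := Num.sqrt (Fre F x ^+ 2 + Fim F x ^+ 2)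
         + Num.sqrt (sqnorm1 g (Fre F) i x + sqnorm1 g (Fim F) i x)
         + Num.sqrt (sqnorm2 g (Fre F) i x + sqnorm2 g (Fim F) i x).
have : (e%:E <= C2_norm g F)%E by apply: ereal_sup_ubound; exists i, x.
move=> /le_lt_trans/(_ HF); rewrite lte_fin => /ltW; apply: le_trans.
apply: (@le_trans _ _ (Num.sqrt (sqnorm2 g (Fre F) i x + sqnorm2 g (Fim F) i x))).
  by apply: ler_wsqrtr; rewrite lerDl; exact: (sqnorm2_ge0 K sfi ix).
by rewrite /e lerDr addr_ge0 ?sqrtr_ge0.
Qed.

Theorem theorem1p1 (R : realType) (n : nat) (X : topologicalType)
    (C : charted R n X) (g I : tensor C) :
  compact [set: X] -> kahler_manifold g I ->
  exists2 eps : R, 0 < eps &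
  forall F : X -> R[i], holomorphic I F -> (C2_norm g F < eps%:E)%E ->
  exists It Jt Kt : R -> tensor (cotangent_charts C),
    let strips :=
      [set U | fueter_strip It Jt Kt
                 (zero_section (C := C)) (differential_graph (C := C) (Fre F)) U] in
    [/\ almost_quaternionic_family It Jt Kt,
        forall U, strips U -> exists w : R -> R -> X,
          forall tau s t, ct_pt (U tau s t) = w s t &
        set_bij strips [set v | complex_gradient_trajectory g I F v]
          (fun U s t => ct_pt (U (clamp 0) s (- t)))].
Proof.
(* The Hessian bound needs [eps n <= 1/4]; the successor keeps the denominator nonzero in dimension
   0. *)
move=> cX K; pose eps : R := 4^-1 / n.+1%:R.
have eps0 : 0 < eps by rewrite divr_gt0.
have epsn : eps * n%:R <= 4^-1.
  by rewrite -mulrA ler_piMr // mulrC ler_pdivrMr // mul1r ler_nat.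
exists eps => // F hol HF; have [sf _ _] := hol.
have Hkap i x : cdom i x -> Num.sqrt (sqnorm2 g (Fre F) i x) <= eps by exact: (C2_norm_hessian K hol HF).
exists (It g I (Fre F)), (Jt g (Fre F)), (Kt g I (Fre F)) => strips.
have graph U : strips U -> exists w : R -> R -> X,
    (forall (tau : interval01 R) s t, U tau s t = dgraph (kahler_mfd K) sf (val tau) (w s t)) /\
    complex_gradient_trajectory g I F (fun s t => w s (- t)).
  move=> HU; have [w [HUw _ Hmu]] := fueter_graph K sf cX (ltW eps0) epsn Hkap HU.
  by exists w; split=> //; apply: (strip_to_trajectory hol HU HUw) => z i Bz iz; have [] := Hmu z i Bz iz.
split.
- exact: (structure_quaternionic K sf).
- by move=> U /graph[w [HUw _]]; exists w => tau s t; rewrite HUw.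
- split.
  + move=> U /graph[w [HUw Hw]]; rewrite /=.
    suff -> : (fun s t => ct_pt (U (clamp 0) s (- t))) = (fun s t => w s (- t)) by [].
    by apply/funext => s; apply/funext => t; rewrite HUw.
  + move=> U1 U2; rewrite !inE => /graph[w1 [HU1 _]] /graph[w2 [HU2 _]] E.
    apply/funext => tau; apply/funext => s; apply/funext => t.
    rewrite HU1 HU2; congr dgraph.
    by have := congr1 (fun v : R -> R -> X => v s (- t)) E; rewrite /= HU1 HU2 /= opprK.
  + move=> v Hv; exists (fun tau s t => dgraph (kahler_mfd K) sf (val tau) (v s (- t))).
      exact: (trajectory_to_strip K sf cX Hv).
    by apply/funext => s; apply/funext => t; rewrite /= opprK.
Qed.
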